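(* Suppose that $\mathbf E Z=0$ and that $Z$ is multivariate regularly varying with index $\alpha>1$ and spectral probability measure $\mathbf S$ on $\mathfrak N_d$. Suppose there is $D\in[1,\infty)$ such that $\|\sigma(x)-\sigma(y)\|\vee\|a(x)-a(y)\|\le D\|x-y\|$ for all $x,y\in\mathbb R^m$, and there is $C\in[1,\infty)$ such that $\|a(x)\|\vee\|\sigma(x)\|\le C$ for all $x\in\mathbb R^m$. Let $k\in\mathbb N=\{0,1,2,\dots\}$, $T>0$, $\epsilon>0$, and let $A\subseteq\mathbb R^m$ be nonempty and compact. Then, as $\eta\downarrow0$, $$\lambda^{-k}(\eta)\,\mathbf P\big(X^{\eta}_{[0,T]}(x)\in\cdot\,\big)\to\mathbf C^{(k)}_{[0,T]}(\,\cdot\,;x)\quad\text{in }\mathbb M\big(\mathbb D[0,T]\setminus\mathbb D^{(k-1)}_A[0,T](\epsilon)\big)\text{ uniformly in }x\text{ on }A.$$ Furthermore, for any Borel set $B\subseteq\mathbb D[0,T]$ that is bounded away from $\mathbb D^{(k-1)}_A[0,T](\epsilon)$ for some (and hence all) $\epsilon>0$ small enough, $$\inf_{x\in A}\mathbf C^{(k)}_{[0,T]}(B^\circ;x)\le\liminf_{\eta\downarrow0}\frac{\inf_{x\in A}\mathbf P(X^{\eta}_{[0,T]}(x)\in B)}{\lambda^k(\eta)}\le\limsup_{\eta\downarrow0}\frac{\sup_{x\in A}\mathbf P(X^{\eta}_{[0,T]}(x)\in B)}{\lambda^k(\eta)}\le\sup_{x\in A}\mathbf C^{(k)}_{[0,T]}(B^-;x)<\infty,$$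 where $B^\circ$ and $B^-$ are the interior and closure of $B$.
   Context: $\|\cdot\|$ is the Euclidean norm (operator norm for matrices); $u\vee v=\max\{u,v\}$. $\mathbb M$-convergence. For a metric space $(\mathbb S,\mathbf d)$ and Borel $\mathbb C\subseteq\mathbb S$, let $\mathbb C^r=\{y:\inf_{c\in\mathbb C}\mathbf d(c,y)\le r\}$ ($\inf\emptyset=\infty$). $\mathbb M(\mathbb S\setminus\mathbb C)$ is the set of Borel measures $\nu$ on $\mathbb S\setminus\mathbb C$ with $\nu(\mathbb S\setminus\mathbb C^r)<\infty$ for all $r>0$; $\mathcal C(\mathbb S\setminus\mathbb C)$ is the set of non-negative bounded continuous functions on $\mathbb S\setminus\mathbb C$ vanishing on $\mathbb C^r$ for some $r>0$. $\nu_n\to\nu$ in $\mathbb M(\mathbb S\setminus\mathbb C)$ means $\nu_n(f)\to\nu(f)$ for all $f\in\mathcal C(\mathbb S\setminus\mathbb C)$, where $\nu(f)=\int f\,d\nu$; for families, $\mu^\eta_\theta\to\mu_\theta$ uniformly in $\theta$ on $\Theta$ as $\eta\downarrow0$ means $\sup_{\theta\in\Theta}|\mu^\eta_\theta(f)-\mu_\theta(f)|\to0$ for all such $f$. Measures on $\mathbb S$ are restricted to $\mathbb S\setminus\mathbb C$. Sets $E,F$ are bounded away from each other if $\inf_{x\in E,y\in F}\mathbf d(x,y)>0$. Noise. $Z,Z_1,Z_2,\dots$ are iid random vectors in $\mathbb R^d$; $H(x)=\mathbf P(\|Z\|>x)$; $\lambda(\eta)=\eta^{-1}H(\eta^{-1})$,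 $\lambda^k(\eta)=(\lambda(\eta))^k$. $\mathfrak N_d$ is the unit sphere of $\mathbb R^d$; $\Phi(x)=(\|x\|,x/\|x\|)$ for $x\ne0$, $\Phi(0)=(0,(1,0,\dots,0))$; $\nu_\alpha$ is the Borel measure on $(0,\infty)$ with $\nu_\alpha[x,\infty)=x^{-\alpha}$. ''$Z$ is multivariate regularly varying with index $\alpha$ and spectral measure $\mathbf S$'' means: $\lim_{x\to\infty}H(tx)/H(x)=t^{-\alpha}$ for all $t>0$, and with $(R,\Theta)=\Phi(Z)$, $\mathbf P((x^{-1}R,\Theta)\in\cdot)/H(x)\to\nu_\alpha\times\mathbf S$ in $\mathbb M\big(([0,\infty)\times\mathfrak N_d)\setminus(\{0\}\times\mathfrak N_d)\big)$ as $x\to\infty$. Process. $a:\mathbb R^m\to\mathbb R^m$, $\sigma:\mathbb R^m\to\mathbb R^{m\times d}$. For $\eta>0$: $X^{\eta}_0(x)=x$, $X^{\eta}_t(x)=X^{\eta}_{t-1}(x)+\eta a(X^{\eta}_{t-1}(x))+\eta\sigma(X^{\eta}_{t-1}(x))Z_t$ for $t\ge1$, and $X^{\eta}_{[0,T]}(x)=\{X^{\eta}_{\lfloor t/\eta\rfloor}(x):t\in[0,T]\}$. Path space. $\mathbb D[0,T]$ is the space of càdlàg functions $[0,T]\to\mathbb R^m$ with the Skorokhod $J_1$ metric $\inf_{\lambda}\sup_{t\in[0,T]}|\lambda(t)-t|\vee\|x(\lambda(t))-y(t)\|$, infimum over increasing homeomorphisms $\lambda$ of $[0,T]$. For $E\subseteq\mathbb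 R$, $E^{k\uparrow}=\{(t_1,\dots,t_k)\in E^k:t_1<\dots<t_k\}$. Perturbed ODE. For $x\in\mathbb R^m$, $W=(w_1,\dots,w_k)\in\mathbb R^{d\times k}$, $V=(v_1,\dots,v_k)\in\mathbb R^{m\times k}$, $\mathbf t=(t_1,\dots,t_k)\in(0,T]^{k\uparrow}$, let $\bar h^{(k)}_{[0,T]}(x,W,V,\mathbf t)=\xi\in\mathbb D[0,T]$ be the solution of $\xi_0=x$; $d\xi_s/ds=a(\xi_s)$ for $s\in[0,T]\setminus\{t_1,\dots,t_k\}$; $\xi_s=\xi_{s-}+v_j+\sigma(\xi_{s-}+v_j)w_j$ if $s=t_j$. Put $h^{(k)}_{[0,T]}(x,W,\mathbf t)=\bar h^{(k)}_{[0,T]}(x,W,(0,\dots,0),\mathbf t)$. For $k=0$ it is the solution of the ODE started at $x$. With $\bar B_\epsilon(0)$ the closed $\epsilon$-ball in $\mathbb R^m$, $\mathbb D^{(k)}_A[0,T](\epsilon)=\bar h^{(k)}_{[0,T]}\big(A\times\mathbb R^{d\times k}\times(\bar B_\epsilon(0))^k\times(0,T]^{k\uparrow}\big)$ and $\mathbb D^{(-1)}_A[0,T](\epsilon)=\emptyset$. Limit measure. $((\nu_\alpha\times\mathbf S)\circ\Phi)(E)=(\nu_\alpha\times\mathbf S)(\Phi(E))$ for Borel $E\subseteq\mathbb R^d\setminus\{0\}$, with $k$-fold product $((\nu_\alpha\times\mathbf S)\circ\Phi)^k$ in $W=(w_1,\dots,w_k)$; $\mathcal L^{k\uparrow}_T$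 is Lebesgue measure restricted to $(0,T)^{k\uparrow}$; $$\mathbf C^{(k)}_{[0,T]}(\cdot;x)=\int\mathbb I\{h^{(k)}_{[0,T]}(x,W,\mathbf t)\in\cdot\}\,((\nu_\alpha\times\mathbf S)\circ\Phi)^k(dW)\times\mathcal L^{k\uparrow}_T(d\mathbf t),$$ which for $k=0$ is the Dirac mass at $h^{(0)}_{[0,T]}(x)$. *)

(* Defs.v *)
From HB Require Import structures.
From mathcomp Require Import all_boot all_order all_algebra.
From mathcomp Require Import all_classical all_reals all_analysis.
From mathcomp Require Import ring lra.

Set Implicit Arguments.
Unset Strict Implicit.
Unset Printing Implicit Defensive.

Import Order.TTheory GRing.Theory Num.Theory.
Import numFieldNormedType.Exports.

Local Open Scope classical_set_scope.
Local Open Scope ring_scope.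

(* Euclidean norm; the norm `|x| of the library on matrices is the max norm. *)
Definition enorm (R : realType) (n : nat) (x : 'cV[R]_n) : R :=
  Num.sqrt (\sum_i x i ord0 ^+ 2).

Definition opnorm (R : realType) (m n : nat) (M : 'M[R]_(m, n)) : R :=
  sup [set enorm (M *m w) | w in [set w | enorm w <= 1]].

Section enorm_theory.
Context {R : realType} {n : nat}.
Implicit Types x y z : 'cV[R]_n.

Lemma enorm_ge0 x : 0 <= enorm x.
Proof. exact: sqrtr_ge0. Qed.

Let sumsq_ge0 x : 0 <= \sum_i x i ord0 ^+ 2.
Proof. by apply: sumr_ge0 => i _; exact: sqr_ge0. Qed.

Lemma enorm_sqr x : enorm x ^+ 2 = \sum_i x i ord0 ^+ 2.
Proof. by rewrite sqr_sqrtr. Qed.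

Lemma enorm0 : enorm (0 : 'cV[R]_n) = 0.
Proof.
by rewrite /enorm big1 ?sqrtr0// => i _; rewrite mxE expr0n.
Qed.

Lemma enorm_eq0 x : enorm x = 0 -> x = 0.
Proof.
move=> x0; have /eqP : \sum_i x i ord0 ^+ 2 = 0.
  by rewrite -enorm_sqr x0 expr0n.
rewrite psumr_eq0 => [/allP h|i _]; last exact: sqr_ge0.
apply/colP => i; rewrite mxE; apply/eqP.
by have := h i (mem_index_enum i); rewrite sqrf_eq0.
Qed.

Lemma enormN x : enorm (- x) = enorm x.
Proof. by congr Num.sqrt; apply: eq_bigr => i _; rewrite mxE sqrrN. Qed.

Lemma enorm_distC x y : enorm (x - y) = enorm (y - x).
Proof. by rewrite -enormN opprB. Qed.

Lemma enormZ a x : enorm (a *: x) = `|a| * enorm x.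
Proof.
rewrite /enorm -sqrtr_sqr -sqrtrM ?sqr_ge0// mulr_sumr; congr Num.sqrt.
by apply: eq_bigr => i _; rewrite mxE exprMn.
Qed.

Lemma cauchy_schwarz x y :
  \sum_i x i ord0 * y i ord0 <= enorm x * enorm y.
Proof.
have [/enorm_eq0->|x0] := eqVneq (enorm x) 0.
  rewrite enorm0 mul0r big1// => i _; by rewrite mxE mul0r.
have [/enorm_eq0->|y0] := eqVneq (enorm y) 0.
  rewrite enorm0 mulr0 big1// => i _; by rewrite mxE mulr0.
have xp : 0 < enorm x by rewrite lt0r x0 enorm_ge0.
have yp : 0 < enorm y by rewrite lt0r y0 enorm_ge0.
have : 0 <= \sum_i (enorm y * x i ord0 - enorm x * y i ord0) ^+ 2.
  by apply: sumr_ge0 => i _; exact: sqr_ge0.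
rewrite (_ : \sum_i _ = enorm y ^+ 2 * (\sum_i x i ord0 ^+ 2)
   + enorm x ^+ 2 * (\sum_i y i ord0 ^+ 2)
   - 2 * enorm x * enorm y * (\sum_i x i ord0 * y i ord0)); last first.
  rewrite !mulr_sumr -big_split -sumrB; apply: eq_bigr => i _ /=.
  by rewrite sqrrB !exprMn; ring.
rewrite -!enorm_sqr (_ : _ + _ - _ = 2 * (enorm x * enorm y) *
  (enorm x * enorm y - \sum_i x i ord0 * y i ord0)); last by ring.
by rewrite pmulr_rge0 ?subr_ge0// !mulr_gt0.
Qed.

Lemma enorm_triangle x y : enorm (x + y) <= enorm x + enorm y.
Proof.
rewrite -(@ler_pXn2r _ 2)// ?nnegrE ?addr_ge0 ?enorm_ge0//.
rewrite sqrrD !enorm_sqr (_ : \sum_i _ = \sum_i x i ord0 ^+ 2 +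
  (\sum_i x i ord0 * y i ord0) *+ 2 + \sum_i y i ord0 ^+ 2); last first.
  rewrite -sumrMnl -!big_split; apply: eq_bigr => i _ /=.
  by rewrite mxE sqrrD.
by rewrite lerD2r lerD2l lerMn2r cauchy_schwarz.
Qed.

Lemma enorm_dist_triangle y x z : enorm (x - z) <= enorm (x - y) + enorm (y - z).
Proof. by rewrite (le_trans _ (enorm_triangle _ _))// subrKA. Qed.

Lemma enorm_le_norm x : enorm x <= n%:R * `|x|.
Proof.
rewrite -(@ler_pXn2r _ 2)// ?nnegrE ?mulr_ge0 ?enorm_ge0//.
rewrite enorm_sqr (@le_trans _ _ (\sum_(i < n) `|x| ^+ 2))//.
  apply: ler_sum => i _; rewrite -real_normK ?num_real//.
  rewrite ler_pXn2r ?nnegrE// [leRHS]/Num.norm/= mx_normrE.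
  by rewrite (le_trans _ (le_bigmax _ _ (i, ord0))).
rewrite sumr_const card_ord exprMn -[leLHS]mulr_natl ler_wpM2r ?sqr_ge0//.
by rewrite -natrX ler_nat -[leqLHS]expn1; case: (n) => // k; rewrite leq_pexp2l.
Qed.

End enorm_theory.

Definition borel (T : ptopologicalType) := g_sigma_algebraType (@open T).

HB.structure Definition PointedMetric (K : numDomainType) :=
  { M of Metric K M & isPointed M }.

Section skorokhod.
Context (R : realType) (m : nat) (T : {posnum R}).
Local Notation I := (`[0, T%:num]%classic : set R).

Definition cadlag (f : R -> 'cV[R]_m) : Prop :=
  (forall t : R, 0 <= t < T%:num -> f u @[u --> t^'+] --> f t) /\
  (forall t : R, 0 < t <= T%:num -> cvg (f u @[u --> t^'-])).

(* D[0,T]: a function on [0,T] is represented by its extension by 0 to R. *)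
Record Dspace := MkD {
  dfun :> R -> 'cV[R]_m ;
  dfun_cadlag : cadlag dfun ;
  dfun_out : forall t, ~ I t -> dfun t = 0 }.

Lemma Dspace_ext (x y : Dspace) : (forall t, I t -> x t = y t) -> x = y.
Proof.
move=> xy; have {xy} : dfun x = dfun y.
  apply/funext => t; have [It|It] := pselect (I t); first exact: xy.
  by rewrite !dfun_out.
case: x y => x cx ox [y cy oy] /= e; move: cy oy; rewrite -e => cy oy.
by congr MkD; exact: Prop_irrelevance.
Qed.

HB.instance Definition _ := gen_eqMixin Dspace.
HB.instance Definition _ := gen_choiceMixin Dspace.

Definition D0 : Dspace.
Proof.
exists (fun=> 0) => //; split=> t _; first exact: cvg_cst.
exact: is_cvg_cst.
Defined.

HB.instance Definition _ := isPointed.Build Dspace D0.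

Definition time_change (l : R -> R) : Prop :=
  {in I &, {homo l : s t / s < t}} /\
  exists k : R -> R, [/\ {homo l : t / I t}, {homo k : t / I t},
    {within I, continuous l}, {within I, continuous k}
  & {in I, cancel l k} /\ {in I, cancel k l}].

Definition J1dist (x y : Dspace) : R :=
  inf [set sup [set Num.max `|l t - t| (enorm (x (l t) - y t)) | t in I]
      | l in time_change].

Lemma cvg_enorm_lt {F : set_system R} {FF : Filter F} (f : R -> 'cV[R]_m) (l : 'cV[R]_m) :
  f @ F --> l -> forall e, 0 < e -> \forall u \near F, enorm (f u - l) < e.
Proof.
move=> fl e e0; have e1 : 0 < e / m.+1%:R by rewrite divr_gt0.
have /cvgrPdist_lt/(_ _ e1) := fl; apply: filterS => u; rewrite distrC => h.
rewrite (le_lt_trans (enorm_le_norm _))//.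
apply: (@le_lt_trans _ _ (m.+1%:R * `|f u - l|)).
  by rewrite ler_wpM2r// ler_nat.
by rewrite -ltr_pdivlMl// mulrC.
Qed.

Lemma cadlag_bounded f : cadlag f ->
  exists2 M, 0 <= M & forall t, I t -> enorm (f t) <= M.
Proof.
move=> [fr fl].
have : \forall M \near +oo, forall t, I t -> I t -> enorm (f t) <= M.
  apply: (compact_near_coveringP I).1; first exact: segment_compact.
  move=> t It; have /andP[t0 tT] : 0 <= t <= T%:num by move: It; rewrite /= in_itv.
  have : exists M, \forall u \near t, I u -> enorm (f u) <= M.
    have [Mr hr] : exists M, \forall u \near t, I u -> t < u -> enorm (f u) <= M.
      have [tltT|Tlet] := ltP t T%:num; last first.
        exists 0; near=> u; rewrite /= in_itv/= => /andP[_ uT] tu.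
        by have := lt_le_trans (le_lt_trans Tlet tu) uT; rewrite ltxx.
      exists (enorm (f t) + 1).
      have {}fr := fr t; rewrite t0 tltT in fr; have {}fr := fr isT.
      have H : \forall u \near t^'+, enorm (f u - f t) < 1.
        exact: cvg_enorm_lt fr _ ltr01.
      rewrite near_withinE in H; apply: filterS H => u + _ tu.
      move=> /(_ tu) fu; rewrite -[f u](subrK (f t)) addrC.
      by rewrite (le_trans (enorm_triangle _ _))// lerD2l ltW// addrC.
    have [Ml hl] : exists M, \forall u \near t, I u -> u < t -> enorm (f u) <= M.
      have [tgt0|tle0] := ltP 0 t; last first.
        exists 0; near=> u; rewrite /= in_itv/= => /andP[u0 _] tu.
        by have := lt_le_trans (le_lt_trans u0 tu) tle0; rewrite ltxx.
      have {}fl := fl t; rewrite tgt0 tT in fl; have {}fl := fl isT.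
      exists (enorm (lim (f u @[u --> t^'-])) + 1).
      have H : \forall u \near t^'-, enorm (f u - lim (f u @[u --> t^'-])) < 1.
        exact: cvg_enorm_lt fl _ ltr01.
      rewrite near_withinE in H; apply: filterS H => u + _ tu.
      move=> /(_ tu) fu; rewrite -[f u](subrK (lim (f u @[u --> t^'-]))) addrC.
      by rewrite (le_trans (enorm_triangle _ _))// lerD2l ltW// addrC.
    exists (Num.max (enorm (f t)) (Num.max Mr Ml)).
    near=> u => Iu; rewrite !le_max; have [ut|tu|->] := ltgtP u t.
    - by apply/orP; right; apply/orP; right; move: Iu ut; near: u; exact: hl.
    - by apply/orP; right; apply/orP; left; move: Iu tu; near: u; exact: hr.
    - by rewrite lexx.
  move=> [M hM]; near=> u N => /=.
  move=> Iu.
  apply: (@le_trans _ _ M); first by move: Iu; near: u.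
  by near: N; apply: nbhs_pinfty_ge; exact: num_real.
move=> hM; near (+oo : set_system R) => M.
exists M => [|t It]; first by near: M; apply: nbhs_pinfty_ge; exact: num_real.
suff : forall t, I t -> I t -> enorm (f t) <= M by move=> /(_ t It It).
by near: M.
Unshelve. all: by end_near. Qed.

End skorokhod.

Section J1_theory.
Context (R : realType) (m : nat) (T : {posnum R}).
Local Notation I := (`[0, T%:num]%classic : set R).
Implicit Types (x y z : Dspace m T) (l k : R -> R).

Let J1set l x y := [set Num.max `|l t - t| (enorm (x (l t) - y t)) | t in I].

Let I0 : I 0. Proof. by rewrite /= in_itv/= lexx ge0. Qed.

Let time_changeI l t : time_change T l -> I t -> I (l t).
Proof. by move=> [_ [k [h _ _ _ _]]] /h. Qed.

Let J1set_sup l x y : time_change T l -> has_sup (J1set l x y).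
Proof.
move=> hl; split; first by eexists; exists 0.
have [M M0 hM] := cadlag_bounded (dfun_cadlag x).
have [N N0 hN] := cadlag_bounded (dfun_cadlag y).
exists (Num.max T%:num (M + N)) => _ [t It <-]; rewrite ge_max !le_max.
apply/andP; split; apply/orP; [left|right].
  have := time_changeI hl It; move: It; rewrite /= !in_itv/=.
  by move=> /andP[? ?] /andP[? ?]; rewrite ler_norml; apply/andP; split; lra.
rewrite (le_trans (enorm_triangle _ _))// enormN lerD ?hM ?hN//.
exact: time_changeI.
Qed.

Let le_J1set l x y t : time_change T l -> I t ->
  Num.max `|l t - t| (enorm (x (l t) - y t)) <= sup (J1set l x y).
Proof.
by move=> hl It; apply: ub_le_sup; [case: (J1set_sup x y hl)|exists t].
Qed.

Let J1set_le l x y c : time_change T l ->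
  (forall t, I t -> Num.max `|l t - t| (enorm (x (l t) - y t)) <= c) ->
  sup (J1set l x y) <= c.
Proof.
move=> hl h; apply: ge_sup; first by case: (J1set_sup x y hl).
by move=> _ [t It <-]; exact: h.
Qed.

Let J1set_ge0 l x y : time_change T l -> 0 <= sup (J1set l x y).
Proof.
by move=> hl; rewrite (le_trans _ (le_J1set x y hl I0))// le_max normr_ge0.
Qed.

Lemma time_change_id : time_change T id.
Proof.
split=> //; exists id; split => //; try split => //.
all: by apply: continuous_subspaceT => u; exact: cvg_id.
Qed.

Lemma J1dist_has_inf x y :
  has_inf [set sup (J1set l x y) | l in time_change T].
Proof.
split; first by eexists; exists id => //; exact: time_change_id.
by exists 0 => _ [l hl <-]; exact: J1set_ge0.
Qed.

Lemma J1dist_ge0 x y : 0 <= J1dist x y.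
Proof.
apply: lb_le_inf; first by case: (J1dist_has_inf x y).
by move=> _ [l hl <-]; exact: J1set_ge0.
Qed.

Lemma J1dist_le l x y c : time_change T l ->
  (forall t, I t -> Num.max `|l t - t| (enorm (x (l t) - y t)) <= c) ->
  J1dist x y <= c.
Proof.
move=> hl /(J1set_le hl); apply: le_trans.
by apply: ge_inf; [case: (J1dist_has_inf x y)|exists l].
Qed.

Lemma J1dist_lt x y c : J1dist x y < c -> exists2 l, time_change T l &
  forall t, I t -> `|l t - t| < c /\ enorm (x (l t) - y t) < c.
Proof.
rewrite -subr_gt0 => h.
have [_ [l hl <-]] := inf_adherent h (J1dist_has_inf x y).
rewrite addrC subrK => lc; exists l => // t It.
have /le_lt_trans/(_ lc) := le_J1set x y hl It.
by rewrite gt_max => /andP[].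
Qed.

Lemma J1distxx x : J1dist x x = 0.
Proof.
apply/eqP; rewrite eq_le J1dist_ge0 andbT.
apply: (J1dist_le time_change_id) => t It.
by rewrite !subrr enorm0 normr0 maxxx.
Qed.

Lemma time_change_inv l : time_change T l -> exists2 k, time_change T k &
  {in I, cancel l k} /\ {in I, cancel k l}.
Proof.
move=> [inc [k [lI kI lc kc [lk kl]]]]; exists k => //; split; last first.
  by exists l; split.
move=> s t Is It st; rewrite ltNge; apply/negP; rewrite le_eqVlt => /orP[/eqP|] h.
  by move: st; rewrite -(kl _ Is) -(kl _ It) h ltxx.
have kIs := mem_set (kI _ (set_mem Is)); have kIt := mem_set (kI _ (set_mem It)).
have := inc _ _ kIt kIs h; rewrite kl// kl// => ts.
by have := lt_trans st ts; rewrite ltxx.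
Qed.

Lemma J1dist_sym x y : J1dist x y = J1dist y x.
Proof.
wlog suff h : x y / J1dist y x <= J1dist x y.
  by apply/eqP; rewrite eq_le !h.
apply/ler_addgt0Pl => e e0.
have /J1dist_lt[l /time_change_inv[k hk [lk kl]] hl] :
  J1dist x y < e + J1dist x y by rewrite ltrDr.
apply: (J1dist_le hk) => t It; have := hl _ (time_changeI hk It).
rewrite kl ?inE// distrC enorm_distC => -[? ?].
by rewrite ge_max !ltW.
Qed.

Lemma time_change_comp k l : time_change T k -> time_change T l ->
  time_change T (k \o l).
Proof.
move=> [inck [k' [kI k'I kc k'c [kk' k'k]]]] [incl [l' [lI l'I lc l'c [ll' l'l]]]].
have comp (f g : R -> R) : {homo g : t / I t} ->
    {within I, continuous f} -> {within I, continuous g} ->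
    {within I, continuous (f \o g)}.
  move=> gI /subspace_continuousP fc /subspace_continuousP gc.
  apply/subspace_continuousP => t It.
  apply: (cvg_comp _ _ _ (fc _ (gI _ It))).
  move=> A /= ; rewrite /within/= => hA.
  have : nbhs t (fun u => I u -> I (g u) -> A (g u)) := gc _ It _ hA.
  by apply: filterS => u hu Iu; apply: hu => //; exact: gI.
split.
  move=> s t Is It st /=; apply: inck.
  - by apply/mem_set/lI/set_mem.
  - by apply/mem_set/lI/set_mem.
  - exact: incl.
exists (l' \o k'); split.
- by move=> t /lI/kI.
- by move=> t /k'I/l'I.
- exact: comp.
- exact: comp.
- split=> t It /=.
    by rewrite kk' ?ll'//; apply/mem_set/lI/set_mem.
  by rewrite l'l ?k'k//; apply/mem_set/k'I/set_mem.
Qed.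

Lemma J1dist_triangle y x z : J1dist x z <= J1dist x y + J1dist y z.
Proof.
apply/ler_addgt0Pl => e e0; have e20 : 0 < e / 2 by rewrite divr_gt0.
have /J1dist_lt[k hk hxy] : J1dist x y < e / 2 + J1dist x y by rewrite ltrDr.
have /J1dist_lt[l hl hyz] : J1dist y z < e / 2 + J1dist y z by rewrite ltrDr.
apply: (J1dist_le (time_change_comp hk hl)) => t It /=.
have [a1 a2] := hxy _ (time_changeI hl It); have [b1 b2] := hyz _ It.
have c1 := ler_distD (l t) (k (l t)) t.
have c2 := enorm_dist_triangle (y (l t)) (x (k (l t))) (z t).
by rewrite ge_max; apply/andP; split; lra.
Qed.

Let time_changeT l : time_change T l -> l T%:num = T%:num.
Proof.
have IT : I T%:num by rewrite /= in_itv/= lexx ge0.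
move=> hl; have [k hk [lk kl]] := time_change_inv hl.
have := time_changeI hk IT; rewrite /= in_itv/= => /andP[k0].
rewrite le_eqVlt => /orP[/eqP kT|kT].
  by rewrite -[in LHS]kT kl// inE.
have [inc _] := hl.
have := inc _ _ (mem_set (time_changeI hk IT)) (mem_set IT) kT.
rewrite kl ?inE// => h; have := time_changeI hl IT.
by rewrite /= in_itv/= => /andP[_ /(lt_le_trans h)]; rewrite ltxx.
Qed.

Lemma J1dist_positivity x y : J1dist x y = 0 -> x = y.
Proof.
move=> d0; apply: Dspace_ext => t It; apply/subr0_eq/enorm_eq0/eqP.
rewrite eq_le enorm_ge0 andbT; apply/ler_addgt0Pl => e e0; rewrite addr0.
have e30 : 0 < e / 3 by rewrite divr_gt0.
have [t0 tT] : 0 <= t /\ t <= T%:num.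
  by move: It; rewrite /= in_itv/= => /andP[].
move: tT; rewrite le_eqVlt => /orP[/eqP tT|tT].
  have /J1dist_lt[l hl /(_ _ It)[_]] : J1dist x y < e by rewrite d0.
  by rewrite tT time_changeT// => /ltW.
have tI : 0 <= t < T%:num by rewrite t0 tT.
have /(cvg_enorm_lt)/(_ _ e30) := (dfun_cadlag x).1 t tI.
have /(cvg_enorm_lt)/(_ _ e30) := (dfun_cadlag y).1 t tI.
rewrite !near_withinE => /nbhs_ballP[a /= a0 ya] /nbhs_ballP[b /= b0 xb].
pose c := Num.min (T%:num - t) (Num.min a b).
have c0 : 0 < c by rewrite !lt_min subr_gt0 tT a0 b0.
have [cT ca cb] : [/\ c <= T%:num - t, c <= a & c <= b].
  by rewrite !ge_min !lexx !orbT.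
have d00 : 0 < Num.min (e / 3) (c / 2) by rewrite lt_min e30 divr_gt0.
have /J1dist_lt[l hl hd] : J1dist x y < Num.min (e / 3) (c / 2) by rewrite d0.
pose s := t + c / 2.
have Is : I s by rewrite /= in_itv/= /s; apply/andP; split; lra.
have := hd _ Is; rewrite !lt_min => -[/andP[_ ls] /andP[xys _]].
move: ls; rewrite ltr_norml => /andP[ls1 ls2].
have ys : enorm (y s - y t) < e / 3.
  apply: ya => /=; last by rewrite /s; lra.
  by rewrite -ball_normE /= /s ltr_norml; apply/andP; split; lra.
have xs : enorm (x (l s) - x t) < e / 3.
  apply: xb => /=; last by rewrite /s in ls1; lra.
  by rewrite /s in ls1 ls2 *; rewrite -ball_normE /= ltr_norml; apply/andP; split; lra.
have c1 := enorm_dist_triangle (x (l s)) (x t) (y t).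
have c2 := enorm_dist_triangle (y s) (x (l s)) (y t).
rewrite (enorm_distC (x t) (x (l s))) in c1; lra.
Qed.

HB.instance Definition _ := isMetric.Build R (Dspace m T)
  J1distxx J1dist_positivity J1dist_sym J1dist_triangle.

End J1_theory.

Record halfline (R : realType) := Halfline {
  hval :> R ;
  hval_ge0 : 0 <= hval }.

HB.instance Definition _ (R : realType) := [isSub for @hval R].
HB.instance Definition _ (R : realType) := [Choice of halfline R by <:].

Section halfline_metric.
Context {R : realType}.

Let dist (x y : halfline R) : R := `|hval x - hval y|.

Let distxx x : dist x x = 0.
Proof. by rewrite /dist subrr normr0. Qed.

Let dist_positivity x y : dist x y = 0 -> x = y.
Proof. by move=> /normr0_eq0/subr0_eq xy; apply/val_inj. Qed.

Let dist_sym x y : dist x y = dist y x.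
Proof. exact: distrC. Qed.

Let dist_triangle y x z : dist x z <= dist x y + dist y z.
Proof. exact: ler_distD. Qed.

HB.instance Definition _ := isPointed.Build (halfline R) (Halfline (lexx 0)).
HB.instance Definition _ := isMetric.Build R (halfline R)
  distxx dist_positivity dist_sym dist_triangle.

End halfline_metric.

Record sphere (R : realType) (d : nat) := Sphere {
  sphere_val :> 'cV[R]_d.+1 ;
  sphere_norm : enorm sphere_val == 1 }.

HB.instance Definition _ (R : realType) d := [isSub for @sphere_val R d].
HB.instance Definition _ (R : realType) d := [Choice of sphere R d by <:].

Section sphere_metric.
Context {R : realType} {d : nat}.

Let dist (x y : sphere R d) : R := enorm (sphere_val x - sphere_val y).

Let distxx x : dist x x = 0.
Proof. by rewrite /dist subrr enorm0. Qed.

Let dist_positivity x y : dist x y = 0 -> x = y.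
Proof. by move=> /enorm_eq0/subr0_eq xy; apply/val_inj. Qed.

Let dist_sym x y : dist x y = dist y x.
Proof. exact: enorm_distC. Qed.

Let dist_triangle y x z : dist x z <= dist x y + dist y z.
Proof. exact: enorm_dist_triangle. Qed.

Let delta_norm : enorm (delta_mx ord0 ord0 : 'cV[R]_d.+1) == 1.
Proof.
rewrite /enorm (bigD1 ord0)//= big1 => [|i /negPf i0].
  by rewrite mxE !eqxx addr0 expr1n sqrtr1.
by rewrite mxE i0 expr0n.
Qed.

Definition north : sphere R d := Sphere delta_norm.

HB.instance Definition _ := isPointed.Build (sphere R d) north.
HB.instance Definition _ := isMetric.Build R (sphere R d)
  distxx dist_positivity dist_sym dist_triangle.

End sphere_metric.

Section prod_metric.
Context {R : realType} (M N : metricType R).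

Let dist (x y : M * N) : R := Num.max (mdist x.1 y.1) (mdist x.2 y.2).

Let dist_ge0 x y : 0 <= dist x y.
Proof. by rewrite le_max mdist_ge0. Qed.

Let dist_positivity x y : dist x y = 0 -> x = y.
Proof.
case: x y => [x1 x2] [y1 y2] d0.
have : dist (x1, x2) (y1, y2) <= 0 by rewrite d0.
rewrite ge_max /= => /andP[h1 h2]; congr pair; apply: mdist_positivity.
  by apply/eqP; rewrite eq_le h1 mdist_ge0.
by apply/eqP; rewrite eq_le h2 mdist_ge0.
Qed.

Let ballEdist x e : ball x e = [set y | dist x y < e].
Proof.
apply/seteqP; split => y /=.
  by move=> [/=]; rewrite !ballEmdist /= /dist gt_max => -> ->.
by rewrite /dist gt_max => /andP[? ?]; split => /=; rewrite ballEmdist.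
Qed.

HB.instance Definition _ := @PseudoMetric_isMetric.Build R (M * N)%type
  dist dist_ge0 dist_positivity ballEdist.

End prod_metric.

HB.instance Definition _ (R : realType) (M N : PointedMetric.type R) :=
  Metric.on (M * N)%type.

Section polar.
Context {R : realType} {d : nat}.
Local Notation Rd := 'cV[R]_d.+1.

(* x / ||x|| for x != 0 (directionE), and (1, 0, ..., 0) at 0 (direction0). *)
Definition direction (x : Rd) : sphere R d := insubd north ((enorm x)^-1 *: x).

Lemma direction0 : direction 0 = north.
Proof. by apply/val_inj; rewrite val_insubd scaler0 enorm0 eq_sym oner_eq0. Qed.

Lemma directionE x : x != 0 -> direction x = (enorm x)^-1 *: x :> Rd.
Proof.
move=> x0; have nx0 : enorm x != 0 by apply: contra_neq x0; exact: enorm_eq0.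
rewrite /direction val_insubd enormZ ger0_norm ?invr_ge0 ?enorm_ge0//.
by rewrite mulVf// eqxx.
Qed.

Definition polar (x : Rd) : halfline R * sphere R d :=
  (Halfline (enorm_ge0 x), direction x).

(* The absolute value only makes the map total: c is taken to +oo. *)
Definition rescale (c : R) (p : halfline R * sphere R d) :
    halfline R * sphere R d :=
  (Halfline (mulr_ge0 (normr_ge0 c^-1) (hval_ge0 p.1)), p.2).

End polar.

Section M_convergence.
Context {R : realType} {S : PointedMetric.type R}.
Implicit Types (C : set S) (nu : set (borel S) -> \bar R) (f : S -> R).

Definition fattening C (r : R) : set S :=
  [set y | (ereal_inf [set (mdist c y)%:E | c in C] <= r%:E)%E].

Definition bounded_away (E F : set S) : Prop :=
  (0 < ereal_inf [set (mdist p.1 p.2)%:E | p in E `*` F])%E.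

(* Measures on S \ C are represented by set functions on S, of which only the
   values on the Borel sets disjoint from C matter; similarly, only the values
   outside C of a test function matter. *)
Definition in_M C nu : Prop :=
  (exists mu : {measure set (borel S) -> \bar R},
    forall E : set (borel S), measurable E -> E `<=` ~` C -> nu E = mu E) /\
  (forall r, 0 < r -> (nu (~` fattening C r) < +oo)%E).

Definition test_function C f : Prop :=
  [/\ forall x, ~ C x -> 0 <= f x,
      exists M, forall x, ~ C x -> f x <= M,
      {within ~` C, continuous f}
    & exists2 r, 0 < r & forall x, ~ C x -> fattening C r x -> f x = 0].

Definition Mcvg_uniform (J Th : Type) (F : set_system J) C (Theta : set Th)
    (nu_ : J -> Th -> set (borel S) -> \bar R)
    (nu : Th -> set (borel S) -> \bar R) : Prop :=
  [/\ \forall j \near F, forall th, Theta th -> in_M C (nu_ j th),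
      forall th, Theta th -> in_M C (nu th)
    & forall f, test_function C f ->
      (ereal_sup [set `| \int[nu_ j th]_(x in ~` C) (f x)%:E
                       - \int[nu th]_(x in ~` C) (f x)%:E | | th in Theta]
        @[j --> F] --> 0)%E].

Definition Mcvg (J : Type) (F : set_system J) C
    (nu_ : J -> set (borel S) -> \bar R) (nu : set (borel S) -> \bar R) : Prop :=
  [/\ \forall j \near F, in_M C (nu_ j), in_M C nu
    & forall f, test_function C f ->
      (\int[nu_ j]_(x in ~` C) (f x)%:E @[j --> F]
        --> \int[nu]_(x in ~` C) (f x)%:E)%E].

End M_convergence.

Section noise.
Context {R : realType} {d : nat} {disp : measure_display}.
Context {Omega : measurableType disp} (P : probability Omega R).
Local Notation Rd := 'cV[R]_d.+1.

Definition iid (Z : nat -> Omega -> borel Rd) : Prop :=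
  (forall n (B : set (borel Rd)), measurable B ->
     P (Z n @^-1` B) = P (Z 0%N @^-1` B)) /\
  (forall (s : seq nat) (B : nat -> set (borel Rd)), uniq s ->
     (forall n, measurable (B n)) ->
     P (\bigcap_(n in [set` s]) (Z n @^-1` B n)) =
     (\prod_(n <- s) P (Z n @^-1` B n))%E).

Definition tail_prob (Z : Omega -> Rd) (x : R) : R :=
  fine (P [set w | enorm (Z w) > x]).

Definition lambda (Z : Omega -> Rd) (eta : R) : R := eta^-1 * tail_prob Z eta^-1.

(* nu_alpha lives on ]0,+oo[; it is extended to [0,+oo[ without charging 0. *)
Definition is_nu_alpha (alpha : R) (nu : set (borel (halfline R)) -> \bar R) :=
  nu [set y | hval y = 0] = 0%E /\
  forall x, 0 < x -> nu [set y | x <= hval y] = (x `^ (- alpha))%:E.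

Definition MRV (Z : Omega -> Rd) (alpha : R)
    (nu : set (borel (halfline R)) -> \bar R)
    (S : set (borel (sphere R d)) -> \bar R) : Prop :=
  (forall t, 0 < t ->
     tail_prob Z (t * x) / tail_prob Z x @[x --> +oo] --> t `^ (- alpha)) /\
  Mcvg +oo%R [set p : halfline R * sphere R d | hval p.1 = 0]
    (fun x E => P [set w | E (rescale x (polar (Z w)))] * ((tail_prob Z x)^-1)%:E)%E
    (nu \x S)%E.

End noise.

Section process.
Context {R : realType} {m d : nat}.
Context (a : 'cV[R]_m -> 'cV[R]_m) (sigma : 'cV[R]_m -> 'M[R]_(m, d)).

Fixpoint sgd (eta : R) (z : nat -> 'cV[R]_d) (x : 'cV[R]_m) (t : nat) :=
  if t is t'.+1 then
    let y := sgd eta z x t' in y + eta *: a y + eta *: (sigma y *m z t'.+1)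
  else x.

End process.

Section step_path.
Context {R : realType} {m : nat} (T : {posnum R}).
Variables (u : nat -> 'cV[R]_m) (eta : R).

Definition step_fun (t : R) : 'cV[R]_m :=
  if t \in `[0, T%:num] then u (Num.truncn (t / eta)) else 0.

Let truncn_nonpos (s : R) : eta <= 0 -> 0 <= s -> Num.truncn (s / eta) = 0%N.
Proof.
move=> eta0 s0; apply/truncn0Pn; rewrite -ltNge (@le_lt_trans _ _ 0)//.
by rewrite mulr_ge0_le0// invr_le0.
Qed.

Let truncn_right (t : R) : 0 <= t ->
  \forall s \near t^'+, Num.truncn (s / eta) = Num.truncn (t / eta).
Proof.
move=> t0; have [eta0|eta0] := ltP 0 eta; last first.
  apply: filterS (nbhs_right_ge t) => s ts.
  by rewrite !truncn_nonpos// (le_trans t0).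
have te0 : 0 <= t / eta by rewrite divr_ge0// ltW.
have /andP[n1 n2] := truncn_itv te0.
have tn : t < (Num.truncn (t / eta)).+1%:R * eta by rewrite -ltr_pdivrMr.
apply: filterS2 (nbhs_right_ge t) (nbhs_right_lt tn) => s ts sn.
apply: truncn_def; rewrite ltr_pdivrMr// sn andbT.
by rewrite (le_trans n1)// ler_pM2r ?invr_gt0.
Qed.

Let truncn_left (t : R) : 0 < t ->
  exists n, \forall s \near t^'-, Num.truncn (s / eta) = n.
Proof.
move=> t0; have [eta0|eta0] := ltP 0 eta; last first.
  exists 0%N; apply: filterS (nbhs_left_ge t0) => s s0.
  by rewrite truncn_nonpos.
have te0 : 0 <= t / eta by rewrite divr_ge0// ltW.
have te1 : 0 < t / eta by rewrite divr_gt0.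
have [n n1 n2] : exists2 n : nat, n%:R < t / eta & t / eta <= n.+1%:R.
  have /andP[] := truncn_itv te0; case: (Num.truncn _) => [|n].
    by move=> _ /ltW; exists 0%N.
  rewrite le_eqVlt => /orP[/eqP <- _|h /ltW]; last by exists n.+1.
  by exists n => //; rewrite ltr_nat.
exists n; have nt : n%:R * eta < t by rewrite -ltr_pdivlMr.
apply: filterS2 (nbhs_left_ge nt) (nbhs_left_lt t) => s ns st.
apply: truncn_def; rewrite ler_pdivlMr// ns/=.
by apply: lt_le_trans n2; rewrite ltr_pM2r ?invr_gt0.
Qed.

Lemma step_cadlag : cadlag T step_fun.
Proof.
split=> t /andP[t0 tT].
  apply: cvg_near_cst.
  apply: filterS3 (truncn_right t0) (nbhs_right_gt t) (nbhs_right_lt tT).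
  move=> s hs ts sT; rewrite /step_fun !in_itv/= t0 (ltW tT) (ltW sT).
  by rewrite (le_trans t0 (ltW ts))/= hs.
have [n hn] := truncn_left t0; apply/cvg_ex; exists (u n).
apply: cvg_near_cst; apply: filterS3 hn (nbhs_left_lt t) (nbhs_left_ge t0).
move=> s hs st s0; rewrite /step_fun in_itv/= s0 (le_trans (ltW st) tT)/=.
by rewrite hs.
Qed.

Lemma step_out t : ~ `[0, T%:num]%classic t -> step_fun t = 0.
Proof. by rewrite /step_fun; case: ifP. Qed.

Definition step_path : Dspace m T := MkD step_cadlag step_out.

End step_path.

(* W, V and t are k-tuples of vectors, resp. of reals: tuples carry a product
   sigma-algebra in the library. *)
Section limit.
Context {R : realType} {m d : nat}.
Local Notation Rm := 'cV[R]_m.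
Local Notation Rd := 'cV[R]_d.
Context (a : Rm -> Rm) (sigma : Rm -> 'M[R]_(m, d)) (T : {posnum R}).
Local Notation I := (`[0, T%:num]%classic : set R).

Definition increasing_tuples (k : nat) (E : set R) : set (k.-tuple R) :=
  [set t | (forall i, E (tnth t i)) /\
           (forall i j : 'I_k, (i < j)%N -> tnth t i < tnth t j)].

(* The derivative is relative to [0,T], hence one-sided at 0 and T. *)
Definition perturbed_ode (k : nat) (x : Rm) (W : k.-tuple Rd)
    (V : k.-tuple Rm) (t : k.-tuple R) (xi : Dspace m T) : Prop :=
  [/\ xi 0 = x,
      forall s : R, I s -> (forall j, s <> tnth t j) ->
        (u - s)^-1 *: (xi u - xi s) @[u --> within I s^'] --> a (xi s)
    & forall j, let y := lim (xi u @[u --> (tnth t j)^'-]) + tnth V j in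
        xi (tnth t j) = y + sigma y *m tnth W j].

(* [get] selects the solution, which exists and is unique when a is Lipschitz
   continuous and t is increasing in ]0,T]. *)
Definition perturbed_path (k : nat) (x : Rm) (W : k.-tuple Rd) (V : k.-tuple Rm)
    (t : k.-tuple R) : Dspace m T :=
  get (perturbed_ode x W V t).

Definition jump_path (k : nat) (x : Rm) (W : k.-tuple Rd) (t : k.-tuple R) :=
  perturbed_path x W [tuple of nseq k 0] t.

Definition jump_paths (A : set Rm) (k : nat) (eps : R) : set (Dspace m T) :=
  [set xi | exists x (W : k.-tuple Rd) V t,
    [/\ A x, forall j, enorm (tnth V j) <= eps,
        @increasing_tuples k `]0, T%:num]%classic t & xi = perturbed_path x W V t]].

(* The paths with k - 1 jumps; the set of paths with -1 jumps is empty. *)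
Definition jump_paths_pred (A : set Rm) (k : nat) (eps : R) :=
  if k is k'.+1 then jump_paths A k' eps else set0.

End limit.
Arguments jump_paths_pred {R m d} a sigma T A k eps.

Section mpower.
Context {R : realType} {disp : measure_display} {X : measurableType disp}.
Variable mu : set X -> \bar R.

Fixpoint mpower (k : nat) : set (k.-tuple X) -> \bar R :=
  match k with
  | 0%N => \d_[tuple]
  | k'.+1 => pushforward (mu \x @mpower k')%E (fun p => [tuple of p.1 :: p.2])
  end.

End mpower.
Arguments mpower {R disp X} mu k.

Section limit_measure.
Context {R : realType} {m d : nat}.
Local Notation Rm := 'cV[R]_m.
Local Notation Rd := 'cV[R]_d.+1.

(* (nu x S) o Phi *)
Definition polar_measure (nu : set (borel (halfline R)) -> \bar R)
    (S : set (borel (sphere R d)) -> \bar R) (E : set (borel Rd)) : \bar R :=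
  (nu \x S)%E (polar @` (E `\ 0)).

Definition lebesgue_increasing (T : R) (k : nat)
    (E : set (k.-tuple (measurableTypeR R))) : \bar R :=
  mpower lebesgue_measure k (E `&` @increasing_tuples R k `]0, T[%classic).

Context (a : Rm -> Rm) (sigma : Rm -> 'M[R]_(m, d.+1)) (T : {posnum R}).

Definition limit_measure (nu : set (borel (halfline R)) -> \bar R)
    (S : set (borel (sphere R d)) -> \bar R) (k : nat) (x : Rm)
    (B : set (borel (Dspace m T))) : \bar R :=
  (\int[mpower (polar_measure nu S) k \x @lebesgue_increasing T%:num k]_p
     (\1_B (jump_path a sigma T x p.1 p.2))%:E)%E.

End limit_measure.
Arguments limit_measure {R m d} a sigma T nu S k x B.

(* Main.v *)
Require Import Defs.
From HB Require Import structures.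
From mathcomp Require Import all_boot all_order all_algebra.
From mathcomp Require Import all_classical all_reals all_analysis measurable_realfun.
From mathcomp Require Import ring lra zify.

Set Implicit Arguments.
Unset Strict Implicit.
Unset Printing Implicit Defensive.

Import Order.TTheory GRing.Theory Num.Theory.
Import numFieldNormedType.Exports.

Local Open Scope classical_set_scope.
Local Open Scope ring_scope.
Import HBNNSimple.

(** The scheme makes about T / eta steps, and a noise of norm of order 1 / eta
    occurs with probability of order lambda(eta) in total.  Clip the noise at
    norm delta / eta: an exponential Markov inequality with parameter of order
    ln (1 / eta) shows that the accumulated clipped noise stays small except on
    an event of probability O(eta^N) with N as large as we like, by the choice
    of delta; this is negligible with respect to lambda(eta)^k.  On the
    complement, by Gronwall, the scheme is close to a path of the differential
    equation perturbed at the times of the large noises.  Test functions vanish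
    near paths with k - 1 jumps, even shifted ones, since a small k-th jump can
    be absorbed in a shift; and k + 1 large noises have probability
    O(lambda(eta)^(k + 1)).  Hence only exactly k large noises contribute: the
    expectation is a sum over the sets of k grid times of integrals against the
    law of the noise; after division by lambda(eta)^k, regular variation turns
    the law of eta Z into the limit measure, and the sum over the grid times into
    a Lebesgue integral.  This is done along sequences eta_n -> 0, x_n -> x for
    Lipschitz test functions; compactness of A makes the convergence uniform,
    inf-convolutions extend it to continuous test functions, and truncated
    distances to B and to its complement give the portmanteau inequalities. *)

(** * Euclidean and operator norms *)

Section euclidean_norm.
Context {R : realType}.

(** Comparing the scheme with an unshifted path would multiply errors through jumps that are
    unbounded. Shifts reset the comparison path before each jump and keep the error free of the
    noise sizes. The set avoided by the test functions allows the same shifts, so fewer than [k]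
    large noises are handled without bounding them. Only with exactly [k] are the shifts dropped,
    once the scaled noises are restricted to norm at most [K].

    Two thresholds coexist. [delta1] depends on the test function and decides which jumps matter in
    the limit; the clipping level [delta] must be smaller still for the exponential bound to beat
    [lambda], which regular variation bounds below by a power of [eta]. The noises between the two
    are few and go into the error.

    The statement uses set functions and a solution picked by [get]: an explicit flow with
    uniqueness is built, and each set function is matched with a measure. Measurability on path
    space comes from continuous dependence on finitely many real numbers. *)

Lemma enorm_coord n (x : 'cV[R]_n) i : `|x i ord0| <= enorm x.
Proof.
rewrite -(@ler_pXn2r _ 2)// ?nnegrE ?enorm_ge0// enorm_sqr real_normK ?num_real//.
by rewrite (bigD1 i)//= lerDl sumr_ge0// => j _; exact: sqr_ge0.
Qed.

Lemma enorm_le_sum n (x : 'cV[R]_n) : enorm x <= \sum_i `|x i ord0|.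
Proof.
rewrite -(@ler_pXn2r _ 2)// ?nnegrE ?enorm_ge0// ?sumr_ge0// enorm_sqr.
rewrite [leRHS]expr2 mulr_suml; apply: ler_sum => i _.
rewrite -real_normK ?num_real// expr2 ler_wpM2l//.
by rewrite (bigD1 i)//= lerDl sumr_ge0.
Qed.

Lemma enormB_ge n (x y : 'cV[R]_n) : enorm x - enorm y <= enorm (x - y).
Proof. by rewrite lerBlDr -{1}(subrK y x) enorm_triangle. Qed.

Lemma enorm_sum n (I : Type) (r : seq I) (Q : pred I) (f : I -> 'cV[R]_n) :
  enorm (\sum_(i <- r | Q i) f i) <= \sum_(i <- r | Q i) enorm (f i).
Proof.
apply: (big_ind2 (fun (v : 'cV[R]_n) c => enorm v <= c)) => //; first by rewrite enorm0.
by move=> v1 c1 v2 c2 h1 h2; rewrite (le_trans (enorm_triangle _ _))// lerD.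
Qed.

Lemma norm_le_enorm n (x : 'cV[R]_n) : `|x| <= enorm x.
Proof.
rewrite [leLHS]/Num.norm/= mx_normrE; apply/bigmax_leP; split; first exact: enorm_ge0.
by move=> [i j] _ /=; rewrite (ord1 j) enorm_coord.
Qed.

(** The library topology on vectors comes from the max norm; equivalence of norms lets all later
    limits be stated with [enorm]. *)
Lemma enorm_cvgP n {J : Type} {F : set_system J} {FF : Filter F}
    (f : J -> 'cV[R]_n) (l : 'cV[R]_n) :
  f @ F --> l <-> forall e, 0 < e -> \forall u \near F, enorm (f u - l) < e.
Proof.
split=> [fl e e0|h].
  have e1 : 0 < e / n.+1%:R by rewrite divr_gt0.
  have /cvgrPdist_lt/(_ _ e1) := fl; apply: filterS => u; rewrite distrC => h.
  rewrite (le_lt_trans (enorm_le_norm _))//.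
  apply: (@le_lt_trans _ _ (n.+1%:R * `|f u - l|)).
    by rewrite ler_wpM2r// ler_nat.
  by rewrite -ltr_pdivlMl// mulrC.
apply/cvgrPdist_lt => e e0; near=> u.
rewrite distrC (le_lt_trans (norm_le_enorm _))//.
by near: u; exact: h.
Unshelve. all: by end_near. Qed.

(** The Frobenius norm. It bounds the set whose supremum is [opnorm]; without a bound that supremum
    would carry no information. *)
Let frob m n (M : 'M[R]_(m, n)) : R := Num.sqrt (\sum_i enorm (row i M)^T ^+ 2).

Let frobP m n (M : 'M[R]_(m, n)) (w : 'cV[R]_n) :
  enorm (M *m w) <= frob M * enorm w.
Proof.
have F0 : 0 <= \sum_i enorm (row i M)^T ^+ 2 by apply: sumr_ge0 => i _; exact: sqr_ge0.
rewrite -(@ler_pXn2r _ 2)// ?nnegrE ?enorm_ge0// ?mulr_ge0 ?enorm_ge0 ?sqrtr_ge0//.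
rewrite exprMn enorm_sqr sqr_sqrtr// mulr_suml; apply: ler_sum => i _.
rewrite -real_normK ?num_real// -exprMn ler_pXn2r// ?nnegrE ?mulr_ge0 ?enorm_ge0//.
rewrite mxE; set s := \sum__ _.
have -> : s = \sum_j (row i M)^T j ord0 * w j ord0.
  by apply: eq_bigr => j _; rewrite !mxE.
rewrite ler_norml cauchy_schwarz andbT lerNl -sumrN.
under eq_bigr do rewrite -mulrN.
have -> : \sum_j (row i M)^T j ord0 * - w j ord0
   = \sum_j (row i M)^T j ord0 * (- w) j ord0.
  by apply: eq_bigr => j _; rewrite [(- w) _ _]mxE.
by rewrite -(enormN w) cauchy_schwarz.
Qed.

Lemma enorm_mulmx m n (M : 'M[R]_(m, n)) (w : 'cV[R]_n) :
  enorm (M *m w) <= opnorm M * enorm w.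
Proof.
have ub : has_ubound [set enorm (M *m w) | w in [set w | enorm w <= 1]].
  exists (frob M) => _ [u /= u1 <-]; rewrite (le_trans (frobP _ _))//.
  by rewrite ler_piMr// sqrtr_ge0.
have [/eqP/enorm_eq0 ->|w0] := boolP (enorm w == 0).
  by rewrite mulmx0 !enorm0 mulr0.
have wp : 0 < enorm w by rewrite lt0r w0 enorm_ge0.
rewrite -ler_pdivrMr//; apply: ub_le_sup => //=.
exists ((enorm w)^-1 *: w) => /=.
  by rewrite enormZ ger0_norm ?invr_ge0 ?enorm_ge0// mulVf.
by rewrite -scalemxAr enormZ ger0_norm ?invr_ge0 ?enorm_ge0// mulrC.
Qed.

(** Identities and estimates for the flow are proved on its dyadic approximations; this removes the
    geometric error. *)
Lemma ler_add_geom (x y K : R) : (forall n, x <= y + K / 2 ^+ n) -> x <= y.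
Proof.
move=> h; apply/ler_addgt0Pr => e e0.
have K1 : 0 < `|K| + 1 by rewrite ltr_wpDl.
have [n hn] : exists n, (`|K| + 1) / e < 2 ^+ n.
  exists (Num.truncn ((`|K| + 1) / e)).+1.
  rewrite (lt_le_trans (truncnS_gt _))// -natrX ler_nat.
  exact/ltnW/ltn_expl.
apply: (le_trans (h n)); rewrite lerD2l ler_pdivrMr ?exprn_gt0//.
rewrite ltr_pdivrMr// in hn; rewrite mulrC (le_trans _ (ltW hn))//.
by rewrite (le_trans (ler_norm _))// lerDl.
Qed.

(** With [c n = 2 K / 2 ^ n], the sequence [u n - c n] increases, [u n + c n] decreases and the two
    never cross; the limit is the supremum of the former, which makes the rate explicit. *)
Lemma geom_cvg_real (u : nat -> R) (K : R) :
  (forall n, `|u n.+1 - u n| <= K / 2 ^+ n) ->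
  exists l, forall n, `|u n - l| <= K *+ 2 / 2 ^+ n.
Proof.
move=> h; pose c n : R := K *+ 2 / 2 ^+ n.
have hc n : c n.+1 + K / 2 ^+ n = c n.
  rewrite /c exprS mulr2n; have : (2 : R) ^+ n != 0 by rewrite expf_neq0.
  by move=> ?; field.
have h1 n : u n - c n <= u n.+1 - c n.+1.
  by have := h n; rewrite ler_norml -(hc n) => /andP[? ?]; lra.
have h2 n : u n.+1 + c n.+1 <= u n + c n.
  by have := h n; rewrite ler_norml -(hc n) => /andP[? ?]; lra.
have c0 n : 0 <= c n.
  have K0 : 0 <= K by have := le_trans (normr_ge0 _) (h 0%N); rewrite expr0 divr1.
  by rewrite /c divr_ge0// ?mulrn_wge0// exprn_ge0.
have mono1 n k : u n - c n <= u (n + k)%N - c (n + k)%N.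
  by elim: k => [|k ih]; rewrite ?addn0// addnS (le_trans ih).
have mono2 n k : u (n + k)%N + c (n + k)%N <= u n + c n.
  by elim: k => [|k ih]; rewrite ?addn0// addnS (le_trans _ ih).
have cross n k : u n - c n <= u k + c k.
  rewrite (le_trans (mono1 n k))// (le_trans _ (mono2 k n))// addnC.
  by have := c0 (k + n)%N; lra.
pose A := [set u n - c n | n in setT].
exists (sup A) => n; rewrite ler_distlC; apply/andP; split.
  by apply: ub_le_sup; [exists (u 0%N + c 0%N) => _ [k _ <-]|exists n].
by apply: ge_sup; [exists (u 0%N - c 0%N); exists 0%N|move=> _ [k _ <-]].
Qed.

Lemma geom_cvg n (u : nat -> 'cV[R]_n) (K : R) :
  (forall k, enorm (u k.+1 - u k) <= K / 2 ^+ k) ->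
  exists l, forall k, enorm (u k - l) <= n%:R * (K *+ 2) / 2 ^+ k.
Proof.
move=> h.
have /choice[l hl] : forall i : 'I_n,
    exists l, forall k, `|u k i ord0 - l| <= K *+ 2 / 2 ^+ k.
  move=> i; apply: geom_cvg_real => k; apply: le_trans (h k).
  by rewrite (le_trans _ (enorm_coord _ i))// !mxE.
exists (\col_i l i) => k; rewrite (le_trans (enorm_le_sum _))//.
apply: (@le_trans _ _ (\sum_(i < n) (K *+ 2 / 2 ^+ k))).
  by apply: ler_sum => i _; rewrite !mxE.
by rewrite sumr_const card_ord -[leLHS]mulr_natl mulrA.
Qed.

End euclidean_norm.

(** * The flow of a bounded Lipschitz vector field *)

Section flow.
Context {R : realType} {m : nat}.
Local Notation Rm := 'cV[R]_m.
Variables (a : Rm -> Rm) (D C : R).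
Hypotheses (D0 : 0 <= D) (C0 : 0 <= C).
Hypothesis aL : forall x y, enorm (a x - a y) <= D * enorm (x - y).
Hypothesis aB : forall x, enorm (a x) <= C.

Definition euler (h : R) (n : nat) (x : Rm) : Rm := iter n (fun y => y + h *: a y) x.

Lemma eulerS h n x : euler h n.+1 x = euler h n x + h *: a (euler h n x).
Proof. by []. Qed.

Lemma eulerD h i j x : euler h (i + j) x = euler h j (euler h i x).
Proof. by rewrite addnC /euler iterD. Qed.

Let step_lip h (x y : Rm) : 0 <= h ->
  enorm ((x + h *: a x) - (y + h *: a y)) <= (1 + h * D) * enorm (x - y).
Proof.
move=> h0.
have -> : x + h *: a x - (y + h *: a y) = (x - y) + h *: (a x - a y).
  by rewrite scalerBr opprD addrACA.
rewrite (le_trans (enorm_triangle _ _))// mulrDl mul1r lerD2l enormZ ger0_norm//.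
by rewrite -mulrA ler_wpM2l.
Qed.

Lemma euler_lip h n x y : 0 <= h ->
  enorm (euler h n x - euler h n y) <= expR (D * (n%:R * h)) * enorm (x - y).
Proof.
move=> h0; elim: n => [|n ih]; first by rewrite mul0r mulr0 expR0 mul1r.
rewrite !eulerS (le_trans (step_lip _ _ h0))//.
have e1 : 1 + h * D <= expR (D * h) by rewrite [D * h]mulrC expR_ge1Dx.
have -> : D * (n.+1%:R * h) = D * h + D * (n%:R * h) by rewrite -natr1; ring.
by rewrite expRD -mulrA ler_pM// ?addr_ge0 ?mulr_ge0 ?enorm_ge0.
Qed.

Lemma euler_move h n x : 0 <= h -> enorm (euler h n x - x) <= n%:R * h * C.
Proof.
move=> h0; elim: n => [|n ih]; first by rewrite subrr enorm0 !mul0r.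
rewrite eulerS addrAC (le_trans (enorm_triangle _ _))//.
have -> : n.+1%:R * h * C = n%:R * h * C + h * C by rewrite -natr1; ring.
by rewrite lerD// enormZ ger0_norm// ler_wpM2l.
Qed.

Lemma euler_step h n x : 0 <= h ->
  enorm (euler h n x - x - (n%:R * h) *: a x) <= D * C * (n%:R * h) ^+ 2.
Proof.
move=> h0; elim: n => [|n ih].
  by rewrite subrr !mul0r scale0r subr0 enorm0 expr0n/= mulr0.
have -> : euler h n.+1 x - x - (n.+1%:R * h) *: a x =
    (euler h n x - x - (n%:R * h) *: a x) + h *: (a (euler h n x) - a x).
  rewrite eulerS -natr1 mulrDl mul1r scalerDl scalerBr.
  by apply/colP => i; rewrite !mxE; ring.
rewrite (le_trans (enorm_triangle _ _))// enormZ ger0_norm//.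
have h2 : h * enorm (a (euler h n x) - a x) <= h * (D * (n%:R * h * C)).
  by rewrite ler_wpM2l// (le_trans (aL _ _))// ler_wpM2l// euler_move.
rewrite (le_trans (lerD ih h2))// -natr1.
have : 0 <= D * C * h ^+ 2 * (n%:R + 1).
  by rewrite !mulr_ge0 ?sqr_ge0.
lra.
Qed.

(** Replacing one step by two half steps costs at most [h ^+ 2 * D * C], and the errors of [n] steps
    are amplified by the exponential Lipschitz factor. *)
Let halving h n x : 0 <= h ->
  enorm (euler (h / 2) n.*2 x - euler h n x) <=
  n%:R * h ^+ 2 * D * C * expR (D * (n%:R * h)).
Proof.
move=> h0; have h20 : 0 <= h / 2 by rewrite divr_ge0.
elim: n => [|n ih]; first by rewrite subrr enorm0 !mul0r.
rewrite doubleS !eulerS; set y := euler (h / 2) _ _ in ih *; set z := euler h n x in ih *.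
set E := expR _ in ih.
have -> : y + (h / 2) *: a y + (h / 2) *: a (y + (h / 2) *: a y) - (z + h *: a z) =
  ((y + h *: a y) - (z + h *: a z)) + (h / 2) *: (a (y + (h / 2) *: a y) - a y).
  by rewrite scalerBr; apply/colP => i; rewrite !mxE; field.
rewrite (le_trans (enorm_triangle _ _))//.
have l1 := le_trans (step_lip y z h0) (ler_wpM2l _ ih).
have l2 : enorm ((h / 2) *: (a (y + (h / 2) *: a y) - a y)) <= h ^+ 2 * D * C.
  rewrite enormZ ger0_norm//.
  have -> : h ^+ 2 * D * C = (h / 2) * (D * ((h * 2) * C)) by field.
  rewrite ler_wpM2l// (le_trans (aL _ _))// ler_wpM2l//.
  rewrite addrC addKr enormZ ger0_norm//.
  by rewrite (le_trans (ler_wpM2l h20 (aB _)))// ler_wpM2r//; lra.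
apply: (le_trans (lerD (l1 _) l2)); first by rewrite addr_ge0// mulr_ge0.
have -> : D * (n.+1%:R * h) = h * D + D * (n%:R * h) by rewrite -natr1; ring.
rewrite expRD -/E -natr1.
have e1 : 1 + h * D <= expR (h * D) by rewrite expR_ge1Dx.
set K := h ^+ 2 * D * C; have K0 : 0 <= K by rewrite !mulr_ge0// sqr_ge0.
have E1 : 1 <= E by rewrite -expR0 ler_expR !mulr_ge0.
have EE : 1 <= expR (h * D) * E.
  by rewrite -expRD -expR0 ler_expR addr_ge0 ?mulr_ge0.
have p1 : 0 <= (expR (h * D) - (1 + h * D)) * (n%:R * K * E).
  by rewrite mulr_ge0 ?subr_ge0// !mulr_ge0// (le_trans ler01).
have p2 : 0 <= K * (expR (h * D) * E - 1) by rewrite mulr_ge0// subr_ge0.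
suff -> : (n%:R + 1) * h ^+ 2 * D * C * (expR (h * D) * E)
  = (1 + h * D) * (n%:R * h ^+ 2 * D * C * E) + h ^+ 2 * D * C
    + ((expR (h * D) - (1 + h * D)) * (n%:R * K * E) + K * (expR (h * D) * E - 1)).
  by rewrite lerDl addr_ge0.
by rewrite /K; ring.
Qed.

Let dy (t : R) (n : nat) : nat := Num.truncn (t * 2 ^+ n).
Let approx (t : R) x n := euler (2 ^+ n)^-1 (dy t n) x.

Let p2 n : 0 < (2 : R) ^+ n. Proof. by rewrite exprn_gt0. Qed.
Let p2i n : 0 <= ((2 : R) ^+ n)^-1. Proof. by rewrite invr_ge0 ltW. Qed.

Let dyP t n : 0 <= t -> (dy t n)%:R * (2 ^+ n)^-1 <= t /\
   t < (dy t n)%:R * (2 ^+ n)^-1 + (2 ^+ n)^-1.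
Proof.
move=> t0; have := truncn_itv (mulr_ge0 t0 (ltW (p2 n))).
rewrite -/(dy t n) => /andP[h1 h2]; split; first by rewrite ler_pdivrMr.
by rewrite -{2}[(_ ^+ n)^-1]mul1r -mulrDl ltr_pdivlMr// natr1.
Qed.

Let dyS t n : 0 <= t -> exists b : bool, dy t n.+1 = ((dy t n).*2 + b)%N.
Proof.
move=> t0; have /andP[h1 h2] := truncn_itv (mulr_ge0 t0 (ltW (p2 n))).
have /andP[k1 k2] := truncn_itv (mulr_ge0 t0 (ltW (p2 n.+1))).
rewrite -!/(dy _ _) in h1 h2 k1 k2.
have j1 : ((dy t n).*2 < (dy t n.+1).+1)%N.
  by rewrite -(ltr_nat R) (le_lt_trans _ k2)// exprS -muln2 natrM; lra.
have j2 : (dy t n.+1 < (dy t n).*2.+2)%N.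
  rewrite -(ltr_nat R) (le_lt_trans k1)// exprS -doubleS -muln2 natrM; lra.
exists (dy t n.+1 == (dy t n).*2.+1); case: eqP => [->|/eqP h]; lia.
Qed.

(** The first term comes from [halving], the second from the half step that refining the dyadic grid
    may add before [t]. *)
Let K1 t := t * D * C * expR (D * t) + C.

Let approx_cauchy t x n : 0 <= t ->
  enorm (approx t x n.+1 - approx t x n) <= K1 t / 2 ^+ n.
Proof.
move=> t0; have [b hb] := dyS n t0.
have eh : ((2 : R) ^+ n.+1)^-1 = (2 ^+ n)^-1 / 2.
  by rewrite exprS invfM mulrC.
rewrite /approx hb eh eulerD; set h := (2 ^+ n)^-1.
have h0 : 0 <= h := p2i n.
have h20 : 0 <= h / 2 by rewrite divr_ge0.
set y := euler (h / 2) _ x; set z := euler h _ x.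
rewrite -(subrK y (euler _ _ _)) -addrA (le_trans (enorm_triangle _ _))//.
have l1 : enorm (euler (h / 2) b y - y) <= C * h.
  rewrite (le_trans (euler_move _ _ h20))// mulrC ler_wpM2l//.
  by case: b {hb} => /=; rewrite ?mul0r ?mul1r//; lra.
have l2 : enorm (y - z) <= t * D * C * expR (D * t) * h.
  rewrite (le_trans (halving _ _ h0))//.
  have [th _] := dyP n t0; rewrite -/h in th.
  have -> : (dy t n)%:R * h ^+ 2 * D * C * expR (D * ((dy t n)%:R * h)) =
    (((dy t n)%:R * h) * (D * C * h)) * expR (D * ((dy t n)%:R * h)) by ring.
  have -> : t * D * C * expR (D * t) * h = (t * (D * C * h)) * expR (D * t) by ring.
  by rewrite ler_pM ?expR_ge0 ?ler_expR ?ler_wpM2l ?ler_wpM2r ?mulr_ge0.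
rewrite (le_trans (lerD l1 l2))// /K1; lra.
Qed.

(** The limit of the dyadic Euler schemes, picked through its rate of convergence, so that every
    approximation comes with an explicit error. *)
Definition flow (t : R) (x : Rm) : Rm :=
  get [set l | forall n, enorm (approx t x n - l) <= m%:R * (K1 t *+ 2) / 2 ^+ n].

Let K2 t := m%:R * (K1 t *+ 2).

Let flowP t x n : 0 <= t -> enorm (approx t x n - flow t x) <= K2 t / 2 ^+ n.
Proof.
move=> t0; have := geom_cvg (fun k => approx_cauchy x k t0).
move=> [l hl]; rewrite /flow; case: xgetP => [y _|/(_ l)]; first by move=> ->.
by move=> /(_ hl).
Qed.

Lemma flow0 x : flow 0 x = x.
Proof.
apply/subr0_eq/enorm_eq0/eqP; rewrite eq_le enorm_ge0 andbT.
apply: (@ler_add_geom _ _ _ (K2 0)) => n; rewrite add0r enorm_distC.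
by have := flowP x n (lexx 0); rewrite /approx /dy mul0r truncn0.
Qed.

Let limit2 s t x y n (c : R) : 0 <= s -> 0 <= t ->
  enorm (approx s x n - approx t y n) <= c ->
  enorm (flow s x - flow t y) <= c + (K2 s + K2 t) / 2 ^+ n.
Proof.
move=> s0 t0 h; have := flowP x n s0; rewrite enorm_distC => h1.
have h2 := flowP y n t0.
have := enorm_dist_triangle (approx s x n) (flow s x) (flow t y).
have := enorm_dist_triangle (approx t y n) (approx s x n) (flow t y).
rewrite mulrDl; lra.
Qed.

Lemma flow_lip t x y : 0 <= t ->
  enorm (flow t x - flow t y) <= expR (D * t) * enorm (x - y).
Proof.
move=> t0; apply: (@ler_add_geom _ _ _ (K2 t + K2 t)) => n; apply: limit2 => //.
rewrite (le_trans (euler_lip _ _ _ (p2i n)))// ler_wpM2r ?enorm_ge0//.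
by rewrite ler_expR ler_wpM2l//; case: (dyP n t0).
Qed.

Let flow_move1 s t x : 0 <= s -> s <= t ->
  enorm (flow t x - flow s x) <= C * (t - s).
Proof.
move=> s0 st; have t0 := le_trans s0 st.
apply: (@ler_add_geom _ _ _ (C + (K2 t + K2 s))) => n.
have [h1 h2] := dyP n s0; have [h3 h4] := dyP n t0.
rewrite [_ / _]mulrDl addrA; apply: limit2 => //.
have dd : (dy s n <= dy t n)%N by rewrite le_truncn// ler_wpM2r// ltW.
rewrite /approx -(subnKC dd) eulerD (le_trans (euler_move _ _ (p2i n)))//.
rewrite natrB// mulrC -mulrDr ler_wpM2l//; lra.
Qed.

Lemma flow_move s t x : 0 <= s -> 0 <= t ->
  enorm (flow t x - flow s x) <= C * `|t - s|.
Proof.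
move=> s0 t0; have [st|ts] := leP s t.
  by rewrite ger0_norm ?subr_ge0// flow_move1.
by rewrite enorm_distC ltr0_norm ?subr_lt0// opprB flow_move1// ltW.
Qed.

Lemma flow_step t x : 0 <= t ->
  enorm (flow t x - x - t *: a x) <= D * C * t ^+ 2.
Proof.
move=> t0; apply: (@ler_add_geom _ _ _ (K2 t + C)) => n.
have [h1 h2] := dyP n t0; set d := (dy t n)%:R * _ in h1 h2.
have -> : flow t x - x - t *: a x = (flow t x - approx t x n) +
   ((approx t x n - x - d *: a x) + (d - t) *: a x).
  by rewrite scalerBl; apply/colP => i; rewrite !mxE; ring.
have l1 := flowP x n t0; rewrite enorm_distC in l1.
have l2 : enorm (approx t x n - x - d *: a x) <= D * C * t ^+ 2.
  rewrite (le_trans (euler_step _ _ (p2i n)))// ler_wpM2l ?mulr_ge0//.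
  by rewrite ler_pXn2r// ?nnegrE ?mulr_ge0.
have l3 : enorm ((d - t) *: a x) <= C / 2 ^+ n.
  rewrite enormZ distrC ger0_norm ?subr_ge0// mulrC.
  by rewrite ler_pM ?enorm_ge0 ?subr_ge0//; lra.
have := enorm_triangle (flow t x - approx t x n)
  ((approx t x n - x - d *: a x) + (d - t) *: a x).
have := enorm_triangle (approx t x n - x - d *: a x) ((d - t) *: a x).
rewrite mulrDl; lra.
Qed.

(** At a dyadic time [sq] the Euler steps before and after it add up exactly on all finer grids,
    which gives the identity for [sq]; continuity in time then lets [sq] tend to [s]. *)
Lemma flowD s t x : 0 <= s -> 0 <= t -> flow (s + t) x = flow t (flow s x).
Proof.
move=> s0 t0; apply/subr0_eq/enorm_eq0/eqP; rewrite eq_le enorm_ge0 andbT.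
apply: (@ler_add_geom _ _ _ (C + expR (D * t) * C)) => q; rewrite add0r.
have [h1 h2] := dyP q s0; set p := dy s q in h1 h2; set sq := p%:R * _ in h1 h2.
have sq0 : 0 <= sq by rewrite mulr_ge0.
have key : flow (sq + t) x = flow t (flow sq x).
  apply/subr0_eq/enorm_eq0/eqP; rewrite eq_le enorm_ge0 andbT.
  apply: (@ler_add_geom _ _ _ (K2 (sq + t) + (expR (D * t) * K2 sq + K2 t))) => r.
  rewrite add0r.
  have n_ : approx (sq + t) x (q + r) = approx t (approx sq x (q + r)) (q + r).
    have d1 : dy sq (q + r) = (p * 2 ^ r)%N.
      rewrite /dy /sq exprD mulrA mulfVK ?lt0r_neq0// -natrX -natrM.
      by rewrite natrK.
    rewrite /approx -eulerD; congr euler; rewrite d1 /dy mulrDl.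
    have -> : sq * 2 ^+ (q + r) = (p * 2 ^ r)%:R.
      by rewrite /sq exprD mulrA mulfVK ?lt0r_neq0// -natrX -natrM.
    apply: truncn_def.
    have /andP[e1 e2] := truncn_itv (mulr_ge0 t0 (ltW (p2 (q + r)))).
    rewrite natrD lerD2l e1/= -addnS natrD ltrD2l//.
  have r1 := flowP x (q + r) (addr_ge0 sq0 t0).
  have r2 := flowP x (q + r) sq0.
  have r3 := flowP (approx sq x (q + r)) (q + r) t0.
  have r4 := flow_lip (approx sq x (q + r)) (flow sq x) t0.
  have hh (c : R) : 0 <= c -> c / 2 ^+ (q + r) <= c / 2 ^+ r.
    move=> c0; rewrite ler_wpM2l//. rewrite lef_pV2 ?posrE//.
    by rewrite ler_eXn2l ?ltr1n// leq_addl.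
  have K20 u : 0 <= u -> 0 <= K2 u.
    by move=> u0; rewrite /K2 /K1 mulr_ge0// mulrn_wge0// addr_ge0// !mulr_ge0// expR_ge0.
  have r1' := le_trans r1 (hh _ (K20 _ (addr_ge0 sq0 t0))).
  have r2' := le_trans r2 (hh _ (K20 _ sq0)).
  have r3' := le_trans r3 (hh _ (K20 _ t0)).
  have r4' := le_trans r4 (ler_wpM2l (expR_ge0 _) r2').
  rewrite -n_ in r3'.
  rewrite !mulrDl; apply: le_trans (enorm_dist_triangle (approx (sq + t) x (q + r)) _ _) _.
  apply: lerD; first by rewrite enorm_distC.
  apply: le_trans (enorm_dist_triangle (flow t (approx sq x (q + r))) _ _) _.
  by rewrite addrC; apply: lerD; rewrite // -mulrA.
have m1 := flow_move x (addr_ge0 sq0 t0) (addr_ge0 s0 t0).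
have m2 := flow_lip (flow sq x) (flow s x) t0.
have m3 := flow_move x s0 sq0.
rewrite (_ : s + t - (sq + t) = s - sq) in m1; last by ring.
have ds : `|s - sq| <= (2 ^+ q)^-1.
  by rewrite ger0_norm ?subr_ge0// lerBlDl ltW.
have ds' : `|sq - s| <= (2 ^+ q)^-1 by rewrite distrC.
have m1' := le_trans m1 (ler_wpM2l C0 ds).
have m3' := le_trans m3 (ler_wpM2l C0 ds').
have m2' := le_trans m2 (ler_wpM2l (expR_ge0 _) m3').
apply: le_trans (enorm_dist_triangle (flow (sq + t) x) _ _) _.
rewrite mulrDl; apply: lerD; first exact: m1'.
by rewrite key -mulrA; exact: m2'.
Qed.

End flow.

(** * Difference quotients and one-sided limits in epsilon form *)

Section elementary_limits.
Context {R : realType} {m : nat}.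
Local Notation Rm := 'cV[R]_m.
Implicit Types (xi : R -> Rm) (A : set R).

(** Differentiability relative to [A], without division; with [[0, T]] for [A] it is the derivative
    of [perturbed_ode], one-sided at the end points. *)
Definition diff_at A xi (s : R) (v : Rm) : Prop :=
  forall e, 0 < e -> exists2 g, 0 < g & forall u, A u -> `|u - s| < g ->
    enorm (xi u - xi s - (u - s) *: v) <= e * `|u - s|.

Lemma diff_atP A xi s v :
  (u - s)^-1 *: (xi u - xi s) @[u --> within A s^'] --> v <-> diff_at A xi s v.
Proof.
split=> [/enorm_cvgP h e e0|h].
  have := h _ e0; rewrite near_withinE => /nbhs_ballP[g /= g0 hg].
  exists g => // u Au us; have [->|ne] := eqVneq u s.
    by rewrite !subrr scale0r subr0 enorm0 normr0 mulr0.
  have := hg u; rewrite /ball/= distrC => /(_ us ne Au) hu.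
  have us0 : u - s != 0 by rewrite subr_eq0.
  have -> : xi u - xi s - (u - s) *: v
      = (u - s) *: ((u - s)^-1 *: (xi u - xi s) - v).
    by rewrite scalerBr scalerA divff// scale1r.
  by rewrite enormZ mulrC ler_wpM2r// ltW.
apply/enorm_cvgP => e e0; have e20 : 0 < e / 2 by rewrite divr_gt0.
have [g g0 hg] := h _ e20.
rewrite near_withinE; exists g => //= u; rewrite /ball_/= distrC => us ne Au.
have us0 : u - s != 0 by rewrite subr_eq0.
have -> : (u - s)^-1 *: (xi u - xi s) - v
   = (u - s)^-1 *: (xi u - xi s - (u - s) *: v).
  by rewrite [RHS]scalerBr scalerA mulVf// scale1r.
rewrite enormZ normfV.
rewrite mulrC ltr_pdivrMr ?normr_gt0// (le_lt_trans (hg _ Au us))//.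
by rewrite ltr_pM2r ?normr_gt0//; lra.
Qed.

Definition left_lim xi (s : R) (v : Rm) : Prop :=
  forall e, 0 < e -> exists2 g, 0 < g & forall u, s - g < u -> u < s ->
    enorm (xi u - v) < e.

Lemma left_limP xi s v : xi u @[u --> s^'-] --> v <-> left_lim xi s v.
Proof.
split=> [/enorm_cvgP h e e0|h].
  have := h _ e0; rewrite near_withinE => /nbhs_ballP[g /= g0 hg].
  exists g => // u us us'; apply: hg => //.
  by rewrite /ball/= ger0_norm; lra.
apply/enorm_cvgP => e /h[g g0 hg]; rewrite near_withinE.
exists g => //= u; rewrite /ball_/= => us us'; apply: hg => //.
by move: us; rewrite ger0_norm; lra.
Qed.

Lemma left_lim_lim xi s v : left_lim xi s v -> lim (xi u @[u --> s^'-]) = v.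
Proof. by move=> /left_limP; exact: cvg_lim. Qed.

Definition right_cont xi (s : R) : Prop :=
  forall e, 0 < e -> exists2 g, 0 < g & forall u, s <= u -> u < s + g ->
    enorm (xi u - xi s) < e.

Lemma right_contP xi s : xi u @[u --> s^'+] --> xi s <-> right_cont xi s.
Proof.
split=> [/enorm_cvgP h e e0|h].
  have := h _ e0; rewrite near_withinE => /nbhs_ballP[g /= g0 hg].
  exists g => // u; rewrite le_eqVlt => /orP[/eqP <-|su us].
    by rewrite subrr enorm0.
  by apply: hg => //; rewrite /ball/= ltr0_norm; lra.
apply/enorm_cvgP => e /h[g g0 hg]; rewrite near_withinE.
exists g => //= u; rewrite /ball_/= => us us'; apply: hg => //; first exact: ltW.
by move: us; rewrite ltr0_norm; lra.
Qed.

Lemma diff_at_move A xi s v : diff_at A xi s v ->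
  exists2 g, 0 < g & forall u, A u -> `|u - s| < g ->
    enorm (xi u - xi s) <= (enorm v + 1) * `|u - s|.
Proof.
move=> /(_ 1 ltr01)[g g0 h]; exists g => // u Au us.
rewrite -(subrK ((u - s) *: v) (xi u - xi s)).
rewrite (le_trans (enorm_triangle _ _))// enormZ.
by have := h _ Au us; lra.
Qed.

End elementary_limits.

(** The mean value theorem, with derivative and continuity in the epsilon form produced by estimates
    on the flow. *)
Lemma zero_derivative_const {R : realType} (g : R -> R) (s t : R) : s <= t ->
  (forall v, s < v < t -> forall e, 0 < e ->
     exists2 c, 0 < c & forall w, `|w - v| < c -> `|g w - g v| <= e * `|w - v|) ->
  (forall v, s <= v <= t -> forall e, 0 < e ->
     exists2 c, 0 < c & forall w, s <= w <= t -> `|w - v| < c -> `|g w - g v| < e) ->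
  g t = g s.
Proof.
move=> st hd hc.
have [] := @MVT_segment R g (fun=> 0) s t st.
- move=> v; rewrite in_itv/= => vst.
  have cv : h^-1 *: ((g \o shift v) (h *: (1 : R)) - g v) @[h --> 0^'] --> (0 : R).
    apply/cvgrPdist_lt => e e0; have e20 : 0 < e / 2 by rewrite divr_gt0.
    have [c c0 h] := hd v vst _ e20.
    exists c => //= y; rewrite /ball_/= sub0r normrN => yc y0.
    have -> : y *: (1 : R) = y by rewrite /GRing.scale/= mulr1.
    rewrite sub0r normrN /GRing.scale/= normrM normfV mulrC.
    rewrite ltr_pdivrMr ?normr_gt0//.
    have := h (y + v); rewrite addrK => /(_ yc) /le_lt_trans; apply.
    by rewrite ltr_pM2r ?normr_gt0//; lra.
  apply: DeriveDef; first by apply/cvg_ex; exists 0.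
  exact: cvg_lim cv.
- apply/subspace_continuousP => v; rewrite /= in_itv/= => vst.
  apply/cvgrPdist_lt => e e0; have [c c0 h] := hc v vst _ e0.
  rewrite near_withinE; exists c => //= w; rewrite /ball_/= => wv.
  rewrite in_itv/= => wst; rewrite distrC; apply: h => //.
  by rewrite distrC.
by move=> c _; rewrite mul0r => /eqP; rewrite subr_eq0 => /eqP.
Qed.

(** * Uniqueness for the equation without jumps *)

Section uniqueness.
Context {R : realType} {m : nat}.
Local Notation Rm := 'cV[R]_m.

(** Everything the rest of the development knows of the flow; the Euler scheme stays behind this
    interface. *)
Record is_flow (a : Rm -> Rm) (D C : R) (phi : R -> Rm -> Rm) : Prop := IsFlow {
  is_flow_D : 0 <= D ;
  is_flow_C : 0 <= C ;
  is_flow_aL : forall x y, enorm (a x - a y) <= D * enorm (x - y) ;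
  is_flow_aB : forall x, enorm (a x) <= C ;
  is_flow0 : forall x, phi 0 x = x ;
  is_flow_lip : forall t x y, 0 <= t ->
    enorm (phi t x - phi t y) <= expR (D * t) * enorm (x - y) ;
  is_flow_move : forall s t x, 0 <= s -> 0 <= t ->
    enorm (phi t x - phi s x) <= C * `|t - s| ;
  is_flow_step : forall t x, 0 <= t ->
    enorm (phi t x - x - t *: a x) <= D * C * t ^+ 2 ;
  is_flowD : forall s t x, 0 <= s -> 0 <= t -> phi (s + t) x = phi t (phi s x) }.

Lemma ex_flow (a : Rm -> Rm) (D C : R) : 0 <= D -> 0 <= C ->
  (forall x y, enorm (a x - a y) <= D * enorm (x - y)) ->
  (forall x, enorm (a x) <= C) -> exists phi, is_flow a D C phi.
Proof.
move=> D0 C0 aL aB; exists (flow a D C); split => //.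
- exact: flow0.
- exact: flow_lip.
- exact: flow_move.
- exact: flow_step.
- exact: flowD.
Qed.

Variables (a : Rm -> Rm) (D C : R) (phi : R -> Rm -> Rm).
Hypothesis F : is_flow a D C phi.

Let D0 := is_flow_D F.
Let C0 := is_flow_C F.

(** Transport [xi v] up to time [u] along the flow: as [v] varies, the result [psi v] moves only at
    second order, so it is constant, and its values at [u] and [s0] are the two sides. *)
Lemma flow_unique (xi : R -> Rm) (s0 s1 : R) :
  (forall u, s0 < u < s1 -> diff_at `]s0, s1[ xi u (a (xi u))) ->
  right_cont xi s0 ->
  forall u, s0 <= u < s1 -> xi u = phi (u - s0) (xi s0).
Proof.
move=> hd hr u /andP[]; rewrite le_eqVlt => /orP[/eqP <- _|s0u us1].
  by rewrite subrr (is_flow0 F).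
pose psi v := phi (u - v) (xi v).
suff h : psi u = psi s0 by move: h; rewrite /psi subrr (is_flow0 F).
pose E := expR (D * (u - s0)); have E0 : 0 < E by exact: expR_gt0.
have lipE v x y : s0 <= v <= u ->
    enorm (phi (u - v) x - phi (u - v) y) <= E * enorm (x - y).
  move=> /andP[v1 v2]; rewrite (le_trans (is_flow_lip F _ _ _))//; first lra.
  rewrite ler_wpM2r ?enorm_ge0// ler_expR ler_wpM2l//; lra.
apply/colP => i; 
have coord w v : `|psi w i ord0 - psi v i ord0| <= enorm (psi w - psi v).
  by rewrite (le_trans _ (enorm_coord _ i))// !mxE.
apply: (@zero_derivative_const R (fun v => psi v i ord0) s0 u); first exact: ltW.
- move=> v /andP[s0v vu] e e0.
  have v01 : s0 < v < s1 by rewrite s0v (lt_trans vu).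
  have e1 : 0 < e / (2 * E) by rewrite divr_gt0// mulr_gt0.
  have [g g0 hg] := hd v v01 _ e1.
  have [g' g'0 hg'] := diff_at_move (hd v v01).
  (* [D * C] bounds the error of one flow step, [D * (C + 1)] the change of the field along [xi],
     whose local speed is at most [C + 1]. *)
  pose K := D * (C + 1) + D * C + 1.
  have K0 : 0 < K by rewrite ltr_wpDl// addr_ge0// mulr_ge0// addr_ge0.
  pose c := Num.min (Num.min g g') (Num.min (Num.min (v - s0) (u - v)) (e / (2 * E) / K)).
  have c0 : 0 < c by rewrite !lt_min g0 g'0 !subr_gt0 s0v vu divr_gt0.
  exists c => // w wv; rewrite (le_trans (coord _ _))//.
  move: wv; rewrite !lt_min => /andP[/andP[wg wg'] /andP[/andP[w1 w2] w3]].
  have ws : s0 < w < u.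
    by move: w1 w2; rewrite !ltr_norml => /andP[? ?] /andP[? ?]; apply/andP; split; lra.
  have [ws0 wu] := andP ws.
  have Iw : `]s0, s1[%classic w by rewrite /= in_itv/= ws0 (lt_trans wu).
  have h1 := hg w Iw wg; have h2 := hg' w Iw wg'.
  have h2' : enorm (xi w - xi v) <= (C + 1) * `|w - v|.
    by rewrite (le_trans h2)// ler_wpM2r// lerD2r (is_flow_aB F).
  have wK : `|w - v| * K <= e / (2 * E) by rewrite -ler_pdivlMr// ltW.
  have DC0 : 0 <= D * C by rewrite mulr_ge0.
  have sq : (w - v) ^+ 2 = `|w - v| ^+ 2 by rewrite real_normK// num_real.
  suff : enorm (psi w - psi v) <= E * (e / (2 * E) * `|w - v| + K * `|w - v| ^+ 2).
    move/le_trans; apply.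
    have -> : e * `|w - v| = E * (e / (2 * E) * `|w - v| + e / (2 * E) * `|w - v|).
      by field; rewrite lt0r_neq0.
    rewrite ler_pM2l// lerD2l expr2 mulrA ler_wpM2r// mulrC//.
  (* The flow runs forward only, so the earlier of the two points is carried to the later time
     before the comparison. *)
  have [vw|wv] := leP v w.
    have -> : psi v = phi (u - w) (phi (w - v) (xi v)).
      by rewrite -(is_flowD F) ?subr_ge0//; [congr phi; ring|exact: ltW].
    rewrite (le_trans (lipE _ _ _ _))//; first by rewrite !ltW.
    rewrite ler_pM2l//.
    have st := is_flow_step F (t := w - v) (xi v).
    rewrite subr_ge0 in st; have {}st := st vw.
    have -> : xi w - phi (w - v) (xi v) = (xi w - xi v - (w - v) *: a (xi v))
       - (phi (w - v) (xi v) - xi v - (w - v) *: a (xi v)).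
      by apply/colP => j; rewrite !mxE; ring.
    rewrite (le_trans (enorm_triangle _ _))// enormN lerD// (le_trans st)// sq.
    by rewrite ler_wpM2r ?sqr_ge0// /K; have := mulr_ge0 D0 (addr_ge0 C0 ler01); lra.
  have -> : psi w = phi (u - v) (phi (v - w) (xi w)).
    by rewrite -(is_flowD F) ?subr_ge0//; [congr phi; ring|exact: ltW|exact: ltW].
  rewrite (le_trans (lipE _ _ _ _))//; first by rewrite !ltW.
  rewrite ler_pM2l//.
  have st := is_flow_step F (t := v - w) (xi w).
  rewrite subr_ge0 in st; have {}st := st (ltW wv).
  have -> : phi (v - w) (xi w) - xi v = (xi w - xi v - (w - v) *: a (xi v)) +
     ((phi (v - w) (xi w) - xi w - (v - w) *: a (xi w))
      + (v - w) *: (a (xi w) - a (xi v))).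
    by apply/colP => j; rewrite !mxE; ring.
  rewrite (le_trans (enorm_triangle _ _))// lerD//.
  rewrite (le_trans (enorm_triangle _ _))//.
  have l3 : enorm ((v - w) *: (a (xi w) - a (xi v))) <= D * (C + 1) * `|w - v| ^+ 2.
    rewrite enormZ distrC (_ : D * _ * _ = `|w - v| * (D * ((C + 1) * `|w - v|))); last by ring.
    by rewrite ler_wpM2l// (le_trans (is_flow_aL F _ _))// ler_wpM2l.
  have l4 : enorm (phi (v - w) (xi w) - xi w - (v - w) *: a (xi w)) <= D * C * `|w - v| ^+ 2.
    by rewrite -sq (_ : (w - v) ^+ 2 = (v - w) ^+ 2)//; ring.
  rewrite (le_trans (lerD l4 l3))// -mulrDl ler_wpM2r ?sqr_ge0// /K; lra.
- move=> v /andP[s0v vu] e e0.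
  have [g g0 hg] : exists2 g, 0 < g & forall w, s0 <= w <= u -> `|w - v| < g ->
      enorm (xi w - xi v) < e / (2 * E).
    have e1 : 0 < e / (2 * E) by rewrite divr_gt0// mulr_gt0.
    move: s0v; rewrite le_eqVlt => /orP[/eqP vs|s0v].
      have [g g0 hg] := hr _ e1; exists g => // w /andP[w1 w2].
      by rewrite -vs ltr_norml => /andP[? ?]; apply: hg => //; lra.
    have v01 : s0 < v < s1 by rewrite s0v (le_lt_trans vu).
    have [g' g'0 hg'] := diff_at_move (hd v v01).
    pose K := enorm (a (xi v)) + 1.
    have K0 : 0 < K by rewrite ltr_wpDl// enorm_ge0.
    exists (Num.min (v - s0) (Num.min g' (e / (2 * E) / K))).
      by rewrite !lt_min subr_gt0 s0v g'0 divr_gt0.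
    move=> w /andP[w1 w2]; rewrite !lt_min => /andP[wv /andP[wg wK]].
    have Iw : `]s0, s1[%classic w.
      rewrite /= in_itv/=; apply/andP; split; last exact: le_lt_trans w2 us1.
      by move: wv; rewrite ltr_norml => /andP[? ?]; lra.
    rewrite (le_lt_trans (hg' _ Iw wg))// mulrC -ltr_pdivlMr//.
  exists (Num.min g (e / (2 * (C + 1)))).
    by rewrite lt_min g0 divr_gt0// mulr_gt0// ltr_wpDl.
  move=> w /andP[w1 w2]; rewrite lt_min => /andP[wg wC].
  rewrite (le_lt_trans (coord _ _))//.
  apply: (le_lt_trans (enorm_dist_triangle (phi (u - w) (xi v)) _ _)).
  have l1 : enorm (psi w - phi (u - w) (xi v)) < e / 2.
    apply: (le_lt_trans (lipE _ _ _ _)); first by rewrite w1.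
    have -> : e / 2 = E * (e / (2 * E)) by field; rewrite lt0r_neq0.
    by rewrite ltr_pM2l// hg// w1.
  have l2 : enorm (phi (u - w) (xi v) - psi v) <= e / 2.
    rewrite (le_trans (is_flow_move F _ _ _)) ?subr_ge0//.
    rewrite (_ : u - w - (u - v) = v - w); last by ring.
    rewrite distrC (@le_trans _ _ ((C + 1) * `|w - v|))//.
      by rewrite ler_wpM2r//; lra.
    rewrite mulrC -ler_pdivlMr ?ltr_wpDl// -mulrA -invfM ltW//.
  by lra.
Qed.

End uniqueness.

(** * Paths with jumps *)

Section jump_flow.
Context {R : realType} {m d : nat}.
Local Notation Rm := 'cV[R]_m.
Local Notation Rd := 'cV[R]_d.
Variables (a : Rm -> Rm) (sigma : Rm -> 'M[R]_(m, d)) (D C : R) (phi : R -> Rm -> Rm).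
Hypothesis F : is_flow a D C phi.

Let D0 := is_flow_D F.
Let C0 := is_flow_C F.

Definition jump (y : Rm) (p : Rd * Rm) : Rm := y + p.2 + sigma (y + p.2) *m p.1.

(* l lists the jumps (time, (w, v)) in increasing order of time, after s. *)
Fixpoint jp (l : seq (R * (Rd * Rm))) (s : R) (x : Rm) (t : R) : Rm :=
  if l is j :: l' then
    if t < j.1 then phi (t - s) x else jp l' j.1 (jump (phi (j.1 - s) x) j.2) t
  else phi (t - s) x.

(** As [jp], except that a jump at time [t] itself is still to come: this is the left limit at
    [t]. *)
Fixpoint jp_left (l : seq (R * (Rd * Rm))) (s : R) (x : Rm) (t : R) : Rm :=
  if l is j :: l' then
    if t <= j.1 then phi (t - s) x else jp_left l' j.1 (jump (phi (j.1 - s) x) j.2) t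
  else phi (t - s) x.

Local Notation times l := [seq j.1 | j <- l].

Let flow_diff s x t : s <= t ->
  diff_at [set u | s <= u] (fun u => phi (u - s) x) t (a (phi (t - s) x)).
Proof.
move=> st e e0; pose K := 2 * (D * C) + 1.
have DC0 : 0 <= D * C by rewrite mulr_ge0.
have K0 : 0 < K by rewrite /K; lra.
exists (e / K); first by rewrite divr_gt0.
move=> u /= su ut; suff : enorm (phi (u - s) x - phi (t - s) x
    - (u - t) *: a (phi (t - s) x)) <= K * (u - t) ^+ 2.
  move/le_trans; apply; rewrite -real_normK ?num_real// expr2 mulrA.
  by rewrite ler_wpM2r// mulrC -ler_pdivlMr// ltW.
have [tu|ut'] := leP t u.
  have -> : phi (u - s) x = phi (u - t) (phi (t - s) x).
    by rewrite -(is_flowD F) ?subr_ge0//; congr phi; ring.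
  rewrite (le_trans (is_flow_step F _ _)) ?subr_ge0// ler_wpM2r ?sqr_ge0// /K; lra.
(* To the left of [t] the expansion is made at the earlier state [y], and the field at [y] is then
   exchanged for the field at the later state. *)
set y := phi (u - s) x; have -> : phi (t - s) x = phi (t - u) y.
  by rewrite -(is_flowD F) ?subr_ge0//; [congr phi; ring|exact: ltW].
have -> : y - phi (t - u) y - (u - t) *: a (phi (t - u) y) =
   - (phi (t - u) y - y - (t - u) *: a y) + (t - u) *: (a (phi (t - u) y) - a y).
  by apply/colP => i; rewrite !mxE; ring.
rewrite (le_trans (enorm_triangle _ _))// enormN.
have tu0 : 0 <= t - u by rewrite subr_ge0 ltW.
have h1 := is_flow_step F y tu0.
have h2 : enorm ((t - u) *: (a (phi (t - u) y) - a y)) <= D * C * (t - u) ^+ 2.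
  rewrite enormZ ger0_norm// (_ : D * C * _ = (t - u) * (D * (C * (t - u)))); last by ring.
  rewrite ler_wpM2l// (le_trans (is_flow_aL F _ _))// ler_wpM2l//.
  have := is_flow_move F y (lexx 0) tu0.
  by rewrite subr0 (is_flow0 F) ger0_norm.
have -> : (u - t) ^+ 2 = (t - u) ^+ 2 by ring.
by rewrite (le_trans (lerD h1 h2))// -mulrDl ler_wpM2r ?sqr_ge0// /K; lra.
Qed.

Lemma jp_lt j l s x t : t < j.1 -> jp (j :: l) s x t = phi (t - s) x.
Proof. by move=> /= ->. Qed.

Lemma jp_ge j l s x t : j.1 <= t ->
  jp (j :: l) s x t = jp l j.1 (jump (phi (j.1 - s) x) j.2) t.
Proof. by rewrite /= ltNge => ->. Qed.

Lemma jp_left_le j l s x t : t <= j.1 -> jp_left (j :: l) s x t = phi (t - s) x.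
Proof. by move=> /= ->. Qed.

Lemma jp_left_gt j l s x t : j.1 < t ->
  jp_left (j :: l) s x t = jp_left l j.1 (jump (phi (j.1 - s) x) j.2) t.
Proof. by rewrite /= leNgt => ->. Qed.

Lemma jp_start l s x : path <%R s (times l) -> jp l s x s = x.
Proof. by case: l => [|j l] /=; [|move=> /andP[-> _]]; rewrite subrr (is_flow0 F). Qed.

Lemma jp_right_cont l s x t : path <%R s (times l) -> s <= t ->
  right_cont (jp l s x) t.
Proof.
have fl s' x' t' : s' <= t' -> right_cont (fun u => phi (u - s') x') t'.
  move=> st e e0; exists (e / (C + 1)); first by rewrite divr_gt0// ltr_wpDl.
  move=> u tu ut; rewrite (le_lt_trans (is_flow_move F _ _ _)) ?subr_ge0//.
    exact: le_trans tu.
  rewrite (_ : u - s' - (t' - s') = u - t'); last by ring.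
  rewrite ger0_norm ?subr_ge0// (@le_lt_trans _ _ ((C + 1) * (u - t')))//.
    by rewrite ler_wpM2r ?subr_ge0//; lra.
  by rewrite mulrC -ltr_pdivlMr ?ltr_wpDl//; lra.
elim: l s x => [|j l ih] s x; first by move=> _; exact: fl.
move=> /andP[sj pl] st e e0; have [tj|jt] := ltP t j.1.
  have [g g0 hg] := fl s x t st e e0.
  exists (Num.min g (j.1 - t)); first by rewrite lt_min g0 subr_gt0.
  move=> u tu ut; have : t + Num.min g (j.1 - t) <= j.1.
    by rewrite -lerBrDl ge_min lexx orbT.
  have : t + Num.min g (j.1 - t) <= t + g by rewrite lerD2l ge_min lexx.
  move=> h1 h2; rewrite !jp_lt// ?(lt_le_trans ut h2)//; apply: hg => //.
  exact: lt_le_trans h1.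
have [g g0 hg] := ih j.1 (jump (phi (j.1 - s) x) j.2) pl jt e e0.
by exists g => // u tu ut; rewrite !jp_ge// ?(le_trans jt tu)//; exact: hg.
Qed.

Lemma jp_left_lim l s x t : path <%R s (times l) -> s < t ->
  left_lim (jp l s x) t (jp_left l s x t).
Proof.
have fl s' x' t' : s' < t' -> left_lim (fun u => phi (u - s') x') t' (phi (t' - s') x').
  move=> st e e0; exists (Num.min (t' - s') (e / (C + 1))).
    by rewrite lt_min subr_gt0 st divr_gt0// ltr_wpDl.
  move=> u; rewrite ltrBlDl -ltrBlDr lt_min => /andP[u1 u2] ut.
  rewrite (le_lt_trans (is_flow_move F _ _ _)) ?subr_ge0//; [lra|lra|].
  rewrite (_ : u - s' - (t' - s') = u - t'); last by ring.
  rewrite distrC ger0_norm ?subr_ge0 ?ltW//.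
  rewrite (@le_lt_trans _ _ ((C + 1) * (t' - u)))//.
    by rewrite ler_wpM2r ?subr_ge0 ?ltW//; lra.
  by rewrite mulrC -ltr_pdivlMr ?ltr_wpDl//; lra.
elim: l s x => [|j l ih] s x; first by move=> _; exact: fl.
move=> /andP[sj pl] st e e0; have [tj|jt] := leP t j.1.
  have [g g0 hg] := fl s x t st e e0.
  by exists g => // u tu ut; rewrite jp_left_le// jp_lt ?(lt_le_trans ut tj)//; exact: hg.
have [g g0 hg] := ih j.1 (jump (phi (j.1 - s) x) j.2) pl jt e e0.
exists (Num.min g (t - j.1)); first by rewrite lt_min g0 subr_gt0.
move=> u; rewrite ltrBlDl -ltrBlDr lt_min => /andP[u1 u2] ut.
rewrite jp_left_gt// jp_ge; last by lra.
by apply: hg => //; lra.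
Qed.

Lemma jp_diff l s x t : path <%R s (times l) -> s <= t -> t \notin times l ->
  diff_at [set u | s <= u] (jp l s x) t (a (jp l s x t)).
Proof.
elim: l s x => [|j l ih] s x; first by move=> _ st _; exact: flow_diff.
move=> /andP[sj pl] st; rewrite inE negb_or => /andP[tnj tnl] e e0.
have [tj|jt] := ltP t j.1.
  have [g g0 hg] := flow_diff x st e0.
  exists (Num.min g (j.1 - t)); first by rewrite lt_min g0 subr_gt0.
  move=> u su; rewrite lt_min => /andP[ug uj].
  have uj' : u < j.1 by move: uj; rewrite ltr_norml => /andP[? ?]; lra.
  by rewrite !jp_lt//; exact: hg.
have {}jt : j.1 < t by rewrite lt_neqAle eq_sym tnj.
have [g g0 hg] := ih j.1 (jump (phi (j.1 - s) x) j.2) pl (ltW jt) tnl e e0.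
exists (Num.min g (t - j.1)); first by rewrite lt_min g0 subr_gt0.
move=> u su; rewrite lt_min => /andP[ug uj].
have ju : j.1 <= u by move: uj; rewrite ltr_norml => /andP[? ?]; lra.
by rewrite !jp_ge ?(ltW jt)//; exact: hg.
Qed.

Lemma jp_jump l s x j : path <%R s (times l) -> j \in l ->
  jp l s x j.1 = jump (jp_left l s x j.1) j.2.
Proof.
elim: l s x => [|j' l ih] s x //= /andP[sj pl].
rewrite inE => /orP[/eqP ->|jl].
  by rewrite ltxx lexx jp_start.
have jj : j'.1 < j.1.
  move: pl => /(order_path_min lt_trans)/allP; apply.
  by apply/mapP; exists j.
by rewrite ltNge (ltW jj)/= leNgt jj/= ih.
Qed.

Lemma left_lim_unique (xi : R -> Rm) s y y' : left_lim xi s y -> left_lim xi s y' -> y = y'.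
Proof. by move=> /left_lim_lim <- /left_lim_lim <-. Qed.

Lemma diff_at_sub A B (xi : R -> Rm) s v : A `<=` B -> diff_at B xi s v -> diff_at A xi s v.
Proof. by move=> AB h e /h[g g0 hg]; exists g => // u /AB; exact: hg. Qed.

Lemma left_lim_eq (xi xi' : R -> Rm) s t y : s < t ->
  (forall u, s < u < t -> xi u = xi' u) -> left_lim xi t y -> left_lim xi' t y.
Proof.
move=> st h hx e /hx[g g0 hg]; exists (Num.min g (t - s)).
  by rewrite lt_min g0 subr_gt0.
move=> u; rewrite ltrBlDl -ltrBlDr lt_min => /andP[u1 u2] ut.
by rewrite -h; [apply: hg => //; lra|apply/andP; split; lra].
Qed.

Lemma diff_left_lim (xi : R -> Rm) s t v : s < t -> diff_at `[s, t] xi t v ->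
  left_lim xi t (xi t).
Proof.
move=> st /diff_at_move[g g0 hg] e e0.
exists (Num.min (t - s) (Num.min g (e / (enorm v + 1)))).
  by rewrite !lt_min subr_gt0 st g0 divr_gt0// ltr_wpDl// enorm_ge0.
move=> u; rewrite ltrBlDl -ltrBlDr !lt_min => /andP[u1 /andP[u2 u3]] ut.
have tu : `|u - t| = t - u by rewrite distrC ger0_norm// subr_ge0 ltW.
rewrite (le_lt_trans (hg _ _ _)) ?tu//.
  by rewrite /= in_itv/=; apply/andP; split; lra.
by rewrite mulrC -ltr_pdivlMr ?ltr_wpDl ?enorm_ge0.
Qed.

(** Induction on the jumps: [flow_unique] determines [xi] before the next jump time, hence its left
    limit there, and the jump condition restarts the argument. *)
Lemma jp_unique (T : R) (xi : R -> Rm) l s x :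
  0 <= s -> s <= T -> path <%R s (times l) -> all (<= T) (times l) ->
  xi s = x -> (forall t, s <= t < T -> right_cont xi t) ->
  (forall t, s < t <= T -> t \notin times l -> diff_at `[0, T] xi t (a (xi t))) ->
  (forall j, j \in l -> exists2 y, left_lim xi j.1 y & xi j.1 = jump y j.2) ->
  forall t, s <= t <= T -> xi t = jp l s x t.
Proof.
move=> s0 sT; elim: l s s0 sT x => [|j l ih] s s0 sT x /=.
  move=> _ _ <- hr hd _.
  move: sT; rewrite le_eqVlt => /orP[/eqP <-|sT] t.
    by move=> st; rewrite (le_anti st) subrr (is_flow0 F).
  have fl u : s <= u < T -> xi u = phi (u - s) (xi s).
    apply: (flow_unique F); last by apply: hr; rewrite lexx.
    move=> v /andP[sv vT]; apply: diff_at_sub (hd v _ _) => //; last by rewrite sv ltW.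
    by apply: subset_itv; rewrite bnd_simp.
  move=> /andP[st]; rewrite le_eqVlt => /orP[/eqP ->|tT]; last by apply: fl; rewrite st.
  (* [flow_unique] stops short of the end; as no jump is left, [xi] is left continuous at [T] and
     both sides are the same left limit. *)
  apply: (@left_lim_unique xi T).
    apply: (diff_left_lim sT (diff_at_sub _ (hd T _ _))) => //; last by rewrite sT lexx.
    by apply: subset_itv; rewrite bnd_simp.
  apply: (@left_lim_eq (jp [::] s (xi s)) xi s) => //; last exact: jp_left_lim.
  by move=> u /andP[su uT]; rewrite (fl u) ?(ltW su).
move=> /andP[sj pl] /andP[jT aT] <- hr hd hj t /andP[st tT].
have nin u : u < j.1 -> (u \notin j.1 :: times l).
  move=> uj; rewrite inE negb_or lt_eqF//=; apply/negP => ul.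
  have ju : j.1 < u := allP (order_path_min lt_trans pl) u ul.
  by have := lt_trans ju uj; rewrite ltxx.
have fl u : s <= u < j.1 -> xi u = phi (u - s) (xi s).
  apply: (flow_unique F); last by apply: hr; rewrite lexx (lt_le_trans sj).
  move=> v /andP[sv vT]; apply: diff_at_sub (hd v _ _) => //.
  - by apply: subset_itv; rewrite bnd_simp.
  - by rewrite sv ltW// (lt_le_trans vT).
  - exact: nin.
have xj : xi j.1 = jump (phi (j.1 - s) (xi s)) j.2.
  have [y ly ->] := hj j (mem_head _ _); congr jump.
  apply: (@left_lim_unique xi j.1) => //.
  apply: (@left_lim_eq (jp [::] s (xi s)) xi s) => //; last exact: jp_left_lim.
  by move=> u /andP[su uT]; rewrite (fl u) ?(ltW su).
have [tj|jt] := ltP t j.1; first by apply: fl; rewrite st.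
apply: ih => //.
- exact: le_trans (ltW sj).
- by move=> u /andP[ju uT]; apply: hr; rewrite uT (le_trans (ltW sj)).
- move=> u /andP[ju uT] un; apply: hd; first by rewrite uT (lt_trans sj).
  by rewrite inE negb_or un gt_eqF.
- by move=> j' jl; apply: hj; rewrite inE jl orbT.
- by rewrite jt.
Qed.

Variable T : {posnum R}.
Local Notation I := (`[0, T%:num]%classic : set R).

Let jfun l x t := if t \in `[0, T%:num] then jp l 0 x t else 0.

Let jfun_cadlag l x : path <%R 0 (times l) -> cadlag T (jfun l x).
Proof.
move=> pl; split=> t /andP[t0 tT].
  apply/right_contP => e e0; have [g g0 hg] := jp_right_cont x pl t0 e0.
  exists (Num.min g (T%:num - t)); first by rewrite lt_min g0 subr_gt0.
  move=> u tu; rewrite -ltrBlDl lt_min => /andP[ug uT].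
  rewrite /jfun !in_itv/= t0 (ltW tT) (le_trans t0 tu)/= (_ : u <= _); last by lra.
  by apply: hg => //; lra.
apply/cvg_ex; exists (jp_left l 0 x t); apply/left_limP.
apply: (@left_lim_eq (jp l 0 x) _ 0) => //; last exact: jp_left_lim.
by move=> u /andP[u0 ut]; rewrite /jfun in_itv/= (ltW u0) (le_trans (ltW ut)).
Qed.

Let jfun_out l x t : ~ I t -> jfun l x t = 0.
Proof. by rewrite /jfun; case: ifP. Qed.

Definition jlist (k : nat) (W : k.-tuple Rd) (V : k.-tuple Rm) (t : k.-tuple R) :=
  zip t (zip W V).

Lemma times_jlist k (W : k.-tuple Rd) (V : k.-tuple Rm) (t : k.-tuple R) :
  times (jlist W V t) = t.
Proof. by rewrite -/(unzip1 _) unzip1_zip// size_zip !size_tuple minnn. Qed.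

Lemma increasing_path k (t : k.-tuple R) (s T' : R) :
  increasing_tuples `]s, T']%classic t <-> (path <%R s t /\ all (<= T') t).
Proof.
split=> [[h1 h2]|[h1 h2]].
  split.
    apply/(pathP 0) => i; rewrite size_tuple => ik; case: i ik => [|i] ik /=.
      by have := h1 (Ordinal ik); rewrite (tnth_nth 0)/= in_itv/= => /andP[].
    have := h2 (Ordinal (ltnW ik)) (Ordinal ik).
    by rewrite !(tnth_nth 0)/=; exact.
  by apply/all_tnthP => i; have := h1 i; rewrite /= in_itv/= => /andP[].
split=> [i|i j ij].
  rewrite /= in_itv/=; apply/andP; split; last exact: (all_tnthP h2).
  by move: h1 => /(order_path_min lt_trans)/all_tnthP/(_ i).
rewrite !(tnth_nth 0); have := path_sorted h1.
by move=> /(sorted_ltn_nth lt_trans 0); apply => //; rewrite inE size_tuple.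
Qed.

(** [jp] provides a solution, so [get] returns one, and uniqueness identifies it with [jp]. Paths
    are handled through this formula from here on. *)
Lemma perturbed_pathE k x (W : k.-tuple Rd) (V : k.-tuple Rm) (t : k.-tuple R) u :
  increasing_tuples `]0, T%:num]%classic t -> I u ->
  perturbed_path a sigma T x W V t u = jp (jlist W V t) 0 x u.
Proof.
move=> /increasing_path[p1 p2]; set l := jlist W V t.
have tl : times l = t :> seq R by exact: times_jlist.
have pl : path <%R 0 (times l) by rewrite tl.
have jin j : (tnth t j, (tnth W j, tnth V j)) \in l.
  have sl : size l = k by rewrite !size_zip !size_tuple !minnn.
  have := @mem_nth _ (0, (0, 0)) l j; rewrite sl ltn_ord => /(_ isT).
  by rewrite !nth_zip ?size_zip ?size_tuple ?minnn// -!tnth_nth.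
have T0 : 0 <= T%:num by [].
have I0 : 0 \in `[0, T%:num] by rewrite in_itv/= lexx.
pose xi := MkD (jfun_cadlag x pl) (@jfun_out l x).
have xiE v : I v -> xi v = jp l 0 x v by rewrite /= /jfun => ->.
have ex : perturbed_ode a sigma x W V t xi.
  split.
  - by rewrite xiE// jp_start.
  - move=> s Is sn; apply/diff_atP => e e0.
    have s0 : 0 <= s by move: Is; rewrite /= in_itv/= => /andP[].
    have snl : s \notin times l.
      by rewrite tl; apply/negP => /tnthP[j]; exact: sn.
    have [g g0 hg] := jp_diff x pl s0 snl e0; exists g => // v Iv vs.
    rewrite !xiE//; apply: hg => //.
    by move: Iv; rewrite /= in_itv/= => /andP[].
  - move=> j y; have tj0 : 0 < tnth t j.
      by move: p1 => /(order_path_min lt_trans)/all_tnthP/(_ j).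
    have tjT : tnth t j <= T%:num by exact: (all_tnthP p2).
    have Itj : I (tnth t j) by rewrite /= in_itv/= ltW.
    rewrite xiE// (jp_jump x pl (jin j))/= /jump /= -/y.
    suff -> : jp_left l 0 x (tnth t j) + tnth V j = y by [].
    rewrite /y; congr (_ + _); apply/esym/left_lim_lim.
    apply: (@left_lim_eq (jp l 0 x) _ 0) => //; last exact: jp_left_lim.
    by move=> v /andP[v0 vt]; rewrite xiE//= in_itv/= (ltW v0) (le_trans (ltW vt)).
have := getPex (ex_intro [eta perturbed_ode a sigma x W V t] xi ex).
rewrite -/(perturbed_path a sigma T x W V t).
move: (perturbed_path a sigma T x W V t) => xi' [h1 h2 h3].
 rewrite /= in_itv/=; apply: jp_unique => //.
- by rewrite tl.
- by move=> v /andP[v0 vT]; apply/right_contP; have := (dfun_cadlag xi').1 v; rewrite v0 vT; move/(_ isT).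
- move=> v /andP[v0 vT]; rewrite tl => vn; apply/diff_atP; apply: h2.
    by rewrite /= in_itv/= ltW.
  by move=> j vj; move: vn; rewrite vj mem_tnth.
- move=> j jl; have sl : size l = k by rewrite !size_zip !size_tuple !minnn.
  have := nth_index (0, (0, 0)) jl.
  have ik : (index j l < k)%N by rewrite -sl index_mem.
  pose i := Ordinal ik.
  rewrite !nth_zip ?size_zip ?size_tuple ?minnn//.
  rewrite -[index j l]/(nat_of_ord i) -!tnth_nth => <- /=.
  have tj0 : 0 < tnth t i.
    by move: p1 => /(order_path_min lt_trans)/all_tnthP/(_ i).
  have tjT : tnth t i <= T%:num by exact: (all_tnthP p2).
  exists (lim (xi' u @[u --> (tnth t i)^'-])).
    by apply/left_limP; have := (dfun_cadlag xi').2 (tnth t i); rewrite tj0 tjT; move/(_ isT).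
  exact: h3.
Qed.

End jump_flow.

(** * Stability of paths with jumps *)

Section stability.
Context {R : realType} {m d : nat}.
Local Notation Rm := 'cV[R]_m.
Local Notation Rd := 'cV[R]_d.
Variables (a : Rm -> Rm) (sigma : Rm -> 'M[R]_(m, d)) (D C : R) (phi : R -> Rm -> Rm).
Hypothesis F : is_flow a D C phi.
Hypothesis sL : forall x y w,
  enorm ((sigma x - sigma y) *m w) <= D * enorm (x - y) * enorm w.
Hypothesis sB : forall x w, enorm (sigma x *m w) <= C * enorm w.
Variable T : R.
Hypothesis T0 : 0 <= T.

Local Notation times l := [seq j.1 | j <- l].
Local Notation jp := (jp sigma phi).
Local Notation jump := (jump sigma).
Local Notation E := (expR (D * T)).

Let D0 := is_flow_D F.
Let C0 := is_flow_C F.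

Let E1 : 1 <= E. Proof. by rewrite -expR0 ler_expR mulr_ge0. Qed.
Let lipE t x y : 0 <= t <= T -> enorm (phi t x - phi t y) <= E * enorm (x - y).
Proof.
move=> /andP[t0 tT]; rewrite (le_trans (is_flow_lip F _ _ t0))//.
by rewrite ler_wpM2r ?enorm_ge0// ler_expR ler_wpM2l.
Qed.

Let jump_lip y y' w v v' : enorm (jump y (w, v) - jump y' (w, v')) <=
  (1 + D * enorm w) * enorm ((y + v) - (y' + v')).
Proof.
rewrite /jump/=; set p := y + v; set q := y' + v'.
have -> : p + sigma p *m w - (q + sigma q *m w) = (p - q) + (sigma p - sigma q) *m w.
  by rewrite mulmxBl opprD addrACA.
rewrite (le_trans (enorm_triangle _ _))// mulrDl mul1r lerD2l (le_trans (sL _ _ _))//.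
by rewrite mulrAC.
Qed.

Let jump_eq y y' w v v' : y + v = y' + v' -> jump y (w, v) = jump y' (w, v').
Proof. by rewrite /jump/= => ->. Qed.

(** At a jump the shift adds at most [b] and the Lipschitz bound on [sigma] multiplies by at most
    [1 + D * K]; the flow multiplies by [E]. There is one factor per jump and one after the last. *)
Lemma jp_lip (K b : R) l s x y t : 0 <= K -> 0 <= b ->
  (forall j, j \in l -> enorm j.2.1 <= K /\ enorm j.2.2 <= b) ->
  0 <= s -> path <%R s (times l) -> s <= t <= T ->
  enorm (jp l s x t - jp [seq (j.1, (j.2.1, 0)) | j <- l] s y t) <=
    ((1 + D * K) * E + 1) ^+ (size l).+1 * (enorm (x - y) + b).
Proof.
move=> K0 b0; set Q := _ + 1.
have Kp : 1 <= 1 + D * K by rewrite lerDl mulr_ge0.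
have QE : E <= Q.
  rewrite /Q (le_trans (_ : E <= (1 + D * K) * E)) ?lerDl// ler_peMl//.
have Q1 : 1 <= Q by exact: le_trans QE.
have base n s' t' x' y' : 0 <= s' -> s' <= t' <= T ->
    enorm (phi (t' - s') x' - phi (t' - s') y') <= Q ^+ n.+1 * (enorm (x' - y') + b).
  move=> s0 /andP[st tT]; rewrite (le_trans (lipE _ _ _))//.
    by apply/andP; split; lra.
  rewrite ler_pM ?enorm_ge0 ?lerDl//.
  by rewrite (le_trans QE)// exprS ler_peMr ?exprn_ege1// (le_trans ler01).
elim: l s x y => [|j l ih] s x y; first by move=> _ s0 _ st; exact: base.
move=> hl s0 /andP[sj pl] /andP[st tT].
have [tj|jt] := ltP t j.1.
  by rewrite map_cons !jp_lt//; apply: base => //; rewrite st.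
rewrite map_cons !jp_ge//=.
have [wK vb] := hl j (mem_head _ _).
apply: (le_trans (ih _ _ _ _ _ _ _)) => //.
- by move=> j' jl; apply: hl; rewrite inE jl orbT.
- exact: le_trans (ltW sj).
- by rewrite jt.
rewrite [Q ^+ _.+2]exprSr -mulrA ler_wpM2l ?exprn_ge0 ?(le_trans ler01)//.
rewrite [Q * _]mulrDl mul1r lerD ?lerDr ?enorm_ge0//.
case: j.2 wK vb => w v /= wK vb; apply: (le_trans (jump_lip _ _ _ _ _)).
rewrite -mulrA ler_pM ?enorm_ge0 ?addr_ge0 ?mulr_ge0 ?enorm_ge0 ?lerD2l ?ler_wpM2l//.
rewrite addr0 addrAC (le_trans (enorm_triangle _ _))// mulrDr lerD//.
  by apply: lipE; apply/andP; split; lra.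
by rewrite (le_trans vb)// ler_peMl.
Qed.

(* The small jump is deferred to the next one, as part of its shift v, and
   dropped altogether if it is the last one. *)
Lemma jp_remove_small (r : R) l s x : 0 <= r ->
  (forall j, j \in l -> j.2.2 = 0) -> (exists2 j, j \in l & enorm j.2.1 <= r) ->
  0 <= s -> path <%R s (times l) -> all (<= T) (times l) ->
  exists l', [/\ (size l').+1 = size l, path <%R s (times l'), all (<= T) (times l'),
    forall j, j \in l' -> enorm j.2.2 <= E * (C * r) &
    forall t, s <= t <= T -> enorm (jp l s x t - jp l' s x t) <= E * (C * r)].
Proof.
move=> r0; set B := E * _; have B0 : 0 <= B by rewrite !mulr_ge0.
(* Deleting a jump whose noise is at most [r] moves the state by at most [C * r], and the flow up to
   time [T] multiplies this by at most [E]. *)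
have small j s' x' t : j.2.2 = 0 -> enorm j.2.1 <= r -> 0 <= s' -> s' < j.1 -> j.1 <= t <= T ->
    enorm (phi (t - j.1) (jump (phi (j.1 - s') x') j.2) - phi (t - s') x') <= B.
  case: j => tau [w v] /= -> wr s0 st /andP[jt tT].
  have -> : phi (t - s') x' = phi (t - tau) (phi (tau - s') x').
    by rewrite -(is_flowD F) ?subr_ge0//; [congr phi; ring|exact: ltW].
  rewrite (le_trans (lipE _ _ _))//; first by apply/andP; split; lra.
  rewrite ler_wpM2l// /jump/= addr0 addrC addKr (le_trans (sB _ _))//.
  by rewrite ler_wpM2l.
elim: l s x => [|j l ih] s x hv [j0]; first by [].
rewrite inE => j0l j0r s0 /andP[sj pl] /andP[jT lT].
have [jr|jr] := leP (enorm j.2.1) r.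
  have j0v := hv j (mem_head _ _).
  case: l ih hv j0l pl lT => [|j2 l] ih hv j0l pl lT.
    exists [::]; split => // t /andP[st tT] /=.
    have [tj|jt] := ltP t j.1; first by rewrite subrr enorm0.
    by apply: small => //; rewrite jt.
  have j2v : j2.2.2 = 0 by apply: hv; rewrite !inE eqxx orbT.
  move: pl lT => /andP[jj2 pl] /andP[j2T lT]; rewrite -!/(times _) in pl lT.
  pose v := phi (j2.1 - j.1) (jump (phi (j.1 - s) x) j.2) - phi (j2.1 - s) x.
  have vB : enorm v <= B by apply: small => //; rewrite (ltW jj2).
  exists ((j2.1, (j2.2.1, v)) :: l); split => //=.
  - by rewrite (lt_trans sj).
  - by apply/andP; split.
  - move=> j'; rewrite inE => /orP[/eqP -> //|j'l].
    by rewrite hv ?enorm0// !inE j'l !orbT.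
  move=> t /andP[st tT]; have [tj|jt] := ltP t j.1.
    by rewrite (lt_trans tj jj2) subrr enorm0.
  have [tj2|j2t] := ltP t j2.1; first by apply: small => //; rewrite jt.
  suff -> : jump (phi (j2.1 - j.1) (jump (phi (j.1 - s) x) j.2)) j2.2
     = jump (phi (j2.1 - s) x) (j2.2.1, v) by rewrite subrr enorm0.
  by rewrite {1}(surjective_pairing j2.2) j2v; apply: jump_eq; rewrite addr0 /v [RHS]addrC subrK.
have [|||||l' [h1 h2 h3 h4 h5]] := ih j.1 (jump (phi (j.1 - s) x) j.2).
- by move=> j' j'l; apply: hv; rewrite inE j'l orbT.
- exists j0 => //; move: j0l => /orP[/eqP j0j|//].
  by move: j0r; rewrite j0j leNgt jr.
- exact: le_trans (ltW sj).
- exact: pl.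
- exact: lT.
exists (j :: l'); split => //=; first by rewrite h1.
- by rewrite sj.
- by apply/andP; split.
- move=> j'; rewrite inE => /orP[/eqP ->|]; last exact: h4.
  by rewrite hv ?enorm0// mem_head.
move=> t /andP[st tT]; have [tj|jt] := ltP t j.1; first by rewrite subrr enorm0.
by apply: h5; rewrite jt.
Qed.

Section chain.
Variables (eta : R) (z : nat -> Rd) (x0 : Rm) (J : seq nat) (c : R) (n : nat).
Hypotheses (eta0 : 0 < eta) (c0 : 0 <= c) (nT : n%:R * eta <= T).
Local Notation u := (sgd a sigma eta z x0).

(** The accumulated noise of the steps outside [J]. Step [q], counted from 0, uses the noise
    numbered [q.+1], and [J] lists noise numbers. *)
Definition small_noise (i : nat) : Rm :=
  \sum_(q < i | q.+1 \notin J) eta *: (sigma (u q) *m z q.+1).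

Hypothesis noise : forall i, (i <= n)%N -> enorm (small_noise i) <= c.

Let noiseS i : i.+1 \notin J ->
  small_noise i.+1 = small_noise i + eta *: (sigma (u i) *m z i.+1).
Proof. by move=> iJ; rewrite /small_noise big_mkcond big_ord_recr /= iJ -big_mkcond. Qed.

Let gronwall (f : nat -> R) (G k : R) (q : nat) : 0 <= k ->
  (forall p, (p <= q)%N -> f p <= G + k * \sum_(i < p) f i) ->
  f q <= G * (1 + k) ^+ q.
Proof.
move=> k0; elim: q {-2}q (leqnn q) => [|n' ih] q qn h.
  move: qn; rewrite leqn0 => /eqP ->; rewrite expr0 mulr1.
  by have := h 0%N (leq0n _); rewrite big_ord0 mulr0 addr0.
apply: (le_trans (h q (leqnn q))).
have geo p : k * \sum_(i < p) (1 + k) ^+ i = (1 + k) ^+ p - 1.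
  elim: p => [|p ihp]; first by rewrite big_ord0 mulr0 expr0 subrr.
  by rewrite big_ord_recr/= mulrDr ihp exprS; ring.
rewrite -[(1 + k) ^+ q](subrK 1) -geo mulrDr mulr1 [leRHS]addrC lerD2l.
rewrite mulrCA ler_wpM2l// mulr_sumr; apply: ler_sum => i _.
apply: ih; first by rewrite -ltnS (leq_trans (ltn_ord i)).
by move=> p pi; apply: h; rewrite (leq_trans pi)// ltnW.
Qed.

(** Without large noise the scheme and the flow satisfy the same Euler recursion, up to the initial
    error [b], two partial sums of noise bounded by [c] each, and a truncation error of
    [eta ^+ 2 * (D * C)] per step; Gronwall gives the factor [E]. *)
Lemma chain_flow i0 q y b : enorm (y - u i0) <= b ->
  (forall p, (p < q)%N -> (i0 + p).+1 \notin J) -> (i0 + q <= n)%N ->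
  enorm (phi (q%:R * eta) y - u (i0 + q)) <= (b + 2 * c + T * (eta * (D * C))) * E.
Proof.
move=> yb hJ hn; have b0 : 0 <= b by rewrite (le_trans (enorm_ge0 _) yb).
have eta0' := ltW eta0.
have qT : q%:R * eta <= T.
  by rewrite (le_trans _ nT)// ler_wpM2r// ler_nat (leq_trans _ hn)// leq_addl.
pose G := b + 2 * c + T * (eta * (D * C)).
have G0 : 0 <= G by rewrite !addr_ge0 ?mulr_ge0// ltW.
have sol p : (p <= q)%N -> u (i0 + p) = u i0 + \sum_(i < p) eta *: a (u (i0 + i)%N)
    + (small_noise (i0 + p) - small_noise i0).
  elim: p => [_|p ih pq]; first by rewrite big_ord0 !addn0 subrr !addr0.
  rewrite big_ord_recr/= addnS noiseS ?hJ//= ih ?(ltnW pq)//.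
  by apply/colP => i; rewrite !mxE; ring.
have fl p : enorm (phi (p%:R * eta) y - y
    - \sum_(i < p) eta *: a (phi (i%:R * eta) y)) <= p%:R * (eta ^+ 2 * (D * C)).
  elim: p => [|p ih]; first by rewrite big_ord0 !mul0r (is_flow0 F) subrr subr0 enorm0.
  rewrite big_ord_recr/= -natr1 mulrDl mul1r (is_flowD F) ?mulr_ge0//.
  set yp := phi (p%:R * eta) y.
  have -> : phi eta yp - y - (\sum_(i < p) eta *: a (phi (i%:R * eta) y) + eta *: a yp)
    = (yp - y - \sum_(i < p) eta *: a (phi (i%:R * eta) y)) + (phi eta yp - yp - eta *: a yp).
    by apply/colP => i; rewrite !mxE; ring.
  rewrite (le_trans (enorm_triangle _ _))// [leRHS]mulrDl mul1r lerD// mulrC.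
  exact: (is_flow_step F).
have key p : (p <= q)%N -> enorm (phi (p%:R * eta) y - u (i0 + p)) <=
    G + (eta * D) * \sum_(i < p) enorm (phi (i%:R * eta) y - u (i0 + i)%N).
  move=> pq; rewrite sol//; set S := \sum_(i < p) _ *: _; set N := _ - small_noise i0.
  pose S' := \sum_(i < p) eta *: a (phi (i%:R * eta) y).
  have -> : phi (p%:R * eta) y - (u i0 + S + N) =
    (y - u i0) + (phi (p%:R * eta) y - y - S') + (S' - S) - N.
    by apply/colP => i; rewrite !mxE; ring.
  rewrite (le_trans (enorm_triangle _ _))// enormN.
  have Nc : enorm N <= 2 * c.
    rewrite (le_trans (enorm_triangle _ _))// enormN mulrDl mul1r.
    by rewrite lerD// noise// (leq_trans _ hn)// ?leq_add2l// leq_addr.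
  have SS : enorm (S' - S) <= (eta * D) * \sum_(i < p) enorm (phi (i%:R * eta) y - u (i0 + i)%N).
    rewrite /S /S' -sumrB mulr_sumr.
    rewrite (le_trans (enorm_sum _ _ _))//; apply: ler_sum.
    move=> i _; rewrite -scalerBr enormZ ger0_norm// -mulrA ler_wpM2l//.
    exact: (is_flow_aL F).
  have flp := fl p.
  have pT : p%:R * (eta ^+ 2 * (D * C)) <= T * (eta * (D * C)).
    rewrite expr2 -mulrA mulrA ler_wpM2r ?mulr_ge0//.
    by rewrite (le_trans _ qT)// ler_wpM2r// ler_nat.
  have t1 := enorm_triangle (y - u i0 + (phi (p%:R * eta) y - y - S')) (S' - S).
  have t2 := enorm_triangle (y - u i0) (phi (p%:R * eta) y - y - S').
  apply: (le_trans (lerD (le_trans t1 (lerD (le_trans t2 (lerD yb (le_trans flp pT))) SS)) Nc)).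
  by rewrite /G; lra.
apply: (le_trans (gronwall _ key)); first by rewrite mulr_ge0.
rewrite ler_wpM2l//; apply: (@le_trans _ _ (expR (eta * D) ^+ q)).
  by rewrite lerXn2r ?nnegrE ?addr_ge0 ?mulr_ge0 ?expR_ge0 ?expR_ge1Dx.
rewrite -expRM_natl ler_expR.
by rewrite mulrA mulrC ler_wpM2l.
Qed.

Definition chain_jumps (Jr : seq nat) (V : seq Rm) : seq (R * (Rd * Rm)) :=
  zip [seq i%:R * eta | i <- Jr] (zip [seq eta *: z i | i <- Jr] V).

(** The [eta * C] inside the product is the drift omitted at the previous jump, and the last term
    covers the motion of the flow within a grid step; the rest is the error of [chain_flow]. *)
Definition chain_error : R := (eta * C + 2 * c + T * (eta * (D * C))) * E + 2 * (eta * C).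

(* The shifts V reset the path to the state of the scheme just before each
   jump, so that the noise does not amplify the accumulated error. *)
Lemma chain_jp Jr i0 y : path ltn i0 Jr -> all (leq^~ n) Jr -> (i0 <= n)%N ->
  (forall i, (i0 < i <= n)%N -> (i \in J) = (i \in Jr)) ->
  enorm (y - u i0) <= eta * C -> exists V : seq Rm, [/\ size V = size Jr,
    forall v, v \in V -> enorm v <= chain_error &
    forall t, i0%:R * eta <= t <= T -> t < n.+1%:R * eta ->
      enorm (jp (chain_jumps Jr V) (i0%:R * eta) y t - u (Num.truncn (t / eta)))
        <= chain_error].
Proof.
have eta0' := ltW eta0.
have step j0 y0 q t : enorm (y0 - u j0) <= eta * C ->
    (forall p, (p < q)%N -> (j0 + p).+1 \notin J) -> (j0 + q <= n)%N ->
    (j0 + q)%:R * eta <= t <= (j0 + q).+1%:R * eta ->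
    enorm (phi (t - j0%:R * eta) y0 - u (j0 + q)%N) <= chain_error.
  move=> h1 h2 h3 /andP[h4 h5]; have h6 := chain_flow h1 h2 h3.
  have e0 : 0 <= eta * C by rewrite mulr_ge0.
  have tq : 0 <= q%:R * eta by rewrite mulr_ge0.
  rewrite -natr1 natrD in h4 h5.
  have tt : 0 <= t - j0%:R * eta by lra.
  have h7 := is_flow_move F y0 tq tt.
  have h8 : `|t - j0%:R * eta - q%:R * eta| <= eta by rewrite ger0_norm; lra.
  have h9 : C * `|t - j0%:R * eta - q%:R * eta| <= eta * C by rewrite mulrC ler_wpM2r.
  apply: (le_trans (enorm_dist_triangle (phi (q%:R * eta) y0) _ _)).
  by rewrite addrC /chain_error; apply: lerD => //; apply: (le_trans h7); lra.
elim: Jr i0 y => [|j Jr ih] i0 y.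
  move=> _ _ i0n hJ hy; exists [::]; split=> // t /andP[t1 t2] t3 /=.
  have te0 : 0 <= t / eta by rewrite divr_ge0// (le_trans _ t1)// mulr_ge0.
  have /andP[e1 e2] := truncn_itv te0.
  move: (Num.truncn (t / eta)) e1 e2 => k e1 e2.
  rewrite ler_pdivlMr// in e1; rewrite ltr_pdivrMr// in e2.
  have ii : (i0 <= k)%N.
    by rewrite -ltnS -(ltr_nat R) -(ltr_pM2r eta0) (le_lt_trans t1).
  have iin : (k <= n)%N.
    by rewrite -ltnS -(ltr_nat R) -(ltr_pM2r eta0) (le_lt_trans e1).
  rewrite -(subnKC ii); apply: step => //.
  - move=> p; rewrite ltn_subRL => pq.
    by rewrite hJ// ltnS leq_addr (leq_trans pq iin).
  - by rewrite subnKC.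
  - by rewrite subnKC// e1 ltW.
move=> /andP[i0j pJ] /andP[jn Jn] i0n hJ hy.
have [j' jE] : exists j', j = j'.+1 by exists j.-1; rewrite prednK// (leq_trans _ i0j).
have i0j' : (i0 <= j')%N by rewrite -ltnS -jE.
have notJ i : (i0 < i < j)%N -> i \notin J.
  move=> /andP[i1 i2]; rewrite hJ; last by rewrite i1 (leq_trans (ltnW i2)).
  rewrite inE negb_or (ltn_eqF i2)/=; apply/negP => iJ.
  have := allP (order_path_min ltn_trans pJ) i iJ; move: i2; clear; lia.
pose v := u j' - phi (j%:R * eta - i0%:R * eta) y.
have vB : enorm v <= chain_error.
  rewrite /v enorm_distC -(subnKC i0j'); apply: step => //.
  - by move=> p pq; apply: notJ; move: pq jE i0j'; clear; lia.
  - by rewrite subnKC//; move: jn jE; clear; lia.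
  - by rewrite subnKC// -jE lexx andbT ler_wpM2r// ler_nat jE.
(* The path jumps from the state before step [j] and misses the drift of that step, hence the
   initial error [eta * C] allowed by the induction. *)
pose y' := u j' + sigma (u j') *m (eta *: z j).
have y'u : enorm (y' - u j) <= eta * C.
  have -> : y' - u j = - (eta *: a (u j')).
    by rewrite /y' jE /= -scalemxAr; apply/colP => i; rewrite !mxE; ring.
  by rewrite enormN enormZ ger0_norm// ler_wpM2l// (is_flow_aB F).
have [|||||V [V1 V2 V3]] := ih j y'.
- exact: pJ.
- exact: Jn.
- exact: jn.
- move=> i /andP[ji iin]; rewrite hJ; last by rewrite (ltn_trans i0j ji).
  by rewrite inE gtn_eqF.
- exact: y'u.
exists (v :: V); split; first by rewrite /= V1.
- by move=> v'; rewrite inE => /orP[/eqP -> //|]; exact: V2.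
move=> t /andP[t1 t2] t3.
have te0 : 0 <= t / eta by rewrite divr_ge0// (le_trans _ t1)// mulr_ge0.
have /andP[e1 e2] := truncn_itv te0.
have [k kE] : exists k, k = Num.truncn (t / eta) by exists (Num.truncn (t / eta)).
rewrite -kE in e1 e2 *.
rewrite ler_pdivlMr// in e1; rewrite ltr_pdivrMr// in e2.
rewrite /chain_jumps !map_cons /=; have [tj|jt] := ltP t (j%:R * eta).
  have ii : (i0 <= k)%N.
    by rewrite -ltnS -(ltr_nat R) -(ltr_pM2r eta0) (le_lt_trans t1).
  have iij : (k < j)%N.
    by rewrite -(ltr_nat R) -(ltr_pM2r eta0) (le_lt_trans e1).
  rewrite -(subnKC ii); apply: step => //.
  - move=> p pq; apply: notJ; move: pq ii iij; clear; lia.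
  - by rewrite subnKC//; move: iij jn; clear; lia.
  - by rewrite subnKC// e1 ltW.
have -> : jump (phi (j%:R * eta - i0%:R * eta) y) (eta *: z j, v) = y'.
  by rewrite /jump/= /v (addrC (phi _ _)) subrK.
by rewrite kE; apply: V3 => //; rewrite jt.
Qed.

End chain.

End stability.

(** * Upper bounds for the Skorokhod distance *)

Section skorokhod_distance.
Context {R : realType} {m : nat} {T : {posnum R}}.
Local Notation I := (`[0, T%:num]%classic : set R).

Lemma mdistJ1 (x y : Dspace m T) : mdist x y = J1dist x y.
Proof. by []. Qed.

Lemma mdist_sup (x y : Dspace m T) c :
  (forall t, 0 <= t <= T%:num -> enorm (x t - y t) <= c) -> mdist x y <= c.
Proof.
move=> h; rewrite mdistJ1; apply: (J1dist_le (time_change_id T)) => t /=.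
rewrite in_itv/= => It; rewrite subrr normr0 ge_max h// andbT.
exact: le_trans (enorm_ge0 _) (h t It).
Qed.

(** Increments at least half as large make [f] injective and its inverse 2-Lipschitz; the
    intermediate value theorem makes it onto. *)
Lemma time_change_expanding (f : R -> R) : f 0 = 0 -> f T%:num = T%:num ->
  continuous f -> (forall s t, s <= t -> (t - s) / 2 <= f t - f s) -> time_change T f.
Proof.
move=> f0 fT fc fe.
have inc s t : s <= t -> f s <= f t.
  move=> st; have := fe s t st; have : 0 <= (t - s) / 2 by rewrite divr_ge0// subr_ge0.
  by lra.
have fI t : I t -> I (f t).
  rewrite /= !in_itv/= => /andP[t0 tT].
  by rewrite -{1}f0 -{1}fT !inc.
have fcT := continuous_subspaceT fc.
have surj v : I v -> exists2 t, I t & f t = v.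
  rewrite /= in_itv/= => /andP[v0 vT].
  have [] := @IVT R f 0 T%:num v (ltW [gt0 of T%:num]) (fcT _).
    by rewrite f0 fT (min_idPl _) ?(max_idPr _) ?v0.
  by move=> t It <-; exists t.
split.
  move=> s t _ _ st; have := fe s t (ltW st).
  have : 0 < (t - s) / 2 by rewrite divr_gt0// subr_gt0.
  by lra.
pose k v := if pselect (I v) is left Iv then sval (cid2 (surj v Iv)) else 0.
have kP v : I v -> I (k v) /\ f (k v) = v.
  by move=> Iv; rewrite /k; case: pselect => // Iv'; case: cid2.
have lip u v : I u -> I v -> `|k u - k v| <= 2 * `|u - v|.
  move=> Iu Iv; have [Iku fu] := kP u Iu; have [Ikv fv] := kP v Iv.
  rewrite -{2}fu -{2}fv; have [uv|vu] := leP (k u) (k v).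
    have := fe _ _ uv; rewrite distrC (distrC (f _)) !ger0_norm ?subr_ge0//; first lra.
    exact: inc.
  have := fe _ _ (ltW vu); rewrite !ger0_norm ?subr_ge0//; first lra.
  - exact/inc/ltW.
  - exact/ltW.
have inj s t : f s = f t -> s = t.
  move=> fst; apply/eqP; rewrite eq_le; apply/andP; split; rewrite leNgt; apply/negP => st.
    by have := fe _ _ (ltW st); rewrite fst subrr; lra.
  by have := fe _ _ (ltW st); rewrite fst subrr; lra.
exists k; split => //.
- by move=> v /kP[].
- apply/subspace_continuousP => v Iv; apply/cvgrPdist_lt => e e0.
  rewrite near_withinE; exists (e / 2); first by rewrite /= divr_gt0.
  move=> u; rewrite /ball_/= => uv Iu.
  by rewrite (le_lt_trans (lip _ _ Iv Iu))//; lra.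
- split=> v; rewrite inE => Iv; last by case: (kP v Iv).
  by apply: inj; case: (kP _ (fI _ Iv)).
Qed.

(** A bump of height one and half-width [k] at [c]: combinations of such bumps move given jump times
    to nearby ones. *)
Definition tent (c k t : R) : R := Num.max 0 (1 - `|t - c| / k).

Lemma tent_lip c k s t : 0 < k -> `|tent c k t - tent c k s| <= `|t - s| / k.
Proof.
move=> k0; rewrite /tent.
have h : `| (`|t - c| / k - `|s - c| / k) | <= `|t - s| / k.
  have ki : 0 <= k^-1 by rewrite invr_ge0 ltW.
  rewrite -mulrBl normrM (ger0_norm ki) ler_wpM2r//.
  by rewrite (le_trans (ler_dist_dist _ _))// opprB addrA subrK.
move: h; rewrite !ler_norml => /andP[h1 h2].
have [a1|a1] := leP 0 (1 - `|t - c| / k); have [b1|b1] := leP 0 (1 - `|s - c| / k);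
  apply/andP; split; lra.
Qed.

Lemma tent_center c k : tent c k c = 1.
Proof. by rewrite /tent subrr normr0 mul0r subr0 (max_idPr _). Qed.

Lemma tent_far c k t : 0 < k -> k <= `|t - c| -> tent c k t = 0.
Proof.
move=> k0 h; rewrite /tent (max_idPl _)//.
by rewrite subr_le0 ler_pdivlMr// mul1r.
Qed.

Lemma tent_ge0_le1 c k t : 0 < k -> 0 <= tent c k t <= 1.
Proof.
move=> k0; rewrite /tent le_max lexx ge_max ler01/= gerBl divr_ge0//; exact: ltW.
Qed.

Lemma continuous_tent c k : 0 < k -> continuous (tent c k).
Proof.
move=> k0 t; apply/cvgrPdist_lt => e e0; exists (e * k) => /=.
  by rewrite mulr_gt0.
move=> s; rewrite /ball_/= => h; rewrite (le_lt_trans (tent_lip _ _ _ k0))//.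
by rewrite ltr_pdivrMr.
Qed.

End skorokhod_distance.

(** * Stability of paths with jumps in the Skorokhod metric *)

Section path_stability.
Context {R : realType} {m d : nat}.
Local Notation Rm := 'cV[R]_m.
Local Notation Rd := 'cV[R]_d.
Variables (a : Rm -> Rm) (sigma : Rm -> 'M[R]_(m, d)) (D C : R) (phi : R -> Rm -> Rm).
Hypothesis F : is_flow a D C phi.
Hypothesis sL : forall x y w,
  enorm ((sigma x - sigma y) *m w) <= D * enorm (x - y) * enorm w.
Hypothesis sB : forall x w, enorm (sigma x *m w) <= C * enorm w.
Variable T : {posnum R}.

Local Notation I := (`[0, T%:num]%classic : set R).
Local Notation jp := (jp sigma phi).
Local Notation jump := (jump sigma).
Local Notation E := (expR (D * T%:num)).
Local Notation times l := [seq j.1 | j <- l].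
Local Notation Inc k := (@increasing_tuples R k `]0, T%:num]%classic).

Let D0 := is_flow_D F.
Let C0 := is_flow_C F.
Let T0 : 0 <= T%:num. Proof. by []. Qed.

Let V0 k : k.-tuple Rm := [tuple of nseq k 0].

Let V0E k i : tnth (V0 k) i = 0.
Proof. by rewrite (tnth_nth 0) nth_nseq if_same. Qed.

Let pathE k x (W : k.-tuple Rd) (V : k.-tuple Rm) (t : k.-tuple R) u :
  Inc k t -> 0 <= u <= T%:num ->
  perturbed_path a sigma T x W V t u = jp (jlist W V t) 0 x u.
Proof. by move=> h1 h2; apply: (perturbed_pathE sigma F) => //; rewrite /= in_itv. Qed.

Let mem_jlist k (W : k.-tuple Rd) (V : k.-tuple Rm) (t : k.-tuple R) j :
  j \in jlist W V t -> exists i, j = (tnth t i, (tnth W i, tnth V i)).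
Proof.
move=> jl; have sl : size (jlist W V t) = k by rewrite !size_zip !size_tuple !minnn.
have ik : (index j (jlist W V t) < k)%N by rewrite -[X in (_ < X)%N]sl index_mem.
exists (Ordinal ik); have := nth_index (0, (0, 0)) jl.
rewrite !nth_zip ?size_zip ?size_tuple ?minnn//.
by rewrite -[index j _]/(nat_of_ord (Ordinal ik)) -!tnth_nth.
Qed.

Let jlist_path k (W : k.-tuple Rd) (V : k.-tuple Rm) (t : k.-tuple R) :
  Inc k t -> path <%R 0 (times (jlist W V t)) /\ all (<= T%:num) (times (jlist W V t)).
Proof. by move=> /increasing_path; rewrite times_jlist. Qed.

Lemma perturbed_jump_dist k x (W : k.-tuple Rd) (V : k.-tuple Rm) (t : k.-tuple R) (K b : R) :
  0 <= K -> 0 <= b -> Inc k t -> (forall i, enorm (tnth W i) <= K) ->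
  (forall i, enorm (tnth V i) <= b) ->
  mdist (perturbed_path a sigma T x W V t) (jump_path a sigma T x W t) <=
    ((1 + D * K) * E + 1) ^+ k.+1 * b.
Proof.
move=> K0 b0 it WK Vb; apply: mdist_sup => u u0T; rewrite /jump_path -/(V0 k) !pathE//.
have sl : size (jlist W V t) = k by rewrite !size_zip !size_tuple !minnn.
have -> : jlist W (V0 k) t = [seq (j.1, (j.2.1, 0)) | j <- jlist W V t].
  rewrite /jlist /=; move: (size_tuple W) (size_tuple V) (size_tuple t).
  move: (tval W) (tval V) (tval t); clear; elim: k => [|k ih] [|w W] [|v V] [|s t] //=.
  by move=> [sW] [sV] [st]; congr cons; exact: ih.
have := @jp_lip _ _ _ _ _ _ _ _ F sL T%:num T0 K b (jlist W V t) 0 x x u K0 b0.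
rewrite subrr enorm0 add0r sl; apply => //; last by case: (jlist_path W V it).
by move=> j /mem_jlist[i ->] /=; split.
Qed.

Let list_tuples k (l : seq (R * (Rd * Rm))) : size l = k ->
  exists (W : k.-tuple Rd) (V : k.-tuple Rm) (t : k.-tuple R), jlist W V t = l.
Proof.
move=> sl; have s1 : size (unzip1 (unzip2 l)) == k by rewrite !size_map sl.
have s2 : size (unzip2 (unzip2 l)) == k by rewrite !size_map sl.
have s3 : size (unzip1 l) == k by rewrite !size_map sl.
by exists (Tuple s1), (Tuple s2), (Tuple s3); rewrite /jlist/= !zip_unzip.
Qed.

(** A path with one small jump is close to a path with fewer but shifted jumps: this is what makes
    test functions vanish as soon as one jump is small. *)
Lemma jump_path_remove_small k x (W : k.+1.-tuple Rd) (t : k.+1.-tuple R) r :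
  0 <= r -> Inc k.+1 t -> (exists i, enorm (tnth W i) <= r) ->
  exists (W' : k.-tuple Rd) (V' : k.-tuple Rm) (t' : k.-tuple R),
    [/\ Inc k t', forall i, enorm (tnth V' i) <= E * (C * r) &
      mdist (jump_path a sigma T x W t) (perturbed_path a sigma T x W' V' t')
        <= E * (C * r)].
Proof.
move=> r0 it [i Wi]; pose l := jlist W (V0 k.+1) t.
have [p1 p2] := jlist_path W (V0 k.+1) it.
have sl : size l = k.+1 by rewrite !size_zip !size_tuple !minnn.
have [| |l' [h1 h2 h3 h4 h5]] := jp_remove_small F sB x r0 _ _ (lexx 0) p1 p2.
- by move=> j /mem_jlist[i' ->] /=; rewrite V0E.
- exists (tnth t i, (tnth W i, 0)) => //.
  have := @mem_nth _ (0, (0, 0)) l i; rewrite sl ltn_ord => /(_ isT).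
  rewrite !nth_zip ?size_zip ?size_nseq ?size_tuple ?minnn// -!tnth_nth.
  by rewrite V0E.
have [W' [V' [t' l'E]]] := list_tuples (succn_inj (etrans h1 sl)).
exists W', V', t'; rewrite -l'E in h2 h3 h4 h5.
have it' : Inc k t' by apply/increasing_path; rewrite -(times_jlist W' V' t').
split => //.
  move=> j; apply: (h4 (tnth t' j, (tnth W' j, tnth V' j))).
  have sl' : size (jlist W' V' t') = k by rewrite !size_zip !size_tuple !minnn.
  have := @mem_nth _ (0, (0, 0)) (jlist W' V' t') j; rewrite sl' ltn_ord => /(_ isT).
  by rewrite !nth_zip ?size_zip ?size_tuple ?minnn// -!tnth_nth.
by apply: mdist_sup => u uT; rewrite !pathE//; exact: h5.
Qed.

Lemma chain_perturbed k x (z : nat -> Rd) (eta c : R) (J : k.-tuple nat) :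
  0 < eta -> 0 <= c -> path ltn 0 J -> all (leq^~ (Num.truncn (T%:num / eta))) J ->
  (forall i, (i <= Num.truncn (T%:num / eta))%N ->
     enorm (small_noise a sigma eta z x J i) <= c) ->
  let t := [tuple of [seq i%:R * eta | i <- J]] in
  let W := [tuple of [seq eta *: z i | i <- J]] in
  Inc k t /\ exists V : k.-tuple Rm,
    (forall i, enorm (tnth V i) <= chain_error D C T%:num eta c) /\
    mdist (step_path T (sgd a sigma eta z x) eta) (perturbed_path a sigma T x W V t)
      <= chain_error D C T%:num eta c.
Proof.
move=> eta0 c0 pJ aJ hn t W; set n := Num.truncn _ in aJ hn.
have Te0 : 0 <= T%:num / eta by rewrite divr_ge0// ltW.
have /andP[n1 n2] := truncn_itv Te0; rewrite -/n in n1 n2.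
rewrite ler_pdivlMr// in n1; rewrite ltr_pdivrMr// in n2.
have it : Inc k t.
  apply/increasing_path; split.
    have -> : (0 : R) = 0%:R * eta by rewrite mul0r.
    apply: homo_path pJ => i j ij; by rewrite ltr_pM2r// ltr_nat.
  apply/allP => _ /mapP[i iJ ->] /=; rewrite (le_trans _ n1)// ler_pM2r// ler_nat.
  exact: (allP aJ).
split => //.
have [|V [V1 V2 V3]] := chain_jp F T0 eta0 c0 n1 hn pJ aJ (leq0n _) (fun _ _ => erefl) (y := x).
  by rewrite subrr enorm0 mulr_ge0// ltW.
have sV : size V == k by rewrite V1 size_tuple.
exists (Tuple sV); split; first by move=> i; apply/V2/mem_tnth.
apply: mdist_sup => u /andP[u0 uT]; rewrite /= /step_fun in_itv/= u0 uT/=.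
rewrite pathE ?u0// enorm_distC.
have := V3 u; rewrite mul0r u0 uT; apply => //.
exact: le_lt_trans n2.
Qed.

(** Jump lists with equal shifts, close times and close noises, whose times are matched by [f]: by
    the order condition, one path at time [t] and the other at time [f t] have made the same number
    of jumps. *)
Let close_lists (g : R) (f : R -> R) :=
  fix close (l l' : seq (R * (Rd * Rm))) : Prop := match l, l' with
  | [::], [::] => True
  | j :: k, j' :: k' => [/\ `|j'.1 - j.1| <= g, enorm (j'.2.1 - j.2.1) <= g,
      j'.2.2 = j.2.2, (forall t, 0 <= t <= T%:num -> (t < j.1) = (f t < j'.1)) & close k k']
  | _, _ => False
  end.

Let close_sub g g' f l l' : g <= g' -> close_lists g f l l' -> close_lists g' f l l'.
Proof.
move=> gg; elim: l l' => [|j l ih] [|j' l'] //= [h1 h2 h3 h4 h5].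
by split => //; [exact: le_trans gg|exact: le_trans gg|exact: ih].
Qed.

Let close_zip g f k (W W' : seq Rd) (t t' : seq R) :
  (forall s u, (s < u) = (f s < f u)) ->
  size W = k -> size W' = k -> size t = k -> size t' = k ->
  (forall i, (i < k)%N -> f (nth 0 t i) = nth 0 t' i) ->
  (forall i, (i < k)%N -> enorm (nth 0 W' i - nth 0 W i) <= g) ->
  (forall i, (i < k)%N -> `|nth 0 t' i - nth 0 t i| <= g) ->
  close_lists g f (zip t (zip W (nseq k 0))) (zip t' (zip W' (nseq k 0))).
Proof.
move=> fmono; elim: k W W' t t' => [|k ih] [|w W] [|w' W'] [|s t] [|s' t'] //=.
move=> [sW] [sW'] [st] [st'] ft Wg tg; split.
- exact: (tg 0%N isT).
- exact: (Wg 0%N isT).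
- by [].
- by move=> u _; have := ft 0%N isT; rewrite /= fmono => ->.
- by apply: ih => // i ik; [exact: (ft i.+1)|exact: (Wg i.+1)|exact: (tg i.+1)].
Qed.

(** The second path is read along the time change [f], so that both are always between corresponding
    jumps; errors then pass through the jumps by the Lipschitz and boundedness assumptions on
    [sigma]. *)
Lemma jp_continuous l s x : 0 <= s -> path <%R s (times l) -> all (<= T%:num) (times l) ->
  forall e, 0 < e -> exists2 g, 0 < g & forall l' s' x' f,
    0 <= s' -> path <%R s' (times l') -> `|s' - s| <= g -> enorm (x' - x) <= g ->
    (forall t, s <= t <= T%:num -> s' <= f t <= T%:num /\ `|f t - t| <= g) ->
    close_lists g f l l' ->
    forall t, s <= t <= T%:num -> enorm (jp l' s' x' (f t) - jp l s x t) <= e.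
Proof.
move: l s x; pose K := E + 2 * C + 1.
have K1 : 1 <= K by rewrite lerDr addr_ge0 ?expR_ge0 ?mulr_ge0.
have K0 : 0 < K by exact: lt_le_trans K1.
have fl g s s' t t' x x' : 0 <= g -> 0 <= s -> 0 <= s' -> s <= t <= T%:num -> s' <= t' <= T%:num ->
    `|s' - s| <= g -> `|t' - t| <= g -> enorm (x' - x) <= g ->
    enorm (phi (t' - s') x' - phi (t - s) x) <= K * g.
  move=> g0 s0 s'0 /andP[st tT] /andP[st' tT'] sg tg xg.
  have ts0 : 0 <= t - s by rewrite subr_ge0.
  have ts0' : 0 <= t' - s' by rewrite subr_ge0.
  apply: (le_trans (enorm_dist_triangle (phi (t' - s') x) _ _)).
  have h1 : enorm (phi (t' - s') x' - phi (t' - s') x) <= E * g.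
    rewrite (le_trans (is_flow_lip F _ _ ts0'))//.
    by rewrite ler_pM ?expR_ge0 ?enorm_ge0 ?ler_expR ?ler_wpM2l//; lra.
  have h2 : enorm (phi (t' - s') x - phi (t - s) x) <= C * (g + g).
    rewrite (le_trans (is_flow_move F x ts0 ts0'))// ler_wpM2l//.
    rewrite (_ : _ - _ = (t' - t) - (s' - s)); last by ring.
    by rewrite (le_trans (ler_normB _ _))// lerD.
  by rewrite (le_trans (lerD h1 h2))// /K; lra.
elim=> [|j l ih] s x s0.
  move=> _ _ e e0; exists (e / K); first by rewrite divr_gt0.
  move=> [|? ?] s' x' f s'0 _ sg xg fg // _ t st.
  have [f1 f2] := fg t st.
  rewrite /= (le_trans (fl (e / K) _ _ _ _ _ _ _ s0 s'0 st f1 sg f2 xg))//.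
    by rewrite divr_ge0 ?ltW.
  by rewrite mulrC divfK// lt0r_neq0.
move=> /andP[sj pl] /andP[jT lT] e e0.
set y := jump (phi (j.1 - s) x) j.2.
have [g1 g10 hg1] := ih j.1 y (le_trans s0 (ltW sj)) pl lT e e0.
(* The error after the jump: the error [K * g] before it, amplified by the Lipschitz bound on
   [sigma], plus [C * g] from the change of noise. *)
pose K' := K * (1 + D * enorm j.2.1) + C.
have K'0 : 0 < K' by rewrite ltr_wpDr// mulr_gt0// ltr_wpDr// mulr_ge0// enorm_ge0.
pose g := Num.min g1 (Num.min (e / K) (g1 / K')).
have gg1 : g <= g1 by rewrite ge_min lexx.
have ge : g <= e / K by rewrite !ge_min lexx orbT.
have gK : g <= g1 / K' by rewrite !ge_min lexx !orbT.
have g0 : 0 < g by rewrite !lt_min g10 !divr_gt0.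
exists g => // -[|j' l'] s' x' f s'0 // /andP[sj' pl'] sg xg fg [c1 c2 c3 c4 c5] t st.
have [f1 f2] := fg t st; have /andP[st1 st2] := st.
have t0T : 0 <= t <= T%:num by rewrite (le_trans s0 st1).
have [tj|jt] := ltP t j.1.
  rewrite !jp_lt//; last by rewrite -c4.
  rewrite (le_trans (fl g _ _ _ _ _ _ _ s0 s'0 st f1 sg f2 xg))//; first exact: ltW.
  by rewrite mulrC -ler_pdivlMr.
have ft : j'.1 <= f t by rewrite leNgt -c4// -leNgt.
rewrite !jp_ge//; apply: hg1 => //.
- exact: le_trans (ltW sj').
- exact: le_trans gg1.
- rewrite /y; have h := fl g s s' j.1 j'.1 x x' (ltW g0) s0 s'0.
  have {}h : enorm (phi (j'.1 - s') x' - phi (j.1 - s) x) <= K * g.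
    apply: h => //; first by rewrite (ltW sj).
    rewrite (ltW sj')/= (le_trans ft)//.
    by have /andP[] := f1.
  move: h; set p := phi (j'.1 - s') x'; set q := phi (j.1 - s) x => h.
  rewrite /jump c3.
  have -> : p + j.2.2 + sigma (p + j.2.2) *m j'.2.1 - (q + j.2.2 + sigma (q + j.2.2) *m j.2.1)
    = (p - q) + ((sigma (p + j.2.2) - sigma (q + j.2.2)) *m j.2.1
                + sigma (p + j.2.2) *m (j'.2.1 - j.2.1)).
    rewrite mulmxBl mulmxBr; apply/colP => i; rewrite !mxE; ring.
  rewrite (le_trans (enorm_triangle _ _))//.
  have h1 : enorm ((sigma (p + j.2.2) - sigma (q + j.2.2)) *m j.2.1) <= D * (K * g) * enorm j.2.1.
    rewrite (le_trans (sL _ _ _))// ler_wpM2r ?enorm_ge0// ler_wpM2l//.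
    by rewrite opprD addrACA subrr addr0.
  have h2 : enorm (sigma (p + j.2.2) *m (j'.2.1 - j.2.1)) <= C * g.
    by rewrite (le_trans (sB _ _))// ler_wpM2l.
  apply: (le_trans (lerD h (le_trans (enorm_triangle _ _) (lerD h1 h2)))).
  apply: (@le_trans _ _ (K' * g)); first by rewrite /K'; lra.
  by rewrite mulrC -ler_pdivlMr.
- move=> v /andP[v1 v2]; have sv : s <= v <= T%:num by rewrite v2 (le_trans (ltW sj)).
  have [/andP[f3 f4] f5] := fg v sv; rewrite f4 (le_trans f5 gg1) andbT; split => //.
  by rewrite leNgt -c4 ?v2 ?(le_trans s0 (le_trans (ltW sj) v1))// -leNgt.
- exact: close_sub c5.
- by rewrite jt.
Qed.

(** A time change fixes 0 and [T], so that it can follow the jump times only if they lie strictly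
    between the two. *)
Lemma jump_path_continuous k x (W : k.-tuple Rd) (t : k.-tuple R) :
  increasing_tuples `]0, T%:num[%classic t ->
  forall e, 0 < e -> exists2 g, 0 < g & forall x' (W' : k.-tuple Rd) (t' : k.-tuple R),
    Inc k t' -> enorm (x' - x) <= g -> (forall i, enorm (tnth W' i - tnth W i) <= g) ->
    (forall i, `|tnth t' i - tnth t i| <= g) ->
    mdist (jump_path a sigma T x' W' t') (jump_path a sigma T x W t) <= e.
Proof.
move=> [ht1 ht2] e e0.
have it : Inc k t.
  split=> // i; have := ht1 i; rewrite /= !in_itv/= => /andP[-> /ltW ->//].
(* [c] is a common lower bound of the gaps between jump times and of their distances to 0 and [T]: a
   tent of half-width [c] vanishes at the other jump times and at the end points. *)
have [c c0 [hc1 hc2 hc3]] : exists2 c, 0 < c & [/\ forall i, c <= tnth t i,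
    forall i, c <= T%:num - tnth t i &
    forall i j, i != j -> c <= `|tnth t i - tnth t j|].
  have : \forall c \near 0^'+, forall i, c <= tnth t i.
    apply: filter_forall => i; apply: nbhs_right_le.
    by have := ht1 i; rewrite /= in_itv/= => /andP[].
  have : \forall c \near 0^'+, forall i, c <= T%:num - tnth t i.
    apply: filter_forall => i; apply: nbhs_right_le.
    by have := ht1 i; rewrite /= in_itv/= subr_gt0 => /andP[].
  have : \forall c \near (0 : R)^'+, forall i j, i != j -> c <= `|tnth t i - tnth t j|.
    apply: filter_forall => i; apply: filter_forall => j.
    have [->|ij] := eqVneq i j; first exact: nearW.
    have : 0 < `|tnth t i - tnth t j|.
      rewrite normr_gt0 subr_eq0; move: ij; rewrite neq_ltn => /orP[|] /ht2 tt.
        by rewrite lt_eqF.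
      by rewrite gt_eqF.
    by move=> /nbhs_right_le; apply: filterS => c hc _.
  move=> h1 h2 h3; near (0 : R)^'+ => c; exists c; first by [].
  by split; near: c.
pose l := jlist W (V0 k) t.
have [p1 p2] := jlist_path W (V0 k) it.
have [g1 g10 hg1] := jp_continuous x (lexx 0) p1 p2 e0.
(* Division by [k.+1] controls the sum of the [k] displacements, and the bound [c / 2] leaves [f] a
   slope of at least one half. *)
pose g := Num.min (Num.min g1 e) (c / 2) / k.+1%:R.
have g0 : 0 < g by rewrite divr_gt0// !lt_min g10 e0 divr_gt0.
have gk : g * k%:R <= Num.min (Num.min g1 e) (c / 2).
  rewrite /g -mulrA ler_piMr//; first by rewrite ltW// !lt_min g10 e0 divr_gt0.
  by rewrite mulrC ler_pdivrMr// mul1r ler_nat.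
have gg : g <= Num.min (Num.min g1 e) (c / 2).
  rewrite /g ler_piMr//; first by rewrite ltW// !lt_min g10 e0 divr_gt0.
  by rewrite invf_le1// ler1n.
move: gk gg; rewrite !le_min => /andP[/andP[gk1 gke] gkc] /andP[/andP[gg1 gge] ggc].
exists g => // x' W' t' it' xg Wg tg.
pose f u := u + \sum_i (tnth t' i - tnth t i) * tent (tnth t i) c u.
have fu u : `|f u - u| <= g * k%:R.
  rewrite /f addrC addKr (le_trans (ler_norm_sum _ _ _))//.
  apply: (@le_trans _ _ (\sum_(i < k) g)); last by rewrite sumr_const card_ord mulr_natr.
  apply: ler_sum => i _; rewrite normrM.
  have /andP[b1 b2] := tent_ge0_le1 (tnth t i) u c0.
  by rewrite -[leRHS]mulr1 ler_pM// ger0_norm.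
have ft i : f (tnth t i) = tnth t' i.
  rewrite /f (bigD1 i)//= tent_center mulr1 big1 ?addr0; first by ring.
  move=> j ji; rewrite tent_far ?mulr0//.
  by apply: hc3; rewrite eq_sym.
have f0 : f 0 = 0.
  rewrite /f add0r big1// => i _; rewrite tent_far ?mulr0// sub0r normrN.
  by rewrite (le_trans (hc1 i))// ler_norm.
have fT : f T%:num = T%:num.
  rewrite /f big1 ?addr0// => i _; rewrite tent_far ?mulr0//.
  by rewrite (le_trans (hc2 i))// ler_norm.
have fe s u : s <= u -> (u - s) / 2 <= f u - f s.
  move=> su; rewrite /f opprD addrACA -sumrB.
  suff : `|\sum_(i < k) ((tnth t' i - tnth t i) * tent (tnth t i) c u -
       (tnth t' i - tnth t i) * tent (tnth t i) c s)| <= (u - s) / 2.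
    by rewrite ler_norml => /andP[? ?]; lra.
  rewrite (le_trans (ler_norm_sum _ _ _))//.
  apply: (@le_trans _ _ (\sum_(i < k) (g * ((u - s) / c)))).
    apply: ler_sum => i _; rewrite -mulrBr normrM ler_pM//.
    by rewrite (le_trans (tent_lip _ _ _ c0))// ger0_norm ?subr_ge0.
  rewrite sumr_const card_ord.
  have -> : g * ((u - s) / c) *+ k = g * k%:R * ((u - s) / c).
    by rewrite -[LHS]mulr_natr -mulrA [_ * k%:R]mulrC mulrA.
  have us : 0 <= (u - s) / c by apply: divr_ge0; [rewrite subr_ge0|exact: ltW].
  rewrite (le_trans (ler_wpM2r us gkc))//.
  suff -> : c / 2 * ((u - s) / c) = (u - s) / 2 by [].
  by field; rewrite lt0r_neq0.
have fc : continuous f.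
  move=> u; apply: cvgD; first exact: cvg_id.
  apply: (@cvg_big R 'I_k +%R 0 xpredT _ R (nbhs u) _
    (fun i v => (tnth t' i - tnth t i) * tent (tnth t i) c v)).
    by move=> p; exact: add_continuous.
  by move=> i _; apply: cvgMl_tmp; exact: continuous_tent.
have tf := time_change_expanding f0 fT fc fe.
have finc s u : s < u -> f s < f u.
  move=> su; have := fe s u (ltW su).
  have : 0 < (u - s) / 2 by rewrite divr_gt0// subr_gt0.
  by lra.
have fmono s u : (s < u) = (f s < f u).
  apply/idP/idP; first exact: finc.
  have [//|] := ltP s u; rewrite le_eqVlt => /orP[/eqP ->|/finc/lt_trans h /h].
    by rewrite ltxx.
  by rewrite ltxx.
have fI u : 0 <= u <= T%:num -> 0 <= f u <= T%:num.
  by move=> /andP[u0 uT]; rewrite -{1}f0 -{1}fT !leNgt -!fmono -!leNgt u0.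
rewrite mdistJ1; apply: (J1dist_le tf) => u /=; rewrite in_itv/= => u0T.
rewrite ge_max (le_trans (fu u))//=.
rewrite /jump_path !pathE ?fI//; apply: hg1 => //.
- by case: (jlist_path W' (V0 k) it').
- by rewrite subrr normr0 ltW.
- exact: le_trans gg1.
- by move=> v v0T; split; [exact: fI|exact: le_trans gk1].
rewrite /jlist; move: ft it' Wg tg => {}ft _ {}Wg {}tg.
have ft' i : (i < k)%N -> f (nth 0 t i) = nth 0 t' i.
  by move=> ik; have := ft (Ordinal ik); rewrite !(tnth_nth 0).
have Wg' i : (i < k)%N -> enorm (nth 0 W' i - nth 0 W i) <= g1.
  move=> ik; have := Wg (Ordinal ik); rewrite !(tnth_nth 0) => /le_trans; exact.
have tg' i : (i < k)%N -> `|nth 0 t' i - nth 0 t i| <= g1.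
  move=> ik; have := tg (Ordinal ik); rewrite !(tnth_nth 0) => /le_trans; exact.
by apply: close_zip => //; rewrite size_tuple.
Unshelve. all: by end_near. Qed.

(** With fixed jump times the identity time change suffices, and a jump at [T] is allowed; grid
    times may be equal to [T]. *)
Lemma jump_path_continuous_noise k x (W : k.-tuple Rd) (t : k.-tuple R) : Inc k t ->
  forall e, 0 < e -> exists2 g, 0 < g & forall x' (W' : k.-tuple Rd),
    enorm (x' - x) <= g -> (forall i, enorm (tnth W' i - tnth W i) <= g) ->
    mdist (jump_path a sigma T x' W' t) (jump_path a sigma T x W t) <= e.
Proof.
move=> it e e0; have [p1 p2] := jlist_path W (V0 k) it.
have [g g0 hg] := jp_continuous x (lexx 0) p1 p2 e0.
exists g => // x' W' xg Wg; apply: mdist_sup => u u0T.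
rewrite /jump_path !pathE//; apply: (hg _ 0 x' id) => //.
- by case: (jlist_path W' (V0 k) it).
- by rewrite subrr normr0 ltW.
- by move=> v v0T; split=> //; rewrite subrr normr0 ltW.
have Wg' i : (i < k)%N -> enorm (nth 0 W' i - nth 0 W i) <= g.
  by move=> ik; have := Wg (Ordinal ik); rewrite !(tnth_nth 0).
by apply: close_zip => //; rewrite ?size_tuple// => i _; rewrite subrr normr0 ltW.
Qed.

End path_stability.

(** * Powers of a measure *)

Section set_function_integral.
Context {disp : measure_display} {X : measurableType disp} {R : realType}.

(* The integral only evaluates the set function on measurable subsets of the
   domain: the fiber at 0 of a simple function is weighted by 0. *)
Lemma integral_set_function (m m' : set X -> \bar R) (A : set X) (f : X -> \bar R) :
  (forall B, measurable B -> B `<=` A -> m B = m' B) ->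
  (\int[m]_(x in A) f x = \int[m']_(x in A) f x)%E.
Proof.
move=> mm; have key (g : X -> \bar R) : (forall x, ~ A x -> g x = 0%E) ->
    [set sintegral m h | h in [set h : {nnsfun X >-> R} | forall x, ((h x)%:E <= g x)%E]] =
    [set sintegral m' h | h in [set h : {nnsfun X >-> R} | forall x, ((h x)%:E <= g x)%E]].
  move=> gA; suff h (h : {nnsfun X >-> R}) : (forall x, ((h x)%:E <= g x)%E) ->
      sintegral m h = sintegral m' h.
    by apply/seteqP; split=> _ [k /= hk <-]; exists k => //; rewrite h.
  move=> hg; rewrite /sintegral; apply: eq_fsbigr => x _.
  have [->|x0] := eqVneq x 0; first by rewrite !mul0e.
  congr (_ * _)%E; apply: mm; first exact: measurable_sfunP.
  move=> y /= hy; apply: contrapT => /gA g0; have := hg y; rewrite g0 hy lee_fin.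
  have : 0 <= h y by [].
  by rewrite hy => x1 x2; move: x0; rewrite eq_le x1 x2.
rewrite /integral /=; congr (ereal_sup _ - ereal_sup _)%E; apply: key => x nAx.
  by rewrite funeposE patchE memNset// maxxx.
by rewrite funenegE patchE memNset// oppe0 maxxx.
Qed.

End set_function_integral.

Section mpower_measure.
Context {disp : measure_display} {X : measurableType disp} {R : realType}.
Local Open Scope ereal_scope.

Lemma measurable_tcons k :
  measurable_fun setT (fun p : X * k.-tuple X => [tuple of p.1 :: p.2]).
Proof. exact: measurable_cons. Qed.

Section cons_measure.
Variables (mu : {sigma_finite_measure set X -> \bar R}) (k : nat).
Variable M : {sigma_finite_measure set (k.-tuple X) -> \bar R}.

(** One step of [mpower] over an abstract sigma-finite [M]: the structure has to exist for this step
    before an induction on [k] can give it to all powers. *)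
Definition mcons : set (k.+1.-tuple X) -> \bar R :=
  pushforward (mu \x M) (fun p => [tuple of p.1 :: p.2]).

Let mcons_pushforward : {measure set (k.+1.-tuple X) -> \bar R} :=
  measure_function_pushforward__canonical__measure_function_Measure
    (mu \x M)%E (@measurable_tcons k).

Let mcons0 : mcons set0 = 0. Proof. exact: (measure0 mcons_pushforward). Qed.
Let mcons_ge0 A : 0 <= mcons A. Proof. exact: (measure_ge0 mcons_pushforward). Qed.
Let mcons_sigma : semi_sigma_additive mcons.
Proof. exact: (@measure_semi_sigma_additive _ _ _ mcons_pushforward). Qed.

HB.instance Definition _ := isMeasure.Build _ _ _ mcons mcons0 mcons_ge0 mcons_sigma.

Let mcons_sigma_finite : sigma_finite setT mcons.
Proof.
have /sigma_finiteP[F [FT ndF Foo]] := sigma_finiteT mu.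
have /sigma_finiteP[G [GT ndG Goo]] := sigma_finiteT M.
pose g (t : k.+1.-tuple X) : X * k.-tuple X := (thead t, [tuple of behead t]).
have mg : measurable_fun setT g.
  apply/measurable_fun_pairP; split; first exact: measurable_tnth.
  apply/measurable_fun_tnthP => i; rewrite (_ : _ \o _ = (@tnth _ X)^~ (lift ord0 i)).
    exact: measurable_tnth.
  by apply/funext => t /=; rewrite tnth_behead; congr tnth; apply/val_inj; rewrite /= inordK// ltnS.
exists (fun n => g @^-1` (F n `*` G n)).
  rewrite -preimage_bigcup -(preimage_setT g); congr (_ @^-1` _).
  rewrite predeqE => -[x s]; split=> // _.
  have [n _ Fn] : (\bigcup_n F n) x by rewrite -FT.
  have [n' _ Gn] : (\bigcup_n G n) s by rewrite -GT.
  exists (maxn n n') => //; split => /=.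
    by move: Fn; exact/subsetPset/ndF/leq_maxl.
  by move: Gn; exact/subsetPset/ndG/leq_maxr.
move=> n; have [mF Fn] := Foo n; have [mG Gn] := Goo n.
have mFG : measurable (F n `*` G n) by exact: measurableX.
split; first by rewrite -[X in measurable X]setTI; exact: mg.
rewrite /mcons /pushforward (_ : _ @^-1` _ = F n `*` G n).
  by rewrite product_measure1E// lte_mul_pinfty// ge0_fin_numE.
apply/seteqP; split => -[x s]; rewrite /preimage/= /g theadE (_ : [tuple of _] = s)//.
  by apply/val_inj.
by apply/val_inj.
Qed.

HB.instance Definition _ := Measure_isSigmaFinite.Build _ _ _ mcons mcons_sigma_finite.

End cons_measure.

Variable mu : {sigma_finite_measure set X -> \bar R}.

Lemma mpower_measure k :
  exists M : {sigma_finite_measure set (k.-tuple X) -> \bar R}, mpower mu k = M.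
Proof.
elim: k => [|k [M IH]]; first by exists (\d_[tuple] : {sigma_finite_measure set _ -> \bar R}).
by exists (mcons mu M : {sigma_finite_measure set _ -> \bar R}); rewrite /= IH.
Qed.

Let mpower0 k : mpower mu k set0 = 0.
Proof. by have [M ->] := mpower_measure k. Qed.
Let mpower_ge0 k A : 0 <= mpower mu k A.
Proof. by have [M ->] := mpower_measure k. Qed.
Let mpower_sigma k : semi_sigma_additive (mpower mu k).
Proof. by have [M ->] := mpower_measure k; exact: measure_semi_sigma_additive. Qed.

HB.instance Definition _ k := isMeasure.Build _ _ _ (mpower mu k)
  (mpower0 k) (@mpower_ge0 k) (@mpower_sigma k).

Let mpower_sigma_finite k : sigma_finite setT (mpower mu k).
Proof. by have [M ->] := mpower_measure k; exact: sigma_finiteT. Qed.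

HB.instance Definition _ k := Measure_isSigmaFinite.Build _ _ _ (mpower mu k)
  (mpower_sigma_finite k).

Lemma integral_mpowerS k (f : k.+1.-tuple X -> \bar R) :
  measurable_fun [set: k.+1.-tuple X] f -> (forall t, 0 <= f t) ->
  \int[mpower mu k.+1]_t f t =
  \int[mu]_x \int[mpower mu k]_s f [tuple of x :: s].
Proof.
move=> mf f0; rewrite [LHS](_ : _ = \int[mu \x mpower mu k]_p f [tuple of p.1 :: p.2]).
  rewrite fubini_tonelli1//.
  by apply: measurableT_comp => //; exact: measurable_tcons.
have := @ge0_integral_pushforward _ _ _ _ R _ (@measurable_tcons k) (mu \x mpower mu k)
  setT f measurableT mf (fun t _ => f0 t).
by rewrite preimage_setT.
Qed.

Lemma integral_mpower0 (f : 0.-tuple X -> \bar R) :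
  \int[mpower mu 0]_t f t = f [tuple].
Proof.
have h t : f t = cst (f [tuple]) t by congr f; apply/val_inj; rewrite /= tuple0.
rewrite (eq_integral (cst (f [tuple]))); last by move=> t _; exact: h.
by rewrite integral_cst//= diracT mule1.
Qed.

End mpower_measure.

(** The measure of the limiting jumps is given by a formula that agrees with a measure on measurable
    sets; this carries the agreement over to its powers. *)
Lemma mpower_set_function {disp : measure_display} {X : measurableType disp} {R : realType}
    (m m' : set X -> \bar R) k :
  (forall B, measurable B -> m B = m' B) ->
  forall B, measurable B -> mpower m k B = mpower m' k B.
Proof.
move=> mm; elim: k => // k ih B mB /=; rewrite /pushforward.
set B' := _ @^-1` B; have mB' : measurable B'.
  by rewrite -[X in measurable X]setTI; apply: measurable_tcons.
rewrite /product_measure1 /=.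
transitivity (\int[m]_x (mpower m' k \o xsection B') x)%E.
  congr (integral _ _ _); apply/funext => x; apply: ih; exact: measurable_xsection.
by apply: integral_set_function => C mC _; exact: mm.
Qed.

(** * Joint law of finitely many noises *)

Section iid_tuples.
Context {disp dX : measure_display} {Omega : measurableType disp} {X : measurableType dX}
  {R : realType}.
Variables (P : probability Omega R) (Z : nat -> Omega -> X).
Hypothesis mZ : forall n, measurable_fun setT (Z n).
Variable mu : {sigma_finite_measure set X -> \bar R}.
Hypothesis Zmu : forall n B, measurable B -> P (Z n @^-1` B) = mu B.
Hypothesis Zind : forall (s : seq nat) (B : nat -> set X), uniq s ->
  (forall n, measurable (B n)) ->
  P (\bigcap_(n in [set` s]) (Z n @^-1` B n)) = (\prod_(n <- s) P (Z n @^-1` B n))%E.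
Local Open Scope ereal_scope.

Definition sample k (s : k.-tuple nat) (w : Omega) : k.-tuple X :=
  [tuple Z (tnth s i) w | i < k].

Lemma measurable_sample k (s : k.-tuple nat) : measurable_fun setT (sample s).
Proof.
apply/measurable_fun_tnthP => i; rewrite (_ : _ \o _ = Z (tnth s i)); first exact: mZ.
by apply/funext => w /=; rewrite tnth_mktuple.
Qed.

Definition rectangle k (B : 'I_k -> set X) : set (k.-tuple X) :=
  [set t | forall i, B i (tnth t i)].

Lemma measurable_rectangle k (B : 'I_k -> set X) : (forall i, measurable (B i)) ->
  measurable (rectangle B).
Proof.
move=> mB; rewrite (_ : rectangle B = \bigcap_(i in [set: 'I_k]) (@tnth k X ^~ i @^-1` B i)).
  apply: fin_bigcap_measurable => // i _; rewrite -[X in measurable X]setTI.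
  exact: measurable_tnth.
by apply/seteqP; split=> t /=; [move=> h i _; exact: h|move=> h i; exact: h].
Qed.

Lemma mpower_rectangle k (B : 'I_k -> set X) : (forall i, measurable (B i)) ->
  mpower mu k (rectangle B) = \prod_(i < k) mu (B i).
Proof.
elim: k B => [|k ih] B mB.
  rewrite big_ord0/= diracE mem_set// => -[]//.
rewrite big_ord_recl /= /pushforward.
rewrite (_ : _ @^-1` _ = B ord0 `*` rectangle (fun i => B (lift ord0 i))).
  rewrite product_measure1E//; last exact: measurable_rectangle.
  by congr (_ * _); apply: ih => i; exact: mB.
apply/seteqP; split=> -[x s]; rewrite /preimage/=.
  move=> h; split; first exact: (h ord0).
  by move=> i /=; have := h (lift ord0 i); rewrite tnthS.
move=> [h1 h2] i; have [->//|i0] := eqVneq i ord0.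
have [j -> _] := unlift_some (negbT (introF eqP (fun e => negP i0 (introT eqP (esym e))))).
by rewrite tnthS; exact: h2.
Qed.

(** Both sides agree on rectangles, by independence and [mpower_rectangle]; rectangles are stable
    under intersection and generate the product sigma-algebra. *)
Lemma sample_law k (s : k.-tuple nat) (B : set (k.-tuple X)) : uniq s -> measurable B ->
  P (sample s @^-1` B) = mpower mu k B.
Proof.
move=> us mB; pose law : {measure set (k.-tuple X) -> \bar R} :=
  measure_function_pushforward__canonical__measure_function_Measure P (measurable_sample s).
rewrite -[LHS]/(law B).
pose G := [set rectangle C | C in [set C : 'I_k -> set X | forall i, measurable (C i)]].
have rectT : rectangle (fun=> setT) = [set: k.-tuple X] by apply/seteqP; split.
have lawR C : (forall i, measurable (C i)) -> law (rectangle C) = mpower mu k (rectangle C).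
  move=> mC; rewrite mpower_rectangle//.
  rewrite /law /= /pushforward.
  (* Independence is indexed by noise numbers rather than positions: [D] looks up the position of
     [n] in [s], and is the whole space for numbers outside [s]. *)
  pose D n := if insub (index n s) is Some i then C i else setT : set X.
  have Ds i : D (tnth s i) = C i.
    by rewrite /D (tnth_nth 0%N) index_uniq ?size_tuple// insubT// => ik; congr C; apply/val_inj.
  rewrite (_ : _ @^-1` _ = \bigcap_(n in [set` tval s]) (Z n @^-1` D n)).
    rewrite Zind//; last by move=> n; rewrite /D; case: insubP.
    rewrite big_tuple; apply: eq_bigr => i _; rewrite Ds Zmu//.
  apply/seteqP; split=> w /=.
    move=> h n /= /tnthP[i ->]; rewrite Ds; have := h i.
    by rewrite tnth_mktuple.
  by move=> h i; rewrite tnth_mktuple -Ds; apply: h; exact: mem_tnth.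
apply: (@g_sigma_algebra_measure_unique _ R _ G _ (fun=> setT) _ _ law (mpower mu k)).
- by move=> _ [C mC <-]; exact: measurable_rectangle.
- by move=> _; exists (fun=> setT).
- by apply/seteqP; split=> // x _; exists 0%N.
- move=> _ _ [C mC <-] [C' mC' <-]; exists (fun i => C i `&` C' i).
    by move=> i; exact: measurableI.
  apply/seteqP; split=> t; first by move=> h; split=> i; case: (h i).
  by move=> [h1 h2] i; split.
- by move=> _ [C mC <-]; exact: lawR.
- by move=> _; rewrite /law/= /pushforward preimage_setT probability_setT ltry.
apply: (smallest_sub _ _ mB); first exact: smallest_sigma_algebra.
rewrite -bigcup_seq => A [i _ [C mC <-]]; apply: sub_sigma_algebra.
exists (fun j => if j == i then C else setT); first by move=> j; case: ifP.
apply/seteqP; split=> t /=.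
  by move=> /(_ i); rewrite eqxx; split.
by move=> [_ h] j; case: eqP => // ->.
Qed.

End iid_tuples.

(** * Borel measurability *)

Section borel_measurability.
Context {R : realType}.

Lemma borel_measurable_continuous (T : ptopologicalType) (f : T -> R) :
  continuous f -> measurable_fun [set: borel T] (f : borel T -> R).
Proof.
move=> /continuousP fc; apply: (measurability _ (RGenOpens.measurableE R)).
move=> _ [_ [x [y ->]] <-]; rewrite setTI; apply: sub_sigma_algebra.
by apply: fc; exact: interval_open.
Qed.

Lemma continuous_enorm_near n (z : 'cV[R]_n) e : 0 < e ->
  \forall y \near z, enorm (y - z) < e.
Proof. by move=> e0; have /enorm_cvgP/(_ _ e0) := @cvg_id _ (nbhs z). Qed.

Lemma continuous_coord n (i : 'I_n) : continuous (fun z : 'cV[R]_n => z i ord0).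
Proof.
move=> z; have FF := nbhs_filter z; apply/cvgrPdist_lt => e e0; near=> y.
have : enorm (y - z) < e by near: y; exact: continuous_enorm_near.
apply: le_lt_trans; rewrite distrC.
by rewrite (le_trans _ (enorm_coord _ i))// !mxE.
Unshelve. all: by end_near. Qed.

Lemma continuous_enorm n : continuous (@enorm R n).
Proof.
move=> z; have FF := nbhs_filter z; apply/cvgrPdist_lt => e e0; near=> y.
have : enorm (y - z) < e by near: y; exact: continuous_enorm_near.
apply: le_lt_trans; rewrite ler_norml.
have := enormB_ge z y; have := enormB_ge y z; rewrite (enorm_distC z y).
by move=> h1 h2; apply/andP; split; lra.
Unshelve. all: by end_near. Qed.

Lemma measurable_coord n (i : 'I_n) :
  measurable_fun [set: borel 'cV[R]_n] (fun z : borel 'cV[R]_n => (z : 'cV[R]_n) i ord0).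
Proof. exact: (borel_measurable_continuous (@continuous_coord n i)). Qed.

Lemma measurable_enorm n :
  measurable_fun [set: borel 'cV[R]_n] (fun z : borel 'cV[R]_n => enorm (z : 'cV[R]_n)).
Proof. exact: (borel_measurable_continuous (@continuous_enorm n)). Qed.

(** * Measurability of continuous functions of finitely many real variables *)

Section discretization.
Context {disp : measure_display} {Omega : measurableType disp}.
Variables (I : finType) (u : I -> Omega -> R) (M : PointedMetric.type R).
Hypothesis mu : forall i, measurable_fun setT (u i).
Variables (A : set Omega) (F : (I -> R) -> M).
Hypothesis mA : measurable A.
Hypothesis Fc : forall w, A w -> forall e, 0 < e -> exists2 g, 0 < g &
  forall y : I -> R, (forall i, `|y i - u i w| <= g) -> mdist (F y) (F (u^~ w)) <= e.

Let grid n (c : {ffun I -> int}) (i : I) : R := (c i)%:~R / 2 ^+ n.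
Let cell n w : {ffun I -> int} := [ffun i => Num.floor (u i w * 2 ^+ n)].

Let cell_measurable n c : measurable [set w | cell n w = c].
Proof.
rewrite (_ : [set w | _] = \bigcap_(i in [set: I])
   [set w | (c i)%:~R <= u i w * 2 ^+ n < (c i + 1)%:~R]).
  apply: fin_bigcap_measurable => // i _.
  have mui : measurable_fun setT (fun w => u i w * 2 ^+ n) by exact: measurable_funM.
  have := mui measurableT _ (measurable_itv `[(c i)%:~R, (c i + 1)%:~R[).
  by rewrite setTI; congr (measurable _); apply/seteqP; split=> w; rewrite /= in_itv.
apply/seteqP; split=> w /=.
  by move=> <- i _ /=; rewrite ffunE; exact: floor_itv.
by move=> h; apply/ffunP => i; rewrite ffunE; apply/floor_def/h.
Qed.

Let approx n w : M := F (grid n (cell n w)).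

Let approx_measurable n (B : set M) : measurable [set w | B (approx n w)].
Proof.
pose E k := if @unpickle {ffun I -> int} k is Some c then
  if `[< B (F (grid n c)) >] then [set w | cell n w = c] else set0 else set0.
rewrite (_ : [set w | _] = \bigcup_k E k).
  apply: bigcup_measurable => k _; rewrite /E; case: (unpickle k) => [c|] //.
  by case: asboolP => // _; exact: cell_measurable.
apply/seteqP; split=> w /=.
  move=> Bw; exists (pickle (cell n w)) => //; rewrite /E pickleK.
  by case: asboolP.
move=> [k _]; rewrite /E; case: (unpickle k) => [c|] //.
by case: asboolP => // Bc /= wc; rewrite /approx wc.
Qed.

Let approx_cvg w e : A w -> 0 < e -> exists N, forall n, (N <= n)%N ->
  mdist (approx n w) (F (u^~ w)) <= e.
Proof.
move=> Aw e0; have [g g0 hg] := Fc Aw e0.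
exists (Num.truncn g^-1).+1 => n Nn; apply: hg => i; rewrite /grid ffunE.
have p0 : 0 < (2 : R) ^+ n by rewrite exprn_gt0.
have /andP[h1 h2] := floor_itv (u i w * 2 ^+ n).
set c : R := (Num.floor _)%:~R in h1 h2 *; rewrite intrD -/c in h2.
have -> : c / 2 ^+ n - u i w = - ((u i w * 2 ^+ n - c) / 2 ^+ n).
  by field; rewrite lt0r_neq0.
have p0' := ltW p0; rewrite normrN ger0_norm; last by rewrite divr_ge0 ?subr_ge0.
rewrite ler_pdivrMr//; apply: (@le_trans _ _ 1); first by rewrite lerBlDr addrC ltW.
rewrite -ler_pdivrMl// mulr1 (le_trans (ltW (truncnS_gt _)))//.
by rewrite -natrX ler_nat (leq_trans Nn)// ltnW// ltn_expl.
Qed.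

(* Rounding u to finer and finer grids gives maps with countably many values,
   so that no separability of M is involved. *)
Lemma measurable_discretization (B : set (borel M)) : measurable B ->
  measurable (A `&` [set w | B (F (u^~ w))]).
Proof.
move: B; apply: (@measurability _ _ _ _ A (fun w => F (u^~ w) : borel M) (@open M)) => //.
(* On [A], the value lies in the open set [B] exactly when, for some [k], the ball of radius
   [1 / k.+1] about all but finitely many approximations is contained in [B]. The approximations
   take countably many values, so each of these events is measurable. *)
move=> _ [B oB <-]; rewrite (_ : _ `&` _ = A `&` \bigcup_k \bigcup_N \bigcap_(n in [set n | (N <= n)%N])
  [set w | [set y : M | ball y (k.+1%:R^-1) `<=` B] (approx n w)]).
  apply: measurableI => //; apply: bigcup_measurable => k _; apply: bigcup_measurable => N _.
  by apply: bigcap_measurable => [|n _]; [exists N => /=|exact: approx_measurable].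
rewrite predeqE => w; split=> -[Aw]; rewrite /preimage/=.
  move=> Bw; split=> //.
  have : nbhs (F (u^~ w)) B by exact: open_nbhs_nbhs.
  move=> /nbhs_ballP[e /= e0 eB]; pose k := Num.truncn (2 / e).
  have k0 : (0 : R) < k.+1%:R^-1 by rewrite invr_gt0.
  have ke : k.+1%:R^-1 + k.+1%:R^-1 <= e.
    have h := truncnS_gt (2 / e); rewrite -/k ltr_pdivrMr// in h.
    have : (k.+1%:R^-1 : R) * 2 <= k.+1%:R^-1 * (k.+1%:R * e) by rewrite ler_pM2l// ltW.
    by rewrite mulKf// mulrDr mulr1.
  have [N hN] := approx_cvg Aw k0.
  exists k => //; exists N => // n /= Nn y; rewrite ballEmdist /= => hy.
  apply: eB; rewrite ballEmdist /=; apply: lt_le_trans ke.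
  rewrite (le_lt_trans (metric_triangle _ (approx n w) _))// metric_sym.
  by rewrite ler_ltD// hN.
move=> [k _ [N _ hN]]; split=> //.
have k0 : (0 : R) < k.+1%:R^-1 / 2 by rewrite divr_gt0// invr_gt0.
have [N' hN'] := approx_cvg Aw k0.
apply: (hN (maxn N N')); first by rewrite /= leq_maxl.
rewrite ballEmdist /=; rewrite (le_lt_trans (hN' _ _)) ?leq_maxr//.
by rewrite ltr_pdivrMr// ltr_pMr ?invr_gt0// ltr1n.
Qed.

End discretization.

End borel_measurability.

(** * Regularly varying tails *)

Section regular_tail.
Context {R : realType} {d : nat} {disp : measure_display} {Omega : measurableType disp}.
Variables (P : probability Omega R) (Z : Omega -> 'cV[R]_d.+1) (alpha : R).
Hypothesis mZ : measurable_fun setT (fun w => enorm (Z w)).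
Hypothesis alpha_gt1 : 1 < alpha.
Local Notation H := (tail_prob P Z).
Hypothesis Hreg : forall t : R, 0 < t -> H (t * x) / H x @[x --> +oo] --> t `^ (- alpha).

Lemma measurable_tail x : measurable [set w | enorm (Z w) > x].
Proof.
have := mZ measurableT (measurable_itv `]x, +oo[); rewrite setTI.
by congr (measurable _); apply/seteqP; split=> w; rewrite /= in_itv/= andbT.
Qed.

Lemma tail_probE x : P [set w | enorm (Z w) > x] = (H x)%:E.
Proof. by rewrite /tail_prob fineK// fin_num_measure//; exact: measurable_tail. Qed.

Lemma tail_prob_ge0 x : 0 <= H x.
Proof. by rewrite /tail_prob fine_ge0. Qed.

Lemma tail_prob_le1 x : H x <= 1.
Proof. by rewrite -lee_fin -tail_probE probability_le1//; exact: measurable_tail. Qed.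

Lemma tail_prob_mono x y : x <= y -> H y <= H x.
Proof.
move=> xy; rewrite -lee_fin -!tail_probE le_measure ?inE//; try exact: measurable_tail.
by move=> w /=; exact: le_lt_trans.
Qed.

Lemma tail_prob_gt0 x : 0 < H x.
Proof.
have a0 : (0 : R) < 2 `^ (- alpha) by rewrite powR_gt0.
have : \forall y \near +oo, 0 < H (2 * y) / H y.
  exact: (cvgr_gt _ (Hreg (ltr0n _ 2))).
move=> near0; near (+oo : set_system R) => y.
have xy : x <= y by near: y; apply: nbhs_pinfty_ge; exact: num_real.
have hy : 0 < H (2 * y) / H y by near: y.
apply: lt_le_trans (tail_prob_mono xy); rewrite lt0r tail_prob_ge0 andbT.
by apply/eqP => Hy0; move: hy; rewrite Hy0 invr0 mulr0 ltxx.
Unshelve. all: by end_near. Qed.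

Lemma powR2X (p : R) n : (2 ^+ n : R) `^ p = (2 `^ p) ^+ n.
Proof. by rewrite -powR_mulrn// -powRrM mulrC powRrM powR_mulrn// powR_ge0. Qed.

(** [H (2 * x) / H x] tends to 2 to the power [- alpha], hence is eventually below 2 to the power
    [- q]; this is iterated along doublings. *)
Lemma tail_prob_doubling_le q : q < alpha ->
  exists2 x0, 1 <= x0 & forall n, H (2 ^+ n * x0) <= (2 `^ (- q)) ^+ n.
Proof.
move=> qa; have lt2 : (2 : R) `^ (- alpha) < 2 `^ (- q).
  by rewrite /powR ifF ?pnatr_eq0// ltr_expR ltr_pM2r ?ltrN2// ln_gt0// ltr1n.
have near1 : \forall x \near +oo, H (2 * x) / H x < 2 `^ (- q).
  exact: (cvgr_lt _ (Hreg (ltr0n _ 2))).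
have [x1 [_ hx1]] := near1.
exists (Num.max 1 (x1 + 1)); first by rewrite le_max lexx.
set x0 := Num.max _ _; have x01 : 1 <= x0 by rewrite le_max lexx.
elim=> [|n ih]; first by rewrite expr0 tail_prob_le1.
have h : x1 < 2 ^+ n * x0.
  have : x1 + 1 <= x0 by rewrite le_max lexx orbT.
  have : x0 <= 2 ^+ n * x0.
    by rewrite ler_peMl ?(le_trans ler01)// exprn_ege1// ler1n.
  lra.
have /ltW := hx1 _ h; rewrite ler_pdivrMr ?tail_prob_gt0// mulrA -exprS.
by move=> /le_trans; apply; rewrite exprS ler_wpM2l ?powR_ge0.
Qed.

(** The same iteration with a lower bound and [N > alpha]. It bounds [lambda] below by a power of
    [eta], against which a bad clipped noise is negligible. *)
Lemma tail_prob_ge_poly : exists N : nat, exists2 c, 0 < c &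
  forall x, 1 <= x -> c * x ^- N <= H x.
Proof.
pose N := (Num.truncn alpha).+1; exists N.
have Na : alpha < N%:R by exact: truncnS_gt.
have lt2 : (2 : R) ^- N < 2 `^ (- alpha).
  rewrite -powR_mulrn// -powRN /powR ifF ?pnatr_eq0// ltr_expR.
  by rewrite ltr_pM2r ?ltrN2// ln_gt0// ltr1n.
have near1 : \forall x \near +oo, 2 ^- N < H (2 * x) / H x.
  exact: (cvgr_gt _ (Hreg (ltr0n _ 2))).
have [x1 [_ hx1]] := near1.
pose x0 := Num.max 1 (x1 + 1).
have x01 : 1 <= x0 by rewrite le_max lexx.
have x00 : 0 < x0 by exact: lt_le_trans x01.
have iter n : (2 ^- N) ^+ n * H x0 <= H (2 ^+ n * x0).
  elim: n => [|n ih]; first by rewrite !expr0 !mul1r.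
  have h : x1 < 2 ^+ n * x0.
    have : x1 + 1 <= x0 by rewrite le_max lexx orbT.
    have : x0 <= 2 ^+ n * x0.
      by rewrite ler_peMl ?(le_trans ler01)// exprn_ege1// ler1n.
    lra.
  have /ltW := hx1 _ h; rewrite ler_pdivlMr ?tail_prob_gt0// mulrA -exprS.
  apply: le_trans; rewrite exprS -mulrA ler_wpM2l// invr_ge0 exprn_ge0//.
exists (H x0 * 2 ^- N); first by rewrite mulr_gt0 ?tail_prob_gt0// invr_gt0 exprn_gt0.
move=> x x1'; have x00' : 0 < x by exact: lt_le_trans x1'.
pose n := ex_minn (_ : exists n, x <= 2 ^+ n).
have ex : exists n, x <= 2 ^+ n.
  exists (Num.truncn x).+1; rewrite (le_trans (ltW (truncnS_gt _)))//.
  by rewrite -natrX ler_nat ltnW// ltn_expl.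
(* The least such [n] satisfies [2 ^+ n <= 2 * x], which turns decay in [n] into decay in [x]. *)
have [{}n xn nmin] := ex_minnP ex.
have nx : 2 ^+ n <= 2 * x.
  case: n xn nmin => [|n] xn nmin; first by rewrite expr0; lra.
  rewrite exprS ler_pM2l// leNgt; apply/negP => /ltW xn'.
  by have := nmin _ xn'; rewrite ltnn.
have xx : x <= 2 ^+ n * x0.
  by rewrite (le_trans xn)// ler_peMr// exprn_ge0.
apply: le_trans (tail_prob_mono xx); apply: le_trans (iter n).
have -> : (2 ^- N : R) ^+ n = ((2 ^+ n) ^+ N)^-1 by rewrite exprVn -!exprM mulnC.
have -> : H x0 * 2 ^- N * x ^- N = ((2 * x) ^+ N)^-1 * H x0.
  by rewrite exprMn invfM -mulrA mulrC.
rewrite ler_wpM2r ?tail_prob_ge0// lef_pV2 ?posrE ?exprn_gt0 ?mulr_gt0//.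
by have x0w := ltW x00'; rewrite lerXn2r ?nnegrE ?mulr_ge0 ?exprn_ge0.
Qed.

(** Dyadic layers: beyond [x0], layer [n] has weight of order [b ^+ n] and probability at most
    [r ^+ n]. Taking [q] between [p] and [alpha] gives [b * r < 1], so the series is geometric. *)
Lemma enorm_moment p : 0 < p -> p < alpha ->
  (\int[P]_w (enorm (Z w) `^ p)%:E < +oo)%E.
Proof.
move=> p0 pa; pose q := (p + alpha) / 2.
have [pq qa] : p < q /\ q < alpha by rewrite /q; split; lra.
have [x0 x01 hx0] := tail_prob_doubling_le qa.
have x00 : 0 < x0 by exact: lt_le_trans x01.
have x0w := ltW x00; have p0w := ltW p0.
pose b := (2 : R) `^ p; pose r := (2 : R) `^ (- q).
have b0 : 0 <= b by exact: powR_ge0.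
have br : b * r < 1.
  rewrite /b /r -powRD ?pnatr_eq0 ?implybT// -[ltRHS](powRr0 2).
  by rewrite /powR ifF ?pnatr_eq0// ltr_expR ltr_pM2r ?ln_gt0 ?ltr1n//; lra.
have br0 : 0 <= b * r by rewrite mulr_ge0 ?powR_ge0.
pose c n := x0 `^ p * b ^+ n.+1.
have c0 n : 0 <= c n by rewrite mulr_ge0 ?powR_ge0 ?exprn_ge0.
pose A n := [set w | enorm (Z w) > 2 ^+ n * x0].
have mA n : measurable (A n) by exact: measurable_tail.
pose f n w : \bar R := (c n * \1_(A n) w)%:E.
have f0 n w : (0 <= f n w)%E by rewrite lee_fin mulr_ge0.
have mf n : measurable_fun setT (f n).
  apply/measurable_EFinP; apply: measurable_funM => //.
have le w : ((enorm (Z w) `^ p)%:E <= (x0 `^ p)%:E + \sum_(0 <= n <oo) f n w)%E.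
  have S0 : (0 <= \sum_(0 <= n <oo) f n w)%E by exact: nneseries_ge0.
  have [zx|xz] := leP (enorm (Z w)) x0.
    apply: (@le_trans _ _ (x0 `^ p)%:E); last by rewrite leeDl.
    by rewrite lee_fin ge0_ler_powR ?nnegrE ?enorm_ge0.
  have ex : exists n, enorm (Z w) <= 2 ^+ n * x0.
    exists (Num.truncn (enorm (Z w))).+1; rewrite (le_trans (ltW (truncnS_gt _)))//.
    rewrite (@le_trans _ _ (2 ^+ (Num.truncn (enorm (Z w))).+1))//.
      by rewrite -natrX ler_nat ltnW// ltn_expl.
    by rewrite ler_peMr// exprn_ge0.
  have [[|n] hn nmin] := ex_minnP ex; first by move: hn; rewrite expr0 mul1r leNgt xz.
  have Anw : A n w.
    rewrite /A/= ltNge; apply/negP => h.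
    by have := nmin _ h; rewrite ltnn.
  apply: (@le_trans _ _ (f n w)).
    rewrite /f indicE mem_set// mulr1 lee_fin /c.
    rewrite (_ : b ^+ n.+1 = (2 ^+ n.+1) `^ p); last by rewrite powR2X.
    rewrite mulrC -powRM ?exprn_ge0//.
    by rewrite ge0_ler_powR ?nnegrE ?enorm_ge0 ?mulr_ge0 ?exprn_ge0.
  apply: (@le_trans _ _ (\sum_(0 <= n <oo) f n w)%E); last by rewrite leeDr ?lee_fin ?powR_ge0.
  apply: (@le_trans _ _ (\sum_(0 <= i < n.+1) f i w)%E); last exact: nneseries_lim_ge.
  by rewrite big_nat_recr//= leeDr// sume_ge0.
have mZp : measurable_fun setT (fun w => (enorm (Z w) `^ p)%:E).
  apply/measurable_EFinP; exact: measurableT_comp (measurable_powR _) mZ.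
have mS : measurable_fun setT (fun w => \sum_(0 <= n <oo) f n w)%E.
  by apply: ge0_emeasurable_sum => // n w _ _; exact: f0.
apply: (@le_lt_trans _ _ (\int[P]_w ((x0 `^ p)%:E + \sum_(0 <= n <oo) f n w))%E).
  apply: ge0_le_integral => //.
  - by move=> w _; rewrite lee_fin powR_ge0.
  - by apply: emeasurable_funD.
rewrite ge0_integralD//; first last.
- by move=> w _; exact: nneseries_ge0.
- by move=> w _; rewrite lee_fin powR_ge0.
rewrite integral_cst//= probability_setT mule1 integral_nneseries//.
rewrite lte_add_pinfty ?ltry//.
have fE n : (\int[P]_w f n w = (c n * H (2 ^+ n * x0))%:E)%E.
  rewrite /f; under eq_integral do rewrite EFinM.
  rewrite ge0_integralZl ?lee_fin//; first last.
  - by apply/measurable_EFinP.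
  by rewrite integral_indic// setIT -[X in (_ * P X)%E]/(A n) /A tail_probE.
apply: (@le_lt_trans _ _ (x0 `^ p * b / (1 - b * r))%:E); last by rewrite ltry.
apply: lime_le; first by apply: is_cvg_nneseries => n _ _; rewrite fE lee_fin mulr_ge0 ?tail_prob_ge0.
apply: nearW => N; rewrite (eq_bigr (fun n => (c n * H (2 ^+ n * x0))%:E)); last by move=> n _.
rewrite sumEFin lee_fin.
apply: (@le_trans _ _ (\sum_(0 <= n < N) (x0 `^ p * b) * (b * r) ^+ n)).
  apply: ler_sum => n _; rewrite /c exprS exprMn.
  have := ler_wpM2l (c0 n) (hx0 n); rewrite /c exprS -/r => /le_trans; apply.
  by rewrite le_eqVlt; apply/orP; left; apply/eqP; ring.
have br1 : 0 < 1 - b * r by rewrite subr_gt0.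
rewrite -[leLHS]/(series (geometric (x0 `^ p * b) (b * r)) N) geometric_seriesE ?lt_eqF//=.
rewrite ler_pM2r ?invr_gt0// ler_piMr ?mulr_ge0 ?powR_ge0//.
by rewrite gerBl exprn_ge0.
Qed.

End regular_tail.

(** * The limit measure of the noise *)

Section polar_coordinates.
Context {R : realType} {d : nat}.
Local Notation Rd := 'cV[R]_d.+1.
Local Notation HS := (halfline R * sphere R d)%type.

Definition origin : set HS := [set p | hval p.1 = 0].

(** An inverse of [polar] off the origin that is continuous everywhere, while [polar] is
    discontinuous at 0; measures and test functions are moved through it. *)
Definition unpolar (p : HS) : Rd := hval p.1 *: sphere_val p.2.

Lemma enorm_sphere (s : sphere R d) : enorm (sphere_val s) = 1.
Proof. by apply/eqP; case: s. Qed.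

Lemma enorm_unpolar p : enorm (unpolar p) = hval p.1.
Proof. by rewrite /unpolar enormZ enorm_sphere mulr1 ger0_norm// hval_ge0. Qed.

Lemma unpolarK z : z != 0 -> unpolar (polar z) = z.
Proof.
move=> z0; rewrite /unpolar/= directionE// scalerA divff ?scale1r//.
by apply: contra_neq z0; exact: enorm_eq0.
Qed.

Lemma polarK p : hval p.1 != 0 -> polar (unpolar p) = p.
Proof.
move=> p0; case: p p0 => r s /= r0.
have u0 : unpolar (r, s) != 0.
  by apply: contra_neq r0 => u0; rewrite -(enorm_unpolar (r, s)) u0 enorm0.
congr pair; first by apply/val_inj; rewrite /= enorm_unpolar.
apply/val_inj; change (sphere_val (direction (unpolar (r, s))) = sphere_val s).
rewrite directionE// enorm_unpolar /unpolar/= scalerA mulVf// scale1r//.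
Qed.

Lemma unpolar_eq0 p : unpolar p = 0 <-> hval p.1 = 0.
Proof.
split=> [u0|p0]; first by rewrite -enorm_unpolar u0 enorm0.
by rewrite /unpolar p0 scale0r.
Qed.

(** The image in the definition of [polar_measure] becomes a preimage under a continuous map, hence
    a measurable set. *)
Lemma polar_image (E : set Rd) : polar @` (E `\ 0) = unpolar @^-1` (E `\ 0).
Proof.
apply/seteqP; split=> [_ [z [Ez z0] <-]|p [Ep p0]].
  by rewrite /preimage/= unpolarK//; apply/eqP.
exists (unpolar p) => //; rewrite polarK//.
by apply/eqP => /unpolar_eq0.
Qed.

Lemma mdistHS (p q : HS) :
  mdist p q = Num.max `|hval p.1 - hval q.1| (enorm (sphere_val p.2 - sphere_val q.2)).
Proof. by []. Qed.

Lemma nbhs_mdist (M : metricType R) (x : M) e : 0 < e -> \forall y \near x, mdist x y < e.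
Proof.
move=> e0; apply/nbhs_ballP; exists e => //= y; rewrite ballEmdist.
exact.
Qed.

Lemma unpolar_dist p q : enorm (unpolar p - unpolar q) <= (hval p.1 + 1) * mdist p q.
Proof.
rewrite mdistHS; set e := Num.max _ _.
have e1 : `|hval p.1 - hval q.1| <= e by rewrite le_max lexx.
have e2 : enorm (sphere_val p.2 - sphere_val q.2) <= e by rewrite le_max lexx orbT.
have -> : unpolar p - unpolar q = hval p.1 *: (sphere_val p.2 - sphere_val q.2)
   + (hval p.1 - hval q.1) *: sphere_val q.2.
  by rewrite /unpolar scalerBr scalerBl addrA subrK.
rewrite (le_trans (enorm_triangle _ _))// !enormZ enorm_sphere mulr1 mulrDl mul1r.
by rewrite lerD// ger0_norm ?hval_ge0// ler_wpM2l ?hval_ge0.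
Qed.

Lemma continuous_unpolar : continuous unpolar.
Proof.
move=> p; apply/enorm_cvgP => e e0.
have c0 : 0 < hval p.1 + 1 by rewrite ltr_wpDl ?hval_ge0.
have h : \forall q \near p, mdist p q < e / (hval p.1 + 1).
  by apply: nbhs_mdist; rewrite divr_gt0.
apply: filterS h => q h; rewrite enorm_distC (le_lt_trans (unpolar_dist _ _))//.
by rewrite mulrC -ltr_pdivlMr.
Qed.

Lemma fattening_origin r : fattening origin r = [set p | hval p.1 <= r].
Proof.
apply/seteqP; split=> p; rewrite /fattening /=.
  move=> h; rewrite -lee_fin (le_trans _ h)//; apply: le_ereal_inf_tmp => _ [q q0 <-].
  rewrite lee_fin mdistHS le_max; apply/orP; left.
  by rewrite q0 sub0r normrN ger0_norm ?hval_ge0.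
move=> pr; apply: (@le_trans _ _ (hval p.1)%:E); last by rewrite lee_fin.
apply: ereal_inf_lbound; exists (Halfline (lexx 0), p.2) => //.
rewrite mdistHS /= subrr enorm0 sub0r normrN ger0_norm ?hval_ge0//.
by rewrite max_l ?hval_ge0.
Qed.

End polar_coordinates.

Lemma continuous_borel_measurable (T U : ptopologicalType) (f : T -> U) :
  continuous f -> measurable_fun setT (f : borel T -> borel U).
Proof.
move=> /continuousP fc; apply: (@measurability _ _ (borel T) (borel U) setT f (@open U)) => // _ [B oB <-].
by rewrite setTI; apply: sub_sigma_algebra; exact: fc.
Qed.

Lemma measurable_enorm_itv {R : realType} n (i : interval R) :
  measurable ([set z : 'cV[R]_n | enorm z \in i] : set (borel 'cV[R]_n)).
Proof. by have := @measurable_enorm R n measurableT _ (measurable_itv i); rewrite setTI. Qed.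

Lemma measurable_enorm_gt {R : realType} n (r : R) :
  measurable ([set z : 'cV[R]_n | r < enorm z] : set (borel 'cV[R]_n)).
Proof.
have := @measurable_enorm_itv R n `]r, +oo[.
by congr (measurable _); apply/seteqP; split=> w; rewrite /= in_itv/= andbT.
Qed.

Lemma measurable_enorm_ge {R : realType} n (r : R) :
  measurable ([set z : 'cV[R]_n | r <= enorm z] : set (borel 'cV[R]_n)).
Proof.
have := @measurable_enorm_itv R n `[r, +oo[.
by congr (measurable _); apply/seteqP; split=> w; rewrite /= in_itv/= andbT.
Qed.

(** * Transport of a measure from polar coordinates to vectors *)

Section radial_measure.
Context {R : realType} {d : nat}.
Local Notation Rd := 'cV[R]_d.+1.
Local Notation HS := (halfline R * sphere R d)%type.
Variable mu : {measure set (borel HS) -> \bar R}.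
Hypothesis mu_fin : forall r, 0 < r -> (mu (~` fattening origin r) < +oo)%E.

Let mq : measurable_fun setT (unpolar : borel HS -> borel Rd).
Proof.
by apply: continuous_borel_measurable; exact: continuous_unpolar.
Qed.

Lemma measurable_borel_open (T : ptopologicalType) (U : set T) : open U ->
  measurable (U : set (borel T)).
Proof. exact: sub_sigma_algebra. Qed.

Lemma measurable_borel_closed (T : ptopologicalType) (U : set T) : closed U ->
  measurable (U : set (borel T)).
Proof.
move=> cU; rewrite -[U]setCK; apply: measurableC; apply: measurable_borel_open.
exact: closed_openC.
Qed.

Let m0 : measurable ([set 0] : set (borel Rd)).
Proof.
apply: measurable_borel_closed; apply: accessible_closed_set1.
exact: hausdorff_accessible.
Qed.

Definition radial (E : set (borel Rd)) : \bar R := mu (unpolar @^-1` (E `\ (0 : Rd))).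

Let mE E : measurable (E : set (borel Rd)) ->
  measurable (unpolar @^-1` (E `\ (0 : Rd)) : set (borel HS)).
Proof.
by move=> mE; rewrite -[X in measurable X]setTI; apply: mq => //; exact: measurableD.
Qed.

Let radial0 : radial set0 = 0%E.
Proof. by rewrite /radial set0D preimage_set0 measure0. Qed.

Let radial_ge0 E : (0 <= radial E)%E. Proof. exact: measure_ge0. Qed.

Let radial_sigma : semi_sigma_additive radial.
Proof.
move=> F mF tF mUF; rewrite /radial setD_bigcupl preimage_bigcup.
apply: measure_semi_sigma_additive.
- by move=> n; exact: mE.
- apply/trivIsetP => i j _ _ ij; rewrite -preimage_setI.
  rewrite (_ : _ `&` _ = set0) ?preimage_set0//.
  move/trivIsetP : tF => /(_ i j I I ij) h; rewrite predeqE => z; split => // -[[Fi _] [Fj _]].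
  by rewrite -h.
- by rewrite -preimage_bigcup -setD_bigcupl; exact: mE.
Qed.

HB.instance Definition _ := isMeasure.Build _ _ _ radial radial0 radial_ge0 radial_sigma.

Lemma radial_fin (r : R) : 0 < r -> (radial [set z : Rd | (r <= enorm z)%R] < +oo)%E.
Proof.
move=> r0; have r20 : 0 < r / 2 by rewrite divr_gt0.
have fr : measurable (~` fattening origin (r / 2) : set (borel HS)).
  rewrite fattening_origin (_ : ~` _ = unpolar @^-1` [set z | r / 2 < enorm z]).
    rewrite -[X in measurable X]setTI; apply: mq => //.
    exact: measurable_enorm_gt.
  by apply/seteqP; split=> p; rewrite /preimage/= enorm_unpolar ltNge => /negP.
apply: le_lt_trans (mu_fin r20); apply: le_measure; rewrite ?inE//.
  by apply: mE; exact: measurable_enorm_ge.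
move=> p [/=]; rewrite enorm_unpolar fattening_origin /= => rp _ pr.
by have := le_trans rp pr; lra.
Qed.

Let radial_sigma_finite : sigma_finite setT radial.
Proof.
(* The origin carries no mass, and the complement of a ball about it has finite mass. *)
exists (fun n => [set 0] `|` [set z : Rd | n.+1%:R^-1 <= enorm z]).
  rewrite predeqE => z; split => // _; have [->|z0] := eqVneq z 0; first by exists 0%N => //; left.
  have zp : 0 < enorm z.
    by rewrite lt0r enorm_ge0 andbT; apply: contra_neq z0; exact: enorm_eq0.
  exists (Num.truncn (enorm z)^-1) => //; right => /=.
  by rewrite -[leRHS]invrK lef_pV2 ?posrE ?invr_gt0// ltW// truncnS_gt.
move=> n; have mn : measurable ([set z : Rd | n.+1%:R^-1 <= enorm z] : set (borel Rd)).
  exact: measurable_enorm_ge.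
split; first exact: measurableU.
have n0 : (0 : R) < n.+1%:R^-1 by rewrite invr_gt0.
rewrite (le_lt_trans _ (radial_fin n0))//.
rewrite /radial; apply: le_measure; rewrite ?inE; [by apply: mE; apply: measurableU|exact: mE|].
by move=> p [[p0|Bp] pn]; [case: (pn p0)|split].
Qed.

HB.instance Definition _ := Measure_isSigmaFinite.Build _ _ _ radial radial_sigma_finite.

Lemma ex_radial_measure : exists rho : {sigma_finite_measure set (borel Rd) -> \bar R},
  [/\ forall E, rho E = mu (unpolar @^-1` (E `\ (0 : Rd))),
   forall r : R, 0 < r -> (rho [set z : Rd | (r <= enorm z)%R] < +oo)%E &
   forall g : borel Rd -> \bar R, measurable_fun setT g -> (forall z, 0 <= g z)%E -> g 0 = 0%E ->
     (\int[rho]_z g z = \int[mu]_(p in ~` origin) g (unpolar p))%E].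
Proof.
exists radial; split => //; first exact: radial_fin.
move=> g mg g_ge0 g0.
have mD : measurable (~` [set 0] : set (borel Rd)) by exact: measurableC.
have -> : (\int[radial]_z g z = \int[radial]_(z in ~` [set (0%R : Rd)]) g z)%E.
  rewrite [RHS]integral_mkcond; congr (integral _ _ _); apply/funext => z.
  by rewrite patchE; case: ifPn => //; rewrite notin_setE => /contrapT ->.
transitivity (\int[pushforward mu (unpolar : borel HS -> borel Rd)]_(z in ~` [set (0%R : Rd)]) g z)%E.
  apply: integral_set_function => B mB B0; rewrite /pushforward /= /radial.
  congr (mu _); rewrite predeqE => p; split => [[]//|Bp]; split => //; exact: B0.
rewrite (ge0_integral_pushforward mq)//; last exact: measurable_funTS.
congr (integral _ _ _); rewrite predeqE => p; split => p0; apply: contra_not p0.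
  by move=> /unpolar_eq0.
by move=> /unpolar_eq0.
Qed.

End radial_measure.

(** * Regular variation in terms of vectors *)

Section vague_convergence.
Context {R : realType} {d : nat} {disp : measure_display} {Omega : measurableType disp}.
Variable P : probability Omega R.
Local Notation Rd := 'cV[R]_d.+1.
Local Notation HS := (halfline R * sphere R d)%type.

Lemma unpolar_rescale x (z : Rd) : 0 < x -> unpolar (rescale x (polar z)) = x^-1 *: z.
Proof.
move=> x0; rewrite /unpolar/= ger0_norm ?invr_ge0 ?ltW// -scalerA.
have [->|z0] := eqVneq z 0; first by rewrite enorm0 scale0r scaler0.
by rewrite -/(unpolar (polar z)) unpolarK.
Qed.

Let rescale_continuous x (z : Rd) : z != 0 ->
  forall e, 0 < e -> exists2 g, 0 < g & forall y, enorm (y - z) < g ->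
    mdist (rescale x (polar z)) (rescale x (polar y)) < e.
Proof.
move=> z0 e e0; have zp : 0 < enorm z.
  by rewrite lt0r enorm_ge0 andbT; apply: contra_neq z0; exact: enorm_eq0.
pose K := `|x^-1| + 2 / enorm z + 1.
have K0 : 0 < K by rewrite ltr_wpDl// addr_ge0// divr_ge0// ltW.
exists (Num.min (enorm z) (e / K)); first by rewrite lt_min zp divr_gt0.
move=> y; rewrite lt_min => /andP[yz1 yz2].
have y0 : y != 0 by apply: contraTneq yz1 => ->; rewrite sub0r enormN ltxx.
have yp : 0 < enorm y.
  by rewrite lt0r enorm_ge0 andbT; apply: contra_neq y0; exact: enorm_eq0.
have dn : `|enorm z - enorm y| <= enorm (y - z).
  rewrite ler_norml; have := enormB_ge z y; have := enormB_ge y z.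
  by rewrite (enorm_distC z y) => h1 h2; apply/andP; split; lra.
apply: (@le_lt_trans _ _ (K * enorm (y - z))); last by rewrite mulrC -ltr_pdivlMr.
rewrite mdistHS ge_max /=; apply/andP; split.
  rewrite -mulrBr normrM normr_id.
  apply: (le_trans (ler_wpM2l (normr_ge0 _) dn)).
  rewrite ler_wpM2r ?enorm_ge0// /K.
  have : 0 <= 2 / enorm z by rewrite divr_ge0// ltW.
  lra.
rewrite !directionE//.
have -> : (enorm z)^-1 *: z - (enorm y)^-1 *: y =
   (enorm z)^-1 *: (z - y) + ((enorm z)^-1 - (enorm y)^-1) *: y.
  by rewrite scalerBr scalerBl addrA subrK.
rewrite (le_trans (enorm_triangle _ _))// !enormZ.
have -> : `|(enorm z)^-1 - (enorm y)^-1| * enorm y = `|enorm z - enorm y| / enorm z.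
  have -> : (enorm z)^-1 - (enorm y)^-1 = (enorm y - enorm z) / (enorm z * enorm y).
    by field; rewrite !lt0r_neq0.
  rewrite normrM distrC normfV (ger0_norm (_ : 0 <= enorm z * enorm y)).
    by field; rewrite !lt0r_neq0.
  by rewrite mulr_ge0 ?enorm_ge0.
rewrite ger0_norm ?invr_ge0 ?enorm_ge0// enorm_distC.
have h1 : `|enorm z - enorm y| / enorm z <= enorm (y - z) / enorm z.
  by rewrite ler_wpM2r// invr_ge0 ltW.
have h2 : 0 <= (`|x^-1| + 1) * enorm (y - z) by rewrite mulr_ge0 ?enorm_ge0// addr_ge0.
apply: (le_trans (lerD (lexx _) h1)); rewrite /K.
set E := enorm (y - z) in h2 *; set N := enorm z.
have -> : (`|x^-1| + 2 / N + 1) * E = (`|x^-1| + 1) * E + (N^-1 * E + E / N) by ring.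
by rewrite lerDr.
Qed.

(** The map is continuous off the origin, so the preimage of an open set is an open set together
    with, possibly, the point 0. *)
Lemma measurable_rescale_polar x :
  measurable_fun setT (fun z : borel Rd => rescale x (polar z) : borel HS).
Proof.
apply: (@measurability _ _ (borel Rd) (borel HS) setT _ (@open HS)) => // _ [B oB <-].
have m0 : measurable ([set 0] : set (borel Rd)).
  apply: measurable_borel_closed; apply: accessible_closed_set1.
  exact: hausdorff_accessible.
pose f (z : Rd) := rescale x (polar z).
rewrite (_ : _ `&` _ = (if `[< B (f 0) >] then [set 0] else set0) `|`
    [set z : Rd | z != 0 /\ B (f z)]).
  apply: measurableU; first by case: ifP.
  apply: measurable_borel_open; rewrite openE => z [z0 Bz] /=.
  have : nbhs (f z) B by exact: open_nbhs_nbhs.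
  move=> /nbhs_ballP[e /= e0 eB].
  have [g g0 hg] := rescale_continuous x z0 e0.
  have FF := nbhs_filter z.
  have h1 : \forall y \near z, enorm (y - z) < g by exact: continuous_enorm_near.
  have zp : 0 < enorm z.
    by rewrite lt0r enorm_ge0 andbT; apply: contra_neq z0; exact: enorm_eq0.
  have h2 : \forall y \near z, enorm (y - z) < enorm z by exact: continuous_enorm_near.
  apply: filterS2 h1 h2 => y h1 h2; split.
    by apply: contraTneq h2 => ->; rewrite sub0r enormN ltxx.
  by apply: eB; rewrite ballEmdist; exact: hg.
rewrite predeqE => z; rewrite setTI; split.
  move=> Bz; have [z0|z0] := eqVneq z (0 : Rd); last by right.
  by left; rewrite z0 in Bz *; case: asboolP.
by move=> [|[_ Bz//]]; case: asboolP => // Bf ->.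
Qed.

Variables (Z : {RV P >-> borel Rd}) (alpha : R).
Variables (nu : set (borel (halfline R)) -> \bar R) (S : set (borel (sphere R d)) -> \bar R).
Hypothesis ZMRV : MRV P Z alpha nu S.

(** A function on vectors that vanishes near 0 becomes, by composition with [unpolar], a test
    function in polar coordinates. From here on, regular variation is used only through [rho] and
    the tail ratios. *)
Lemma MRV_radial : exists rho : {sigma_finite_measure set (borel Rd) -> \bar R},
  [/\ forall E, measurable E -> polar_measure nu S E = rho E,
   forall r : R, 0 < r -> (rho [set z : Rd | (r <= enorm z)%R] < +oo)%E &
   forall (g : Rd -> R) (r M : R), 0 < r -> continuous g -> (forall z, 0 <= g z <= M) ->
     (forall z, enorm z <= r -> g z = 0) ->
     (\int[P]_w (g (x^-1 *: (Z w : Rd)))%:E * ((tail_prob P Z x)^-1)%:E @[x --> +oo%R]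
       --> \int[rho]_z (g z)%:E)%E].
Proof.
have [_ [_ [[mu muE] mufin] cvgZ]] := ZMRV.
have mufin' r : 0 < r -> (mu (~` fattening origin r) < +oo)%E.
  move=> r0; rewrite -muE; first exact: mufin.
    apply: measurableC; rewrite fattening_origin.
    rewrite (_ : [set p | _] = unpolar @^-1` (~` [set z | r < enorm z])); last first.
      by apply/seteqP; split=> p; rewrite /preimage/= enorm_unpolar leNgt => /negP.
    have := continuous_borel_measurable (@continuous_unpolar R d) measurableT
      (measurableC (@measurable_enorm_gt R d.+1 r)).
    by rewrite setTI.
  move=> p; rewrite fattening_origin /= => pr p0; apply: pr.
  by rewrite p0 ltW.
have [rho [rhoE rhofin rhoint]] := ex_radial_measure mufin'.
have mD : measurable (~` origin : set (borel HS)).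
  rewrite (_ : ~` _ = unpolar @^-1` [set z | 0 < enorm z]).
    have := continuous_borel_measurable (@continuous_unpolar R d) measurableT
      (@measurable_enorm_gt R d.+1 0).
    by rewrite setTI.
  apply/seteqP; split=> p; rewrite /preimage/= enorm_unpolar lt0r hval_ge0 andbT.
    by move=> /eqP.
  by move=> /eqP.
exists rho; split => //.
  move=> E mE; rewrite rhoE /polar_measure polar_image muE//.
    have mE0 : measurable (E `\ (0 : Rd)).
      apply: measurableD => //; apply: measurable_borel_closed; apply: accessible_closed_set1.
      exact: hausdorff_accessible.
    have := continuous_borel_measurable (@continuous_unpolar R d) measurableT mE0.
    by rewrite setTI.
  by move=> p [_ p0] /unpolar_eq0.
move=> g r M r0 gc gM gr.
have g0 : g 0 = 0 by rewrite gr// enorm0 ltW.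
have mg : measurable_fun setT (g : borel Rd -> R) by exact: borel_measurable_continuous.
have mgE : measurable_fun setT (EFin \o g : borel Rd -> \bar R) by exact/measurable_EFinP.
have gge0 z : (0 <= (g z)%:E)%E by rewrite lee_fin; case/andP: (gM z).
have tf : test_function origin (g \o unpolar).
  split.
  - by move=> p _ /=; case/andP: (gM (unpolar p)).
  - by exists M => p _ /=; case/andP: (gM (unpolar p)).
  - apply: continuous_subspaceT => p; apply: continuous_comp; last exact: gc.
    exact: continuous_unpolar.
  - exists r => // p _; rewrite fattening_origin /= => pr.
    by rewrite gr// enorm_unpolar.
have limE : @integral _ (borel HS) R (product_measure1 nu S) (~` origin) (fun p => ((g \o unpolar) p)%:E)
    = (\int[rho]_z (g z)%:E)%E.
  rewrite (rhoint (EFin \o g))//=; last by rewrite g0.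
  by apply: integral_set_function => B mB BD; exact: muE.
have := cvgZ _ tf; rewrite [X in _ --> X -> _]limE.
move=> h; apply: cvg_trans h; apply: near_eq_cvg; near=> x.
have x0 : 0 < x by near: x; exact: nbhs_pinfty_gt.
have k0 : 0 <= (tail_prob P Z x)^-1 by rewrite invr_ge0 /tail_prob fine_ge0.
pose k : {nonneg R} := NngNum k0.
have mpsi : measurable_fun setT (fun w => rescale x (polar (Z w)) : borel HS).
  apply: (measurableT_comp (measurable_rescale_polar x)); exact: measurable_funPT.
pose theta : {measure set (borel HS) -> \bar R} :=
  measure_function_pushforward__canonical__measure_function_Measure P mpsi.
have mgq : measurable_fun setT (EFin \o (g \o unpolar) : borel HS -> \bar R).
  apply/measurable_EFinP; apply: (measurableT_comp mg).
  exact: (continuous_borel_measurable (@continuous_unpolar R d)).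
transitivity (\int[mscale k theta]_(p in ~` origin) ((g \o unpolar) p)%:E)%E.
  apply: integral_set_function => B mB _.
  by rewrite /mscale /= /pushforward muleC.
rewrite ge0_integral_mscale//; [|exact: measurable_funTS|by move=> p _; exact: gge0].
rewrite muleC; congr (_ * _)%E.
rewrite (ge0_integral_pushforward mpsi)//; [|exact: measurable_funTS|by move=> p _; exact: gge0].
rewrite integral_mkcond; congr (integral _ _ _); apply/funext => w.
rewrite patchE; case: ifPn => [_|]; first by rewrite /= unpolar_rescale.
rewrite notin_setE => /contrapT /unpolar_eq0.
by rewrite unpolar_rescale// => ->; rewrite g0.
Unshelve. all: by end_near. Qed.

End vague_convergence.

(** * Exponential tail bound for the clipped noise *)

Section chain_continuity.
Context {R : realType} {m d : nat}.
Local Notation Rm := 'cV[R]_m.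
Local Notation Rd := 'cV[R]_d.
Variables (a : Rm -> Rm) (sigma : Rm -> 'M[R]_(m, d)) (D C : R).
Hypotheses (D0 : 0 <= D) (C0 : 0 <= C).
Hypothesis aL : forall x y, enorm (a x - a y) <= D * enorm (x - y).
Hypothesis sL : forall x y w,
  enorm ((sigma x - sigma y) *m w) <= D * enorm (x - y) * enorm w.
Hypothesis sB : forall x w, enorm (sigma x *m w) <= C * enorm w.

(** Serves measurability: functionals of the scheme are continuous in the coordinates of finitely
    many noises. *)
Lemma sgd_continuous eta z x n : 0 <= eta -> forall e, 0 < e -> exists2 g, 0 < g &
  forall z', (forall i, (0 < i <= n)%N -> enorm (z' i - z i) <= g) ->
  forall j, (j <= n)%N -> enorm (sgd a sigma eta z' x j - sgd a sigma eta z x j) <= e.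
Proof.
move=> eta0; elim: n => [|n ih] e e0.
  by exists 1 => // z' _ j; rewrite leqn0 => /eqP -> /=; rewrite subrr enorm0 ltW.
pose K := 1 + eta * D + eta * D * enorm (z n.+1) + eta * C.
have ED : 0 <= eta * D * enorm (z n.+1) by rewrite !mulr_ge0// enorm_ge0.
have K1 : 1 <= K.
  have := mulr_ge0 eta0 D0; have := mulr_ge0 eta0 C0; rewrite /K; lra.
have K0 : 0 < K by exact: lt_le_trans K1.
have eK : 0 < e / K by rewrite divr_gt0.
have [g g0 hg] := ih _ eK; exists (Num.min g (e / K)); first by rewrite lt_min g0.
move=> z' hz.
have hz1 i : (0 < i <= n)%N -> enorm (z' i - z i) <= g.
  move=> /andP[i0 iN]; rewrite (le_trans (hz i _)) ?ge_min ?lexx// i0 /=.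
  exact: leqW.
move=> j; rewrite leq_eqVlt => /orP[/eqP ->|]; last first.
  rewrite ltnS => jn; rewrite (le_trans (hg _ hz1 j jn))//.
  by rewrite ler_pdivrMr// ler_peMr// ltW.
have := hg _ hz1 n (leqnn n); rewrite /=.
set u := sgd a sigma eta z' x n; set v := sgd a sigma eta z x n => uv.
have zz : enorm (z' n.+1 - z n.+1) <= e / K.
  by rewrite (le_trans (hz _ _)) ?leqnn ?ge_min ?lexx ?orbT.
have -> : u + eta *: a u + eta *: (sigma u *m z' n.+1) -
    (v + eta *: a v + eta *: (sigma v *m z n.+1)) =
  (u - v) + eta *: (a u - a v) + eta *: ((sigma u - sigma v) *m z n.+1)
  + eta *: (sigma u *m (z' n.+1 - z n.+1)).
  by rewrite mulmxBl mulmxBr; apply/colP => i; rewrite !mxE; ring.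
have h1 : enorm (eta *: (a u - a v)) <= eta * (D * (e / K)).
  by rewrite enormZ ger0_norm// ler_wpM2l// (le_trans (aL _ _))// ler_wpM2l.
have h2 : enorm (eta *: ((sigma u - sigma v) *m z n.+1)) <= eta * (D * (e / K) * enorm (z n.+1)).
  rewrite enormZ ger0_norm// ler_wpM2l// (le_trans (sL _ _ _))//.
  by rewrite ler_wpM2r ?enorm_ge0// ler_wpM2l.
have h3 : enorm (eta *: (sigma u *m (z' n.+1 - z n.+1))) <= eta * (C * (e / K)).
  by rewrite enormZ ger0_norm// ler_wpM2l// (le_trans (sB _ _))// ler_wpM2l.
have e_E : e = K * (e / K) by rewrite mulrC divfK// lt0r_neq0.
rewrite [leRHS]e_E.
apply: (le_trans (enorm_triangle _ _)); apply: (le_trans (lerD (enorm_triangle _ _) h3)).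
apply: (le_trans (lerD (lerD (enorm_triangle _ _) h2) (lexx _))).
apply: (le_trans (lerD (lerD (lerD uv h1) (lexx _)) (lexx _))).
by rewrite /K le_eqVlt; apply/orP; left; apply/eqP; ring.
Qed.

Lemma sgd_ext eta z z' x n : (forall i, (0 < i <= n)%N -> z i = z' i) ->
  sgd a sigma eta z x n = sgd a sigma eta z' x n.
Proof.
elim: n => //= n ih h; rewrite ih => [|i /andP[i0 iN]]; last by rewrite h// i0 leqW.
by rewrite h// leqnn.
Qed.

(** The first step becomes a new starting point, as an induction that integrates out the first noise
    requires. *)
Lemma sgd_shift eta z x n : sgd a sigma eta z x n.+1 =
  sgd a sigma eta (fun i => z i.+1)
    (x + eta *: a x + eta *: (sigma x *m z 1%N)) n.
Proof. by elim: n => // n ih; rewrite [LHS]/= -/(sgd a sigma eta z x n.+1) ih. Qed.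

End chain_continuity.

HB.instance Definition _ (R : realType) := Metric.on R^o.

Lemma measurable_real_coords {R : realType} {disp : measure_display}
    {Omega : measurableType disp} (I : finType) (u : I -> Omega -> R) (F : (I -> R) -> R) :
  (forall i, measurable_fun setT (u i)) ->
  (forall w e, 0 < e -> exists2 g, 0 < g &
    forall y : I -> R, (forall i, `|y i - u i w| <= g) -> `|F y - F (u^~ w)| <= e) ->
  measurable_fun setT (fun w => F (u^~ w)).
Proof.
move=> mu Fc; apply: (measurability _ (RGenOpens.measurableE R)).
move=> _ [_ [x [y ->]] <-].
have Fc' w : setT w -> forall e, 0 < e -> exists2 g, 0 < g &
    forall z : I -> R, (forall i, `|z i - u i w| <= g) -> mdist (F z : R^o) (F (u^~ w)) <= e.
  by move=> _ e e0; have [g g0 hg] := Fc w e e0; exists g => // z hz; rewrite metric_sym; exact: hg.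
have := @measurable_discretization R _ Omega I u (R^o : PointedMetric.type R) mu setT F measurableT Fc' `]x, y[%classic.
by apply; apply: sub_sigma_algebra; exact: interval_open.
Qed.

Lemma measurable_mpowerS {disp : measure_display} {X : measurableType disp} {R : realType}
    (mu : {sigma_finite_measure set X -> \bar R}) k (f : k.+1.-tuple X -> \bar R) :
  measurable_fun [set: k.+1.-tuple X] f -> (forall t, (0 <= f t)%E) ->
  measurable_fun setT (fun x => \int[mpower mu k]_s f [tuple of x :: s])%E.
Proof.
move=> mf f0.
apply: (@measurable_fun_fubini_tonelli_F _ _ X (k.-tuple X) R (mpower mu k)
  (fun p => f [tuple of p.1 :: p.2])) => //.
by apply: measurableT_comp => //; exact: measurable_tcons.
Qed.

Lemma measure_bigcup_fintype_le {disp : measure_display} {X : measurableType disp} {R : realType}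
    (mu : {measure set X -> \bar R}) (I : finType) (E : I -> set X) :
  (forall i, measurable (E i)) ->
  (mu (\bigcup_i E i) <= \sum_(i : I) mu (E i))%E.
Proof.
move=> mE; rewrite (_ : \bigcup_i E i = \bigcup_(i in [set` index_enum I]) E i).
  rewrite bigcup_seq.
  suff [] : measurable (\big[setU/set0]_(i <- index_enum I) E i) /\
    (mu (\big[setU/set0]_(i <- index_enum I) E i) <= \sum_(i <- index_enum I) mu (E i))%E by [].
  elim: (index_enum I) => [|i s [ms ih]]; first by rewrite !big_nil measure0.
  rewrite !big_cons; split; first exact: measurableU.
  by rewrite (le_trans (measureU2 _ _ _))// leeD2l.
by apply: eq_bigcupl; split=> i // _; exact: mem_index_enum.
Qed.

(** * Exponential moments of the clipped noise *)

Section exponential_bound.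
Context {R : realType}.

(** For [u <= 1 / 2] it follows from [1 - u <= expR (- u)]; for larger [u] already
    [4 * u ^+ 2 >= 1]. *)
Lemma expR_quadratic (u : R) : expR u <= 1 + u + 4 * u ^+ 2 * expR `|u|.
Proof.
have u2 : 0 <= u ^+ 2 by exact: sqr_ge0.
have e1 : 1 <= expR `|u| by rewrite -expR0 ler_expR.
have [u12|u12] := leP u (1 / 2).
  have h := expR_ge1Dx (- u); rewrite expRN in h.
  have e0 := expR_gt0 u.
  have {}h : (1 - u) * expR u <= 1.
    by rewrite -ler_pdivlMr// div1r.
  have h2 : expR u <= 1 + u + 2 * u ^+ 2.
    have u1 : 0 < 1 - u by lra.
    rewrite -(ler_pM2l u1) (le_trans h)//.
    have : 0 <= u ^+ 2 * (1 - 2 * u) by rewrite mulr_ge0//; lra.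
    lra.
  have : 0 <= u ^+ 2 * (expR `|u| - 1) by rewrite mulr_ge0// subr_ge0.
  lra.
have uu : expR u <= expR `|u| by rewrite ler_expR ler_norm.
have : 1 <= 4 * u ^+ 2.
  have : 0 <= (u - 1 / 2) * (u + 1 / 2) by rewrite mulr_ge0//; lra.
  lra.
move=> h; have : 0 <= (4 * u ^+ 2 - 1) * expR `|u| by rewrite mulr_ge0 ?subr_ge0// expR_ge0.
lra.
Qed.

Context {m d : nat}.
Local Notation Rm := 'cV[R]_m.
Local Notation Rd := 'cV[R]_d.+1.
Variables (a : Rm -> Rm) (sigma : Rm -> 'M[R]_(m, d.+1)) (D C : R).
Hypotheses (D0 : 0 <= D) (C0 : 0 < C).
Hypothesis aL : forall x y, enorm (a x - a y) <= D * enorm (x - y).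
Hypothesis sL : forall x y w,
  enorm ((sigma x - sigma y) *m w) <= D * enorm (x - y) * enorm w.
Hypothesis sB : forall x w, enorm (sigma x *m w) <= C * enorm w.

Variables (mu : probability (borel Rd) R) (p kappa : R).
Hypotheses (p1 : 1 < p) (p2 : p <= 2) (kappa0 : 0 <= kappa).
Hypothesis mean0 : forall i, (\int[mu]_z ((z : Rd) i ord0)%:E = 0)%E.
Hypothesis moment : (\int[mu]_z (enorm (z : Rd) `^ p)%:E <= kappa%:E)%E.

Definition clip (b : R) (z : Rd) : Rd := if enorm z <= b then z else 0.

(** First term: the linear part that clipping removes, where [enorm z > b]. Second term: the
    quadratic part, where [enorm z <= b]. Both are compared with the power [p] of the norm, which is
    possible because [1 < p <= 2]. *)
Let step_const (tau b : R) : R :=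
  tau * C * b `^ (1 - p) + 4 * expR (tau * C * b) * (tau * C) ^+ 2 * b `^ (2 - p).

Let step_const_ge0 tau b : 0 <= tau -> 0 <= step_const tau b.
Proof.
move=> t0; have C0' := ltW C0.
by rewrite addr_ge0 ?mulr_ge0 ?powR_ge0 ?sqr_ge0 ?expR_ge0.
Qed.

Let enorm_pow_ge z : 0 <= enorm (z : Rd) `^ p. Proof. exact: powR_ge0. Qed.

(** The linear term contains [z] and not [clip b z], so that it integrates to 0 for a centred
    noise. *)
Let pointwise (M : 'M[R]_(m, d.+1)) r (tau b : R) (z : Rd) :
  (forall w, enorm (M *m w) <= C * enorm w) -> 0 < b ->
  expR (tau * (M *m clip b z) r ord0) <=
    1 + tau * (M *m z) r ord0 + step_const `|tau| b * enorm z `^ p.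
Proof.
move=> MC b0; have C0' := ltW C0.
have L1 w : `|tau * (M *m w) r ord0| <= `|tau| * C * enorm w.
  by rewrite normrM -mulrA ler_wpM2l// (le_trans (enorm_coord _ _)).
have k0 : 0 <= `|tau| * C by rewrite mulr_ge0.
have p0 : 0 < p by exact: lt_trans p1.
have z0 := enorm_ge0 z; have b0' := ltW b0.
have t1 : 0 <= `|tau| * C * b `^ (1 - p) by rewrite mulr_ge0 ?powR_ge0.
have t2 : 0 <= 4 * expR (`|tau| * C * b) * (`|tau| * C) ^+ 2 * b `^ (2 - p).
  by rewrite !mulr_ge0 ?powR_ge0 ?sqr_ge0 ?expR_ge0.
rewrite /clip; case: ifPn => [zb|].
  set f := tau * _; have fz : `|f| <= `|tau| * C * enorm z by exact: L1.
  apply: (le_trans (expR_quadratic f)); rewrite lerD2l.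
  apply: (@le_trans _ _ (4 * expR (`|tau| * C * b) * (`|tau| * C) ^+ 2 * b `^ (2 - p) * enorm z `^ p)); last first.
    by rewrite ler_wpM2r// /step_const lerDr.
  have fb : expR `|f| <= expR (`|tau| * C * b).
    by rewrite ler_expR (le_trans fz)// ler_wpM2l.
  have f2 : f ^+ 2 <= (`|tau| * C) ^+ 2 * enorm z ^+ 2.
    by rewrite -exprMn -real_normK ?num_real// ler_pXn2r ?nnegrE ?mulr_ge0.
  have zz : enorm z ^+ 2 <= b `^ (2 - p) * enorm z `^ p.
    have [->|zn0] := eqVneq (enorm z) 0; first by rewrite expr0n mulr_ge0 ?powR_ge0.
    rewrite -powR_mulrn// [X in _ `^ X <= _](_ : 2%:R = (2 - p) + p); last by ring.
    rewrite powRD; last by rewrite zn0 implybT.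
    rewrite ler_wpM2r ?powR_ge0// ge0_ler_powR ?nnegrE ?subr_ge0//.
  have h1 : f ^+ 2 * expR `|f| <= (`|tau| * C) ^+ 2 * (b `^ (2 - p) * enorm z `^ p) * expR (`|tau| * C * b).
    rewrite ler_pM ?sqr_ge0 ?expR_ge0// (le_trans f2)// ler_wpM2l ?sqr_ge0//.
  by rewrite -mulrA (le_trans (ler_wpM2l _ h1))//; lra.
rewrite -ltNge => bz; rewrite mulmx0 mxE mulr0 expR0 -addrA lerDl.
have zp : 0 < enorm z by exact: lt_trans bz.
have zz : enorm z <= b `^ (1 - p) * enorm z `^ p.
  rewrite -{1}(powRr1 z0) [X in _ `^ X <= _](_ : 1 = (1 - p) + p :> R); last by ring.
  rewrite powRD; last by rewrite (lt0r_neq0 zp) implybT.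
  rewrite ler_wpM2r ?powR_ge0// -(opprB p) !powRN lef_pV2 ?posrE ?powR_gt0//.
  by rewrite ge0_ler_powR ?nnegrE ?subr_ge0 ?(ltW p1)// ltW.
have h1 : - (`|tau| * C * enorm z) <= tau * (M *m z) r ord0.
  by have := L1 z; rewrite ler_norml => /andP[].
have h2 : `|tau| * C * enorm z <= `|tau| * C * b `^ (1 - p) * enorm z `^ p.
  by rewrite -[leRHS]mulrA ler_wpM2l.
have h3 : 0 <= 4 * expR (`|tau| * C * b) * (`|tau| * C) ^+ 2 * b `^ (2 - p) * enorm z `^ p.
  by rewrite mulr_ge0.
by rewrite /step_const mulrDl; lra.
Qed.

Let mzp : measurable_fun [set: borel Rd] (fun z : borel Rd => enorm (z : Rd) `^ p).
Proof. exact: (measurableT_comp (measurable_powR p) (@measurable_enorm R d.+1)). Qed.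

Let izp : mu.-integrable setT (fun z : borel Rd => (enorm (z : Rd) `^ p)%:E).
Proof.
apply/integrableP; split; first exact/measurable_EFinP.
rewrite (eq_integral (fun z : borel Rd => (enorm (z : Rd) `^ p)%:E)).
  by rewrite (le_lt_trans moment)// ltry.
by move=> z _; rewrite gee0_abs// lee_fin.
Qed.

Let icst (k : R) : mu.-integrable setT (fun z : borel Rd => k%:E).
Proof. exact: (@finite_measure_integrable_cst _ _ _ mu setT k). Qed.

Let icoord i : mu.-integrable setT (fun z : borel Rd => ((z : Rd) i ord0)%:E).
Proof.
have := integrableD measurableT (icst 1) izp; apply: le_integrable => //.
  by apply/measurable_EFinP; exact: measurable_coord.
move=> z _ /=; rewrite lee_fin [leRHS]ger0_norm ?addr_ge0//.
rewrite (le_trans (enorm_coord _ _))//.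
have [z1|z1] := leP (enorm (z : Rd)) 1; first by rewrite (le_trans z1)// lerDl.
apply: (@le_trans _ _ (enorm (z : Rd) `^ p)); last by rewrite lerDr.
by rewrite -{1}(powRr1 (enorm_ge0 z)) ler_powR ?ltW.
Qed.

Let ilin (M : 'M[R]_(m, d.+1)) r :
  mu.-integrable setT (fun z : borel Rd => ((M *m (z : Rd)) r ord0)%:E) /\
  (\int[mu]_z ((M *m (z : Rd)) r ord0)%:E = 0)%E.
Proof.
have E (z : borel Rd) : ((M *m (z : Rd)) r ord0)%:E = (\sum_i (M r i)%:E * ((z : Rd) i ord0)%:E)%E.
  by rewrite mxE -sumEFin; apply: eq_bigr => i _; rewrite EFinM.
have iE i : mu.-integrable setT (fun z : borel Rd => ((M r i)%:E * ((z : Rd) i ord0)%:E)%E).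
  exact: integrableZl.
split.
  under eq_fun do rewrite E; exact: integrable_sum.
under eq_integral do rewrite E.
by rewrite integral_sum// big1// => i _; rewrite integralZl// mean0 mule0.
Qed.

Let mclip b i : measurable_fun [set: borel Rd] (fun z : borel Rd => clip b (z : Rd) i ord0).
Proof.
rewrite (_ : (fun z => _) = (fun z : borel Rd => if enorm (z : Rd) <= b then (z : Rd) i ord0 else 0)).
  apply: measurable_fun_ifT => //; last exact: measurable_coord.
  by apply: measurable_fun_ler => //; exact: measurable_enorm.
by apply/funext => z; rewrite /clip; case: ifP => // _; rewrite mxE.
Qed.

Let mlinclip (M : 'M[R]_(m, d.+1)) r b :
  measurable_fun [set: borel Rd] (fun z : borel Rd => (M *m clip b (z : Rd)) r ord0).
Proof.
under eq_fun do rewrite mxE; apply: measurable_sum => i.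
by apply: measurable_funM => //; exact: mclip.
Qed.

Lemma one_step (M : 'M[R]_(m, d.+1)) r (tau b : R) :
  (forall w, enorm (M *m w) <= C * enorm w) -> 0 < b ->
  (\int[mu]_z (expR (tau * (M *m clip b (z : Rd)) r ord0))%:E <=
    (1 + step_const `|tau| b * kappa)%:E)%E.
Proof.
move=> MC b0; have [iM M0] := ilin M r; have k0 := step_const_ge0 b (normr_ge0 tau).
have iG : mu.-integrable setT (fun z : borel Rd =>
   1%:E + tau%:E * ((M *m (z : Rd)) r ord0)%:E + (step_const `|tau| b)%:E * (enorm (z : Rd) `^ p)%:E)%E.
  apply: integrableD => //; last exact: integrableZl.
  by apply: integrableD => //; exact: integrableZl.
have GE (z : borel Rd) : (1%:E + tau%:E * ((M *m (z : Rd)) r ord0)%:E + (step_const `|tau| b)%:E * (enorm (z : Rd) `^ p)%:E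
   = (1 + tau * (M *m (z : Rd)) r ord0 + step_const `|tau| b * enorm (z : Rd) `^ p)%:E)%E by [].
apply: (@le_trans _ _ (\int[mu]_z (1%:E + tau%:E * ((M *m (z : Rd)) r ord0)%:E
    + (step_const `|tau| b)%:E * (enorm (z : Rd) `^ p)%:E)))%E.
  apply: ge0_le_integral => //.
  - apply/measurable_EFinP/measurableT_comp => //.
    by apply: measurable_funM => //; exact: mlinclip.
  - exact: measurable_int iG.
  - by move=> z _; rewrite GE lee_fin; exact: pointwise.
rewrite integralD//; first last.
- exact: integrableZl.
- by apply: integrableD => //; exact: integrableZl.
rewrite integralD//; last exact: integrableZl.
rewrite !integralZl// M0 mule0 adde0.
rewrite integral_cst// [X in (X + _)%E](_ : _ = 1%E); last first.
  by rewrite mul1e; exact: probability_setT.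
rewrite -[leRHS]/(1%:E + (step_const `|tau| b * kappa)%:E)%E.
apply: leeD; first exact: lexx.
by rewrite EFinM lee_wpmul2l// lee_fin.
Qed.

Definition clipped_noise (eta b : R) (z : nat -> Rd) (x : Rm) (j : nat) : Rm :=
  \sum_(q < j) eta *: (sigma (sgd a sigma eta z x q) *m clip b (z q.+1)).

(** Noises are numbered from 1, entries of a tuple from 0. *)
Definition tseq (t : seq Rd) (i : nat) : Rd := nth 0 t i.-1.

Lemma clipped_noiseS eta b z x j : clipped_noise eta b z x j.+1 =
  eta *: (sigma x *m clip b (z 1%N)) +
  clipped_noise eta b (fun i => z i.+1) (x + eta *: a x + eta *: (sigma x *m z 1%N)) j.
Proof.
rewrite /clipped_noise big_ord_recl; congr (_ + _); apply: eq_bigr => q _.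
by rewrite sgd_shift.
Qed.

Lemma clipped_noise_ext eta b z z' x j : (forall i, (0 < i <= j)%N -> z i = z' i) ->
  clipped_noise eta b z x j = clipped_noise eta b z' x j.
Proof.
move=> h; apply: eq_bigr => q _; rewrite h ?ltn_ord//; congr (_ *: (sigma _ *m _)).
apply: sgd_ext => i /andP[i0 iq]; apply: h; rewrite i0 (leq_trans iq)//.
exact/ltnW.
Qed.

Let msigma eta n x q r i : 0 <= eta -> measurable_fun [set: n.-tuple (borel Rd)]
  (fun t : n.-tuple (borel Rd) => (sigma (sgd a sigma eta (tseq t) x q)) r i).
Proof.
move=> eta0.
pose zy (y : 'I_n * 'I_d.+1 -> R) (k : nat) : Rd :=
  if insub k.-1 is Some k' then \col_l y (k', l) else 0.
pose F y := sigma (sgd a sigma eta (zy y) x q) r i.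
pose u (kl : 'I_n * 'I_d.+1) (t : n.-tuple (borel Rd)) : R := (tnth t kl.1 : Rd) kl.2 ord0.
have zyE t k : zy (u^~ t) k = tseq t k.
  rewrite /zy /tseq; case: insubP => [k' kn k'k|].
    by apply/colP => l; rewrite mxE /u (tnth_nth (0 : Rd)) /= k'k.
  by rewrite -leqNgt => kn; rewrite nth_default// size_tuple.
rewrite (_ : (fun t => _) = (fun t => F (u^~ t))).
  apply: measurable_real_coords.
    move=> [k l]; apply: (measurableT_comp (@measurable_coord R d.+1 l)).
    exact: measurable_tnth.
  move=> t e e0; have eD : 0 < e / (D + 1) by rewrite divr_gt0// ltr_wpDl.
  have [g g0 hg] := sgd_continuous D0 (ltW C0) aL sL sB (zy (u^~ t)) x q eta0 eD.
  exists (g / d.+1%:R); first by rewrite divr_gt0.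
  move=> y hy; rewrite /F.
  have zz k : (0 < k <= q)%N -> enorm (zy y k - zy (u^~ t) k) <= g.
    move=> _; rewrite /zy; case: insubP => [k' _ _|_]; last by rewrite subrr enorm0 ltW.
    rewrite (le_trans (enorm_le_sum _))//.
    apply: (@le_trans _ _ (\sum_(l < d.+1) (g / d.+1%:R))).
      by apply: ler_sum => l _; rewrite !mxE.
    by rewrite sumr_const card_ord -[leLHS]mulr_natr divfK.
  have := hg _ zz q (leqnn q); set v := sgd _ _ _ _ _ _; set w := sgd _ _ _ _ _ _ => vw.
  have e1 : enorm (delta_mx i ord0 : Rd) = 1.
    rewrite /enorm (bigD1 i)//= big1 => [|k /negPf ki]; first by rewrite mxE !eqxx addr0 expr1n sqrtr1.
    by rewrite mxE ki expr0n.
  have := sL v w (delta_mx i ord0); rewrite e1 mulr1 => h.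
  apply: (@le_trans _ _ (enorm ((sigma v - sigma w) *m delta_mx i ord0))).
    rewrite (le_trans _ (enorm_coord _ r))// -colE !mxE//.
  apply: (le_trans h); apply: (@le_trans _ _ ((D + 1) * (e / (D + 1)))).
    by rewrite ler_pM ?enorm_ge0// lerDl.
  by rewrite mulrC divfK// lt0r_neq0// ltr_wpDl.
apply/funext => t; rewrite /F; congr (sigma _ _ _).
by apply: sgd_ext => k _; rewrite zyE.
Qed.

Lemma measurable_clipped_noise eta b n x j r : 0 <= eta -> measurable_fun [set: n.-tuple (borel Rd)]
  (fun t : n.-tuple (borel Rd) => clipped_noise eta b (tseq t) x j r ord0).
Proof.
move=> eta0; rewrite (_ : (fun t => _) = (fun t : n.-tuple (borel Rd) => \sum_(q < j) eta *
    (\sum_i sigma (sgd a sigma eta (tseq t) x q) r i * clip b (tseq t q.+1) i ord0))).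
  apply: measurable_sum => q; apply: measurable_funM => //.
  apply: measurable_sum => i; apply: measurable_funM; first exact: msigma.
  have [qn|nq] := ltnP q n.
    rewrite (_ : (fun t => _) = (fun t : n.-tuple (borel Rd) => clip b (tnth t (Ordinal qn) : Rd) i ord0)).
      by apply: (measurableT_comp (mclip b i)); exact: measurable_tnth.
    by apply/funext => t; rewrite (tnth_nth (0 : Rd)).
  rewrite (_ : (fun t => _) = cst 0)//; apply/funext => t /=.
  by rewrite /tseq /= nth_default ?size_tuple// /clip if_same mxE.
apply/funext => t; rewrite summxE; apply: eq_bigr => q _.
by rewrite !mxE; congr (_ * _).
Qed.

(** Given the first noise, the remaining steps form the same chain from another starting point, and
    the bound is uniform in that point: each step contributes one factor from [one_step]. *)
Lemma exp_clipped_noise eta b tau n j x r : 0 <= eta -> 0 < b -> (j <= n)%N ->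
  (\int[mpower mu n]_t (expR (tau * clipped_noise eta b (tseq t) x j r ord0))%:E <=
    ((1 + step_const `|tau * eta| b * kappa) ^+ j)%:E)%E.
Proof.
move=> eta0 b0; set Q := 1 + _.
have Q1 : 1 <= Q by rewrite lerDl mulr_ge0// step_const_ge0.
have mf n' j' x' : measurable_fun [set: n'.-tuple (borel Rd)]
    (fun t : n'.-tuple (borel Rd) => (expR (tau * clipped_noise eta b (tseq t) x' j' r ord0))%:E).
  apply/measurable_EFinP/measurableT_comp => //; apply: measurable_funM => //.
  exact: measurable_clipped_noise.
have ge0 n' j' x' (t : n'.-tuple (borel Rd)) : (0 <= (expR (tau * clipped_noise eta b (tseq t) x' j' r ord0))%:E)%E.
  by rewrite lee_fin expR_ge0.
elim: n j x => [|n ih] j x jn.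
  move: jn; rewrite leqn0 => /eqP ->; rewrite (integral_mpower0 mu).
  by rewrite /clipped_noise big_ord0 mxE mulr0 expR0 expr0.
rewrite (integral_mpowerS mu (mf _ _ _))//.
have mexp : measurable_fun [set: borel Rd] (fun y : borel Rd =>
    (expR (tau * eta * (sigma x *m clip b (y : Rd)) r ord0))%:E).
  apply/measurable_EFinP/measurableT_comp => //.
  exact: measurable_funM.
have step (y : borel Rd) (s : n.-tuple (borel Rd)) j' :
   clipped_noise eta b (tseq [tuple of y :: s]) x j'.+1 =
   eta *: (sigma x *m clip b (y : Rd)) +
   clipped_noise eta b (tseq s) (x + eta *: a x + eta *: (sigma x *m (y : Rd))) j'.
  rewrite clipped_noiseS; congr (_ + _); apply: clipped_noise_ext => i.
  by case: i => // i.
case: j jn => [_|j jn].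
  rewrite expr0 (_ : (fun y : borel Rd => _) = (fun y : borel Rd =>
    \int[mpower mu n]_s (expR (tau * clipped_noise eta b (tseq s) x 0 r ord0))%:E)%E).
    rewrite integral_cst// [X in (_ * X)%E](_ : _ = 1%E) ?mule1; last exact: probability_setT.
    by have := ih 0%N x (leq0n n); rewrite expr0.
  by apply/funext => y; apply: eq_integral => s _; rewrite /clipped_noise !big_ord0.
apply: (@le_trans _ _ (\int[mu]_y ((expR (tau * eta * (sigma x *m clip b (y : Rd)) r ord0))%:E
   * (Q ^+ j)%:E)))%E.
  apply: ge0_le_integral => //.
  - by move=> y _; apply: integral_ge0 => s _.
  - exact: (measurable_mpowerS mu (mf _ _ _)).
  - apply: emeasurable_funM => //; exact: mexp.
  - move=> y _; rewrite (eq_integral (fun s : n.-tuple (borel Rd) => (expR (tau * eta * (sigma x *m clip b (y : Rd)) r ord0))%:E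
      * (expR (tau * clipped_noise eta b (tseq s) (x + eta *: a x + eta *: (sigma x *m (y : Rd))) j r ord0))%:E))%E.
      rewrite ge0_integralZl//; last exact: mf.
      by apply: lee_wpmul2l; [rewrite lee_fin expR_ge0|exact: ih].
    move=> s _; rewrite step -EFinM -expRD; congr (expR _)%:E.
    by rewrite !mxE; ring.
rewrite ge0_integralZr//; last by rewrite lee_fin exprn_ge0// (le_trans ler01).
rewrite exprS EFinM; apply: lee_wpmul2r; first by rewrite lee_fin exprn_ge0// (le_trans ler01).
exact: one_step.
Qed.

(** With an exponential parameter of order [y = ln (1 / eta)] and clipping at [delta / eta], a step
    contributes a multiple of [eta]. Factors [y] are absorbed by [y <= expR (s * y) / s], the
    smallness of [delta] keeps the exponential factor below [expR (2 * s * y)], and [4 * s = p - 1]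
    balances the powers of [eta]. *)
Let step_const_log (L delta s eta : R) : 0 < L -> 0 < delta -> s = (p - 1) / 4 ->
  L * C * delta <= 2 * s -> 0 < eta <= 1 ->
  step_const (L * - ln eta * eta) (delta / eta) <=
    eta * (L / s * C * delta `^ (1 - p) + 4 * (L / s * C) ^+ 2 * delta `^ (2 - p)).
Proof.
move=> L0 d0 sE Lds /andP[e0 e1]; set y := - ln eta.
have s0 : 0 < s by rewrite sE divr_gt0// subr_gt0.
have y0 : 0 <= y by rewrite oppr_ge0 -ln1 ler_ln ?posrE.
have etaE : eta = expR (- y) by rewrite opprK lnK// posrE.
have ie0 : 0 <= eta^-1 by rewrite invr_ge0 ltW.
have powE q : (delta / eta) `^ q = delta `^ q * expR (q * y).
  rewrite powRM// ?(ltW d0)//; congr (_ * _).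
  by rewrite etaE -expRN opprK /powR (gt_eqF (expR_gt0 _)) expRK.
have C0' := ltW C0.
have yb : y <= expR (s * y) / s.
  rewrite ler_pdivlMr// mulrC (le_trans _ (expR_ge1Dx _))// lerDr//.
have tb : L * y <= L / s * expR (s * y).
  by rewrite -mulrA ler_pM2l// mulrC.
have D1 : 0 <= delta `^ (1 - p) by exact: powR_ge0.
have D2 : 0 <= delta `^ (2 - p) by exact: powR_ge0.
have L0' := ltW L0; have si0 : 0 <= s^-1 by rewrite invr_ge0 ltW.
have Ls0 : 0 <= L / s by rewrite mulr_ge0.
have Ly0 : 0 <= L * y by rewrite mulr_ge0// ltW.
rewrite /step_const mulrDr; apply: lerD.
  rewrite powE (_ : L * y * eta * C * _ = eta * ((L * y) * C * delta `^ (1 - p) * expR ((1 - p) * y))); last by ring.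
  rewrite ler_pM2l//.
  apply: (@le_trans _ _ (L / s * expR (s * y) * C * delta `^ (1 - p) * expR ((1 - p) * y))).
    by rewrite !ler_wpM2r// expR_ge0.
  rewrite (_ : L / s * _ * C * _ * _ = L / s * C * delta `^ (1 - p) * (expR (s * y) * expR ((1 - p) * y))); last by ring.
  apply: ler_piMr; first by rewrite (mulr_ge0 (mulr_ge0 Ls0 C0') D1).
  rewrite -expRD -[leRHS]expR0 ler_expR.
  have -> : s * y + (1 - p) * y = - (3 * s) * y by rewrite sE; field.
  by rewrite mulNr oppr_le0 !mulr_ge0// ltW.
have E1 : expR (L * y * eta * C * (delta / eta)) <= expR (2 * s * y).
  rewrite ler_expR (_ : L * y * eta * C * _ = L * C * delta * y); last by field; rewrite gt_eqF.
  by rewrite ler_wpM2r.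
have E2 : (L * y * eta * C) ^+ 2 <= (L / s * C) ^+ 2 * expR (2 * s * y) * eta ^+ 2.
  rewrite (_ : 2 * s * y = s * y + s * y); last by ring.
  rewrite expRD -expr2 -!exprMn ler_pXn2r ?nnegrE ?mulr_ge0 ?expR_ge0 ?(ltW e0)//.
  rewrite (_ : L / s * C * _ * _ = L / s * expR (s * y) * eta * C); last by ring.
  by rewrite !ler_wpM2r// ltW.
apply: (@le_trans _ _ (4 * expR (2 * s * y) * ((L / s * C) ^+ 2 * expR (2 * s * y) * eta ^+ 2) *
   (delta `^ (2 - p) * expR ((2 - p) * y)))).
  rewrite powE; apply: ler_wpM2r; first by rewrite mulr_ge0 ?expR_ge0.
  apply: ler_pM => //; rewrite ?sqr_ge0// ?mulr_ge0 ?expR_ge0//.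
  by rewrite ler_wpM2l.
rewrite le_eqVlt; apply/orP; left; apply/eqP.
rewrite (_ : 4 * _ * _ * _ = eta * (4 * (L / s * C) ^+ 2 * delta `^ (2 - p)) *
   (eta * (expR (2 * s * y) * expR (2 * s * y) * expR ((2 - p) * y)))); last by ring.
rewrite -!expRD {2}etaE -expRD.
rewrite (_ : - y + _ = 0) ?expR0 ?mulr1//.
by rewrite sE; field.
Qed.

Let markov_expR n (f : n.-tuple (borel Rd) -> R) (th c : R) :
  measurable_fun setT f -> 0 <= th ->
  (mpower mu n [set t | (c <= f t)%R] <=
   (expR (- (th * c)))%:E * \int[mpower mu n]_t (expR (th * f t))%:E)%E.
Proof.
move=> mf th0; have mE : measurable [set t | c <= f t].
  rewrite (_ : [set t | _] = setT `&` f @^-1` `[c, +oo[%classic).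
    by apply: mf => //; exact: measurable_itv.
  by rewrite setTI; apply/seteqP; split=> t; rewrite /= in_itv/= andbT.
rewrite -ge0_integralZl//; last first.
  by apply/measurable_EFinP/measurableT_comp => //; exact: measurable_funM.
rewrite -[X in (mpower mu n X <= _)%E]setIT -integral_indic//.
apply: ge0_le_integral => //.
- apply/measurable_EFinP; exact: measurable_indic.
- apply/(@measurable_EFinP _ _ _ setT (fun t => expR (- (th * c)) * expR (th * f t))).
  apply: measurable_funM => //; apply: measurableT_comp => //; exact: measurable_funM.
- move=> t _; rewrite -EFinM lee_fin -expRD indicE; case: (boolP (t \in _)) => [|_].
    rewrite inE/= => ct; rewrite -expR0 ler_expR addrC subr_ge0 ler_wpM2l//.
  exact: expR_ge0.
Qed.

(* Exponential Markov inequality with parameter a multiple of ln (1 / eta):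
   a moment of order p, 1 < p < min(alpha, 2), controls the exponential moment
   of a clipped step. *)
Lemma clipped_noise_tail (T0 c : R) (N : nat) : 0 < T0 -> 0 < c ->
  exists2 delta0, 0 < delta0 & forall delta, 0 < delta <= delta0 ->
  exists2 K, 0 <= K & forall eta x n, 0 < eta <= 1 -> n%:R * eta <= T0 ->
    exists E : set (n.-tuple (borel Rd)), [/\ measurable E,
      forall t : n.-tuple (borel Rd), ~ E t ->
        forall j, (j <= n)%N -> enorm (clipped_noise eta (delta / eta) (tseq t) x j) <= c
      & (mpower mu n E <= (K * eta ^+ N)%:E)%E].
Proof.
move=> T00 c0; pose c' := c / m.+1%:R; have c'0 : 0 < c' by rewrite divr_gt0.
(* [L] turns the Markov factor into [eta ^+ N.+1]; the extra power of [eta] pays for the union over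
   the times, of which there are about [T0 / eta]. *)
pose L := N.+1%:R / c'; have L0 : 0 < L by rewrite divr_gt0.
pose s := (p - 1) / 4; have s0 : 0 < s by rewrite divr_gt0// subr_gt0.
(* Exactly the condition on [delta] in [step_const_log]. *)
exists (2 * s / (L * C)); first by rewrite divr_gt0// mulr_gt0.
move=> delta /andP[d0 dd].
have Ld : L * C * delta <= 2 * s by rewrite mulrC -ler_pdivlMr// mulr_gt0.
pose B := L / s * C * delta `^ (1 - p) + 4 * (L / s * C) ^+ 2 * delta `^ (2 - p).
have C0' := ltW C0.
have B0 : 0 <= B.
  by rewrite addr_ge0 ?mulr_ge0 ?powR_ge0 ?sqr_ge0 ?invr_ge0// ltW.
pose K := (T0 + 1) * (2 * m%:R) * expR (T0 * B * kappa).
have K0 : 0 <= K by rewrite !mulr_ge0 ?expR_ge0// addr_ge0// ltW.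
exists K => // eta x n /andP[e0 e1] nT; have e0' := ltW e0.
set b := delta / eta; have b0 : 0 < b by rewrite divr_gt0.
set y := - ln eta; have y0 : 0 <= y by rewrite oppr_ge0 -ln1 ler_ln ?posrE.
pose th := L * y; have th0 : 0 <= th by rewrite mulr_ge0// ltW.
pose f j (r : 'I_m) (sg : bool) (t : n.-tuple (borel Rd)) :=
  (-1) ^+ sg * clipped_noise eta b (tseq t) x j r ord0.
have mf j r sg : measurable_fun setT (f j r sg).
  by apply: measurable_funM => //; exact: measurable_clipped_noise.
(* One event for each time, coordinate and sign. *)
pose I := (('I_n.+1 * 'I_m) * bool)%type.
pose E0 (i : I) : set (n.-tuple (borel Rd)) := [set t | c' <= f i.1.1 i.1.2 i.2 t].
have mE0 i : measurable (E0 i).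
  rewrite (_ : E0 i = setT `&` f i.1.1 i.1.2 i.2 @^-1` `[c', +oo[%classic).
    by apply: mf => //; exact: measurable_itv.
  by rewrite setTI; apply/seteqP; split=> t; rewrite /= in_itv/= andbT.
have PE0 i : (mpower mu n (E0 i) <= (expR (T0 * B * kappa) * eta ^+ N.+1)%:E)%E.
  apply: (le_trans (markov_expR _ (mf _ _ _) th0)); rewrite [leRHS]EFinM [leRHS]muleC.
  have -> : expR (- (th * c')) = eta ^+ N.+1.
    rewrite -[in RHS](lnK (e0 : eta \is Num.pos)) -expRM_natl; congr expR.
    by rewrite /th /L /y; field; rewrite gt_eqF// gt_eqF.
  apply: lee_wpmul2l; first by rewrite lee_fin exprn_ge0.
  pose tau := th * (-1) ^+ i.2.
  have h := exp_clipped_noise tau x i.1.2 e0' b0 (ltn_ord i.1.1 : (i.1.1 <= n)%N).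
  rewrite (eq_integral (fun t : n.-tuple (borel Rd) =>
     (expR (tau * clipped_noise eta b (tseq t) x i.1.1 i.1.2 ord0))%:E)); last first.
    by move=> t _; rewrite /f /tau mulrA.
  apply: (le_trans h); rewrite lee_fin.
  have -> : `|tau * eta| = L * y * eta.
    by rewrite normrM normrM normrX normrN1 expr1n mulr1 !ger0_norm.
  have sc : 0 <= step_const (L * y * eta) b by rewrite step_const_ge0// mulr_ge0.
  have sB' : step_const (L * y * eta) b <= eta * B by apply: step_const_log; rewrite ?e0.
  have jn : (i.1.1 <= n)%N := ltn_ord i.1.1.
  apply: (@le_trans _ _ (expR (step_const (L * y * eta) b * kappa) ^+ i.1.1)).
    by rewrite lerXn2r ?nnegrE ?expR_ge0 ?expR_ge1Dx// addr_ge0// mulr_ge0.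
  rewrite -expRM_natl ler_expR.
  apply: (@le_trans _ _ (n%:R * (eta * B * kappa))).
    by rewrite ler_pM ?mulr_ge0 ?ler_nat// ler_wpM2r.
  by rewrite !mulrA -mulrA -[leRHS]mulrA ler_wpM2r// mulr_ge0.
exists (\bigcup_i E0 i); split.
- by apply: fin_bigcup_measurable => //; exact: finite_finset.
- move=> t nE j jn; rewrite (le_trans (enorm_le_sum _))//.
  apply: (@le_trans _ _ (\sum_(r < m) c')).
    apply: ler_sum => r _; rewrite leNgt; apply/negP => lt; apply: nE.
    have [g0|l0] := leP 0 (clipped_noise eta b (tseq t) x j r ord0).
      exists ((Ordinal (jn : (j < n.+1)%N), r), false) => //=.
      by rewrite /E0 /f /= expr0 mul1r ltW// -(ger0_norm g0).
    exists ((Ordinal (jn : (j < n.+1)%N), r), true) => //=.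
    by rewrite /E0 /f /= expr1 mulN1r ltW// -(ltr0_norm l0).
  rewrite sumr_const card_ord -[leLHS]mulr_natr /c' -mulrA ler_piMr// ?(ltW c0)//.
  by rewrite mulrC ler_pdivrMr// mul1r ler_nat.
apply: (le_trans (measure_bigcup_fintype_le _ mE0)).
apply: (le_trans (lee_sum _ (fun i _ => PE0 i))).
rewrite sumEFin lee_fin sumr_const !card_prod !card_ord card_bool -[leLHS]mulr_natr /K.
rewrite !natrM exprS [leLHS](_ : _ = (n.+1%:R * eta) * (2 * m%:R) * expR (T0 * B * kappa) * eta ^+ N); last first.
  by ring.
rewrite !ler_wpM2r ?expR_ge0 ?exprn_ge0 ?mulr_ge0//.
by rewrite -natr1 mulrDl mul1r lerD.
Qed.

End exponential_bound.

(** * Vague convergence of the large noise *)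

Lemma ler_dist_itv {R : realType} (M x y : R) : 0 <= x -> x <= M -> 0 <= y -> y <= M -> `|x - y| <= M.
Proof. by move=> ? ? ? ?; rewrite ler_norml; apply/andP; split; lra. Qed.

Lemma bounded_integrable {disp : measure_display} {X : measurableType disp} {R : realType}
    (Q : probability X R) (f : X -> R) (M : R) : measurable_fun setT f ->
  (forall x, `|f x| <= M) -> Q.-integrable setT (EFin \o f).
Proof.
move=> mf fM; apply: measurable_bounded_integrable => //.
  by rewrite (le_lt_trans (probability_le1 Q measurableT))// ltry.
exists M; split; first exact: num_real.
by move=> y My x _ /=; rewrite (le_trans (fM x))// ltW.
Qed.

Lemma nbhs_enorm {R : realType} n (z : 'cV[R]_n) (V : set 'cV[R]_n) : nbhs z V ->
  exists2 e, 0 < e & forall y, enorm (y - z) < e -> V y.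
Proof.
move=> /nbhs_ballP[e e0 h]; exists e => // y yz; apply: h.
rewrite -ball_normE/= distrC (le_lt_trans (norm_le_enorm _))//.
Qed.

Lemma compact_enorm_ball {R : realType} n (K : R) : compact [set w : 'cV[R]_n | enorm w <= K].
Proof.
have c2 : compact ((fun v : 'rV[R]_n => v^T) @` [set v : 'rV[R]_n | forall i, `[- K, K]%classic (v ord0 i)]).
  apply: continuous_compact; last exact: (@rV_compact _ _ (fun=> `[- K, K]%classic) (fun i => @segment_compact _ _ _)).
  apply: continuous_subspaceT => v; have FFv := nbhs_filter v; apply/enorm_cvgP => e e0.
  have e1 : 0 < e / n.+1%:R by rewrite divr_gt0.
  have vv : u @[u --> v] --> v by exact: cvg_id.
  have {}vv : \forall u \near v, `|v - u| < e / n.+1%:R by exact: ((cvgrPdist_lt _ _).1 vv).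
  near=> u; have uv : `|u - v| < e / n.+1%:R by rewrite distrC; near: u.
  rewrite (le_lt_trans (enorm_le_norm _))//.
  apply: (@le_lt_trans _ _ (n.+1%:R * `|u - v|)); last by rewrite mulrC -ltr_pdivlMr.
  rewrite ler_pM ?ler_nat// -linearB [leLHS]/Num.norm/= !mx_normrE; apply/bigmax_leP; split => [|i _].
    by rewrite [leRHS]/Num.norm/= mx_normrE; apply: bigmax_ge_id.
  by rewrite mxE [leRHS]/Num.norm/= mx_normrE (le_trans _ (le_bigmax _ _ (i.2, i.1))).
apply: (subclosed_compact _ c2).
- rewrite (_ : [set _ | _] = (fun w : 'cV[R]_n => enorm w) @^-1` [set x | x <= K])//.
  by apply: closed_comp => [w _|]; [exact: continuous_enorm|exact: closed_le].
- move=> w /= wK; exists w^T; last by rewrite trmxK.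
  move=> i; rewrite /= in_itv/= mxE -ler_norml (le_trans _ wK)//; exact: enorm_coord.
Unshelve. all: by end_near. Qed.

Lemma Rintegral_mpowerS {disp : measure_display} {X : measurableType disp} {R : realType}
    (mu : {sigma_finite_measure set X -> \bar R}) k (f : k.+1.-tuple X -> R) :
  measurable_fun setT f -> (forall t, 0 <= f t) ->
  (forall x, (\int[mpower mu k]_s (f [tuple of x :: s])%:E < +oo)%E) ->
  \int[mpower mu k.+1]_t f t = \int[mu]_x \int[mpower mu k]_s f [tuple of x :: s].
Proof.
move=> mf f0 foo; rewrite /Rintegral integral_mpowerS//; last exact/measurable_EFinP.
congr fine; apply: eq_integral => x _; rewrite fineK// ge0_fin_numE//.
by apply: integral_ge0 => s _; rewrite lee_fin.
Qed.

Definition scale_tuple {R : realType} {n : nat} k (c : R) (t : k.-tuple 'cV[R]_n) : k.-tuple 'cV[R]_n :=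
  [tuple of map (fun w => c *: w) t].

Lemma measurable_scale_tuple {R : realType} n k (c : R) :
  measurable_fun setT (scale_tuple c : k.-tuple (borel 'cV[R]_n.+1) -> k.-tuple (borel 'cV[R]_n.+1)).
Proof.
apply/measurable_fun_tnthP => i.
rewrite (_ : _ \o _ = ( *:%R c : borel 'cV[R]_n.+1 -> borel 'cV[R]_n.+1) \o (@tnth k (borel 'cV[R]_n.+1))^~ i).
  apply: measurableT_comp; last exact: measurable_tnth.
  by apply: continuous_borel_measurable; exact: scaler_continuous.
by apply/funext => t /=; rewrite tnth_map.
Qed.

Section vague_limit.
Context {R : realType} {d : nat} {disp : measure_display} {Omega : measurableType disp}.
Local Notation Rd := 'cV[R]_d.+1.
Variables (P : probability Omega R) (Z : {RV P >-> borel Rd}) (alpha : R).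
Hypothesis alpha_gt1 : 1 < alpha.
Local Notation H := (tail_prob P Z).
Hypothesis Hreg : forall t : R, 0 < t -> H (t * x) / H x @[x --> +oo] --> t `^ (- alpha).
Variable rho : {sigma_finite_measure set (borel Rd) -> \bar R}.
Hypothesis rho_fin : forall r : R, 0 < r -> (rho [set z : Rd | (r <= enorm z)%R] < +oo)%E.
Hypothesis rho_cvg : forall (g : Rd -> R) (r M : R), 0 < r -> continuous g ->
  (forall z, 0 <= g z <= M) -> (forall z, enorm z <= r -> g z = 0) ->
  (\int[P]_w (g (x^-1 *: (Z w : Rd)))%:E * ((tail_prob P Z x)^-1)%:E @[x --> +oo%R]
    --> \int[rho]_z (g z)%:E)%E.

Definition law : probability (borel Rd) R := distribution P Z.
Local Notation mu := law.

Let mZ : measurable_fun setT (fun w => enorm (Z w : Rd)).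
Proof. exact: (measurableT_comp (@measurable_enorm R d.+1)). Qed.

Lemma law_tail s : mu [set w : Rd | (s < enorm w)%R] = (H s)%:E.
Proof. by rewrite -(tail_probE P mZ). Qed.

Let H0 x : 0 < H x. Proof. exact: (tail_prob_gt0 mZ Hreg). Qed.

Section along_filter.
Context {J : Type} {F : set_system J} {FF : ProperFilter F}.
Variable eta : J -> R.
Hypothesis eta0 : eta @ F --> 0^'+.

Let eta_gt0 : \forall j \near F, 0 < eta j.
Proof. exact: eta0 (nbhs_right_gt 0). Qed.

Let eta_inv : (eta j)^-1 @[j --> F] --> +oo.
Proof.
apply/gtr0_cvgV0; first by apply: filterS eta_gt0 => j e0; rewrite invr_gt0.
have e1 : eta @ F --> 0 by apply: (cvg_trans eta0); exact: cvg_within.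
apply: cvg_trans e1.
by apply: near_eq_cvg; apply: nearW => j /=; rewrite invrK.
Qed.

Lemma tail_ratio_cvg t : 0 < t -> H (t / eta j) / H (eta j)^-1 @[j --> F] --> t `^ (- alpha).
Proof. by move=> t0; exact: (cvg_comp _ _ eta_inv (Hreg t0)). Qed.

Lemma rho_cvg_filter (g : Rd -> R) (r M : R) : 0 < r -> continuous g ->
  (forall z, 0 <= g z <= M) -> (forall z, enorm z <= r -> g z = 0) ->
  (H (eta j)^-1)^-1 * \int[mu]_w g (eta j *: (w : Rd)) @[j --> F] --> \int[rho]_z g (z : Rd).
Proof.
move=> r0 gc gM gr; have := cvg_comp _ _ eta_inv (rho_cvg r0 gc gM gr).
have mg : measurable_fun setT (g : borel Rd -> R) by exact: borel_measurable_continuous.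
have g0 z : 0 <= g z by have /andP[] := gM z.
have Ifin : (\int[rho]_z (g z)%:E)%E \is a fin_num.
  rewrite ge0_fin_numE; last by apply: integral_ge0 => z _; rewrite lee_fin.
  have mr := @measurable_enorm_ge R d.+1 r.
  apply: (@le_lt_trans _ _ (\int[rho]_z (M * \1_[set z : Rd | r <= enorm z] z)%:E)%E).
    apply: ge0_le_integral => //.
    - by move=> z _; rewrite lee_fin.
    - exact/measurable_EFinP.
    - by apply/measurable_EFinP; apply: measurable_funM => //; exact: measurable_indic.
    - move=> z _; rewrite lee_fin indicE; case: (boolP (z \in _)) => [_|].
        by rewrite mulr1; have /andP[] := gM z.
      rewrite notin_setE/= => /negP; rewrite -ltNge => /ltW zr.
      by rewrite gr// mulr0.
  under eq_integral do rewrite EFinM.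
  have M0 : 0 <= M by have /andP[/le_trans h /h] := gM 0.
  rewrite ge0_integralZl//; last by apply/measurable_EFinP; exact: measurable_indic.
  rewrite integral_indic// setIT; have := rho_fin r0.
  by rewrite -ge0_fin_numE// => h; rewrite -ge0_fin_numE ?mule_ge0// fin_numM.
rewrite -(fineK Ifin) => /fine_cvg; apply: cvg_trans; apply: near_eq_cvg.
near=> j => /=; rewrite invrK mulrC.
rewrite /Rintegral ge0_integral_distribution//; first last.
- by move=> y; rewrite lee_fin.
- apply/measurable_EFinP; apply: (measurableT_comp mg).
  by apply: continuous_borel_measurable; exact: scaler_continuous.
have f1 : (\int[P]_w (g (eta j *: (Z w : Rd)))%:E)%E \is a fin_num.
  rewrite ge0_fin_numE; last by apply: integral_ge0 => z _; rewrite lee_fin.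
  apply: (@le_lt_trans _ _ (\int[P]_w M%:E)%E).
    apply: ge0_le_integral => //.
    - by move=> z _; rewrite lee_fin.
    - apply/measurable_EFinP; apply: (measurableT_comp mg).
      apply: (@measurableT_comp _ _ _ _ _ _ ( *:%R (eta j) : borel Rd -> borel Rd)) => //.
      by apply: continuous_borel_measurable; exact: scaler_continuous.
    - by move=> z _; rewrite lee_fin; have /andP[] := gM (eta j *: (Z z : Rd)).
  by rewrite integral_cst// [X in (_ * X)%E](_ : _ = 1%E) ?mule1 ?ltry//; exact: probability_setT.
by rewrite fineM.
Unshelve. all: by end_near. Qed.

End along_filter.

(** On a large ball the functions are uniformly close to [g] by compactness, and the mass that
    counts is bounded since they vanish near 0; outside, they are bounded by [M] and the tail ratio
    is small. What remains is the convergence for the fixed function [g]. *)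
Lemma vague_cvg1 {J : Type} {F : set_system J} {FF : ProperFilter F} (eta : J -> R)
    (G : J -> Rd -> R) (g : Rd -> R) (r M : R) : 0 < r -> eta @ F --> 0^'+ ->
  (\forall j \near F, [/\ measurable_fun setT (G j : borel Rd -> R),
     forall w, 0 <= G j w <= M & forall w, enorm w <= r -> G j w = 0]) ->
  (forall w e, 0 < e -> exists2 b, 0 < b & \forall j \near F,
    forall w', enorm (w' - w) < b -> `|G j w' - g w| < e) ->
  (H (eta j)^-1)^-1 * \int[mu]_w G j (eta j *: (w : Rd)) @[j --> F] --> \int[rho]_z g (z : Rd).
Proof.
move=> r0 eta0 Gnear Gg.
have Gw w e : 0 < e -> \forall j \near F, `|G j w - g w| < e.
  by move=> e0; have [b b0] := Gg w e e0; apply: filterS => j; apply; rewrite subrr enorm0.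
have gM w : 0 <= g w <= M.
  apply/andP; split; apply/ler_addgt0Pr => e e0.
    have [j [[_ /(_ w)/andP[h _] _]]] := filter_ex (filterI Gnear (Gw w e e0)).
    by rewrite ltr_distl => /andP[_ h2]; rewrite (le_trans h)// ltW.
  have [j [[_ /(_ w)/andP[_ h] _]]] := filter_ex (filterI Gnear (Gw w e e0)).
  by rewrite ltr_distl ltrBlDr => /andP[h1 _]; rewrite (le_trans (ltW h1))// lerD2r.
have gr w : enorm w <= r -> g w = 0.
  move=> wr; apply/eqP; rewrite eq_le; have /andP[-> _] := gM w; rewrite andbT.
  apply/ler_addgt0Pr => e e0.
  have [j [[_ _ /(_ w wr) h]]] := filter_ex (filterI Gnear (Gw w e e0)).
  by rewrite h ltr_distl ltrBlDr => /andP[h1 _]; rewrite ltW.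
have gcont : continuous g.
  move=> w; have FFw := nbhs_filter w; apply/cvgrPdist_lt => e e0.
  have e2 : 0 < e / 2 by rewrite divr_gt0.
  have [b b0 hb] := Gg w _ e2.
  apply: filterS (continuous_enorm_near w b0) => w' w'w.
  have [j [/(_ w' w'w) h1 h2]] := filter_ex (filterI hb (Gw w' _ e2)).
  rewrite -(subrKA (G j w')) (le_lt_trans (ler_normD _ _))// (splitr e) ltrD//.
  by rewrite distrC.
have M0 : 0 <= M by have /andP[/le_trans h /h] := gM 0.
have mg : measurable_fun setT (g : borel Rd -> R) by exact: borel_measurable_continuous.
have mscale c : measurable_fun setT ( *:%R c : borel Rd -> borel Rd).
  by apply: continuous_borel_measurable; exact: scaler_continuous.
have Lim : (H (eta j)^-1)^-1 * \int[mu]_w g (eta j *: (w : Rd)) @[j --> F] --> \int[rho]_z g (z : Rd).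
  by apply: rho_cvg_filter; eassumption.
apply/cvgrPdist_lt => e e0.
(* As [alpha > 1], it is enough that [K >= 1] and [M / K < e / 4]. *)
have [K K0 MK] : exists2 K : R, 0 < K & M * K `^ (- alpha) < e / 4.
  exists (4 * M / e + 1); first by rewrite ltr_wpDl// divr_ge0 ?mulr_ge0// ltW.
  set K := _ + 1; have K1 : 1 <= K by rewrite lerDr divr_ge0 ?mulr_ge0// ltW.
  have K0 : 0 < K by exact: lt_le_trans K1.
  apply: (@le_lt_trans _ _ (M * K^-1)).
    rewrite ler_wpM2l// -powR_inv1 ?(ltW K0)//.
    by rewrite ler_powR// lerN2 ltW.
  rewrite ltr_pdivrMr// /K mulrDr mulr1 mulrC -mulrA [_ * (e / 4)]mulrC (_ : e / 4 * _ = M).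
    by rewrite ltrDl divr_gt0.
  by field; rewrite gt_eqF.
(* For small [eta] the normalised mass outside the ball of radius [r] is less than the bracket, so a
   uniform error [e1] contributes at most [e / 4]. *)
pose e1 := e / (4 * (r `^ (- alpha) + 1)).
have r1 : 0 < r `^ (- alpha) + 1 by rewrite ltr_wpDl// powR_ge0.
have e10 : 0 < e1 by rewrite divr_gt0// mulr_gt0.
have unif : \forall j \near F, forall w, enorm w <= K -> `|G j w - g w| <= e1.
  have : \forall j \near F, forall w, [set w : Rd | enorm w <= K] w -> `|G j w - g w| <= e1.
    apply: (compact_near_coveringP _).1.
      exact: compact_enorm_ball.
    move=> w _; have e12 : 0 < e1 / 2 by rewrite divr_gt0.
    have [b b0 hb] := Gg w _ e12.
    have FFw := nbhs_filter w.
    have gn : \forall w' \near w, `|g w - g w'| < e1 / 2 by exact: ((cvgrPdist_lt _ _).1 (gcont w)).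
    exists ([set w' | enorm (w' - w) < b /\ `|g w - g w'| < e1 / 2],
            [set j | forall w', enorm (w' - w) < b -> `|G j w' - g w| < e1 / 2]).
      split => //=; apply: filterI => //; exact: continuous_enorm_near.
    move=> [w' j] /= [[h1 h2] h3]; rewrite -(subrKA (g w)).
    rewrite (le_trans (ler_normD _ _))// (splitr e1) lerD ?ltW//; exact: h3.
  by apply: filterS => j h w wK; exact: h.
have tr : H (r / eta j) / H (eta j)^-1 @[j --> F] --> r `^ (- alpha) by exact: tail_ratio_cvg.
have tK : H (K / eta j) / H (eta j)^-1 @[j --> F] --> K `^ (- alpha) by exact: tail_ratio_cvg.
have trn : \forall j \near F, H (r / eta j) / H (eta j)^-1 < r `^ (- alpha) + 1.
  by apply: (cvgr_lt _ tr); rewrite ltrDl.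
have tKn : \forall j \near F, M * (H (K / eta j) / H (eta j)^-1) < e / 4.
  by apply: (cvgr_lt _ (cvgM (cvg_cst M) tK)).
have Ln : \forall j \near F, `|\int[rho]_z g (z : Rd) - (H (eta j)^-1)^-1 * \int[mu]_w g (eta j *: (w : Rd))| < e / 2.
  by apply: ((cvgrPdist_lt _ _).1 Lim); rewrite divr_gt0.
have en : \forall j \near F, 0 < eta j by exact: eta0 (nbhs_right_gt 0).
near=> j.
have ej : 0 < eta j by near: j.
have [mG GM Gr] : [/\ measurable_fun setT (G j : borel Rd -> R),
     forall w, 0 <= G j w <= M & forall w, enorm w <= r -> G j w = 0] by near: j.
have Hj := H0 (eta j)^-1.
pose err (w : borel Rd) : R := e1 * \1_[set w : borel Rd | r / eta j < enorm (w : Rd)] w +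
  M * \1_[set w : borel Rd | K / eta j < enorm (w : Rd)] w.
have merr : measurable_fun setT err.
  by apply: measurable_funD; apply: measurable_funM => //; apply: measurable_indic; exact: measurable_enorm_gt.
have iG : mu.-integrable setT (EFin \o (fun w : borel Rd => G j (eta j *: (w : Rd)))).
  apply: (@bounded_integrable _ _ _ mu _ (M)); first exact: (measurableT_comp mG).
  by move=> w; have /andP[h1 h2] := GM (eta j *: (w : Rd)); rewrite ger0_norm.
have ig : mu.-integrable setT (EFin \o (fun w : borel Rd => g (eta j *: (w : Rd)))).
  apply: (@bounded_integrable _ _ _ mu _ (M)); first exact: (measurableT_comp mg).
  by move=> w; have /andP[h1 h2] := gM (eta j *: (w : Rd)); rewrite ger0_norm.
have I0 (A : set (borel Rd)) w : 0 <= \1_A w :> R by rewrite indicE ler0n.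
have ierr : mu.-integrable setT (EFin \o err).
  apply: (@bounded_integrable _ _ _ mu _ (e1 + M)) => // w.
  have err0 : 0 <= err w by apply: addr_ge0; apply: mulr_ge0; rewrite ?(ltW e10)//; exact: I0.
  rewrite ger0_norm// /err.
  by rewrite lerD// ler_piMr ?(ltW e10)// indicE lern1 leq_b1.
have err_int : \int[mu]_w err w = e1 * H (r / eta j) + M * H (K / eta j).
  have ii s : mu.-integrable setT (EFin \o (\1_[set w : borel Rd | s < enorm (w : Rd)] : borel Rd -> R)).
    apply: (@bounded_integrable _ _ _ mu _ (1)); first by apply: measurable_indic; exact: measurable_enorm_gt.
    by move=> u; rewrite indicE ger0_norm// lern1 leq_b1.
  have iv s : \int[mu]_w (\1_[set w : borel Rd | s < enorm (w : Rd)] w) = H s.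
    rewrite /Rintegral integral_indic//; last exact: measurable_enorm_gt.
    by rewrite setIT [X in fine X](law_tail s).
  rewrite RintegralD//; [|exact: (integrableZl _ _ (ii _))|exact: (integrableZl _ _ (ii _))].
  by rewrite !RintegralZl// !iv.
have diff : `|\int[mu]_w G j (eta j *: (w : Rd)) - \int[mu]_w g (eta j *: (w : Rd))|
    <= e1 * H (r / eta j) + M * H (K / eta j).
  have iGg := integrableB measurableT iG ig.
  have iGg' : mu.-integrable setT (EFin \o (fun w : borel Rd => G j (eta j *: (w : Rd)) - g (eta j *: (w : Rd)))) by [].
  rewrite -RintegralB// -err_int; apply: (le_trans (le_normr_Rintegral measurableT iGg')).
  have iGa : mu.-integrable setT (EFin \o (fun w : borel Rd => `|G j (eta j *: (w : Rd)) - g (eta j *: (w : Rd))|)).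
    exact: (integrable_abse iGg').
  apply: (le_Rintegral measurableT iGa ierr) => w _ /=.
  have enw : enorm (eta j *: (w : Rd)) = eta j * enorm (w : Rd) by rewrite enormZ gtr0_norm.
  rewrite /err; have [wr|rw] := leP (enorm (eta j *: (w : Rd))) r.
    rewrite Gr// gr// subrr normr0.
    by apply: addr_ge0; apply: mulr_ge0; rewrite ?(ltW e10)//; exact: I0.
  have -> : \1_[set w : borel Rd | r / eta j < enorm (w : Rd)] w = 1 :> R.
    by rewrite indicE mem_set//= ltr_pdivrMr// mulrC -enw.
  have [wK|Kw] := leP (enorm (eta j *: (w : Rd))) K.
    rewrite mulr1 (@le_trans _ _ e1)//; last by rewrite lerDl mulr_ge0.
    by move: wK; move: (eta j *: (w : Rd)); near: j.
  have -> : \1_[set w : borel Rd | K / eta j < enorm (w : Rd)] w = 1 :> R.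
    by rewrite indicE mem_set//= ltr_pdivrMr// mulrC -enw.
  rewrite !mulr1 (@le_trans _ _ M)//; last by rewrite lerDr ltW.
  have /andP[a1 a2] := GM (eta j *: (w : Rd)); have /andP[b1 b2] := gM (eta j *: (w : Rd)).
  exact: ler_dist_itv.
rewrite -(subrKA ((H (eta j)^-1)^-1 * \int[mu]_w g (eta j *: (w : Rd)))).
rewrite (le_lt_trans (ler_normD _ _))// (splitr e) ltrD//; first by near: j.
rewrite -mulrBr normrM gtr0_norm ?invr_gt0// distrC.
apply: (@le_lt_trans _ _ ((H (eta j)^-1)^-1 * (e1 * H (r / eta j) + M * H (K / eta j)))).
  by rewrite ler_wpM2l// invr_ge0 ltW.
have -> : (H (eta j)^-1)^-1 * (e1 * H (r / eta j) + M * H (K / eta j)) =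
   e1 * (H (r / eta j) / H (eta j)^-1) + M * (H (K / eta j) / H (eta j)^-1) by ring.
have -> : e / 2 = e1 * (r `^ (- alpha) + 1) + e / 4.
  by rewrite /e1; field; rewrite gt_eqF.
by rewrite ltrD ?ltr_pM2l//; near: j.
Unshelve. all: by end_near. Qed.

Definition vanishing_near0 k (r M : R) (G : k.-tuple Rd -> R) :=
  [/\ measurable_fun setT (G : k.-tuple (borel Rd) -> R), forall w, 0 <= G w <= M &
   forall w i, enorm (tnth w i) <= r -> G w = 0].

(** Continuous convergence: index and argument tend to their limits together. It makes the limit
    continuous, and it is preserved when one argument is integrated out. *)
Definition cvg_jointly {J : Type} (F : set_system J) k (G : J -> k.-tuple Rd -> R)
    (g : k.-tuple Rd -> R) :=
  forall w e, 0 < e -> exists2 b, 0 < b & \forall j \near F,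
    forall w', (forall i, enorm (tnth w' i - tnth w i) < b) -> `|G j w' - g w| < e.

Section joint_limit.
Context {J : Type} {F : set_system J} {FF : ProperFilter F} (k : nat).
Variables (G : J -> k.-tuple Rd -> R) (g : k.-tuple Rd -> R) (r M : R).
Hypothesis Gv : \forall j \near F, vanishing_near0 r M (G j).
Hypothesis Gg : cvg_jointly F G g.

Let Gw w e : 0 < e -> \forall j \near F, `|G j w - g w| < e.
Proof.
by move=> e0; have [b b0] := Gg w e0; apply: filterS => j; apply => i; rewrite subrr enorm0.
Qed.

Lemma joint_limit_vanishing : vanishing_near0 r M g.
Proof.
split.
- pose F' (y : 'I_k * 'I_d.+1 -> R) := g [tuple (\col_l y (i, l) : Rd) | i < k].
  pose u (il : 'I_k * 'I_d.+1) (t : k.-tuple (borel Rd)) : R := (tnth t il.1 : Rd) il.2 ord0.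
  have colE t : [tuple (\col_l u (i, l) t : Rd) | i < k] = t.
    by apply: eq_from_tnth => i; rewrite tnth_mktuple; apply/colP => l; rewrite mxE.
  rewrite (_ : g = fun t => F' (u^~ t)); last by apply/funext => t; rewrite /F' colE.
  apply: measurable_real_coords.
    move=> [i l]; apply: (measurableT_comp (@measurable_coord R d.+1 l)).
    exact: measurable_tnth.
  move=> w e e0; have e2 : 0 < e / 2 by rewrite divr_gt0.
  have [b b0 hb] := Gg w e2; exists (b / (d.+2)%:R); first by rewrite divr_gt0.
  move=> y yu; rewrite /F' colE; set w' := [tuple _ | i < k].
  have w'w i : enorm (tnth w' i - tnth w i) < b.
    rewrite (le_lt_trans (enorm_le_sum _))// tnth_mktuple.
    apply: (@le_lt_trans _ _ (\sum_(l < d.+1) (b / d.+2%:R))).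
      by apply: ler_sum => l _; rewrite !mxE; exact: yu (i, l).
    rewrite sumr_const card_ord -[ltLHS]mulr_natr -mulrA gtr_pMr//.
    by rewrite mulrC ltr_pdivrMr// mul1r ltr_nat.
  have [j [/(_ w' w'w) h1 h2]] := filter_ex (filterI hb (Gw w' e2)).
  rewrite -(subrKA (G j w')) (le_trans (ler_normD _ _))// (splitr e) lerD// ltW//.
  by rewrite distrC.
- move=> w; apply/andP; split; apply/ler_addgt0Pr => e e0.
    have [j [[_ /(_ w)/andP[h _] _]]] := filter_ex (filterI Gv (Gw w e0)).
    by rewrite ltr_distl => /andP[_ h2]; rewrite (le_trans h)// ltW.
  have [j [[_ /(_ w)/andP[_ h] _]]] := filter_ex (filterI Gv (Gw w e0)).
  by rewrite ltr_distl ltrBlDr => /andP[h1 _]; rewrite (le_trans (ltW h1))// lerD2r.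
- move=> w i wr; have h0 e : 0 < e -> `|g w| < e.
    move=> e0; have [j [[_ _ /(_ w i wr) h]]] := filter_ex (filterI Gv (Gw w e0)).
    by rewrite h sub0r normrN.
  by apply/eqP; rewrite -normr_le0; apply/ler_addgt0Pr => e e0; rewrite add0r ltW// h0.
Qed.

End joint_limit.

Lemma integral_vanishing_le (nu : {sigma_finite_measure set (borel Rd) -> \bar R}) k r M
    (G : k.-tuple Rd -> R) : vanishing_near0 r M G ->
  (\int[mpower nu k]_w (G w)%:E <= M%:E * (nu [set w : Rd | (r < enorm w)%R]) ^+ k)%E.
Proof.
move=> [mG GM Gr]; have M0 : 0 <= M by have /andP[/le_trans h /h] := GM [tuple of nseq k 0].
pose B (_ : 'I_k) : set (borel Rd) := [set w : Rd | r < enorm w].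
have mB i : measurable (B i) by exact: measurable_enorm_gt.
have mR := measurable_rectangle mB.
apply: (@le_trans _ _ (\int[mpower nu k]_w (M * \1_(rectangle B) w)%:E)%E).
  apply: ge0_le_integral => //.
  - by move=> w _; rewrite lee_fin; have /andP[] := GM w.
  - exact/measurable_EFinP.
  - by apply/measurable_EFinP; apply: measurable_funM => //; exact: measurable_indic.
  - move=> w _; rewrite lee_fin indicE; case: (boolP (w \in _)) => [_|].
      by rewrite mulr1; have /andP[] := GM w.
    rewrite notin_setE /rectangle/= => /existsNP[i /negP]; rewrite -leNgt => wr.
    by rewrite (Gr w i wr) mulr0.
under eq_integral do rewrite EFinM.
rewrite ge0_integralZl//; last by apply/measurable_EFinP; exact: measurable_indic.
rewrite integral_indic// setIT [X in (_ * X <= _)%E](mpower_rectangle nu mB).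
apply: lee_wpmul2l; first by rewrite lee_fin.
rewrite /B -/(nu _); elim: (k) => [|n ih]; first by rewrite big_ord0.
by rewrite big_ord_recl expeS lee_wpmul2l.
Qed.

(** Induction on [k], integrating the first vector last. All filters are covered by the statement
    because the inner integral depends on the index and on the first vector at once: the induction
    hypothesis is applied along their product filter. *)
Lemma vague_cvg {J : Type} {F : set_system J} {FF : ProperFilter F} (eta : J -> R) k
    (G : J -> k.-tuple Rd -> R) (g : k.-tuple Rd -> R) (r M : R) : 0 < r -> eta @ F --> 0^'+ ->
  (\forall j \near F, vanishing_near0 r M (G j)) -> cvg_jointly F G g ->
  (H (eta j)^-1)^-1 ^+ k * \int[mpower mu k]_w G j (scale_tuple (eta j) w) @[j --> F] -->
    \int[mpower rho k]_w g w.
Proof.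
move=> r0; elim: k J F FF eta G g M => [|k ih] J F FF eta G g M eta0 Gv Gg.
  rewrite /Rintegral integral_mpower0/=; apply/cvgrPdist_lt => e e0.
  have [b b0] := Gg [tuple] e e0; apply: filterS => j /(_ [tuple]) h.
  rewrite expr0 mul1r distrC.
  have -> : fine (\int[\d_([tuple] : 0.-tuple (borel Rd))]_x (G j (scale_tuple (eta j) (x : 0.-tuple Rd)))%:E)%E = G j [tuple].
    rewrite (integral_mpower0 mu (fun x : 0.-tuple (borel Rd) => (G j (scale_tuple (eta j) (x : 0.-tuple Rd)))%:E)).
    by congr (G j _); apply/val_inj.
  by apply: h => -[].
have [mg gM gr] := joint_limit_vanishing Gv Gg.
have g0 w : 0 <= g w by have /andP[] := gM w.
have M0 : 0 <= M by have /andP[/le_trans h /h] := gM [tuple of nseq k.+1 0].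
have mcons x : measurable_fun setT (fun s : k.-tuple (borel Rd) => [tuple of x :: s]).
  have := @measurable_tcons _ (borel Rd) k.
  by move=> h; exact: (measurableT_comp h (pair1_measurable x)).
have tnth_cons (x : Rd) (s : k.-tuple Rd) i : tnth [tuple of x :: s] (lift ord0 i) = tnth s i by rewrite tnthS.
have vcons x G' : @vanishing_near0 k.+1 r M G' -> vanishing_near0 r M (fun s : k.-tuple Rd => G' [tuple of x :: s]).
  move=> [mG GM Gr]; split => //.
  - exact: (measurableT_comp mG).
  - by move=> w i wr; apply: (Gr _ (lift ord0 i)); rewrite tnth_cons.
have rfin k' : ((rho [set w : Rd | (r < enorm w)%R]) ^+ k' < +oo)%E.
  have mr : measurable ([set w : Rd | r < enorm w] : set (borel Rd)) := @measurable_enorm_gt R d.+1 r.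
  have f1 : rho [set w : Rd | r < enorm w] \is a fin_num.
    rewrite ge0_fin_numE// (le_lt_trans _ (rho_fin r0))// le_measure ?inE//.
      exact: measurable_enorm_ge.
    by move=> w /= /ltW.
  by rewrite -(fineK f1) -EFin_expe ltry.
rewrite (Rintegral_mpowerS (mu := rho))//; last first.
  move=> x; apply: (le_lt_trans (integral_vanishing_le rho (vcons x g _))) => //.
  have f1 := rfin k; rewrite -ge0_fin_numE in f1; last exact: expe_ge0.
  by rewrite -(fineK f1) -EFinM ltry.
have en : \forall j \near F, 0 < eta j by exact: eta0 (nbhs_right_gt 0).
pose phi j (x : Rd) := (H (eta j)^-1)^-1 ^+ k *
  \int[mpower mu k]_s G j [tuple of x :: scale_tuple (eta j) s].
(* Each of the [k] inner integrations costs a tail ratio, which is eventually below the bracket. *)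
pose C := (r `^ (- alpha) + 1) ^+ k * M.
have tr : H (r / eta j) / H (eta j)^-1 @[j --> F] --> r `^ (- alpha) by exact: tail_ratio_cvg.
have trn : \forall j \near F, H (r / eta j) / H (eta j)^-1 < r `^ (- alpha) + 1.
  by apply: (cvgr_lt _ tr); rewrite ltrDl.
have inner j x : 0 < eta j -> vanishing_near0 r M (G j) ->
    (\int[mpower mu k]_s (G j [tuple of x :: scale_tuple (eta j) s])%:E <=
      (M * H (r / eta j) ^+ k)%:E)%E.
  move=> ej [mG GM Gr].
  have v : vanishing_near0 (r / eta j) M (fun s => G j [tuple of x :: scale_tuple (eta j) s]).
    split => //.
    - apply: (measurableT_comp mG).
      by apply: (measurableT_comp (mcons x)); exact: measurable_scale_tuple.
    - move=> w i wr; apply: (Gr _ (lift ord0 i)).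
      by rewrite tnth_cons tnth_map enormZ gtr0_norm// mulrC -ler_pdivlMr.
  have := integral_vanishing_le mu v.
  by rewrite [X in (_ * X ^+ _)%E](law_tail _) -EFin_expe -EFinM.
have Hp x : 0 <= (H x)^-1 by rewrite invr_ge0 ltW.
have phi_near : \forall j \near F, [/\ measurable_fun setT (phi j : borel Rd -> R),
     forall w, 0 <= phi j w <= C & forall w, enorm w <= r -> phi j w = 0].
  near=> j; have ej : 0 < eta j by near: j.
  have v : vanishing_near0 r M (G j) by near: j.
  have [mG GM Gr] := v; have G0 w : 0 <= G j w by have /andP[] := GM w.
  split.
  - apply: measurable_funM => //; apply: (measurableT_comp (fine_measurable measurableT)).
    pose f (t : k.+1.-tuple (borel Rd)) := (G j [tuple of thead t :: scale_tuple (eta j) [tuple of behead t]])%:E.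
    have -> : (fun x : borel Rd => \int[mpower mu k]_s (G j [tuple of x :: scale_tuple (eta j) s])%:E)%E =
        (fun x => \int[mpower mu k]_s f [tuple of x :: s])%E.
      apply/funext => x; apply: eq_integral => s _; rewrite /f; congr (G j _)%:E.
      by apply: eq_from_tnth => i; congr tnth; apply/val_inj.
    apply: measurable_mpowerS; last by move=> t; rewrite lee_fin.
    apply/measurable_EFinP; apply: (measurableT_comp mG).
    apply/measurable_fun_tnthP => i; have [->|i0] := eqVneq i ord0.
      rewrite (_ : _ \o _ = (fun t : k.+1.-tuple (borel Rd) => thead t)).
        exact: measurable_tnth.
      by apply/funext => t /=; rewrite (tnth_nth (0 : Rd)).
    have [i' -> _] := unlift_some (negbT (introF eqP (fun e => negP i0 (introT eqP (esym e))))).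
    rewrite (_ : _ \o _ = ( *:%R (eta j) : borel Rd -> borel Rd) \o (@tnth k.+1 (borel Rd))^~ (lift ord0 i')).
      apply: measurableT_comp; last exact: measurable_tnth.
      by apply: continuous_borel_measurable; exact: scaler_continuous.
    apply/funext => t /=; rewrite tnth_cons tnth_map tnth_behead; congr (_ *: tnth _ _).
    by apply/val_inj; rewrite /= inordK// ltnS.
  - move=> w; rewrite mulr_ge0 ?exprn_ge0 ?Rintegral_ge0//=.
    have i0 : (0 <= \int[mpower mu k]_s (G j [tuple of w :: scale_tuple (eta j) s])%:E)%E.
      by apply: integral_ge0 => s _; rewrite lee_fin.
    have f1 : (\int[mpower mu k]_s (G j [tuple of w :: scale_tuple (eta j) s])%:E)%E \is a fin_num.
      by rewrite ge0_fin_numE// (le_lt_trans (inner j w ej v))// ltry.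
    have := inner j w ej v; rewrite -(fineK f1) lee_fin => h.
    apply: (@le_trans _ _ ((H (eta j)^-1)^-1 ^+ k * (M * H (r / eta j) ^+ k))).
      by rewrite ler_wpM2l// exprn_ge0.
    have E1 (x y z : R) : x ^+ k * (z * y ^+ k) = (y * x) ^+ k * z by rewrite exprMn; ring.
    rewrite E1 /C ler_wpM2r// lerXn2r ?nnegrE ?addr_ge0 ?powR_ge0 ?mulr_ge0 ?(ltW (H0 _))//.
    by apply: ltW; near: j.
  - move=> w wr; rewrite /phi /Rintegral (eq_integral (cst 0%E)) ?integral0 ?mulr0//.
    by move=> s _; rewrite (Gr _ ord0).
have phi_cvg w e : 0 < e -> exists2 b, 0 < b & \forall j \near F,
    forall w', enorm (w' - w) < b -> `|phi j w' - \int[mpower rho k]_s g [tuple of w :: s]| < e.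
  move=> e0; pose F' : set_system (J * Rd) := filter_prod F (nbhs w).
  have FF' : ProperFilter F' by exact: filter_prod_proper.
  pose G' (jw : J * Rd) (s : k.-tuple Rd) := G jw.1 [tuple of jw.2 :: s].
  have := ih _ F' FF' (eta \o fst) G' (fun s => g [tuple of w :: s]) M.
  move=> /(_ (cvg_comp _ _ cvg_fst eta0)) h.
  have {}h := h _ _.
  have H1 : \forall jw \near F', vanishing_near0 r M (G' jw).
    exists ([set j | vanishing_near0 r M (G j)], setT); first by split => //=; exact: filterT.
    by move=> [j w'] /= [v _]; exact: vcons.
  have H2 : cvg_jointly F' G' (fun s => g [tuple of w :: s]).
    move=> s e' e'0; have [b b0 hb] := Gg [tuple of w :: s] e' e'0; exists b => //.
    exists ([set j | forall w', (forall i, enorm (tnth w' i - tnth [tuple of w :: s] i) < b) ->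
      `|G j w' - g [tuple of w :: s]| < e'], [set w' | enorm (w' - w) < b]).
      by split => //=; exact: continuous_enorm_near.
    move=> [j w'] /= [h1 h2] s' s's; apply: h1 => i; have [->//|i0] := eqVneq i ord0.
    have [i' -> _] := unlift_some (negbT (introF eqP (fun e => negP i0 (introT eqP (esym e))))).
    by rewrite !tnth_cons.
  have {H1 H2}h := h H1 H2.
  have hn : \forall jw \near F', `|\int[mpower rho k]_s g [tuple of w :: s] -
      (H (eta jw.1)^-1)^-1 ^+ k * \int[mpower mu k]_s G' jw (scale_tuple (eta jw.1) s)| < e.
    by apply: ((cvgrPdist_lt _ _).1 h).
  case: hn => -[U V] /= [FU nV] UV.
  have [b b0 bV] := nbhs_enorm nV; exists b => //.
  apply: filterS FU => j Uj w' w'w; rewrite distrC.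
  exact: UV (j, w') (conj Uj (bV _ w'w)).
have := @vague_cvg1 J F FF eta phi _ r C r0 eta0 phi_near phi_cvg.
apply: cvg_trans; apply: near_eq_cvg; near=> j.
have ej : 0 < eta j by near: j.
have v : vanishing_near0 r M (G j) by near: j.
have [mG GM Gr] := v; have G0 w : 0 <= G j w by have /andP[] := GM w.
have fin1 x : (\int[mpower mu k]_s (G j (scale_tuple (eta j) [tuple of x :: s]))%:E < +oo)%E.
  have := le_lt_trans (inner j (eta j *: x) ej v) (ltry _).
  congr (_ < _)%E; apply: eq_integral => s _; congr (G j _)%:E.
  by apply/val_inj.
rewrite (Rintegral_mpowerS (mu := mu))//; last first.
  by apply: (measurableT_comp mG); exact: measurable_scale_tuple.
rewrite /phi [in RHS]exprS -mulrA; congr (_ * _).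
under eq_Rintegral do rewrite /phi.
have c0 : 0 < (H (eta j)^-1)^-1 ^+ k by rewrite exprn_gt0// invr_gt0.
have [mphi phiC _] : [/\ measurable_fun setT (phi j : borel Rd -> R),
     forall w, 0 <= phi j w <= C & forall w, enorm w <= r -> phi j w = 0] by near: j.
have phi0E x : \int[mpower mu k]_s G j [tuple of x :: scale_tuple (eta j) s] =
    ((H (eta j)^-1)^-1 ^+ k)^-1 * phi j x by rewrite /phi mulKf// gt_eqF.
have intg : mu.-integrable setT (EFin \o (fun x : borel Rd =>
    \int[mpower mu k]_s G j [tuple of eta j *: (x : Rd) :: scale_tuple (eta j) s])).
  rewrite (_ : _ \o _ = EFin \o (fun x : borel Rd => ((H (eta j)^-1)^-1 ^+ k)^-1 * phi j (eta j *: (x : Rd)))).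
    apply: (@bounded_integrable _ _ _ mu _ (((H (eta j)^-1)^-1 ^+ k)^-1 * C)).
      apply: measurable_funM => //; apply: (measurableT_comp mphi).
      by apply: continuous_borel_measurable; exact: scaler_continuous.
    have ci0 : 0 <= ((H (eta j)^-1)^-1 ^+ k)^-1 by rewrite invr_ge0 ltW.
    move=> x; have /andP[p0 pC] := phiC (eta j *: (x : Rd)).
    by rewrite ger0_norm; [exact: ler_wpM2l|exact: mulr_ge0].
  by apply/funext => x /=; rewrite phi0E.
rewrite (@RintegralZl _ _ _ mu setT _ _ measurableT intg).
congr (_ * _); apply: eq_Rintegral => x _; apply: eq_Rintegral => s _.
by congr (G j _); apply/val_inj.
Unshelve. all: by end_near. Qed.

End vague_limit.

(** * Jump times on the grid *)

Section index_sets.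
Context {n : nat}.
Implicit Type A : {set 'I_n}.

(** Elements of ['I_n] number the steps from 0, while noises and grid times are numbered from 1,
    hence the successor. Sets of grid times thus range over a finite type. *)
Definition idx A : seq nat := [seq (val i).+1 | i <- enum A].

Lemma size_idx A : size (idx A) = #|A|. Proof. by rewrite size_map -cardE. Qed.

Lemma mem_idx A (i : 'I_n) : (i.+1 \in idx A) = (i \in A).
Proof.
apply/mapP/idP => [[j jA [ij]]|iA]; first by rewrite -mem_enum (val_inj ij).
by exists i => //; rewrite mem_enum.
Qed.

Lemma idx_bound A q : q \in idx A -> (0 < q <= n)%N.
Proof. by move=> /mapP[i _ ->]; rewrite /= ltn_ord. Qed.

Lemma sorted_idx A : sorted ltn (idx A).
Proof.
rewrite /idx (map_comp S) sorted_map.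
apply: (@sub_sorted _ ltn) => //.
rewrite sorted_map /enum_mem; apply: sorted_filter; first by move=> i j l; exact: ltn_trans.
by have := iota_ltn_sorted 0 n; rewrite -val_enum_ord sorted_map enumT.
Qed.

Lemma path_idx A : path ltn 0 (idx A).
Proof.
have := sorted_idx A; have := @idx_bound A; case: (idx A) => //= p s h ->; rewrite andbT.
by have /andP[] := h p (mem_head _ _).
Qed.

Lemma idx_inj : injective idx.
Proof. by move=> A B AB; apply/setP => i; rewrite -!mem_idx AB. Qed.

Lemma ex_idx s : path ltn 0 s -> all (fun q => (q <= n)%N) s -> exists A, idx A = s.
Proof.
move=> ps sn; have ss : sorted ltn s by exact: path_sorted ps.
exists (finset (fun i : 'I_n => i.+1 \in s)); apply: (irr_sorted_eq ltn_trans ltnn) => //.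
  exact: sorted_idx.
move=> q; have [qn|nq] := boolP (0 < q <= n)%N.
  case: q qn => // q /= qn; have := mem_idx (finset (fun i : 'I_n => i.+1 \in s)) (Ordinal qn).
  by rewrite finset.in_set.
transitivity false; first by apply: contraNF nq; exact: idx_bound.
apply/esym; apply: contraNF nq => qs; rewrite (allP sn q qs) andbT.
have := ps; rewrite path_sortedE; last exact: ltn_trans.
by move=> /andP[/allP/(_ q qs)].
Qed.

End index_sets.

Section time_cells.
Context {R : realType} {n : nat} (k : nat).
Implicit Type A : {set 'I_n}.

(** A tuple of length [k] for every [A], cut or padded with 0, so that types carry no proof of
    [#|A| = k]. *)
Definition tidx A : k.-tuple nat := [tuple nth 0%N (idx A) j | j < k].

Lemma tidxE A : #|A| = k -> tidx A = idx A :> seq nat.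
Proof.
move=> Ak; apply: (@eq_from_nth _ 0%N); first by rewrite size_tuple size_idx.
by move=> i; rewrite size_tuple => ik; rewrite -(tnth_nth 0%N _ (Ordinal ik)) tnth_mktuple.
Qed.

Definition times (eta : R) A : k.-tuple R := [tuple of [seq i%:R * eta | i <- tidx A]].

Lemma tnth_times eta A j : tnth (times eta A) j = (nth 0%N (idx A) j)%:R * eta.
Proof. by rewrite tnth_map tnth_mktuple. Qed.

Let nth_idx_bound A (j : 'I_k) : #|A| = k -> (0 < nth 0%N (idx A) j <= n)%N.
Proof. by move=> Ak; apply: (@idx_bound _ A); rewrite mem_nth// size_idx Ak. Qed.

Let nth_idx_lt A (i j : 'I_k) : #|A| = k -> (i < j)%N -> (nth 0%N (idx A) i < nth 0%N (idx A) j)%N.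
Proof.
move=> Ak ij; apply: (sorted_ltn_nth ltn_trans 0%N (sorted_idx A)) => //.
all: by rewrite inE size_idx Ak.
Qed.

Lemma times_increasing (T eta : R) A : #|A| = k -> 0 < eta -> n%:R * eta <= T ->
  @increasing_tuples R k `]0, T]%classic (times eta A).
Proof.
move=> Ak e0 nT; split => [j|i j ij]; rewrite !tnth_times.
  have /andP[p0 pn] := nth_idx_bound j Ak.
  rewrite /= in_itv/= mulr_gt0 ?ltr0n//= (le_trans _ nT)//.
  by rewrite ler_pM2r// ler_nat.
by rewrite ltr_pM2r// ltr_nat; exact: nth_idx_lt.
Qed.

(** The box of side [eta] with the grid times of [A] as upper corner. For sets of size [k] the boxes
    are disjoint and of volume [eta ^+ k], so that the normalised sum over [A] is the integral of a
    step function. *)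
Definition cell (eta : R) A : set (k.-tuple (measurableTypeR R)) :=
  rectangle (fun j : 'I_k =>
    `[(nth 0%N (idx A) j).-1%:R * eta, (nth 0%N (idx A) j)%:R * eta[%classic : set (measurableTypeR R)).

Lemma measurable_cell eta A : measurable (cell eta A).
Proof. by apply: measurable_rectangle => i; exact: measurable_itv. Qed.

Lemma mpower_cell eta A : #|A| = k -> 0 < eta ->
  mpower lebesgue_measure k (cell eta A) = (eta ^+ k)%:E.
Proof.
move=> Ak e0; rewrite (mpower_rectangle lebesgue_measure); last by move=> i; exact: measurable_itv.
have E (i : 'I_k) : lebesgue_measure (`[(nth 0%N (idx A) i).-1%:R * eta, (nth 0%N (idx A) i)%:R * eta[%classic : set (measurableTypeR R)) = eta%:E.
  have /andP[p0 _] := nth_idx_bound i Ak.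
  rewrite lebesgue_measure_itv /= lte_fin ltr_pM2r// ltr_nat prednK// leqnn.
  rewrite -EFinB -mulrBl -natrB ?leq_pred//.
  by rewrite (_ : _ - _ = 1)%N ?mul1r//; move: p0; case: nth => // q _ /=; rewrite subSnn.
transitivity (\prod_(i < k) eta%:E)%E; first by apply: eq_bigr => i _; exact: E.
by rewrite prodEFin prodr_const card_ord.
Qed.

Lemma cell_times eta A (t : k.-tuple R) : #|A| = k -> 0 < eta -> cell eta A t ->
  forall j, `|tnth (times eta A) j - tnth t j| <= eta.
Proof.
move=> Ak e0 tA j; have := tA j; rewrite /= in_itv/= tnth_times => /andP[h1 h2].
have /andP[p0 _] := nth_idx_bound j Ak.
rewrite ger0_norm ?subr_ge0 ?(ltW h2)// lerBlDl (le_trans _ (lerD h1 (lexx eta)))//.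
by rewrite -{1}(prednK p0) -natr1 mulrDl mul1r.
Qed.

Lemma cell_inj eta (A B : {set 'I_n}) (t : k.-tuple R) : #|A| = k -> #|B| = k -> 0 < eta ->
  cell eta A t -> cell eta B t -> A = B.
Proof.
move=> Ak Bk e0 tA tB; apply: idx_inj; rewrite -(tidxE Ak) -(tidxE Bk); congr (val _).
apply: eq_from_tnth => j; rewrite !tnth_mktuple.
have /andP[p0 _] := nth_idx_bound j Ak; have /andP[q0 _] := nth_idx_bound j Bk.
have := tA j; have := tB j; rewrite /= !in_itv/= => /andP[h1 h2] /andP[h3 h4].
have := le_lt_trans h1 h4; have := le_lt_trans h3 h2; rewrite !ltr_pM2r// !ltr_nat.
by move: (nth _ _ _) (nth _ _ _) p0 q0 => p q; clear; lia.
Qed.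

Lemma cell_increasing (T eta : R) A (t : k.-tuple R) : #|A| = k -> 0 < eta -> n%:R * eta <= T ->
  cell eta A t -> @increasing_tuples R k `[0, T[%classic t.
Proof.
move=> Ak e0 nT tA; split => [j|i j ij].
  have /andP[p0 pn] := nth_idx_bound j Ak.
  have := tA j; rewrite /= !in_itv/= => /andP[h1 h2].
  rewrite (le_trans _ h1)/=; last by rewrite mulr_ge0// ltW.
  by rewrite (lt_le_trans h2)// (le_trans _ nT)// ler_pM2r// ler_nat.
have := tA j; have := tA i; rewrite /= !in_itv/= => /andP[h1 h2] /andP[h3 h4].
rewrite (lt_le_trans h2)// (le_trans _ h3)// ler_pM2r// ler_nat.
have := nth_idx_lt Ak ij; by move: (nth _ _ _) (nth _ _ _) => p q; clear; lia.
Qed.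

End time_cells.
Arguments cell {R n} k eta A.
Arguments times {R n} k eta A.

(** Gaps larger than [eta] put the times in distinct grid intervals, and the margin at [T] keeps the
    last interval within the grid. *)
Lemma ex_cell {R : realType} k (T eta : R) (t : k.-tuple R) : 0 < eta ->
  (forall j, 0 <= tnth t j) -> (forall j, tnth t j + eta < T) ->
  (forall i j : 'I_k, (i < j)%N -> tnth t i + eta < tnth t j) ->
  exists A : {set 'I_(Num.truncn (T / eta))}, #|A| = k /\ cell k eta A t.
Proof.
move=> e0 t0 tT tt.
have step x y : x + eta < y -> 0 <= x -> ((Num.truncn (x / eta)).+1 <= Num.truncn (y / eta))%N.
  move=> xy x0; have xe0 : 0 <= x / eta by rewrite divr_ge0// ltW.
  have /andP[h1 h2] := truncn_itv xe0.
  rewrite truncn_ge_nat; last by rewrite divr_ge0 ?ltW// (le_lt_trans _ xy)// addr_ge0// ltW.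
  rewrite ler_pdivlMr// -natr1 mulrDl mul1r (le_trans _ (ltW xy))// lerD2r.
  by rewrite -ler_pdivlMr.
pose s : seq nat := [tuple (Num.truncn (tnth t j / eta)).+1 | j < k].
have snth (j : 'I_k) : nth 0%N s j = (Num.truncn (tnth t j / eta)).+1.
  by rewrite -tnth_nth tnth_mktuple.
have sk : size s = k by rewrite size_tuple.
have ps : path ltn 0 s.
  apply/(pathP 0%N) => i; rewrite sk => ik; case: i ik => [|i] ik /=.
    by rewrite (snth (Ordinal ik)).
  rewrite (snth (Ordinal ik)) (snth (Ordinal (ltnW ik))) ltnS.
  by apply: step => //; exact: tt.
have sn : all (fun q => (q <= Num.truncn (T / eta))%N) s.
  apply/(all_nthP 0%N) => i; rewrite sk => ik; rewrite (snth (Ordinal ik)).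
  exact: step.
have [A As] := ex_idx ps sn; exists A; split; first by rewrite -size_idx As sk.
move=> j; rewrite /= in_itv/= As snth /=.
have xe0 : 0 <= tnth t j / eta by rewrite divr_ge0// ltW.
have /andP[h1 h2] := truncn_itv xe0.
by rewrite -ler_pdivlMr// h1 -ltr_pdivrMr.
Qed.

(** * Riemann sums over increasing grid times *)

Section time_limit.
Context {R : realType} (k : nat).
Local Notation leb := (mpower (@lebesgue_measure R) k).
Variables (T : R) (T0 : 0 < T).
Local Notation I := (@increasing_tuples R k `]0, T[%classic : set (k.-tuple (measurableTypeR R))).
Local Notation I' := (@increasing_tuples R k `]0, T]%classic).

Lemma measurable_increasing (J : interval R) :
  measurable (@increasing_tuples R k [set` J] : set (k.-tuple (measurableTypeR R))).
Proof.
have -> : @increasing_tuples R k [set` J] =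
    rectangle (fun=> [set` J] : set (measurableTypeR R)) `&`
    \bigcap_(p in [set p : 'I_k * 'I_k | (p.1 < p.2)%N])
      [set t : k.-tuple (measurableTypeR R) | (tnth t p.1 : R) < tnth t p.2].
  apply/seteqP; split=> t [h1 h2]; split=> //; first by move=> [i j] ij; exact: h2.
  by move=> i j ij; exact: (h2 (i, j)).
apply: measurableI; first by apply: measurable_rectangle => i; exact: measurable_itv.
apply: fin_bigcap_measurable => [|[i j] _]; first exact: finite_finset.
rewrite -[X in measurable X]setTI.
have mt (l : 'I_k) : measurable_fun setT (fun t : k.-tuple (measurableTypeR R) => tnth t l : R).
  exact: (@measurable_tnth _ (measurableTypeR R) k l).
by apply: (measurable_fun_ltr (mt i) (mt j) measurableT (Y := [set true])).
Qed.

(** Cells may contain points with a coordinate equal to 0, which are outside the open simplex; they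
    form a null set. *)
Let zeros : set (k.-tuple (measurableTypeR R)) := [set t | exists j, tnth t j = 0 :> R].

Let zeros_null : measurable zeros /\ leb zeros = 0%E.
Proof.
pose E (j i : 'I_k) : set (measurableTypeR R) := if i == j then [set 0] else setT.
have mE j i : measurable (E j i) by rewrite /E; case: ifP.
have -> : zeros = \bigcup_j rectangle (E j).
  apply/seteqP; split=> [t [j tj]|t [j _ tj]].
    by exists j => // i; rewrite /E; case: eqP => // ->.
  by exists j; have := tj j; rewrite /E eqxx.
have mr j : measurable (rectangle (E j)) by exact: measurable_rectangle.
split; first by apply: fin_bigcup_measurable => //; exact: finite_finset.
apply/eqP; rewrite -measure_le0 (le_trans (measure_bigcup_fintype_le _ mr))//.
suff z j : mpower lebesgue_measure k (rectangle (E j)) = 0%E.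
  by rewrite big1 ?lexx// => j _; exact: z.
rewrite (mpower_rectangle lebesgue_measure)// (bigD1 j)//= {1}/E eqxx.
have -> : lebesgue_measure ([set 0] : set (measurableTypeR R)) = 0%E by exact: lebesgue_measure_set1.
by rewrite mul0e.
Qed.

Variables (eta : nat -> R) (Phi : nat -> k.-tuple R -> R) (phi : k.-tuple R -> R) (C : R).
Hypothesis eta0 : eta n @[n --> \oo] --> 0^'+.
Hypothesis PhiC : \forall n \near \oo, forall s, I' s -> 0 <= Phi n s <= C.
Hypothesis Phi_phi : forall t, I t -> forall e, 0 < e -> exists2 b, 0 < b &
  \forall n \near \oo, forall s, I' s -> (forall j, `|tnth s j - tnth t j| < b) -> `|Phi n s - phi t| < e.

Local Notation N n := (Num.truncn (T / eta n)).

Let Q n (t : k.-tuple (measurableTypeR R)) : R :=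
  \sum_(A : {set 'I_(N n)} | #|A| == k) Phi n (times k (eta n) A) * \1_(cell k (eta n) A) t.

Let NT n : 0 < eta n -> (N n)%:R * eta n <= T.
Proof.
by move=> e0; rewrite -ler_pdivlMr//; have /andP[] := truncn_itv (divr_ge0 (ltW T0) (ltW e0)).
Qed.

Let QE n t (A : {set 'I_(N n)}) : 0 < eta n -> #|A| = k -> cell k (eta n) A t ->
  Q n t = Phi n (times k (eta n) A).
Proof.
move=> e0 Ak tA; rewrite /Q (bigD1 A) ?Ak//= big1 => [|B /andP[/eqP Bk BA]].
  by rewrite addr0 indicE mem_set// mulr1.
rewrite indicE memNset ?mulr0// => tB; move/eqP: BA; apply.
exact: (cell_inj Bk Ak e0 tB tA).
Qed.

Let Q0 n t : (forall A : {set 'I_(N n)}, #|A| = k -> ~ cell k (eta n) A t) -> Q n t = 0.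
Proof. by move=> h; rewrite /Q big1// => A /eqP Ak; rewrite indicE memNset ?mulr0//; exact: h. Qed.

Let mQ n : measurable_fun setT (Q n).
Proof.
rewrite (_ : Q n = fun t => \sum_(A : {set 'I_(N n)}) (if #|A| == k then
    Phi n (times k (eta n) A) * \1_(cell k (eta n) A) t else 0)).
  apply: measurable_sum => A; case: (#|A| == k) => //; apply: measurable_funM => //.
  by apply: measurable_indic; exact: measurable_cell.
by apply/funext => t; rewrite /Q big_mkcond.
Qed.

(** The sum is the integral of the step function [Q n], which is eventually bounded and converges to
    [phi] at every increasing [t], because cells smaller than the gaps separate the times; the
    simplex has finite volume, and dominated convergence concludes. *)
Lemma time_limit : eta n ^+ k * \sum_(A : {set 'I_(N n)} | #|A| == k) Phi n (times k (eta n) A)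
  @[n --> \oo] --> \int[leb]_(t in I) phi t.
Proof.
have en : \forall n \near \oo, 0 < eta n by exact: eta0 (nbhs_right_gt 0).
have [n0 _ hn0] : \forall n \near \oo, 0 < eta n /\ forall s, I' s -> 0 <= Phi n s <= C.
  by apply: filterI.
have C0 : 0 <= Num.max C 0 by rewrite le_max lexx orbT.
have Qb n t : (n0 <= n)%N -> 0 <= Q n t <= Num.max C 0.
  move=> n0n; have [e0 hP] := hn0 n n0n.
  have [[A [Ak tA]]|h] := pselect (exists A : {set 'I_(N n)}, #|A| = k /\ cell k (eta n) A t).
    rewrite (QE e0 Ak tA); have := hP _ (times_increasing Ak e0 (NT e0)).
    by move=> /andP[-> h]; rewrite le_max h.
  have -> : Q n t = 0 by apply: Q0 => A Ak tA; apply: h; exists A.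
  by rewrite lexx C0.
have mI : measurable I by exact: (measurable_increasing `]0, T[).
have QI n : (n0 <= n)%N -> (\int[leb]_(t in I) (Q n t)%:E =
    (eta n ^+ k * \sum_(A : {set 'I_(N n)} | #|A| == k) Phi n (times k (eta n) A))%:E)%E.
  move=> n0n; have [e0 hP] := hn0 n n0n.
  transitivity (\int[leb]_t (Q n t)%:E)%E.
    rewrite integral_mkcond; have [mz z0] := zeros_null.
    apply: ge0_ae_eq_integral => //.
    - have mQE : measurable_fun I (fun t => (Q n t)%:E).
        by apply/measurable_EFinP; exact: (measurable_funTS (mQ n)).
      exact: (measurable_restrictT _ mI).1.
    - by apply/measurable_EFinP; exact: mQ.
    - by move=> t _; rewrite patchE; case: ifP => // _; rewrite lee_fin; have /andP[] := Qb n t n0n.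
    - by move=> t _; rewrite lee_fin; have /andP[] := Qb n t n0n.
    exists zeros; split => // t /= /not_implyP[_]; rewrite patchE.
    have [It|It] := pselect (I t); first by rewrite mem_set.
    rewrite memNset// => Qt; apply: contrapT => nzt; apply: Qt; congr EFin; apply/esym.
    have [[A [Ak tA]]|h] := pselect (exists A : {set 'I_(N n)}, #|A| = k /\ cell k (eta n) A t).
      have [t1 t2] := cell_increasing Ak e0 (NT e0) tA.
      exfalso; apply: It; split => // j.
      have := t1 j; rewrite /= !in_itv/= => /andP[h1 ->]; rewrite andbT lt_neqAle h1 andbT.
      by apply/eqP => tj; apply: nzt; exists j.
    by apply: Q0 => A Ak tA; apply: h; exists A.
  pose q (A : {set 'I_(N n)}) (t : k.-tuple (measurableTypeR R)) : \bar R :=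
    if #|A| == k then (Phi n (times k (eta n) A) * \1_(cell k (eta n) A) t)%:E else 0%E.
  transitivity (\int[leb]_t \sum_(A : {set 'I_(N n)}) q A t)%E.
    apply: eq_integral => t _; rewrite /Q -sumEFin big_mkcond; apply: eq_bigr => A _.
    by rewrite /q; case: (#|A| == k).
  rewrite ge0_integral_sum//; first last.
  - move=> A t _; rewrite /q; case: eqP => // Ak; rewrite lee_fin mulr_ge0//.
    by have /andP[] := hP _ (times_increasing Ak e0 (NT e0)).
  - move=> A; rewrite /q; case: (#|A| == k) => //.
    apply/measurable_EFinP; apply: measurable_funM => //.
    by apply: measurable_indic; exact: measurable_cell.
  rewrite mulr_sumr -sumEFin [in RHS]big_mkcond; apply: eq_bigr => A _.
  rewrite /q; case: eqP => [Ak|_]; last by rewrite integral0.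
  under eq_integral do rewrite EFinM.
  rewrite ge0_integralZl//; first last.
  - by rewrite lee_fin; have /andP[] := hP _ (times_increasing Ak e0 (NT e0)).
  - by apply/measurable_EFinP; apply: measurable_indic; exact: measurable_cell.
  rewrite integral_indic//; last exact: measurable_cell.
  by rewrite setIT [X in (_ * X)%E](mpower_cell Ak e0) -EFinM mulrC.
have Qphi t : I t -> Q n t @[n --> \oo] --> phi t.
  move=> It; have [t1 t2] := It; apply/cvgrPdist_lt => e e0.
  have [b b0 hb] := Phi_phi It e0.
  have eb : \forall n \near \oo, eta n < b.
    exact: (eta0 (nbhs_right_lt b0)).
  have near_gap (x y : R) : x < y -> \forall n \near \oo, x + eta n < y.
    move=> xy; have : \forall n \near \oo, eta n < y - x.
      by move: xy; rewrite -subr_gt0 => xy; exact: (eta0 (nbhs_right_lt xy)).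
    by apply: filterS => n; rewrite ltrBrDl.
  have tT : \forall n \near \oo, forall j, tnth t j + eta n < T.
    by apply: filter_forall => j; apply: near_gap; have := t1 j; rewrite /= in_itv/= => /andP[].
  have tt : \forall n \near \oo, forall i j : 'I_k, (i < j)%N -> tnth t i + eta n < tnth t j.
    apply: filter_forall => i; apply: filter_forall => j.
    by have [ij|ij] := boolP (i < j)%N; [apply: filterS (near_gap _ _ (t2 i j ij))|apply: nearW].
  near=> n; have e0' : 0 < eta n by near: n.
  have [A [Ak tA]] : exists A : {set 'I_(N n)}, #|A| = k /\ cell k (eta n) A t.
    apply: ex_cell => //.
    - by move=> j; have := t1 j; rewrite /= in_itv/= => /andP[/ltW].
    - by near: n.
    - by near: n.
  rewrite (QE e0' Ak tA) distrC.
  have := times_increasing Ak e0' (NT e0').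
  have : forall j, `|tnth (times k (eta n) A) j - tnth t j| < b.
    by move=> j; rewrite (le_lt_trans (cell_times Ak e0' tA j))//; near: n.
  move: (times _ _ _) => s s1 s2; move: s s2 s1; near: n; exact: hb.
have mphi : measurable_fun I (EFin \o phi).
  apply: (emeasurable_fun_cvg (fun n t => (Q n t)%:E)) => //.
    by move=> n; apply/measurable_EFinP; exact: measurable_funTS.
  by move=> t It; apply: cvg_EFin; [exact: nearW|exact: Qphi].
pose box := rectangle (fun _ : 'I_k => `]0, T[%classic : set (measurableTypeR R)).
have mbox : measurable box by apply: measurable_rectangle => i; exact: measurable_itv.
have boxfin : (leb box < +oo)%E.
  rewrite (mpower_rectangle lebesgue_measure); last by move=> i; exact: measurable_itv.
  rewrite (_ : (\prod_(i < k) _)%E = (\prod_(i < k) T%:E)%E) ; first by rewrite prodEFin ltry.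
  apply: eq_bigr => i _.
  have e1 : lebesgue_measure (`]0, T[%classic : set R) = T%:E by rewrite lebesgue_measure_itv /= lte_fin T0 oppr0 adde0.
  exact: e1.
have Ifin : (leb I < +oo)%E.
  by apply: le_lt_trans boxfin; rewrite le_measure ?inE//; move=> t [].
have ig : leb.-integrable I (EFin \o cst (Num.max C 0)).
  apply: measurable_bounded_integrable => //.
  exists (Num.max C 0); split; first exact: num_real.
  by move=> y Cy t _ /=; rewrite ger0_norm// ltW.
(* The bound holds from [n0] on only, hence the shifted sequence. *)
have [] := @dominated_convergence _ _ _ leb I mI (fun n t => (Q (n + n0)%N t)%:E) (EFin \o phi)
   (EFin \o cst (Num.max C 0)).
- by move=> n; apply/measurable_EFinP; exact: measurable_funTS.
- exact: mphi.
- apply: aeW => t It; apply: cvg_EFin; first exact: nearW.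
  by apply: (cvg_comp _ _ _ (Qphi t It)); exact: cvg_addnr.
- exact: ig.
- apply: aeW => t n It; rewrite /= lee_fin.
  by have /andP[q0 qC] := Qb (n + n0)%N t (leq_addl _ _); rewrite ger0_norm.
move=> iphi _ lim.
have fphi : (\int[leb]_(t in I) (phi t)%:E)%E \is a fin_num by exact: integrable_fin_num.
rewrite -(cvg_shiftn n0) /Rintegral.
move: lim; rewrite -(fineK fphi) => /fine_cvg; apply: cvg_trans; apply: near_eq_cvg.
by apply: nearW => n /=; rewrite QI ?leq_addl.
Unshelve. all: by end_near. Qed.

End time_limit.

(** * Comparison of the scheme with a path with jumps *)

Lemma ex_superset (X : finType) (A : {set X}) q : (#|A| <= q <= #|X|)%N ->
  exists2 B : {set X}, A \subset B & #|B| = q.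
Proof.
elim: q => [|q ih] /andP[Aq qX]; first by exists A => //; apply/eqP; rewrite -leqn0.
move: Aq; rewrite leq_eqVlt => /orP[/eqP Aq|Aq]; first by exists A.
have [|B AB Bq] := ih; first by rewrite -ltnS Aq ltnW.
have : (0 < #|~: B|)%N by rewrite cardsCs finset.setCK Bq subn_gt0.
move=> /card_gt0P[x]; rewrite finset.in_setC => xB.
by exists (x |: B); [rewrite (fintype.subset_trans AB)// finset.subsetUr|rewrite cardsU1 xB Bq].
Qed.

Section comparison.
Context {R : realType} {m d : nat}.
Local Notation Rm := 'cV[R]_m.
Local Notation Rd := 'cV[R]_d.+1.
Variables (a : Rm -> Rm) (sigma : Rm -> 'M[R]_(m, d.+1)) (D C : R) (phi : R -> Rm -> Rm).
Hypothesis F : is_flow a D C phi.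
Hypothesis sL : forall x y w,
  enorm ((sigma x - sigma y) *m w) <= D * enorm (x - y) * enorm w.
Hypothesis sB : forall x w, enorm (sigma x *m w) <= C * enorm w.
Variables (T : {posnum R}) (A : set Rm) (k : nat).
Variables (eps r M L : R) (f : Dspace m T -> R).
Hypotheses (L0 : 0 <= L).
Hypothesis fM : forall y, 0 <= f y <= M.
Hypothesis fL : forall x y, `|f x - f y| <= L * mdist x y.
Hypothesis fv : forall xi y, jump_paths_pred a sigma T A k eps xi -> mdist xi y <= r -> f y = 0.
Local Notation Inc k := (@increasing_tuples R k `]0, T%:num]%classic).
Local Notation E := (expR (D * T%:num)).

Let D0 := is_flow_D F.
Let C0 := is_flow_C F.
Let M0 : 0 <= M. Proof. by have /andP[/le_trans h /h] := fM (step_path T (fun=> 0) 0). Qed.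

(** Such a path is within [r] of a path with [k - 1] jumps and shifts at most [eps], near which [f]
    vanishes. *)
Lemma small_jump_vanish x (W : k.-tuple Rd) (t : k.-tuple R) delta : A x -> Inc k t ->
  0 <= delta -> E * (C * delta) <= eps -> E * (C * delta) <= r ->
  (exists i, enorm (tnth W i) <= delta) -> f (jump_path a sigma T x W t) = 0.
Proof.
move=> Ax it d0 de dr; case: k W t it fv => [|k'] W t it fv' [i Wi]; first by case: i Wi.
have [W' [V' [t' [h1 h2 h3]]]] := jump_path_remove_small F sB x d0 it (ex_intro _ i Wi).
apply: (fv' (perturbed_path a sigma T x W' V' t')).
  by exists x, W', V', t'; split => // j; rewrite (le_trans (h2 j)).
by rewrite metric_sym (le_trans h3).
Qed.

Section one_path.
Variables (eta : R) (z : nat -> Rd) (x : Rm).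
Hypotheses (eta0 : 0 < eta) (Ax : A x).
Local Notation n := (Num.truncn (T%:num / eta)).

Definition big_noise (s : R) : {set 'I_n} := finset (fun i : 'I_n => s < enorm (eta *: z i.+1)).

Let X := step_path T (sgd a sigma eta z x) eta.

Definition jump_sample k (J : {set 'I_n}) : k.-tuple Rd := [tuple of [seq eta *: z i | i <- tidx k J]].

Let G (J : {set 'I_n}) := f (jump_path a sigma T x (jump_sample k J) (times k eta J)).

Variables (delta delta1 c K : R).
Hypotheses (d0 : 0 < delta) (dd : delta <= delta1) (c0 : 0 <= c) (K0 : 0 <= K).

Let d10 : 0 <= delta1. Proof. exact: le_trans (ltW d0) dd. Qed.

Let in_big s (i : 'I_n) : (i \in big_noise s) = (s < enorm (eta *: z i.+1)).
Proof. by rewrite finset.in_set. Qed.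

(** Clipping at [delta / eta] is exactly the removal of the steps in [big_noise delta]. *)
Let noiseE i : (i <= n)%N -> small_noise a sigma eta z x (idx (big_noise delta)) i =
  clipped_noise a sigma eta (delta / eta) z x i.
Proof.
move=> i_n; rewrite /small_noise big_mkcond; apply: eq_bigr => q _.
have qn : (q < n)%N by exact: leq_trans (ltn_ord q) i_n.
rewrite (mem_idx (big_noise delta) (Ordinal qn)) in_big -leNgt /= enormZ gtr0_norm//.
rewrite /clip ler_pdivlMr// [enorm _ * _]mulrC; case: ifP => // _.
by rewrite mulmx0 scaler0.
Qed.

(** A term enters or leaves the sum only at a step of [J] or of [big_noise delta], at most [2 * k]
    in number, and its scaled noise is then at most [delta1] because [J] contains
    [big_noise delta1]. *)
Let noise_change (J : {set 'I_n}) i : (i <= n)%N -> (#|big_noise delta| <= k)%N -> (#|J| <= k)%N ->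
  big_noise delta1 \subset J ->
  enorm (small_noise a sigma eta z x (idx J) i) <=
    enorm (small_noise a sigma eta z x (idx (big_noise delta)) i) + (2 * k)%:R * (C * delta1).
Proof.
move=> i_n Bk Jk BJ.
pose s q := eta *: (sigma (sgd a sigma eta z x q) *m z q.+1).
pose e q := (if q.+1 \notin idx J then s q else 0) - (if q.+1 \notin idx (big_noise delta) then s q else 0).
have eB (q : 'I_n) : enorm (e q) <= ((q \in J) + (q \in big_noise delta))%:R * (C * delta1).
  have sq t : enorm (eta *: z q.+1) <= t -> t <= delta1 -> enorm (s q) <= C * delta1.
    move=> h1 h2; rewrite /s scalemxAr (le_trans (sB _ _))// ler_wpM2l//; exact: le_trans h2.
  have C10 : 0 <= C * delta1 by rewrite mulr_ge0.
  rewrite /e !mem_idx; case: (boolP (q \in J)) => [qJ|qJ]; case: (boolP (q \in big_noise delta)) => /= qB.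
  - by rewrite subrr enorm0 mulr_ge0.
  - rewrite sub0r enormN mul1r; move: qB; rewrite in_big -leNgt => qB.
    exact: (sq delta).
  - rewrite subr0 mul1r; have : q \notin big_noise delta1 by apply: contra qJ; exact: (fintype.subsetP BJ).
    by rewrite in_big -leNgt => h; exact: (sq delta1).
  - by rewrite subrr enorm0 mul0r.
have -> : small_noise a sigma eta z x (idx J) i =
   small_noise a sigma eta z x (idx (big_noise delta)) i + \sum_(q < i) e q.
  rewrite /small_noise big_mkcond [X in _ = X + _]big_mkcond -big_split; apply: eq_bigr => q _ /=.
  by rewrite /e -/(s q) addrC subrK.
rewrite (le_trans (enorm_triangle _ _))// lerD2l (le_trans (enorm_sum _ _ _))//.
rewrite (big_ord_widen n (fun q => enorm (e q)) i_n).
apply: (@le_trans _ _ (\sum_(q < n) ((q \in J) + (q \in big_noise delta))%:R * (C * delta1))).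
  rewrite [leLHS]big_mkcond; apply: ler_sum => q _; case: ifP => // _.
  by rewrite mulr_ge0// mulr_ge0.
rewrite -mulr_suml ler_wpM2r ?mulr_ge0// -natr_sum ler_nat big_split/=.
have cardE' (S : {set 'I_n}) : (\sum_(i0 < n) (i0 \in S) = #|S|)%N.
  by rewrite -sum1_card [RHS]big_mkcond; apply: eq_bigr => j _; case: (j \in S).
by rewrite !cardE' mul2n -addnn leq_add.
Qed.

Local Notation err c := (chain_error D C T%:num eta c).
Hypotheses (de : E * (C * delta1) <= eps) (dr : E * (C * delta1) <= r) (kn : (k <= n)%N).
Hypotheses (ce : err (c + (2 * k)%:R * (C * delta1)) <= eps)
  (cr : err (c + (2 * k)%:R * (C * delta1)) <= r).

Let idx_le k' (J : {set 'I_n}) : #|J| = k' ->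
  path ltn 0 (tidx k' J) /\ all (leq^~ n) (tidx k' J).
Proof.
move=> Jk; rewrite (tidxE Jk); split; first exact: path_idx.
by apply/allP => q /idx_bound/andP[].
Qed.

Let Tn : n%:R * eta <= T%:num.
Proof. 
have h : 0 <= T%:num / eta by rewrite divr_ge0// ltW.
by rewrite -ler_pdivlMr//; have /andP[] := truncn_itv h.
Qed.

Let G_vanish (J : {set 'I_n}) : #|J| = k -> ~~ (J \subset big_noise delta1) -> G J = 0.
Proof.
move=> Jk /fintype.subsetPn[i iJ]; rewrite in_big -leNgt => ir.
have it := times_increasing Jk eta0 Tn.
apply: (small_jump_vanish Ax it d10 de dr).
have : i.+1 \in tval (tidx k J) by rewrite tidxE// mem_idx.
by move=> /tnthP[j ij]; exists j; rewrite tnth_map -ij.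
Qed.

(** Complete [big_noise delta1] to a set of [k - 1] steps and count all other noises as small: the
    scheme is close to a path with [k - 1] shifted jumps, and [f] vanishes there. *)
Let few_big_vanish : (#|big_noise delta| <= k)%N -> (#|big_noise delta1| < k)%N ->
  (forall j, (j <= n)%N -> enorm (clipped_noise a sigma eta (delta / eta) z x j) <= c) -> f X = 0.
Proof.
move=> Bk B1k good; have k1k : (k.-1 <= k)%N by exact: leq_pred.
have [|J BJ Jk] := @ex_superset _ (big_noise delta1) k.-1.
  by rewrite card_ord -ltnS (ltn_predK B1k) B1k (leq_trans k1k).
have [p1 p2] := idx_le Jk.
have c'0 : 0 <= c + (2 * k)%:R * (C * delta1) by rewrite addr_ge0// !mulr_ge0.
have noise i : (i <= n)%N -> enorm (small_noise a sigma eta z x (tidx k.-1 J) i) <=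
    c + (2 * k)%:R * (C * delta1).
  move=> i_n; rewrite (tidxE Jk) (le_trans (noise_change i_n Bk _ BJ))//; first by rewrite Jk.
  by rewrite lerD2r noiseE// good.
have [it [V [hV hX]]] := chain_perturbed F eta0 c'0 p1 p2 noise.
move: it V hV hX; rewrite -/(times k.-1 eta J) -/(jump_sample k.-1 J).
move: (jump_sample _ _) (times _ _ _) => W t it V hV hX.
apply: (@fv (perturbed_path a sigma T x W V t) X).
  have {}hV j : enorm (tnth V j) <= eps by exact: le_trans (hV j) ce.
  move: it hV => {hX p1 p2 noise} it hV; have := ltn_predK B1k.
  case: (k) W t it V hV => // k' /= W t it V hV _.
  by exists x, W, V, t; split.
by rewrite metric_sym (le_trans hX).
Qed.

(** The Lipschitz constant times the sum of two distances: from the scheme to the shifted path, and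
    from there to the path without shifts. *)
Definition path_error : R := L * (err c + ((1 + D * K) * E + 1) ^+ k.+1 * err c).

Let err0 : 0 <= err c.
Proof.
rewrite /chain_error; have e0 := ltW eta0; have t0 : 0 <= T%:num by [].
by rewrite addr_ge0 ?mulr_ge0 ?addr_ge0 ?expR_ge0 ?mulr_ge0.
Qed.

Let path_error0 : 0 <= path_error.
Proof.
by rewrite mulr_ge0// addr_ge0// mulr_ge0// exprn_ge0// addr_ge0// mulr_ge0 ?expR_ge0// addr_ge0// mulr_ge0.
Qed.

Let exact_big_close : #|big_noise delta| = k ->
  (forall i, i \in big_noise delta -> enorm (eta *: z i.+1) <= K) ->
  (forall j, (j <= n)%N -> enorm (clipped_noise a sigma eta (delta / eta) z x j) <= c) ->
  `|f X - G (big_noise delta)| <= path_error.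
Proof.
set J := big_noise delta => Jk JK good; have [p1 p2] := idx_le Jk.
have noise i : (i <= n)%N -> enorm (small_noise a sigma eta z x (tidx k J) i) <= c.
  by move=> i_n; rewrite (tidxE Jk) noiseE// good.
have [it [V [hV hX]]] := chain_perturbed F eta0 c0 p1 p2 noise.
rewrite (le_trans (fL _ _))// ler_wpM2l// (le_trans (metric_triangle _ (perturbed_path a sigma T x (jump_sample k J) V (times k eta J)) _))// lerD//.
apply: (perturbed_jump_dist F sL x) => //.
move=> i; rewrite tnth_map; have : tnth (tidx k J) i \in idx J by rewrite -(tidxE Jk) mem_tnth.
by move=> /mapP[j]; rewrite mem_enum => jJ ->; exact: JK.
Qed.

(* If fewer than k noises exceed delta, then f vanishes at the scheme unless
   the clipped noise is large (bad); the second term accounts for more than k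
   of them; if there are exactly k, the scheme is close to the path that jumps
   at these times. *)
Lemma comparison (bad : bool) :
  (~~ bad -> forall j, (j <= n)%N -> enorm (clipped_noise a sigma eta (delta / eta) z x j) <= c) ->
  `|f X - \sum_(J : {set 'I_n} | #|J| == k) G J| <=
    2 * M * bad%:R +
    M * k.+2%:R * (\sum_(J : {set 'I_n} | #|J| == k.+1) (J \subset big_noise delta)%:R) +
    \sum_(J : {set 'I_n} | #|J| == k) (J \subset big_noise delta1)%:R *
      (path_error + M * (~~ [forall i in J, enorm (eta *: z i.+1) <= K])%:R).
Proof.
move=> good; set N := #|big_noise delta|.
have sub1 : big_noise delta1 \subset big_noise delta.
  by apply/fintype.subsetP => i; rewrite !in_big; exact: le_lt_trans.
have count q : \sum_(J : {set 'I_n} | #|J| == q) (J \subset big_noise delta)%:R = ('C(N, q))%:R :> R.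
  rewrite -natr_sum -cards_draws; congr (_%:R); rewrite -sum1_card.
  rewrite big_mkcond [RHS]big_mkcond; apply: eq_bigr => J _.
  by rewrite finset.in_set; case: (#|J| == q); case: (J \subset _).
have /andP[X0 XM] := fM X.
have Psi0 : 0 <= \sum_(J : {set 'I_n} | #|J| == k) G J.
  by apply: sumr_ge0 => J _; have /andP[] := fM (jump_path a sigma T x (jump_sample k J) (times k eta J)).
have PsiM : \sum_(J : {set 'I_n} | #|J| == k) G J <= M * ('C(N, k))%:R.
  rewrite -count mulr_sumr; apply: ler_sum => J /eqP Jk.
  have /andP[g0 gM] := fM (jump_path a sigma T x (jump_sample k J) (times k eta J)).
  case: (boolP (J \subset big_noise delta)) => [_|JB]; first by rewrite mulr1.
  by rewrite mulr0 G_vanish//; apply: contra JB => h; exact: (fintype.subset_trans h sub1).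
have third0 : 0 <= \sum_(J : {set 'I_n} | #|J| == k) (J \subset big_noise delta1)%:R *
      (path_error + M * (~~ [forall i in J, enorm (eta *: z i.+1) <= K])%:R).
  by apply: sumr_ge0 => J _; rewrite mulr_ge0// addr_ge0// mulr_ge0.
rewrite count; have [Nk|kN] := leqP N k; last first.
  apply: (@le_trans _ _ (M * k.+2%:R * ('C(N, k.+1))%:R)); last first.
    by rewrite -[leLHS]add0r -[leLHS]addr0 lerD// lerD// !mulr_ge0.
  (* From [k.+1 * 'C(N, k.+1) = (N - k) * 'C(N, k)] with [k < N]; one more ['C(N, k.+1)] accounts
     for [f X], hence the factor [k.+2]. *)
  have bk : ('C(N, k) <= k.+1 * 'C(N, k.+1))%N.
    by rewrite mul_bin_left leq_pmull// subn_gt0.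
  have b1 : (0 < 'C(N, k.+1))%N by rewrite bin_gt0.
  apply: (@le_trans _ _ (M * (1 + 'C(N, k))%:R)).
    rewrite natrD mulrDr mulr1; have MC : 0 <= M * ('C(N, k))%:R by rewrite mulr_ge0.
    by rewrite ler_norml; apply/andP; split; lra.
  rewrite -mulrA ler_wpM2l// -natrM ler_nat mulSn.
  by rewrite (leq_trans (leq_add b1 bk)).
rewrite bin_small// mulr0 addr0.
have [bd|gd] := boolP bad.
  rewrite mulr1 -[leLHS]addr0 lerD//.
  have CNk : ('C(N, k) <= 1)%N.
    by move: Nk; rewrite leq_eqVlt => /orP[/eqP <-|h]; rewrite ?binn// bin_small.
  have {}PsiM : \sum_(J : {set 'I_n} | #|J| == k) G J <= M.
    by rewrite (le_trans PsiM)// ler_piMr// lern1.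
  by rewrite ler_norml; apply/andP; split; lra.
rewrite mulr0 add0r; have {}good := good gd.
have [N1k|kN1] := ltnP #|big_noise delta1| k.
  rewrite (few_big_vanish Nk N1k good) big1 ?subrr ?normr0// => J /eqP Jk.
  apply: G_vanish => //; apply/negP => /subset_leq_card; rewrite Jk => h.
  by have := leq_ltn_trans h N1k; rewrite ltnn.
(* At most [k] noises exceed the lower threshold and at least [k] the higher one, so the two sets
   coincide and have [k] elements. *)
have B1B : big_noise delta1 = big_noise delta.
  by apply/eqP; rewrite eqEcard sub1 (leq_trans Nk kN1).
have Nk' : #|big_noise delta| = k.
  by apply/eqP; rewrite eqn_leq Nk -B1B.
rewrite (bigD1 (big_noise delta)) ?Nk'//= big1 ?addr0 => [|J /andP[/eqP Jk JB]]; last first.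
  apply: G_vanish => //; rewrite B1B; apply/negP => JB'; move/eqP: JB; apply.
  by apply/eqP; rewrite eqEcard; apply/andP; split => //; rewrite Jk -Nk'.
rewrite (bigD1 (big_noise delta)) ?Nk'//= B1B subxx mul1r.
apply: (@le_trans _ _ (path_error + M * (~~ [forall i in big_noise delta, enorm (eta *: z i.+1) <= K])%:R)).
  have [JK|_] := boolP [forall i in big_noise delta, enorm (eta *: z i.+1) <= K].
    move/forall_inP: JK => JK; by rewrite mulr0 addr0 exact_big_close.
  rewrite mulr1 (@le_trans _ _ M)//; last by rewrite lerDr.
  by have /andP[g0 gM] := fM (jump_path a sigma T x (jump_sample k (big_noise delta)) (times k eta (big_noise delta))); apply: ler_dist_itv.
rewrite lerDl; apply: sumr_ge0 => J _; rewrite mulr_ge0// addr_ge0// mulr_ge0//.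
Qed.

End one_path.
End comparison.

(** * Measurability of the scheme and frequency of large noise *)

Lemma bin_le_expn n q : ('C(n, q) <= n ^ q)%N.
Proof.
apply: (@leq_trans (n ^_ q)); first by rewrite -bin_ffact leq_pmulr// fact_gt0.
by elim: q => // q ih; rewrite ffactnSr expnSr leq_mul// leq_subr.
Qed.

(** * Expectations of bounded measurable functions *)

Section bounded_expectation.
Context {disp : measure_display} {X : measurableType disp} {R : realType}.
Variable Q : probability X R.

Definition bounded_measurable (g : X -> R) :=
  measurable_fun setT g /\ exists M, forall x, `|g x| <= M.

Lemma bounded_measurable_integrable g : bounded_measurable g -> Q.-integrable setT (EFin \o g).
Proof. by move=> [mg [M gM]]; exact: (bounded_integrable Q mg gM). Qed.

Lemma bounded_measurable_indic (E : set X) : measurable E -> bounded_measurable (\1_E : X -> R).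
Proof.
move=> mE; split; first exact: measurable_indic.
by exists 1 => x; rewrite indicE ger0_norm// lern1 leq_b1.
Qed.

Lemma bounded_measurableD g h : bounded_measurable g -> bounded_measurable h ->
  bounded_measurable (fun x => g x + h x).
Proof.
move=> [mg [M gM]] [mh [N hN]]; split; first exact: measurable_funD.
by exists (M + N) => x; rewrite (le_trans (ler_normD _ _))// lerD.
Qed.

Lemma bounded_measurableZ c g : bounded_measurable g -> bounded_measurable (fun x => c * g x).
Proof.
move=> [mg [M gM]]; split; first exact: measurable_funM.
by exists (`|c| * M) => x; rewrite normrM ler_wpM2l.
Qed.

Lemma bounded_measurable_sum (I : Type) (s : seq I) (p : pred I) (g : I -> X -> R) :
  (forall i, p i -> bounded_measurable (g i)) ->
  bounded_measurable (fun x => \sum_(i <- s | p i) g i x) /\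
  \int[Q]_x (\sum_(i <- s | p i) g i x) = \sum_(i <- s | p i) \int[Q]_x g i x.
Proof.
move=> hg; elim: s => [|i s [b1 e1]].
  split; last by rewrite big_nil; under eq_Rintegral do rewrite big_nil; rewrite Rintegral_cst ?mul0r.
  by under eq_fun do rewrite big_nil; split => //; exists 0 => x; rewrite normr0.
rewrite big_cons.
have -> : (fun x => \sum_(j <- i :: s | p j) g j x) =
    (fun x => if p i then g i x + \sum_(j <- s | p j) g j x else \sum_(j <- s | p j) g j x).
  by apply/funext => x; rewrite big_cons.
case: (boolP (p i)) => [pi|//]; split; first by apply: bounded_measurableD => //; exact: hg.
by rewrite -e1 -RintegralD//; apply: bounded_measurable_integrable => //; exact: hg.
Qed.

Lemma Rintegral_indic (E : set X) : measurable E -> \int[Q]_x \1_E x = fine (Q E).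
Proof. by move=> mE; rewrite /Rintegral integral_indic// setIT. Qed.

End bounded_expectation.

Section path_measurability.
Context {R : realType} {m d : nat} {disp : measure_display} {Omega : measurableType disp}.
Local Notation Rm := 'cV[R]_m.
Local Notation Rd := 'cV[R]_d.+1.
Variables (a : Rm -> Rm) (sigma : Rm -> 'M[R]_(m, d.+1)) (D C : R) (phi : R -> Rm -> Rm).
Hypothesis F : is_flow a D C phi.
Hypothesis sL : forall x y w,
  enorm ((sigma x - sigma y) *m w) <= D * enorm (x - y) * enorm w.
Hypothesis sB : forall x w, enorm (sigma x *m w) <= C * enorm w.
Variables (T : {posnum R}).
Variables (Z : nat -> Omega -> borel Rd).
Hypothesis mZ : forall n, measurable_fun setT (Z n).
Local Notation path eta x w := (step_path T (sgd a sigma eta (Z ^~ w) x) eta : Dspace m T).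

(** The path depends on the coordinates of the first [n] noises only, and continuously so for the
    uniform norm, which dominates the Skorokhod distance. *)
Lemma measurable_step_path eta x : 0 < eta ->
  measurable_fun setT (fun w => path eta x w : borel (Dspace m T)).
Proof.
move=> eta0; set n := Num.truncn (T%:num / eta).
pose zy (y : 'I_n * 'I_d.+1 -> R) (k : nat) : Rd :=
  if insub k.-1 is Some k' then \col_l y (k', l) else 0.
pose u (kl : 'I_n * 'I_d.+1) (w : Omega) : R := (Z kl.1.+1 w : Rd) kl.2 ord0.
pose G y : borel (Dspace m T) := step_path T (sgd a sigma eta (zy y) x) eta.
have tn t : 0 <= t <= T%:num -> (Num.truncn (t / eta) <= n)%N.
  move=> /andP[t0 tT]; apply: le_truncn; by rewrite ler_pM2r// invr_gt0.
have zyE w k : (0 < k <= n)%N -> zy (u^~ w) k = Z k w.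
  case: k => // k /= kn; rewrite /zy /=; case: insubP => [k' _ k'k|]; last by rewrite kn.
  by apply/colP => l; rewrite mxE /u /= k'k.
have GE w : G (u^~ w) = path eta x w.
  apply: Dspace_ext => t /=; rewrite in_itv/= => t0T; rewrite /step_fun !in_itv/= t0T.
  apply: sgd_ext => k /andP[k0 kn]; apply: zyE; rewrite k0 (leq_trans kn)// tn//.
rewrite (_ : (fun w => _) = (fun w => G (u^~ w))); last by apply/funext => w; rewrite GE.
move=> _ B mB.
apply: (@measurable_discretization R _ Omega _ u (Dspace m T : PointedMetric.type R) _ setT G measurableT _ B mB).
  move=> [k l]; apply: (measurableT_comp (@measurable_coord R d.+1 l)); exact: mZ.
move=> w _ e e0.
have [g g0 hg] := sgd_continuous (is_flow_D F) (is_flow_C F) (is_flow_aL F) sL sB (zy (u^~ w)) x n (ltW eta0) e0.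
exists (g / d.+1%:R); first by rewrite divr_gt0.
move=> y hy; apply: mdist_sup => t t0T.
rewrite /= /step_fun !in_itv/= t0T; apply: hg; last exact: tn.
move=> k _; rewrite /zy; case: insubP => [k' _ _|_]; last by rewrite subrr enorm0 ltW.
rewrite (le_trans (enorm_le_sum _))//.
apply: (@le_trans _ _ (\sum_(l < d.+1) (g / d.+1%:R))).
  by apply: ler_sum => l _; rewrite !mxE.
by rewrite sumr_const card_ord -[leLHS]mulr_natr divfK.
Qed.

Lemma measurable_lipschitz_jump (f : Dspace m T -> R) (L : R) k x (t : k.-tuple R) :
  0 <= L -> (forall x y, `|f x - f y| <= L * mdist x y) ->
  @increasing_tuples R k `]0, T%:num]%classic t ->
  measurable_fun setT (fun W : k.-tuple (borel Rd) => f (jump_path a sigma T x (W : k.-tuple Rd) t)).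
Proof.
move=> L0 fL it.
pose u (il : 'I_k * 'I_d.+1) (t : k.-tuple (borel Rd)) : R := (tnth t il.1 : Rd) il.2 ord0.
pose G (y : 'I_k * 'I_d.+1 -> R) := f (jump_path a sigma T x [tuple (\col_l y (i, l) : Rd) | i < k] t).
have colE W : [tuple (\col_l u (i, l) W : Rd) | i < k] = W.
  by apply: eq_from_tnth => i; rewrite tnth_mktuple; apply/colP => l; rewrite mxE.
rewrite (_ : (fun W => _) = fun W => G (u^~ W)); last by apply/funext => W; rewrite /G colE.
apply: measurable_real_coords.
  move=> [i l]; apply: (measurableT_comp (@measurable_coord R d.+1 l)).
  exact: measurable_tnth.
move=> W e e0; have eL : 0 < e / (L + 1) by rewrite divr_gt0// ltr_wpDl.
have [g g0 hg] := jump_path_continuous_noise F sL sB x W it eL.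
exists (g / d.+1%:R); first by rewrite divr_gt0.
move=> y hy; rewrite /G colE (le_trans (fL _ _))//.
apply: (@le_trans _ _ ((L + 1) * (e / (L + 1)))); last by rewrite mulrC divfK// gt_eqF// ltr_wpDl.
rewrite ler_pM ?mdist_ge0 ?lerDl// hg ?subrr ?enorm0 ?(ltW g0)// => i.
rewrite tnth_mktuple (le_trans (enorm_le_sum _))//.
apply: (@le_trans _ _ (\sum_(l < d.+1) (g / d.+1%:R))).
  by apply: ler_sum => l _; rewrite !mxE; exact: hy (i, l).
by rewrite sumr_const card_ord -[leLHS]mulr_natr divfK.
Qed.

End path_measurability.

(** * Moments of the noise and probability of exceptional events *)

Section large_jumps.
Context {R : realType} {m d : nat} {disp : measure_display} {Omega : measurableType disp}.
Local Notation Rm := 'cV[R]_m.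
Local Notation Rd := 'cV[R]_d.+1.
Variables (P : probability Omega R) (Z : nat -> {RV P >-> borel Rd}) (alpha : R).
Hypothesis Z_iid : iid P Z.
Hypothesis alpha_gt1 : 1 < alpha.
Local Notation H := (tail_prob P (Z 0%N)).
Hypothesis Hreg : forall t : R, 0 < t -> H (t * x) / H x @[x --> +oo] --> t `^ (- alpha).
Variable rho : {sigma_finite_measure set (borel Rd) -> \bar R}.
Hypothesis rho_fin : forall r : R, 0 < r -> (rho [set z : Rd | (r <= enorm z)%R] < +oo)%E.
Hypothesis rho_cvg : forall (g : Rd -> R) (r M : R), 0 < r -> continuous g ->
  (forall z, 0 <= g z <= M) -> (forall z, enorm z <= r -> g z = 0) ->
  (\int[P]_w (g (x^-1 *: (Z 0%N w : Rd)))%:E * ((H x)^-1)%:E @[x --> +oo%R]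
    --> \int[rho]_z (g z)%:E)%E.
Local Notation mu := (law (Z 0%N)).
Local Notation lam := (lambda P (Z 0%N)).

Let mZ0 : measurable_fun setT (fun w => enorm (Z 0%N w : Rd)).
Proof. exact: (measurableT_comp (@measurable_enorm R d.+1)). Qed.

Lemma tail_prob_pos x : 0 < H x. Proof. exact: (tail_prob_gt0 mZ0 Hreg). Qed.

Lemma lambda_gt0 eta : 0 < eta -> 0 < lam eta.
Proof. by move=> e0; rewrite mulr_gt0 ?invr_gt0// tail_prob_pos. Qed.

(** Below [alpha], so that the moment of order [p] is finite; above 1 and at most 2, as the
    exponential bound requires. *)
Let p := (1 + Num.min alpha 2) / 2.
Let p1 : 1 < p. Proof.
have h : 1 < Num.min alpha 2 by rewrite lt_min alpha_gt1 ltr1n.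
by rewrite /p; lra.
Qed.
Let p2 : p <= 2. Proof.
have h : Num.min alpha 2 <= 2 by rewrite ge_min lexx orbT.
by rewrite /p; lra.
Qed.
Let pa : p < alpha.
Proof.
have h1 : Num.min alpha 2 <= alpha by rewrite ge_min lexx.
by move: alpha_gt1; rewrite /p; lra.
Qed.

Let kappa : R := fine (\int[P]_w (enorm (Z 0%N w : Rd) `^ p)%:E)%E.

Let momentE : (\int[P]_w (enorm (Z 0%N w : Rd) `^ p)%:E)%E = kappa%:E.
Proof.
rewrite fineK// ge0_fin_numE; last by apply: integral_ge0 => w _; rewrite lee_fin powR_ge0.
by apply: (enorm_moment mZ0 Hreg) => //; exact: lt_trans p1.
Qed.

Let kappa0 : 0 <= kappa.
Proof. by rewrite -lee_fin -momentE; apply: integral_ge0 => w _; rewrite lee_fin powR_ge0. Qed.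

Lemma tail_prob_moment x : 0 < x -> H x <= kappa * x `^ (- p).
Proof.
move=> x0; have p0 : 0 < p by exact: lt_trans p1.
have mE : measurable [set w | x < enorm (Z 0%N w : Rd)] := measurable_tail mZ0 x.
rewrite powRN ler_pdivlMr ?powR_gt0// -lee_fin EFinM muleC -(tail_probE P mZ0) -momentE.
rewrite -[X in (_ * P X)%E]setIT -integral_indic// -ge0_integralZl//; first last.
- by rewrite lee_fin powR_ge0.
- by apply/measurable_EFinP; exact: measurable_indic.
apply: ge0_le_integral => //.
- by move=> w _; rewrite -EFinM lee_fin mulr_ge0// powR_ge0.
- apply/(@measurable_EFinP _ _ _ setT (fun w => x `^ p * \1_[set w | x < enorm (Z 0%N w : Rd)] w)).
  by apply: measurable_funM => //; exact: measurable_indic.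
- by apply/measurable_EFinP; exact: (measurableT_comp (measurable_powR p) mZ0).
move=> w _; rewrite -EFinM lee_fin indicE; case: (boolP (w \in _)) => [|_]; last by rewrite mulr0 powR_ge0.
by rewrite inE/= mulr1 => xw; rewrite ge0_ler_powR ?nnegrE ?enorm_ge0 ?ltW.
Qed.

(** The moment of order [p] bounds [lambda] by [kappa] times the power [p - 1] of [eta], and
    [p > 1]. *)
Lemma lambda_cvg0 {J : Type} {G : set_system J} {FG : ProperFilter G} (eta : J -> R) :
  eta @ G --> 0^'+ -> lam (eta j) @[j --> G] --> 0.
Proof.
move=> eta0; have en : \forall j \near G, 0 < eta j by exact: eta0 (nbhs_right_gt 0).
have p0 : 0 < p - 1 by rewrite subr_gt0; exact: p1.
apply/cvgrPdist_lt => e e0.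
have e1 : 0 < (e / (kappa + 1)) `^ (p - 1)^-1 by rewrite powR_gt0// divr_gt0// ltr_wpDl.
have en1 : \forall j \near G, eta j < (e / (kappa + 1)) `^ (p - 1)^-1 by exact: eta0 (nbhs_right_lt e1).
near=> j; have ej : 0 < eta j by near: j.
rewrite sub0r normrN gtr0_norm ?lambda_gt0// /lambda.
have ei : 0 < (eta j)^-1 by rewrite invr_gt0.
have h1 : eta j `^ (p - 1) < e / (kappa + 1).
  have ek : 0 <= e / (kappa + 1) by apply: divr_ge0; [exact: ltW|rewrite addr_ge0].
  have -> : e / (kappa + 1) = ((e / (kappa + 1)) `^ (p - 1)^-1) `^ (p - 1).
    by rewrite -powRrM mulVf ?gt_eqF// powRr1.
  rewrite gt0_ltr_powR ?nnegrE ?powR_ge0 ?(ltW ej)//.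
  by near: j.
apply: (@le_lt_trans _ _ (kappa * eta j `^ (p - 1))).
  rewrite ler_pdivrMl// (le_trans (tail_prob_moment ei))//.
  rewrite mulrCA ler_wpM2l// -{2}(powRr1 (ltW ej)) -powRD; last by rewrite (lt0r_neq0 ej) implybT.
  by rewrite -(powR_inv1 (ltW ej)) -powRrM mulN1r opprK addrC subrK.
apply: (@le_lt_trans _ _ ((kappa + 1) * eta j `^ (p - 1))).
  by rewrite ler_wpM2r ?powR_ge0// lerDl.
by rewrite mulrC -ltr_pdivlMr// ltr_wpDl.
Unshelve. all: by end_near. Qed.

Lemma probability_big (s : seq nat) (B : nat -> R) : uniq s ->
  P (\bigcap_(n in [set` s]) (Z n @^-1` [set w : borel Rd | (B n < enorm (w : Rd))%R])) =
  (\prod_(n <- s) H (B n))%:E.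
Proof.
move=> us; have [Zid Zind] := Z_iid; rewrite Zind//; last by move=> n; exact: measurable_enorm_gt.
rewrite -prodEFin; apply: eq_bigr => n _; rewrite Zid; last exact: measurable_enorm_gt.
by rewrite -(tail_probE P mZ0).
Qed.

Lemma law_mean : (forall i, ('E_P[fun w => (Z 0%N w : Rd) i ord0] = 0)%E) ->
  forall i, (\int[mu]_z ((z : Rd) i ord0)%:E = 0)%E.
Proof.
move=> Zm i; rewrite -(Zm i) unlock.
have mc : measurable_fun [set: borel Rd] (fun z : borel Rd => ((z : Rd) i ord0)%:E).
  by apply/measurable_EFinP; exact: measurable_coord.
rewrite (@integral_distribution _ _ _ _ _ P (Z 0%N) (fun z : borel Rd => ((z : Rd) i ord0)%:E))//.
have i1 : P.-integrable setT (fun w => (1 + enorm (Z 0%N w : Rd) `^ p)%:E).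
  apply/integrableP; split.
    apply/measurable_EFinP; apply: measurable_funD => //.
    exact: (measurableT_comp (measurable_powR p) mZ0).
  rewrite (eq_integral (fun w => 1%:E + (enorm (Z 0%N w : Rd) `^ p)%:E)%E); last first.
    by move=> w _; rewrite gee0_abs// lee_fin addr_ge0// powR_ge0.
  rewrite ge0_integralD//; first last.
  - by apply/measurable_EFinP; exact: (measurableT_comp (measurable_powR p) mZ0).
  - by move=> w _; rewrite lee_fin powR_ge0.
  rewrite momentE integral_cst// [X in (_ * X)%E](_ : _ = 1%E); last exact: probability_setT.
  by rewrite mule1 -EFinD ltry.
apply: le_integrable i1 => //.
  exact: (measurableT_comp mc).
move=> w _ /=; rewrite lee_fin [leRHS]ger0_norm ?addr_ge0 ?powR_ge0//.
rewrite (le_trans (enorm_coord _ _))//.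
have [z1|z1] := leP (enorm (Z 0%N w : Rd)) 1; first by rewrite (le_trans z1)// lerDl powR_ge0.
apply: (@le_trans _ _ (enorm (Z 0%N w : Rd) `^ p)); last by rewrite lerDr.
rewrite -{1}(powRr1 (enorm_ge0 (Z 0%N w : Rd))) ler_powR ?(ltW z1)//.
exact: (ltW p1).
Qed.

Lemma law_moment : (\int[mu]_z (enorm (z : Rd) `^ p)%:E <= kappa%:E)%E.
Proof.
rewrite ge0_integral_distribution//; first by rewrite -momentE.
- apply/measurable_EFinP; exact: (measurableT_comp (measurable_powR p) (@measurable_enorm R d.+1)).
- by move=> y; rewrite lee_fin powR_ge0.
Qed.

Variables (a : Rm -> Rm) (sigma : Rm -> 'M[R]_(m, d.+1)) (D C : R) (phi : R -> Rm -> Rm).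
Hypothesis F : is_flow a D C phi.
Hypothesis C_gt0 : 0 < C.
Hypothesis sL : forall x y w,
  enorm ((sigma x - sigma y) *m w) <= D * enorm (x - y) * enorm w.
Hypothesis sB : forall x w, enorm (sigma x *m w) <= C * enorm w.
Hypothesis Z_mean : forall i, ('E_P[fun w => (Z 0%N w : Rd) i ord0] = 0)%E.

(** The exceptional set of [clipped_noise_tail] consists of tuples; it is pulled back to [Omega] by
    the noises numbered 1 to [n]. *)
Lemma bad_noise_prob (T0 c : R) (N : nat) : 0 < T0 -> 0 < c ->
  exists2 delta0, 0 < delta0 & forall delta, 0 < delta <= delta0 ->
  exists2 K, 0 <= K & forall eta x n, 0 < eta <= 1 -> n%:R * eta <= T0 ->
    exists E : set Omega, [/\ measurable E,
      forall w, ~ E w ->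
        forall j, (j <= n)%N -> enorm (clipped_noise a sigma eta (delta / eta) (Z ^~ w) x j) <= c
      & fine (P E) <= K * eta ^+ N].
Proof.
move=> T00 c0.
have [delta0 d0 hd] := clipped_noise_tail (is_flow_D F) C_gt0 (is_flow_aL F) sL sB
  p1 p2 kappa0 (law_mean Z_mean) law_moment N T00 c0.
exists delta0 => // delta /hd[K K0 hK]; exists K => // eta x n e0 nT.
have [E [mE hE PE]] := hK eta x n e0 nT.
pose s : n.-tuple nat := [tuple i.+1 | i < n].
have us : uniq s by rewrite map_inj_uniq ?enum_uniq// => i j [] /val_inj.
exists (sample Z s @^-1` E); split.
- rewrite -[X in measurable X]setTI; apply: measurable_sample => // i; exact: measurable_funPT.
- move=> w nE j jn; have := hE _ nE j jn.
  rewrite (_ : clipped_noise _ _ _ _ (tseq _) x j = clipped_noise a sigma eta (delta / eta) (Z ^~ w) x j)//.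
  apply: clipped_noise_ext => -[//|i] /andP[_ ij].
  have i_n : (i < n)%N by exact: leq_trans ij jn.
  transitivity (tnth (sample Z s w) (Ordinal i_n) : Rd); first by rewrite (tnth_nth (0 : Rd)).
  by rewrite !tnth_mktuple.
have [Zid Zind] := Z_iid.
have e : P (sample Z s @^-1` E) = mpower mu n E.
  apply: (@sample_law _ _ _ _ _ P Z _ mu) => //.
by rewrite e -lee_fin fineK// ge0_fin_numE// (le_lt_trans PE)// ltry.
Qed.

End large_jumps.

(** * Convergence along sequences for Lipschitz test functions *)

Lemma quarter_half_quarter {R : realType} (v x y z : R) :
  x <= v / 4 -> y <= v / 2 -> z <= v / 4 -> x + y + z <= v.
Proof. by lra. Qed.

Section path_limit.
Context {R : realType} {m d : nat} {disp : measure_display} {Omega : measurableType disp}.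
Local Notation Rm := 'cV[R]_m.
Local Notation Rd := 'cV[R]_d.+1.
Variables (P : probability Omega R) (Z : nat -> {RV P >-> borel Rd}) (alpha : R).
Hypothesis Z_iid : iid P Z.
Hypothesis alpha_gt1 : 1 < alpha.
Local Notation H := (tail_prob P (Z 0%N)).
Hypothesis Hreg : forall t : R, 0 < t -> H (t * x) / H x @[x --> +oo] --> t `^ (- alpha).
Variable rho : {sigma_finite_measure set (borel Rd) -> \bar R}.
Hypothesis rho_fin : forall r : R, 0 < r -> (rho [set z : Rd | (r <= enorm z)%R] < +oo)%E.
Hypothesis rho_cvg : forall (g : Rd -> R) (r M : R), 0 < r -> continuous g ->
  (forall z, 0 <= g z <= M) -> (forall z, enorm z <= r -> g z = 0) ->
  (\int[P]_w (g (x^-1 *: (Z 0%N w : Rd)))%:E * ((H x)^-1)%:E @[x --> +oo%R]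
    --> \int[rho]_z (g z)%:E)%E.
Local Notation mu := (law (Z 0%N)).
Local Notation lam := (lambda P (Z 0%N)).
Variables (a : Rm -> Rm) (sigma : Rm -> 'M[R]_(m, d.+1)) (D C : R) (phi : R -> Rm -> Rm).
Hypothesis F : is_flow a D C phi.
Hypothesis C_gt0 : 0 < C.
Hypothesis sL : forall x y w,
  enorm ((sigma x - sigma y) *m w) <= D * enorm (x - y) * enorm w.
Hypothesis sB : forall x w, enorm (sigma x *m w) <= C * enorm w.
Hypothesis Z_mean : forall i, ('E_P[fun w => (Z 0%N w : Rd) i ord0] = 0)%E.
Variables (T : {posnum R}) (A : set Rm) (k : nat).
Variables (eps r M L : R) (f : Dspace m T -> R).
Hypotheses (eps0 : 0 < eps) (r0 : 0 < r) (L0 : 0 <= L).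
Hypothesis fM : forall y, 0 <= f y <= M.
Hypothesis fL : forall x y, `|f x - f y| <= L * mdist x y.
Hypothesis fv : forall xi y, jump_paths_pred a sigma T A k eps xi -> mdist xi y <= r -> f y = 0.

Local Notation leb := (mpower (@lebesgue_measure R) k).
Local Notation E := (expR (D * T%:num)).
Local Notation Inc := (@increasing_tuples R k `]0, T%:num]%classic).
Local Notation path eta x w := (step_path T (sgd a sigma eta (Z ^~ w) x) eta : Dspace m T).

Definition limit_value x : R :=
  \int[leb]_(t in (@increasing_tuples R k `]0, T%:num[%classic : set (k.-tuple (measurableTypeR R))))
    \int[mpower rho k]_W f (jump_path a sigma T x (W : k.-tuple Rd) t).

Let D0 := is_flow_D F.
Let M0 : 0 <= M. Proof. by have /andP[/le_trans h /h] := fM (step_path T (fun=> 0) 0). Qed.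
Let E0 : 0 < E. Proof. exact: expR_gt0. Qed.
Let q : R := Num.min eps r.
Let q0 : 0 < q. Proof. by rewrite lt_min eps0. Qed.
(** The factor 8 makes the noises of [noise_change], at most [2 * k] of scaled norm at most
    [delta1], use no more than half of [q] in [chain_error]; the other half is left to the clipped
    noise and to the grid. *)
Let delta1 : R := q / (8 * k.+1%:R * C * E).
Let d10 : 0 < delta1. Proof. by rewrite divr_gt0// !mulr_gt0. Qed.

Let delta1E : 8 * k.+1%:R * (E * (C * delta1)) = q.
Proof.
by rewrite /delta1; field; rewrite !gt_eqF.
Qed.

Let EC0 : 0 <= E * (C * delta1). Proof. by apply: mulr_ge0; [exact: expR_ge0|apply: mulr_ge0; exact: ltW]. Qed.

Let delta1q : E * (C * delta1) <= q.
Proof.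
rewrite -[leRHS]delta1E; apply: (ler_peMl EC0).
by rewrite -natrM ler1n.
Qed.

Let qe : q <= eps. Proof. by rewrite ge_min lexx. Qed.
Let qr : q <= r. Proof. by rewrite ge_min lexx orbT. Qed.

Let delta1_eps : E * (C * delta1) <= eps. Proof. exact: le_trans delta1q qe. Qed.
Let delta1_r : E * (C * delta1) <= r. Proof. exact: le_trans delta1q qr. Qed.

Let jump_vanishing x (t : k.-tuple R) : A x -> Inc t ->
  vanishing_near0 delta1 M (fun W : k.-tuple Rd => f (jump_path a sigma T x W t)).
Proof.
move=> Ax it; split.
- exact: (measurable_lipschitz_jump F sL sB x L0 fL it).
- by move=> W; exact: fM.
- move=> W i Wi; apply: (small_jump_vanish F sB fv Ax it (ltW d10) delta1_eps delta1_r).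
  by exists i.
Qed.

Lemma ex_jump_vanishing : exists2 delta, 0 < delta & forall x (t : k.-tuple R), A x -> Inc t ->
  vanishing_near0 delta M (fun W : k.-tuple Rd => f (jump_path a sigma T x W t)).
Proof. by exists delta1 => //; exact: jump_vanishing. Qed.

Lemma jump_sampleE eta w (J : {set 'I_(Num.truncn (T%:num / eta))}) :
  jump_sample (Z ^~ w) k J = scale_tuple eta (sample Z (tidx k J) w : k.-tuple Rd).
Proof.
by apply: eq_from_tnth => i; rewrite tnth_map [RHS]tnth_map [in RHS]tnth_mktuple.
Qed.

Let mZ n : measurable_fun setT (Z n). Proof. exact: measurable_funPT. Qed.

Lemma integral_sample (s : k.-tuple nat) (g : k.-tuple (borel Rd) -> R) : uniq s ->
  measurable_fun setT g -> (forall W, 0 <= g W) ->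
  \int[P]_w g (sample Z s w) = \int[mpower mu k]_W g W.
Proof.
move=> us mg g0; rewrite /Rintegral; congr fine.
have [Zid Zind] := Z_iid.
rewrite -(integral_set_function (m := pushforward P (sample Z s)) (A := setT)).
  rewrite ge0_integral_pushforward//.
  - exact: measurable_sample.
  - exact/measurable_EFinP.
  - by move=> W _; rewrite lee_fin.
by move=> B mB _; apply: (@sample_law _ _ _ _ _ P Z mZ mu).
Qed.

Section along_sequence.
Variables (eta : nat -> R) (xs : nat -> Rm) (x : Rm).
Hypothesis eta0 : eta n @[n --> \oo] --> 0^'+.
Hypothesis xs_x : xs n @[n --> \oo] --> x.
Hypothesis xsA : forall n, A (xs n).
Local Notation N n := (Num.truncn (T%:num / eta n)).

Let en : \forall n \near \oo, 0 < eta n. Proof. exact: eta0 (nbhs_right_gt 0). Qed.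

Let en_lt e : 0 < e -> \forall n \near \oo, eta n < e.
Proof. by move=> e0; exact: eta0 (nbhs_right_lt e0). Qed.

Let ratio n s := H (s / eta n) / H (eta n)^-1.

Let ratio_cvg s : 0 < s -> ratio n s @[n --> \oo] --> s `^ (- alpha).
Proof. by move=> s0; exact: (tail_ratio_cvg Hreg). Qed.

Let ratio_near s e : 0 < s -> 0 < e -> \forall n \near \oo, ratio n s < s `^ (- alpha) + e.
Proof. by move=> s0 e0; apply: (cvgr_lt _ (ratio_cvg s0)); rewrite ltrDl. Qed.

Let H_gt0 s : 0 < H s. Proof. exact: (tail_prob_pos Hreg). Qed.

Let ratio_ge0 n s : 0 <= ratio n s. Proof. by rewrite divr_ge0// ltW. Qed.

(** The trace of the neighbourhoods of [t] on increasing tuples. Its product with the filter of [n]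
    lets [vague_cvg] give convergence jointly in the index and in the jump times. *)
Let near_time (t : k.-tuple R) : set_system (k.-tuple R) :=
  [set U | exists2 b, 0 < b & forall s, Inc s -> (forall j, `|tnth s j - tnth t j| < b) -> U s].

Let near_time_proper t : Inc t -> ProperFilter (near_time t).
Proof.
move=> it; apply: Build_ProperFilter.
  by move=> [b b0 hb]; apply: (hb t it) => j; rewrite subrr normr0.
split.
- by exists 1.
- move=> U V [b b0 hb] [c c0 hc]; exists (Num.min b c); first by rewrite lt_min b0.
  move=> s i_s h; split; [apply: hb|apply: hc] => // j; have := h j; rewrite lt_min => /andP[] //.
- by move=> U V UV [b b0 hb]; exists b => // s i_s h; apply: UV; exact: hb.
Qed.

(** By independence each expectation is an integral against the law of [k] noises. In the inverse of
    [lambda ^+ k], the power of the tail normalises this law as in [vague_cvg], and the factor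
    [eta ^+ k] is the volume of a cell as in [time_limit]. *)
Lemma sum_limit : (lam (eta n) ^+ k)^-1 *
  \sum_(J : {set 'I_(N n)} | #|J| == k) \int[P]_w
     f (jump_path a sigma T (xs n) (jump_sample (Z ^~ w) k J) (times k (eta n) J))
  @[n --> \oo] --> limit_value x.
Proof.
pose Phi n s := (H (eta n)^-1)^-1 ^+ k *
  \int[mpower mu k]_W f (jump_path a sigma T (xs n) (scale_tuple (eta n) W) s).
have h1 : \forall n \near \oo, forall s, Inc s -> 0 <= Phi n s <= (delta1 `^ (- alpha) + 1) ^+ k * M.
  near=> n => s i_s; have e0 : 0 < eta n by near: n.
  have v : vanishing_near0 (delta1 / eta n) M
      (fun W : k.-tuple Rd => f (jump_path a sigma T (xs n) (scale_tuple (eta n) W) s)).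
    have [mG GM Gr] := jump_vanishing (xsA n) i_s; split => //.
    - by apply: (measurableT_comp mG); exact: measurable_scale_tuple.
    - move=> W i Wi; apply: (Gr _ i).
      by rewrite tnth_map enormZ gtr0_norm// mulrC -ler_pdivlMr.
  have G0 W : 0 <= f (jump_path a sigma T (xs n) (scale_tuple (eta n) W) s).
    by have /andP[] := fM (jump_path a sigma T (xs n) (scale_tuple (eta n) W) s).
  have := integral_vanishing_le mu v; rewrite [X in (_ * X ^+ _)%E](law_tail _) -EFin_expe -EFinM => le1.
  rewrite mulr_ge0 ?exprn_ge0 ?invr_ge0 ?(ltW (H_gt0 _)) ?Rintegral_ge0//=.
  have i0 : (0 <= \int[mpower mu k]_W (f (jump_path a sigma T (xs n) (scale_tuple (eta n) (W : k.-tuple Rd)) s))%:E)%E.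
    by apply: integral_ge0 => W _; rewrite lee_fin.
  have f1 : (\int[mpower mu k]_W (f (jump_path a sigma T (xs n) (scale_tuple (eta n) (W : k.-tuple Rd)) s))%:E)%E \is a fin_num.
    by rewrite ge0_fin_numE// (le_lt_trans le1)// ltry.
  move: le1; rewrite -(fineK f1) lee_fin => le1.
  apply: (@le_trans _ _ ((H (eta n)^-1)^-1 ^+ k * (M * H (delta1 / eta n) ^+ k))).
    by rewrite ler_wpM2l// exprn_ge0// invr_ge0 ltW.
  have E1 (u v0 z : R) : u ^+ k * (z * v0 ^+ k) = (v0 * u) ^+ k * z by rewrite exprMn; ring.
  rewrite E1 ler_wpM2r// lerXn2r ?nnegrE ?addr_ge0 ?powR_ge0 ?mulr_ge0 ?invr_ge0 ?(ltW (H_gt0 _))//.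
  apply: ltW; near: n; exact: ratio_near.
have h2 : forall t, @increasing_tuples R k `]0, T%:num[%classic t -> forall e, 0 < e -> exists2 b, 0 < b &
  \forall n \near \oo, forall s, Inc s -> (forall j, `|tnth s j - tnth t j| < b) ->
    `|Phi n s - \int[mpower rho k]_W f (jump_path a sigma T x (W : k.-tuple Rd) t)| < e.
  move=> t it0 e e0.
  have it : Inc t.
    have [t1 t2] := it0; split => // j; have := t1 j.
    by rewrite /= !in_itv/= => /andP[-> /ltW ->].
  have FFt := near_time_proper it.
  pose F' : set_system (nat * k.-tuple R) := filter_prod \oo (near_time t).
  have FF' : ProperFilter F' by exact: filter_prod_proper.
  pose G (ns : nat * k.-tuple R) (W : k.-tuple Rd) := f (jump_path a sigma T (xs ns.1) W ns.2).
  have ce : (eta \o fst) @ F' --> 0^'+ by apply: cvg_comp eta0; exact: cvg_fst.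
  have v : \forall ns \near F', vanishing_near0 delta1 M (G ns).
    exists (setT, Inc); first by split => /=; [exact: filterT|exists 1].
    by move=> [n s] /= [_ i_s]; exact: jump_vanishing.
  have cj : cvg_jointly F' G (fun W => f (jump_path a sigma T x W t)).
    move=> W e' e'0; have eL : 0 < e' / (L + 1) by rewrite divr_gt0// ltr_wpDl.
    have [g g0 hg] := jump_path_continuous F sL sB x W it0 (divr_gt0 eL (ltr0n _ 2)).
    exists g => //.
    have xn : \forall n \near \oo, enorm (xs n - x) < g by have /enorm_cvgP := xs_x; exact.
    exists ([set n | enorm (xs n - x) < g],
      [set s | Inc s /\ forall j, `|tnth s j - tnth t j| < g]).
      split => //=; exists g => // s i_s h1'; by split.
    move=> [n s] /= [xn' [i_s st]] W' W'W; rewrite (le_lt_trans (fL _ _))//.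
    apply: (@le_lt_trans _ _ ((L + 1) * (e' / (L + 1) / 2))).
      rewrite ler_pM ?mdist_ge0 ?lerDl//; apply: hg => //; first exact: ltW.
        by move=> i; exact: ltW.
      by move=> i; exact: ltW.
    have L1 : L + 1 != 0 by rewrite gt_eqF// ltr_wpDl.
    rewrite [ltLHS](_ : _ = e' / 2); last by field.
    by rewrite ltr_pdivrMr// mulr_natr mulr2n ltrDl.
  have h := @vague_cvg R d disp Omega P (Z 0%N) alpha alpha_gt1 Hreg rho rho_fin rho_cvg
    _ F' FF' (eta \o fst) k G (fun W => f (jump_path a sigma T x W t)) delta1 M d10 ce v cj.
  have hn : \forall ns \near F', `|\int[mpower rho k]_W f (jump_path a sigma T x (W : k.-tuple Rd) t) -
      (H (eta ns.1)^-1)^-1 ^+ k * \int[mpower mu k]_W G ns (scale_tuple (eta ns.1) W)| < e.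
    by apply: ((cvgrPdist_lt _ _).1 h).
  case: hn => -[U V] /= [FU [b b0 hb]] UV; exists b => //.
  apply: filterS FU => n Un s i_s st; rewrite distrC.
  exact: UV (n, s) (conj Un (hb _ i_s st)).
have T0 : 0 < T%:num by [].
have lim := @time_limit R k T%:num T0 eta Phi
  (fun t => \int[mpower rho k]_W f (jump_path a sigma T x (W : k.-tuple Rd) t))
  ((delta1 `^ (- alpha) + 1) ^+ k * M) eta0 h1 h2.
move: lim; apply: cvg_trans; apply: near_eq_cvg; near=> n.
have e0 : 0 < eta n by near: n.
have Tn : (N n)%:R * eta n <= T%:num.
  have h : 0 <= T%:num / eta n by rewrite divr_ge0// ltW.
  by rewrite -ler_pdivlMr//; have /andP[] := truncn_itv h.
rewrite !mulr_sumr; apply: eq_bigr => J /eqP Jk; rewrite /Phi mulrA; congr (_ * _).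
  by rewrite /lambda exprMn invfM !exprVn invrK.
have [mG GM Gr] := jump_vanishing (xsA n) (times_increasing Jk e0 Tn).
rewrite -(@integral_sample (tidx k J) (fun W => f (jump_path a sigma T (xs n) (scale_tuple (eta n) W) (times k (eta n) J)))).
- by apply: eq_Rintegral => w _; rewrite jump_sampleE.
- by rewrite tidxE//; apply: sorted_uniq (sorted_idx J); [exact: ltn_trans|exact: ltnn].
- by apply: (measurableT_comp mG); exact: measurable_scale_tuple.
- by move=> W; have /andP[] := GM (scale_tuple (eta n) W).
Unshelve. all: by end_near. Qed.

Let evt (s : R) n' (J : {set 'I_n'}) (eta' : R) : set Omega :=
  \bigcap_(i in [set` idx J]) (Z i @^-1` [set w : borel Rd | (s / eta' < enorm (w : Rd))%R]).

(** One of the large noises must exceed a higher threshold; with [K] as this threshold, these events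
    cover the case where the noises are too large for the stability bound. *)
Let evt2 (s1 s2 : R) n' (J : {set 'I_n'}) (i0 : 'I_n') (eta' : R) : set Omega :=
  \bigcap_(i in [set` idx J])
    (Z i @^-1` [set w : borel Rd | ((if i == i0.+1 then s2 else s1) / eta' < enorm (w : Rd))%R]).

Let uniq_idx n' (J : {set 'I_n'}) : uniq (idx J).
Proof. by apply: sorted_uniq (sorted_idx J); [exact: ltn_trans|exact: ltnn]. Qed.

Let mbig s (i : nat) : measurable (Z i @^-1` [set w : borel Rd | (s < enorm (w : Rd))%R]).
Proof. by rewrite -[X in measurable X]setTI; apply: mZ => //; exact: measurable_enorm_gt. Qed.

Let mevt s n' (J : {set 'I_n'}) eta' : measurable (evt s J eta').
Proof. by apply: fin_bigcap_measurable => // i _; exact: mbig. Qed.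

Let mevt2 s1 s2 n' (J : {set 'I_n'}) i0 eta' : measurable (evt2 s1 s2 J i0 eta').
Proof. by apply: fin_bigcap_measurable => // i _; exact: mbig. Qed.

Let Pevt s n' (J : {set 'I_n'}) eta' j : #|J| = j -> fine (P (evt s J eta')) = H (s / eta') ^+ j.
Proof.
move=> Jj; rewrite (probability_big Z_iid (fun=> s / eta'))//=.
by rewrite big_const_seq count_predT size_idx Jj iter_mulr_1.
Qed.

Let Pevt2 s1 s2 n' (J : {set 'I_n'}) (i0 : 'I_n') eta' : #|J| = k -> i0 \in J ->
  fine (P (evt2 s1 s2 J i0 eta')) = H (s2 / eta') * H (s1 / eta') ^+ k.-1.
Proof.
move=> Jk iJ; rewrite (probability_big Z_iid (fun i => (if i == i0.+1 then s2 else s1) / eta'))//=.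
have ii : i0.+1 \in idx J by rewrite mem_idx.
rewrite (bigD1_seq i0.+1)//= eqxx; congr (_ * _).
rewrite (eq_bigr (fun=> H (s1 / eta'))); last by move=> i /negPf ->.
rewrite big_const_seq iter_mulr_1; congr (_ ^+ _).
have := count_predC (pred1 i0.+1) (idx J); rewrite count_uniq_mem// ii size_idx Jk.
by move=> <-; rewrite add1n.
Qed.

Let evtE s eta' w (J : {set 'I_(Num.truncn (T%:num / eta'))}) : 0 < eta' ->
  (J \subset big_noise T eta' (Z ^~ w) s)%:R = \1_(evt s J eta') w :> R.
Proof.
move=> e0; rewrite indicE; congr (nat_of_bool _)%:R; apply/idP/idP => [/fintype.subsetP h|].
  rewrite mem_set// => i /= /mapP[j]; rewrite mem_enum => /h.
  by rewrite finset.in_set enormZ gtr0_norm// => h' ->; rewrite ltr_pdivrMr// mulrC.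
rewrite inE => h; apply/fintype.subsetP => i iJ.
rewrite finset.in_set enormZ gtr0_norm// mulrC -ltr_pdivrMr//.
by apply: (h i.+1); rewrite /= mem_idx.
Qed.

Let C0 := is_flow_C F.

(** The bound of [comparison] is integrated. It has four contributions: bad clipped noise, more than
    [k] large noises, the path error for [k] of them, and a noise above [K / eta]. Each is made at
    most [e / 8] relative to [lambda ^+ k], with constants chosen in the order [K], [c], [delta],
    [eta]. *)
Lemma path_limit_error e : 0 < e -> \forall n \near \oo,
  `|(lam (eta n) ^+ k)^-1 * \int[P]_w f (path (eta n) (xs n) w) -
    (lam (eta n) ^+ k)^-1 *
  \sum_(J : {set 'I_(N n)} | #|J| == k) \int[P]_w
     f (jump_path a sigma T (xs n) (jump_sample (Z ^~ w) k J) (times k (eta n) J))| < e.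
Proof.
move=> e0; have T0 : 0 < T%:num by [].
pose U := delta1 `^ (- alpha) + 1; have U1 : 1 <= U by rewrite lerDr powR_ge0.
have U0 : 0 <= U by exact: le_trans ler01 U1.
pose W2 := M * k%:R * T%:num ^+ k * U ^+ k.-1.
have W20 : 0 <= W2 by rewrite !mulr_ge0 ?exprn_ge0.
(* For [K >= 1] the power [- alpha] of [K] is at most [1 / K], which the last argument makes at most
   [e / (16 * (W2 + 1))]. *)
pose K := Num.max delta1 (Num.max 1 (16 * (W2 + 1) / e)).
have K1 : 1 <= K by rewrite !le_max lexx orbT.
have Kd : delta1 <= K by rewrite le_max lexx.
have Kp : 0 < K by exact: lt_le_trans K1.
have KE : W2 * (K `^ (- alpha) + e / (16 * (W2 + 1))) <= e / 8.
  have W21 : 0 < W2 + 1 by rewrite ltr_wpDl.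
  have h : K `^ (- alpha) <= e / (16 * (W2 + 1)).
    apply: (@le_trans _ _ K^-1).
      by rewrite -powR_inv1 ?(ltW Kp)// ler_powR// lerN2 ltW.
    rewrite -[leRHS]invrK lef_pV2 ?posrE ?invr_gt0 ?divr_gt0 ?mulr_gt0// invf_div.
    by rewrite !le_max lexx !orbT.
  apply: (@le_trans _ _ ((W2 + 1) * (e / (16 * (W2 + 1)) + e / (16 * (W2 + 1))))).
    apply: (@le_trans _ _ (W2 * (e / (16 * (W2 + 1)) + e / (16 * (W2 + 1))))).
      by rewrite ler_wpM2l// lerD2r.
    apply: ler_wpM2r; last by rewrite lerDl.
    by apply: addr_ge0; apply: divr_ge0; rewrite ?(ltW e0)// mulr_ge0// ltW.
  by rewrite le_eqVlt; apply/orP; left; apply/eqP; field; rewrite gt_eqF.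
pose Q := ((1 + D * K) * E + 1) ^+ k.+1.
have Q0 : 0 <= Q by rewrite exprn_ge0// addr_ge0// mulr_ge0 ?expR_ge0// addr_ge0// mulr_ge0// ltW.
pose V := L * (1 + Q) * (T%:num ^+ k * U ^+ k).
have V0 : 0 <= V.
  apply: mulr_ge0; first by apply: mulr_ge0 => //; exact: addr_ge0.
  by apply: mulr_ge0; exact: exprn_ge0.
(* The first bound keeps [chain_error] below [q]; the second makes the path error small and involves
   [V], hence [K]. *)
pose c := Num.min (q / (8 * E)) (e / (32 * (V + 1) * E)).
have V1 : 0 < V + 1 by rewrite ltr_wpDl.
have c0 : 0 < c by rewrite lt_min !divr_gt0 ?mulr_gt0.
have c1 : 2 * c * E <= q / 4.
  have : c <= q / (8 * E) by rewrite ge_min lexx.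
  by rewrite ler_pdivlMr ?mulr_gt0// => h; lra.
have c2 : V * (2 * c * E) <= e / 16.
  have : c <= e / (32 * (V + 1) * E) by rewrite ge_min lexx orbT.
  rewrite ler_pdivlMr ?mulr_gt0// => h.
  have : 0 <= c * E by rewrite mulr_ge0 ?expR_ge0// ltW.
  by move: h; rewrite (_ : c * (32 * (V + 1) * E) = 16 * (V * (2 * c * E)) + 32 * (c * E)); [lra|ring].
have [qq [cl cl0 hcl]] := tail_prob_ge_poly (measurableT_comp (@measurable_enorm R d.+1) (mZ 0%N)) Hreg.
(* [lambda] is at least [cl * eta ^+ qq], so the exponent [(qq * k).+1] leaves a spare factor [eta]
   beside [lambda ^+ k]. *)
have [delta0 dl0 hdl] := bad_noise_prob Z_iid alpha_gt1 Hreg F C_gt0 sL sB Z_mean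
  (qq * k).+1 T0 c0.
pose delta := Num.min delta0 delta1.
have dp : 0 < delta by rewrite lt_min dl0 d10.
have dd1 : delta <= delta1 by rewrite ge_min lexx orbT.
have ddl : 0 < delta <= delta0 by rewrite dp ge_min lexx.
have [Kb Kb0 hKb] := hdl delta ddl.
pose S := (C + T%:num * (D * C)) * E + 2 * C.
have S0 : 0 <= S by rewrite addr_ge0 ?mulr_ge0 ?expR_ge0 ?addr_ge0 ?mulr_ge0.
have errE h c' : chain_error D C T%:num h c' = 2 * c' * E + h * S.
  by rewrite /chain_error /S; ring.
pose Ud := delta `^ (- alpha) + 1; have Ud0 : 0 <= Ud by rewrite addr_ge0 ?powR_ge0.
pose B2 := M * k.+2%:R * (T%:num * Ud) ^+ k.+1.
have B20 : 0 <= B2 by rewrite !mulr_ge0 ?exprn_ge0 ?mulr_ge0.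
pose B1 := 2 * M * (Kb / cl ^+ k).
have B10 : 0 <= B1 by rewrite !mulr_ge0 ?invr_ge0 ?exprn_ge0 ?(ltW cl0).
have small_cst (B v : R) : 0 <= B -> 0 < v -> exists2 h, 0 < h & forall y, 0 <= y -> y < h -> B * y <= v.
  move=> B0 v0; exists (v / (B + 1)); first by rewrite divr_gt0// ltr_wpDl.
  move=> y y0; rewrite ltr_pdivlMr ?ltr_wpDl// => h; apply: (le_trans _ (ltW h)).
  by rewrite mulrC ler_wpM2l// lerDl.
have e8 : 0 < e / 8 by rewrite divr_gt0.
have e16 : 0 < e / 16 by rewrite divr_gt0.
have q4 : 0 < q / 4 by rewrite divr_gt0.
have [h1 h10 hh1] := small_cst B1 _ B10 e8.
have [h2 h20 hh2] := small_cst B2 _ B20 e8.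
have [h3 h30 hh3] := small_cst S _ S0 q4.
have VS0 : 0 <= V * S by rewrite mulr_ge0.
have [h4 h40 hh4] := small_cst (V * S) _ VS0 e16.
have lam0 : \forall n \near \oo, lam (eta n) < h2.
  by apply: (cvgr_lt _ (lambda_cvg0 alpha_gt1 Hreg eta0)).
have ek : 0 < e / (16 * (W2 + 1)) by rewrite divr_gt0// mulr_gt0// ltr_wpDl.
have Tk : 0 < T%:num / k.+1%:R by rewrite divr_gt0.
near=> n.
have ej : 0 < eta n by near: n.
have ej0 := ltW ej.
have ej1 : eta n <= 1 by apply: ltW; near: n; exact: en_lt.
have eh1 : eta n < h1 by near: n; exact: en_lt.
have eh3 : eta n < h3 by near: n; exact: en_lt.
have eh4 : eta n < h4 by near: n; exact: en_lt.
have eTk : eta n < T%:num / k.+1%:R by near: n; exact: en_lt.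
have lh2 : lam (eta n) < h2 by near: n.
have r1 : ratio n delta1 <= U by apply: ltW; near: n; exact: ratio_near.
have rd : ratio n delta <= Ud by apply: ltW; near: n; exact: ratio_near.
have rK : ratio n K <= K `^ (- alpha) + e / (16 * (W2 + 1)).
  by apply: ltW; near: n; exact: ratio_near.
have lp : 0 < lam (eta n) by exact: (lambda_gt0 Hreg).
have lkp : 0 < lam (eta n) ^+ k by rewrite exprn_gt0.
set nn := N n.
have TE : 0 <= T%:num / eta n by rewrite divr_ge0.
have nT : nn%:R * eta n <= T%:num.
  by rewrite -ler_pdivlMr//; have /andP[] := truncn_itv TE.
have kn : (k <= nn)%N.
  rewrite /nn truncn_ge_nat// ler_pdivlMr//.
  move: eTk; rewrite ltr_pdivlMr// => /ltW; apply: le_trans.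
  by rewrite mulrC ler_wpM2l// ler_nat.
have [Eb [mEb hEb PEb]] := hKb (eta n) (xs n) nn (introT andP (conj ej ej1)) nT.
have hS : eta n * S <= q / 4 by rewrite mulrC; exact: hh3.
have k8 : 2 * ((2 * k)%:R * (C * delta1)) * E <= q / 2.
  have h : E * (C * delta1) * k%:R <= E * (C * delta1) * k.+1%:R by rewrite ler_wpM2l// ler_nat.
  have := delta1E; rewrite natrM; move: (k%:R) (k.+1%:R) h => x1 x2 h h'.
  rewrite (_ : 2 * _ * E = 4 * (E * (C * delta1) * x1)); last by ring.
  rewrite -h' (_ : _ / 2 = 4 * (E * (C * delta1) * x2)); last by field.
  by rewrite ler_wpM2l.
have ceq : chain_error D C T%:num (eta n) (c + (2 * k)%:R * (C * delta1)) <= q.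
  rewrite errE mulrDr mulrDl.
  exact: quarter_half_quarter.
pose pe := path_error D C T k L (eta n) c K.
have peE : pe = L * (1 + Q) * (2 * c * E + eta n * S).
  by rewrite /pe /path_error errE /Q; ring.
have pe0 : 0 <= pe.
  by rewrite peE !mulr_ge0 ?addr_ge0// !mulr_ge0 ?expR_ge0// ltW.
pose G (J : {set 'I_nn}) w := f (jump_path a sigma T (xs n) (jump_sample (Z ^~ w) k J) (times k (eta n) J)).
(* The bound of [comparison] in terms of events of known probability; that some noise of [J] exceeds
   [K / eta] is bounded by a sum over its elements. *)
pose g w := 2 * M * \1_Eb w +
  M * k.+2%:R * (\sum_(J : {set 'I_nn} | #|J| == k.+1) \1_(evt delta J (eta n)) w) +
  \sum_(J : {set 'I_nn} | #|J| == k) (pe * \1_(evt delta1 J (eta n)) w +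
    M * \sum_(i in J) \1_(evt2 delta1 K J i (eta n)) w).
have le_g w : `|f (path (eta n) (xs n) w) - \sum_(J : {set 'I_nn} | #|J| == k) G J w| <= g w.
  have cmp := @comparison R m d a sigma D C phi F sL sB T A k eps r M L f L0 fM fL fv
    (eta n) (Z ^~ w) (xs n) ej (xsA n) delta delta1 c K dp dd1 (ltW c0) (ltW Kp)
    delta1_eps delta1_r kn (le_trans ceq qe) (le_trans ceq qr) (w \in Eb).
  apply: (le_trans (cmp _)); first by move=> /negP wE; apply: hEb => wE'; apply: wE; rewrite inE.
  rewrite /g indicE; apply: lerD; first apply: lerD => //.
    by rewrite le_eqVlt; apply/orP; left; apply/eqP; congr (_ * _); apply: eq_bigr => J _; rewrite evtE.
  apply: ler_sum => J /eqP Jk; rewrite mulrDr evtE// [leLHS]addrC [leRHS]addrC [_ * pe]mulrC lerD2r.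
  rewrite mulrCA ler_wpM2l//.
  rewrite -evtE//; case: (boolP (J \subset _)) => JB; last by rewrite mul0r sumr_ge0// => i _; rewrite indicE.
  rewrite mul1r; case: (boolP [forall i in J, enorm (eta n *: (Z i.+1 w : Rd)) <= K]) => [_|].
    by rewrite sumr_ge0// => i _; rewrite indicE.
  rewrite negb_forall_in => /existsP[i /andP[iJ]]; rewrite -ltNge => Ki.
  apply: (@le_trans _ _ (\1_(evt2 delta1 K J i (eta n)) w)); last first.
    by rewrite (bigD1 i)//= lerDl sumr_ge0// => j _; rewrite indicE.
  rewrite indicE mem_set// => j /= /mapP[j' ]; rewrite mem_enum => j'J ->.
  have enw : enorm (eta n *: (Z j'.+1 w : Rd)) = eta n * enorm (Z j'.+1 w : Rd).
    by rewrite enormZ gtr0_norm.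
  rewrite ltr_pdivrMr// [ltRHS]mulrC -enw eqSS val_eqE.
  case: eqP => [->//|_]; move/fintype.subsetP: JB => /(_ j' j'J).
  by rewrite finset.in_set.
have bmG (J : {set 'I_nn}) : #|J| = k -> bounded_measurable (G J).
  move=> Jk; have [mG GM _] := jump_vanishing (xsA n) (times_increasing Jk ej nT).
  split.
    rewrite (_ : G J = (fun W : k.-tuple (borel Rd) => f (jump_path a sigma T (xs n) (W : k.-tuple Rd) (times k (eta n) J)))
        \o (scale_tuple (eta n) : k.-tuple (borel Rd) -> k.-tuple (borel Rd)) \o sample Z (tidx k J)).
      apply: (measurableT_comp mG); apply: measurableT_comp; first exact: measurable_scale_tuple.
      exact: measurable_sample.
    by apply/funext => w; rewrite /G jump_sampleE.
  by exists M => w; have /andP[g0 gM] := fM (jump_path a sigma T (xs n) (jump_sample (Z ^~ w) k J) (times k (eta n) J)); rewrite ger0_norm.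
have bmX : bounded_measurable (fun w => f (path (eta n) (xs n) w)).
  split.
    have fc : continuous f.
      move=> y; have FFy := nbhs_filter y; apply/cvgrPdist_lt => v v0; have vL : 0 < v / (L + 1) by rewrite divr_gt0// ltr_wpDl.
      apply: filterS (nbhs_mdist y vL) => y' yy'; rewrite (le_lt_trans (fL _ _))//.
      apply: (@le_lt_trans _ _ ((L + 1) * mdist y y')).
        by rewrite ler_wpM2r ?mdist_ge0// lerDl.
      by rewrite -ltr_pdivlMl ?ltr_wpDl// mulrC.
    apply: (measurableT_comp (borel_measurable_continuous fc)).
    exact: (measurable_step_path F sL sB mZ).
  by exists M => w; have /andP[g0 gM] := fM (path (eta n) (xs n) w); rewrite ger0_norm.
have bmI (B : set Omega) : measurable B -> bounded_measurable (\1_B : Omega -> R).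
  exact: bounded_measurable_indic.
have [bmS eS] := bounded_measurable_sum P (index_enum {set 'I_nn})
  (fun J (Jk : #|J| == k) => bmG J (eqP Jk)).
have [bm2 e2] := bounded_measurable_sum P (index_enum {set 'I_nn}) (p := fun J => #|J| == k.+1)
  (fun J _ => bmI _ (mevt delta J (eta n))).
have bmi (J : {set 'I_nn}) := bounded_measurable_sum P (index_enum 'I_nn) (p := fun i => i \in J)
  (fun i _ => bmI _ (mevt2 delta1 K J i (eta n))).
have bmJ (J : {set 'I_nn}) : bounded_measurable (fun w => pe * \1_(evt delta1 J (eta n)) w +
    M * \sum_(i in J) \1_(evt2 delta1 K J i (eta n)) w).
  apply: bounded_measurableD; apply: bounded_measurableZ; first exact: bmI.
  by have [] := bmi J.
have [bm3 e3] := bounded_measurable_sum P (index_enum {set 'I_nn}) (p := fun J => #|J| == k)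
  (fun J _ => bmJ J).
have I := bounded_measurable_integrable P.
have bmg : bounded_measurable g.
  by apply: bounded_measurableD => //; apply: bounded_measurableD; apply: bounded_measurableZ => //; exact: bmI.
have intg : \int[P]_w g w = 2 * M * fine (P Eb) +
  M * k.+2%:R * (('C(nn, k.+1))%:R * H (delta / eta n) ^+ k.+1) +
  ('C(nn, k))%:R * (pe * H (delta1 / eta n) ^+ k +
    M * (k%:R * (H (K / eta n) * H (delta1 / eta n) ^+ k.-1))).
  have cJ (j : nat) (v : R) : \sum_(J : {set 'I_nn} | #|J| == j) v = ('C(nn, j))%:R * v.
    rewrite sumr_const -[LHS]mulr_natl; congr (_ * _); congr (_%:R).
    by rewrite -[in RHS](card_ord nn) -card_draws; apply: eq_card => J; rewrite !(inE, finset.in_set).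
  rewrite RintegralD//; [|apply: I; apply: bounded_measurableD; apply: bounded_measurableZ => //; exact: bmI|exact: I].
  rewrite RintegralD//; [|apply: I; apply: bounded_measurableZ; exact: bmI|apply: I; exact: bounded_measurableZ].
  rewrite !RintegralZl//; [|exact: I|apply: I; exact: bmI].
  rewrite e2 e3 Rintegral_indic// -!cJ; congr (_ + _ * _ + _).
    by apply: eq_bigr => J /eqP Jk; rewrite Rintegral_indic// (Pevt _ _ Jk).
  apply: eq_bigr => J /eqP Jk; have [bi ei] := bmi J.
  rewrite RintegralD//; [|apply: I; apply: bounded_measurableZ; exact: bmI|apply: I; exact: bounded_measurableZ].
  rewrite !RintegralZl//; [|exact: I|apply: I; exact: bmI].
  rewrite ei Rintegral_indic// (Pevt _ _ Jk); congr (_ + _ * _).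
  rewrite (eq_bigr (fun=> H (K / eta n) * H (delta1 / eta n) ^+ k.-1)).
    by rewrite sumr_const Jk -[LHS]mulr_natl.
  by move=> i iJ; rewrite Rintegral_indic// Pevt2.
rewrite -mulrBr normrM gtr0_norm ?invr_gt0// mulrC ltr_pdivrMr//.
have -> : \sum_(J : {set 'I_nn} | #|J| == k) \int[P]_w G J w =
    \int[P]_w (\sum_(J : {set 'I_nn} | #|J| == k) G J w) by rewrite eS.
have iX := I _ bmX; have iS := I _ bmS.
have iXS : P.-integrable setT (EFin \o (fun w => f (path (eta n) (xs n) w) -
    \sum_(J : {set 'I_nn} | #|J| == k) G J w)).
  exact: (integrableB measurableT iX iS).
have iXSa : P.-integrable setT (EFin \o (fun w => `|f (path (eta n) (xs n) w) -
    \sum_(J : {set 'I_nn} | #|J| == k) G J w|)) by exact: (integrable_abse iXS).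
rewrite -RintegralB//; apply: (le_lt_trans (le_normr_Rintegral measurableT iXS)).
apply: (le_lt_trans (le_Rintegral measurableT iXSa (I _ bmg) (fun w _ => le_g w))).
rewrite intg.
(* Each tail probability supplies a factor [lambda * eta]; the factor [eta] is paired with one
   factor [nn] from the number of index sets, and [nn * eta <= T]. *)
have HE s : H (s / eta n) = ratio n s * lam (eta n) * eta n.
  by rewrite /ratio /lambda; field; rewrite !gt_eqF.
have bn j : ('C(nn, j))%:R <= (nn%:R : R) ^+ j by rewrite -natrX ler_nat bin_le_expn.
have T1 : 2 * M * fine (P Eb) <= B1 * eta n * lam (eta n) ^+ k.
  have lge : cl * eta n ^+ qq <= lam (eta n).
    have ie1 : 1 <= (eta n)^-1 by rewrite invf_ge1.
    have := hcl _ ie1; rewrite exprVn invrK => h; rewrite (le_trans h)//.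
    by rewrite /lambda ler_peMl// ltW.
  have lgk : cl ^+ k * eta n ^+ (qq * k) <= lam (eta n) ^+ k.
    rewrite exprM -exprMn; apply: lerXn2r => //; rewrite nnegrE; last exact: ltW.
    by apply: mulr_ge0; [exact: ltW|exact: exprn_ge0].
  rewrite /B1 -!mulrA ler_wpM2l// ler_wpM2l//.
  apply: (le_trans PEb); rewrite ler_wpM2l// exprS ler_pdivlMl ?exprn_gt0//.
  by rewrite mulrCA ler_wpM2l.
have T2 : M * k.+2%:R * (('C(nn, k.+1))%:R * H (delta / eta n) ^+ k.+1) <=
    B2 * lam (eta n) * lam (eta n) ^+ k.
  have -> : B2 * lam (eta n) * lam (eta n) ^+ k =
      M * k.+2%:R * (T%:num * Ud * lam (eta n)) ^+ k.+1.
    by rewrite /B2 [in RHS]exprMn (exprS (lam (eta n))); ring.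
  rewrite ler_wpM2l ?mulr_ge0//.
  apply: (@le_trans _ _ ((nn%:R : R) ^+ k.+1 * H (delta / eta n) ^+ k.+1)).
    by rewrite ler_wpM2r// exprn_ge0// ltW.
  rewrite -exprMn lerXn2r ?nnegrE ?mulr_ge0 ?invr_ge0 ?(ltW (H_gt0 _)) ?(ltW lp)//.
  rewrite HE [leLHS](_ : _ = (nn%:R * eta n) * (ratio n delta * lam (eta n))); last by ring.
  rewrite -[leRHS]mulrA; apply: ler_pM; [by rewrite mulr_ge0| |by []|by rewrite ler_wpM2r// ltW].
  by rewrite mulr_ge0// ltW.
have T3 : ('C(nn, k))%:R * (pe * H (delta1 / eta n) ^+ k) <=
    T%:num ^+ k * U ^+ k * pe * lam (eta n) ^+ k.
  apply: (@le_trans _ _ ((nn%:R : R) ^+ k * (pe * H (delta1 / eta n) ^+ k))).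
    by rewrite ler_wpM2r// mulr_ge0// exprn_ge0// ltW.
  rewrite HE [leLHS](_ : _ = (nn%:R * eta n) ^+ k * ratio n delta1 ^+ k * (pe * lam (eta n) ^+ k)); last by rewrite !exprMn; ring.
  rewrite -[leRHS]mulrA; apply: ler_wpM2r; first by apply: mulr_ge0 => //; exact: ltW.
  rewrite -2!exprMn; apply: lerXn2r.
  - by rewrite nnegrE; apply: mulr_ge0; [exact: mulr_ge0|exact: ratio_ge0].
  - by rewrite nnegrE; exact: mulr_ge0.
  by apply: ler_pM; [exact: mulr_ge0|exact: ratio_ge0|exact: nT|exact: r1].
have T4 : ('C(nn, k))%:R * (M * (k%:R * (H (K / eta n) * H (delta1 / eta n) ^+ k.-1))) <=
    W2 * ratio n K * lam (eta n) ^+ k.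
  have Hn0 : 0 <= H (K / eta n) * H (delta1 / eta n) ^+ k.-1 by rewrite mulr_ge0 ?exprn_ge0 ?ltW.
  apply: (@le_trans _ _ ((nn%:R : R) ^+ k * (M * (k%:R * (H (K / eta n) * H (delta1 / eta n) ^+ k.-1))))).
    by apply: ler_wpM2r; [apply: mulr_ge0 => //; exact: mulr_ge0|exact: bn].
  (* For [k = 0] the factor [k%:R] vanishes, and otherwise [k.-1] is a true predecessor. *)
  have [k00|k0] := posnP k.
    have kz : (k%:R : R) = 0 by rewrite k00.
    by rewrite /W2 kz !(mul0r, mulr0).
  rewrite !HE /W2.
  have E3 (j : nat) (u h l v1 v2 kk : R) : u ^+ j.+1 * (M * (kk * (v1 * l * h * (v2 * l * h) ^+ j))) =
      M * kk * (u * h) ^+ j.+1 * v2 ^+ j * v1 * l ^+ j.+1.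
    by rewrite !exprMn !exprS; ring.
  have := E3 k.-1 nn%:R (eta n) (lam (eta n)) (ratio n K) (ratio n delta1) k%:R.
  rewrite prednK// => ->.
  apply: ler_wpM2r; first exact: ltW.
  apply: ler_wpM2r => //; apply: ler_pM.
  - by apply: mulr_ge0; [exact: mulr_ge0|exact/exprn_ge0/mulr_ge0].
  - exact: exprn_ge0.
  - apply: ler_wpM2l; first exact: mulr_ge0.
    by apply: lerXn2r; rewrite ?nnegrE ?mulr_ge0.
  - by apply: lerXn2r => //; rewrite nnegrE; exact: ratio_ge0.
have P1 : B1 * eta n <= e / 8 by exact: hh1.
have P2 : B2 * lam (eta n) <= e / 8 by apply: hh2 => //; exact: ltW.
have P3 : T%:num ^+ k * U ^+ k * pe <= e / 8.
  rewrite peE [leLHS](_ : _ = V * (2 * c * E) + V * S * eta n); last by rewrite /V; ring.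
  by rewrite (_ : e / 8 = e / 16 + e / 16); [rewrite lerD// hh4|field].
have P4 : W2 * ratio n K <= e / 8 by apply: le_trans KE; rewrite ler_wpM2l.
have T34 : ('C(nn, k))%:R * (pe * H (delta1 / eta n) ^+ k +
    M * (k%:R * (H (K / eta n) * H (delta1 / eta n) ^+ k.-1))) <= (e / 8 + e / 8) * lam (eta n) ^+ k.
  rewrite mulrDr mulrDl; apply: lerD.
  - by apply: (le_trans T3); apply: ler_wpM2r => //; exact: ltW.
  - by apply: (le_trans T4); apply: ler_wpM2r => //; exact: ltW.
apply: (@le_lt_trans _ _ ((e / 8 + e / 8 + (e / 8 + e / 8)) * lam (eta n) ^+ k)).
  rewrite [leRHS]mulrDl; apply: lerD => //; rewrite [leRHS]mulrDl; apply: lerD.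
  - by apply: (le_trans T1); apply: ler_wpM2r => //; exact: ltW.
  - by apply: (le_trans T2); apply: ler_wpM2r => //; exact: ltW.
rewrite ltr_pM2r// (_ : _ + _ = e / 2); last by field.
by rewrite ltr_pdivrMr// mulr_natr mulr2n ltrDl.
Unshelve. all: by end_near. Qed.

Theorem path_limit : (lam (eta n) ^+ k)^-1 * \int[P]_w f (path (eta n) (xs n) w)
  @[n --> \oo] --> limit_value x.
Proof.
apply/cvgrPdist_lt => e e0; have e2 : 0 < e / 2 by rewrite divr_gt0.
have s1 := (cvgrPdist_lt _ _).1 sum_limit _ e2.
near=> n; rewrite -(subrKA ((lam (eta n) ^+ k)^-1 *
  \sum_(J : {set 'I_(N n)} | #|J| == k) \int[P]_w
     f (jump_path a sigma T (xs n) (jump_sample (Z ^~ w) k J) (times k (eta n) J)))).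
rewrite (le_lt_trans (ler_normD _ _))// (splitr e) ltrD//; first by near: n; exact: s1.
by rewrite distrC; near: n; exact: path_limit_error.
Unshelve. all: by end_near. Qed.

End along_sequence.
End path_limit.

(** * The limit measure on path space *)

(** Read off the definition of the integral by simple functions, because the integrand is arbitrary:
    off the increasing tuples [jump_path] is whatever [get] returns. *)
Lemma ge0_integral_conull {disp : measure_display} {X : measurableType disp} {R : realType}
    (Q : {measure set X -> \bar R}) (D : set X) (f : X -> \bar R) :
  measurable D -> Q (~` D) = 0%E -> (forall x, (0 <= f x)%E) ->
  (\int[Q]_x f x = \int[Q]_(x in D) f x)%E.
Proof.
move=> mD QD f0; rewrite ge0_integralTE// ge0_integralE//; apply/eqP; rewrite eq_le; apply/andP; split.
  apply: ge_ereal_sup => _ [h /= hf <-].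
  have -> : sintegral Q h = sintegral Q (proj_nnsfun h mD).
    rewrite -!integralT_nnsfun; apply: ge0_ae_eq_integral => //.
    - by apply/measurable_EFinP.
    - by apply/measurable_EFinP.
    - by move=> x _; rewrite lee_fin.
    - by move=> x _; rewrite lee_fin.
    exists (~` D); split => //; first exact: measurableC.
    move=> x /= /not_implyP[_]; apply: contra_not => Dx.
    by rewrite /= mindicE mem_set// mulr1.
  apply: ereal_sup_ubound; exists (proj_nnsfun h mD) => //= x.
  rewrite mindicE patchE; case: (boolP (x \in D)) => [_|_]; first by rewrite mulr1.
  by rewrite mulr0.
apply: ge_ereal_sup => _ [h /= hf <-]; apply: ereal_sup_ubound; exists h => //= x.
by rewrite (le_trans (hf x))// patchE; case: ifP.
Qed.

Lemma mdist_lipschitz_continuous {R : realType} {M : metricType R} (f : M -> R) (L : R) :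
  0 <= L -> (forall x y, `|f x - f y| <= L * mdist x y) -> continuous f.
Proof.
move=> L0 fL y; have FFy := nbhs_filter y; apply/cvgrPdist_lt => v v0.
have vL : 0 < v / (L + 1) by rewrite divr_gt0// ltr_wpDl.
apply: filterS (nbhs_mdist y vL) => y' yy'; rewrite (le_lt_trans (fL _ _))//.
apply: (@le_lt_trans _ _ ((L + 1) * mdist y y')).
  by rewrite ler_wpM2r ?mdist_ge0// lerDl.
by rewrite -ltr_pdivlMl ?ltr_wpDl// mulrC.
Qed.

Section limit_measure_theory.
Context {R : realType} {m d : nat}.
Local Notation Rm := 'cV[R]_m.
Local Notation Rd := 'cV[R]_d.+1.
Variables (a : Rm -> Rm) (sigma : Rm -> 'M[R]_(m, d.+1)) (D C : R) (phi : R -> Rm -> Rm).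
Hypothesis F : is_flow a D C phi.
Hypothesis sL : forall x y w,
  enorm ((sigma x - sigma y) *m w) <= D * enorm (x - y) * enorm w.
Hypothesis sB : forall x w, enorm (sigma x *m w) <= C * enorm w.
Variables (T : {posnum R}) (k : nat).
Variable rho : {sigma_finite_measure set (borel Rd) -> \bar R}.
Local Notation leb := (mpower (@lebesgue_measure R) k).
Local Notation TT := (k.-tuple (measurableTypeR R)).
Local Notation WW := (k.-tuple (borel Rd)).
Local Notation I := (@increasing_tuples R k `]0, T%:num[%classic : set TT).

Let mI : measurable I. Proof. exact: measurable_increasing. Qed.

Lemma lebesgue_increasing_fin : (leb I < +oo)%E.
Proof.
pose box := rectangle (fun _ : 'I_k => `]0, T%:num[%classic : set (measurableTypeR R)).
have mbox : measurable box by apply: measurable_rectangle => i; exact: measurable_itv.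
apply: (@le_lt_trans _ _ (leb box)); first by apply: le_measure; rewrite ?inE //; try exact: mI; by move=> t [].
rewrite (mpower_rectangle lebesgue_measure); last by move=> i; exact: measurable_itv.
rewrite (_ : (\prod_(i < k) _)%E = (\prod_(i < k) (T%:num)%:E)%E); first by rewrite prodEFin ltry.
apply: eq_bigr => i _.
have T0 : 0 < T%:num by [].
have e1 : lebesgue_measure (`]0, T%:num[%classic : set R) = (T%:num)%:E.
  by rewrite lebesgue_measure_itv /= lte_fin T0 oppr0 adde0.
exact: e1.
Qed.

(** The same set function as [lebesgue_increasing], with the structure of a finite measure on which
    Tonelli relies. *)
Definition leb_inc : set TT -> \bar R := mfrestr mI lebesgue_increasing_fin.

HB.instance Definition _ := Measure.copy leb_inc (mfrestr mI lebesgue_increasing_fin).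
HB.instance Definition _ := FiniteMeasure.copy leb_inc (mfrestr mI lebesgue_increasing_fin).

Lemma integral_leb_inc (g : TT -> \bar R) : (forall t, (0 <= g t)%E) ->
  (\int[leb_inc]_t g t = \int[leb]_(t in I) g t)%E.
Proof.
move=> g0; rewrite (ge0_integral_conull mI)//; last first.
  by rewrite -[LHS]/(lebesgue_increasing T%:num (~` I)) /lebesgue_increasing setICl; exact: measure0.
apply: integral_set_function => B mB BI.
by rewrite -[LHS]/(lebesgue_increasing T%:num B) /lebesgue_increasing; congr (leb _); apply/setIidPl.
Qed.

Let increasing_near (t : k.-tuple R) : @increasing_tuples R k `]0, T%:num[%classic t ->
  exists2 b, 0 < b & forall t' : k.-tuple R, (forall i, `|tnth t' i - tnth t i| <= b) ->
    @increasing_tuples R k `]0, T%:num]%classic t'.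
Proof.
move=> [t1 t2].
have nb : \forall b \near (0 : R)^'+, [/\ forall i, b < tnth t i, forall i, b < T%:num - tnth t i &
    forall i j : 'I_k, (i < j)%N -> b < (tnth t j - tnth t i) / 2].
  have n1 : \forall b \near (0 : R)^'+, forall i, b < tnth t i.
    apply: filter_forall => i; apply: nbhs_right_lt.
    by have := t1 i; rewrite /= in_itv/= => /andP[].
  have n2 : \forall b \near (0 : R)^'+, forall i, b < T%:num - tnth t i.
    apply: filter_forall => i; apply: nbhs_right_lt.
    by have := t1 i; rewrite /= in_itv/= subr_gt0 => /andP[].
  have n3 : \forall b \near (0 : R)^'+, forall i j : 'I_k, (i < j)%N -> b < (tnth t j - tnth t i) / 2.
    apply: filter_forall => i; apply: filter_forall => j.
    have [ij|ij] := boolP (i < j)%N; last exact: nearW.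
    have tij : 0 < (tnth t j - tnth t i) / 2 by rewrite divr_gt0// subr_gt0 t2.
    by apply: filterS (nbhs_right_lt tij).
  by near=> b; split; near: b.
near (0 : R)^'+ => b; exists b => // t' ht'.
have [b1 b2 b3] : [/\ forall i, b < tnth t i, forall i, b < T%:num - tnth t i &
    forall i j : 'I_k, (i < j)%N -> b < (tnth t j - tnth t i) / 2] by near: b.
split => [i|i j ij].
  have := ht' i; have := b1 i; have := b2 i; rewrite /= in_itv/= ler_norml.
  by move: (tnth t' i) (tnth t i) => u v h1 h2 /andP[h3 h4]; apply/andP; split; lra.
have := ht' i; have := ht' j; have := b3 i j ij; rewrite !ler_norml.
move: (tnth t' i) (tnth t i) (tnth t' j) (tnth t j) => u v u' v' h1 /andP[h2 h3] /andP[h4 h5].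
lra.
Unshelve. all: by end_near. Qed.

(* Only increasing jump times determine a path; elsewhere the value is
   arbitrary, so as to make the map measurable. *)
Definition jump_map (x : Rm) (p : WW * TT) : borel (Dspace m T) :=
  if p.2 \in I then jump_path a sigma T x (p.1 : k.-tuple Rd) (p.2 : k.-tuple R) else point.

(** On increasing tuples the path depends continuously on finitely many real numbers, the
    coordinates of the noises and the jump times; [increasing_near] keeps perturbed times
    increasing. *)
Lemma measurable_jump_map x : measurable_fun setT (jump_map x : WW * TT -> borel (Dspace m T)).
Proof.
pose J := ('I_k * 'I_d.+1 + 'I_k)%type.
pose u (j : J) (p : WW * TT) : R := match j with
  | inl il => (tnth p.1 il.1 : Rd) il.2 ord0 | inr i => tnth p.2 i end.
pose G (y : J -> R) : borel (Dspace m T) := jump_path a sigma T x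
  [tuple (\col_l y (inl (i, l)) : Rd) | i < k] [tuple y (inr i) | i < k].
have uE p : G (u^~ p) = jump_path a sigma T x (p.1 : k.-tuple Rd) (p.2 : k.-tuple R).
  congr jump_path; apply: eq_from_tnth => i; rewrite tnth_mktuple//.
  by apply/colP => l; rewrite mxE.
have mu_ j : measurable_fun setT (u j).
  case: j => [[i l]|i].
    apply: (measurableT_comp (@measurable_coord R d.+1 l)).
    by apply: (measurableT_comp (@measurable_tnth _ (borel Rd) k i)); exact: measurable_fst.
  by apply: (measurableT_comp (@measurable_tnth _ (measurableTypeR R) k i)); exact: measurable_snd.
pose A0 : set (WW * TT) := [set p | I p.2].
have mA0 : measurable A0.
  rewrite (_ : A0 = setT `&` snd @^-1` I); first by apply: (measurable_snd measurableT); exact: mI.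
  by rewrite setTI.
have Gc p : A0 p -> forall e, 0 < e -> exists2 g, 0 < g &
    forall y : J -> R, (forall j, `|y j - u j p| <= g) -> mdist (G y) (G (u^~ p)) <= e.
  move=> ip e e0; have [b b0 hb] := increasing_near ip.
  have [g g0 hg] := jump_path_continuous F sL sB x (p.1 : k.-tuple Rd) ip e0.
  exists (Num.min b (g / d.+1%:R)); first by rewrite lt_min b0 divr_gt0.
  move=> y hy; rewrite uE; apply: hg.
  - apply: hb => i; rewrite tnth_mktuple; have := hy (inr i); rewrite le_min => /andP[] //.
  - by rewrite subrr enorm0 ltW.
  - move=> i; rewrite tnth_mktuple (le_trans (enorm_le_sum _))//.
    apply: (@le_trans _ _ (\sum_(l < d.+1) (g / d.+1%:R))).
      by apply: ler_sum => l _; rewrite !mxE; have := hy (inl (i, l)); rewrite le_min => /andP[].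
    by rewrite sumr_const card_ord -[leLHS]mulr_natr divfK.
  - move=> i; rewrite tnth_mktuple; have := hy (inr i); rewrite le_min => /andP[_ h].
    by rewrite (le_trans h)// ler_pdivrMr// ler_peMr ?(ltW g0)// ler1n.
move=> _ B mB; rewrite setTI.
have mAB := @measurable_discretization R _ _ J u (Dspace m T : PointedMetric.type R) mu_ A0 G mA0 Gc B mB.
have [Bp|Bp] := pselect (B point).
  rewrite (_ : _ @^-1` B = (A0 `&` [set p | B (G (u^~ p))]) `|` ~` A0).
    by apply: measurableU => //; exact: measurableC.
  apply/seteqP; split=> p; rewrite /preimage/= /jump_map uE.
    by case: ifPn => [/set_mem ip h|]; [left|rewrite notin_setE => h _; right].
  by case: ifPn => [/set_mem ip [[]//|//]|_ _].
rewrite (_ : _ @^-1` B = A0 `&` [set p | B (G (u^~ p))])//.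
apply/seteqP; split=> p; rewrite /preimage/= /jump_map uE.
  by case: ifPn => [/set_mem ip h|_ /Bp].
by move=> [ip h]; rewrite mem_set.
Qed.

Definition jump_law (x : Rm) : set (borel (Dspace m T)) -> \bar R :=
  pushforward (mpower rho k \x leb_inc)%E (jump_map x).

HB.instance Definition _ x := Measure.copy (jump_law x)
  (measure_function_pushforward__canonical__measure_function_Measure
    (mpower rho k \x leb_inc)%E (measurable_jump_map x)).

Definition jump_measure x : {measure set (borel (Dspace m T)) -> \bar R} := jump_law x.

Lemma integral_jump_law x (g : borel (Dspace m T) -> \bar R) : measurable_fun setT g ->
  (forall y, (0 <= g y)%E) ->
  (\int[jump_law x]_y g y =
   \int[leb]_(t in I) \int[mpower rho k]_W g (jump_path a sigma T x (W : k.-tuple Rd) (t : k.-tuple R)))%E.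
Proof.
move=> mg g0.
transitivity (\int[(mpower rho k \x leb_inc)%E]_p g (jump_map x p))%E.
  rewrite (@ge0_integral_pushforward _ _ _ _ R (jump_map x) (measurable_jump_map x) (mpower rho k \x leb_inc)%E setT g) //.
rewrite (@fubini_tonelli2 _ _ WW TT R (mpower rho k) leb_inc (fun p => g (jump_map x p)))//; last first.
  by apply: (measurableT_comp mg); exact: measurable_jump_map.
rewrite integral_leb_inc; last by move=> t; exact: integral_ge0.
apply: eq_integral => t; rewrite inE => It; apply: eq_integral => W _.
by rewrite /jump_map/= mem_set.
Qed.

(** Both factors of the product are exchanged for measures, and [jump_path] for the measurable
    [jump_map], which can differ from it only on a null set. *)
Lemma limit_measureE (nu : set (borel (halfline R)) -> \bar R) (S : set (borel (sphere R d)) -> \bar R)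
    x (B : set (borel (Dspace m T))) :
  (forall E, measurable E -> polar_measure nu S E = rho E) -> measurable B ->
  limit_measure a sigma T nu S k x B = jump_law x B.
Proof.
move=> nuS mB; rewrite /limit_measure.
rewrite (integral_set_function (m' := (mpower rho k \x leb_inc)%E)); last first.
  move=> E mE _; rewrite /product_measure1/=.
  transitivity (\int[mpower rho k]_W (@lebesgue_increasing R T%:num k \o xsection E) W)%E.
    apply: integral_set_function => E' mE' _; exact: mpower_set_function.
  by [].
have mA0 : measurable [set p : WW * TT | I p.2].
  rewrite (_ : [set p : WW * TT | I p.2] = setT `&` snd @^-1` I); first by apply: (measurable_snd measurableT); exact: mI.
  by rewrite setTI.
have q0 : (mpower rho k \x leb_inc)%E (~` [set p : WW * TT | I p.2]) = 0%E.
  rewrite -[LHS]/(\int[mpower rho k]_W (leb_inc \o xsection (~` [set p : WW * TT | I p.2])) W)%E.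
  rewrite (eq_integral (cst 0%E)) ?integral0// => W _ /=.
  rewrite (_ : xsection _ W = ~` I); first by rewrite -[LHS]/(lebesgue_increasing T%:num (~` I)) /lebesgue_increasing setICl; exact: measure0.
  by apply/seteqP; split=> t /=; rewrite /xsection/= inE.
rewrite (ge0_integral_conull (D := [set p : WW * TT | I p.2]))//.
transitivity (\int[(mpower rho k \x leb_inc)%E]_p (\1_(jump_map x @^-1` B) p)%:E)%E; last first.
  rewrite integral_indic//; first by rewrite setIT.
  by rewrite -[X in measurable X]setTI; exact: measurable_jump_map.
rewrite [RHS](ge0_integral_conull (D := [set p : WW * TT | I p.2]))//.
apply: eq_integral => p; rewrite inE/= => ip; rewrite !indicE; congr (nat_of_bool _)%:R%:E.
by apply/idP/idP; rewrite !inE /preimage/= /jump_map mem_set.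
Qed.

Hypothesis rho_fin : forall r : R, 0 < r -> (rho [set z : Rd | (r <= enorm z)%R] < +oo)%E.
Variables (A : set Rm) (eps r M L : R) (f : Dspace m T -> R).
Hypotheses (eps0 : 0 < eps) (r0 : 0 < r) (C_gt0 : 0 < C) (L0 : 0 <= L).
Hypothesis fM : forall y, 0 <= f y <= M.
Hypothesis fL : forall x y, `|f x - f y| <= L * mdist x y.
Hypothesis fv : forall xi y, jump_paths_pred a sigma T A k eps xi -> mdist xi y <= r -> f y = 0.

(** Finiteness is the point: [f] vanishes unless all noises exceed [delta] in norm, a set of finite
    mass for the power of [rho], and the simplex has finite volume. *)
Lemma integral_jump_law_lipschitz x : A x ->
  (\int[jump_law x]_y (f y)%:E)%E = (limit_value rho a sigma k f x)%:E.
Proof.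
move=> Ax; have [delta d0 hd] := ex_jump_vanishing F C_gt0 sL sB eps0 r0 L0 fM fL fv.
have M0 : 0 <= M by have /andP[/le_trans h /h] := fM point.
have mf : measurable_fun setT (f : borel (Dspace m T) -> R).
  exact: (borel_measurable_continuous (mdist_lipschitz_continuous L0 fL)).
have f0 y : 0 <= f y by have /andP[] := fM y.
rewrite integral_jump_law//; last exact/measurable_EFinP.
have rfin : ((rho [set w : Rd | (delta < enorm w)%R]) ^+ k)%E \is a fin_num.
  have f1 : rho [set w : Rd | delta < enorm w] \is a fin_num.
    rewrite ge0_fin_numE// (le_lt_trans _ (rho_fin d0))// le_measure ?inE//.
      exact: measurable_enorm_gt.
      exact: measurable_enorm_ge.
    by move=> w /= /ltW.
  by rewrite -(fineK f1) -EFin_expe.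
have inner t : I t -> (\int[mpower rho k]_W (f (jump_path a sigma T x (W : k.-tuple Rd) (t : k.-tuple R)))%:E
    <= (M * fine ((rho [set w : Rd | (delta < enorm w)%R]) ^+ k)%E)%:E)%E.
  move=> it; have it' : @increasing_tuples R k `]0, T%:num]%classic t.
    have [t1 t2] := it; split => // j; have := t1 j.
    by rewrite /= !in_itv/= => /andP[-> /ltW ->].
  by rewrite EFinM fineK//; exact: (integral_vanishing_le rho (hd x t Ax it')).
have inner0 t : (0 <= \int[mpower rho k]_W (f (jump_path a sigma T x (W : k.-tuple Rd) (t : k.-tuple R)))%:E)%E.
  by apply: integral_ge0 => W _; rewrite lee_fin.
have innerf t : I t -> (\int[mpower rho k]_W (f (jump_path a sigma T x (W : k.-tuple Rd) (t : k.-tuple R)))%:E)%E \is a fin_num.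
  by move=> it; rewrite ge0_fin_numE// (le_lt_trans (inner t it))// ltry.
rewrite /limit_value {1}/Rintegral.
have eI : (\int[leb]_(t in I) \int[mpower rho k]_W (f (jump_path a sigma T x (W : k.-tuple Rd) (t : k.-tuple R)))%:E =
   \int[leb]_(t in I) (\int[mpower rho k]_W f (jump_path a sigma T x (W : k.-tuple Rd) (t : k.-tuple R)))%:E)%E.
  by apply: eq_integral => t; rewrite inE => it; rewrite fineK// innerf.
rewrite eI fineK// -eI ge0_fin_numE; last by apply: integral_ge0 => t _; exact: inner0.
set c := M * _ in inner; have c0 : 0 <= c by rewrite mulr_ge0// fine_ge0// expe_ge0.
pose one : TT -> \bar R := fun t => (c%:E)%E.
apply: (@le_lt_trans _ _ (\int[leb]_(t in I) one t)%E); last first.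
  by rewrite integral_cst// lte_mul_pinfty// ?lee_fin// lebesgue_increasing_fin.
apply: ge0_le_integral => //.
- have := @measurable_fun_fubini_tonelli_G _ _ WW TT R (mpower rho k)
    (fun p => (f (jump_map x p))%:E).
  move=> h; have {h}h : measurable_fun setT (fun t : TT => \int[mpower rho k]_W (f (jump_map x (W, t)))%:E)%E.
    apply: h; last by move=> p; rewrite lee_fin.
    by apply/measurable_EFinP; apply: (measurableT_comp mf); exact: measurable_jump_map.
  apply: (eq_measurable_fun (fun t : TT => \int[mpower rho k]_W (f (jump_map x (W, t)))%:E)%E).
    move=> t; rewrite inE => it; apply: eq_integral => W _.
    by rewrite /jump_map/= mem_set.
  exact: measurable_funTS.
- exact: measurable_cst.
Qed.

End limit_measure_theory.

(** * Distance to a set and Lipschitz envelopes *)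

Section distance_to_set.
Context {R : realType} {S : metricType R}.
Implicit Types (E : set S) (y z : S) (b : R).

(* The distance to E, truncated at b, which makes it equal to b if E is empty. *)
Definition tdist b E y : R := inf ([set mdist e y | e in E] `|` [set b]).

Let tdist_has_inf b E y : 0 <= b -> has_inf ([set mdist e y | e in E] `|` [set b]).
Proof.
move=> b0; split; first by exists b; right.
by exists 0 => _ [[e Ee <-]|->//]; exact: mdist_ge0.
Qed.

Lemma tdist_ge0 b E y : 0 <= b -> 0 <= tdist b E y.
Proof.
move=> b0; apply: lb_le_inf; first by exists b; right.
by move=> _ [[e Ee <-]|->//]; exact: mdist_ge0.
Qed.

Lemma tdist_le b E y : 0 <= b -> tdist b E y <= b.
Proof. by move=> b0; apply: ge_inf; [case: (tdist_has_inf E y b0)|right]. Qed.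

Lemma tdist_le_mdist b E y e : 0 <= b -> E e -> tdist b E y <= mdist e y.
Proof.
by move=> b0 Ee; apply: ge_inf; [case: (tdist_has_inf E y b0)|left; exists e].
Qed.

Lemma tdist_lt b E y v : 0 <= b -> tdist b E y < v -> v <= b ->
  exists2 e, E e & mdist e y < v.
Proof.
move=> b0; rewrite -subr_gt0 => h vb.
have [_ [[e Ee <-]|->]] := inf_adherent h (tdist_has_inf E y b0).
  by rewrite -/(tdist b E y) addrC subrK; exists e.
by rewrite -/(tdist b E y) addrC subrK ltNge vb.
Qed.

Lemma tdist_lip b E y z : 0 <= b -> `|tdist b E y - tdist b E z| <= mdist y z.
Proof.
move=> b0; wlog suff h : y z / tdist b E y <= tdist b E z + mdist y z.
  by have := h y z; have := h z y; rewrite (metric_sym z y) ler_norml; move: (tdist b E y) (tdist b E z) (mdist y z) {h} => p q v => h1 h2; apply/andP; split; lra.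
rewrite -lerBlDr; apply: lb_le_inf; first by exists b; right.
move=> _ [[e Ee <-]|->]; rewrite lerBlDr.
  by rewrite (le_trans (tdist_le_mdist y b0 Ee))// (metric_sym y z) metric_triangle.
by rewrite (le_trans (tdist_le E y b0))// lerDl mdist_ge0.
Qed.

Lemma tdist_continuous b E : 0 <= b -> continuous (tdist b E).
Proof.
by move=> b0; apply: (@mdist_lipschitz_continuous _ _ _ 1) => // y z; rewrite mul1r tdist_lip.
Qed.

Lemma tdist0_closure b E y : 0 < b -> tdist b E y = 0 <-> closure E y.
Proof.
move=> b0; split.
  move=> e0 V /nbhs_ballP[v /= v0 hV].
  have m0 : 0 < Num.min v b by rewrite lt_min v0.
  have [|| e Ee ey] := @tdist_lt b E y (Num.min v b) (ltW b0); first by rewrite e0.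
    by rewrite ge_min lexx orbT.
  by exists e; split => //; apply: hV; rewrite ballEmdist/= metric_sym (lt_le_trans ey)// ge_min lexx.
move=> cy; apply/eqP; rewrite eq_le tdist_ge0 ?(ltW b0)// andbT.
apply/ler_addgt0Pl => v v0; rewrite addr0.
have [e [Ee ye]] := cy _ (nbhs_mdist y v0).
by rewrite (le_trans (tdist_le_mdist y (ltW b0) Ee))// metric_sym ltW.
Qed.

Definition clamp (u : R) : R := Num.max 0 (Num.min 1 u).

Lemma clamp_itv u : 0 <= clamp u <= 1.
Proof. by rewrite /clamp le_max lexx/= ge_max ler01 ge_min lexx. Qed.

Lemma clamp_ge1 u : 1 <= u -> clamp u = 1.
Proof. by move=> u1; rewrite /clamp min_l// max_r. Qed.

Lemma clamp_le0 u : u <= 0 -> clamp u = 0.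
Proof. by move=> u0; rewrite /clamp max_l// ge_min u0 orbT. Qed.

Lemma clamp_lip u v : `|clamp u - clamp v| <= `|u - v|.
Proof.
have cP w : [\/ w <= 0 /\ clamp w = 0, 1 <= w /\ clamp w = 1 | [/\ 0 <= w, w <= 1 & clamp w = w]].
  have [w0|w0] := leP w 0; first by apply: Or31; rewrite clamp_le0.
  have [w1|w1] := leP 1 w; first by apply: Or32; rewrite clamp_ge1.
  by apply: Or33; rewrite !ltW// /clamp (min_r (ltW w1)) (max_r (ltW w0)).
have [[u0 ->]|[u1 ->]|[u0 u1 ->]] := cP u; have [[v0 ->]|[v1 ->]|[v0 v1 ->]] := cP v.
all: rewrite -?subrr ?subrr ?normr0//.
all: by rewrite ler_norml; have := ler_norm (u - v); have := ler_norm (- (u - v)); rewrite normrN; move: `|u - v| => q h1 h2; apply/andP; split; lra.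
Qed.

Lemma clamp_tdist_lip b E p q y z : 0 <= b ->
  `|clamp (p + q * tdist b E y) - clamp (p + q * tdist b E z)| <= `|q| * mdist y z.
Proof.
move=> b0; rewrite (le_trans (clamp_lip _ _))// opprD addrACA subrr add0r -mulrBr normrM.
by rewrite ler_wpM2l// tdist_lip.
Qed.

(** The largest [j]-Lipschitz function below [f]. *)
Definition lip_env (f : S -> R) (j : nat) y : R :=
  inf [set f z + j%:R * mdist z y | z in setT].

Section lip_env.
Variable f : S -> R.
Hypothesis f0 : forall y, 0 <= f y.

Let env_ge0 j y z : 0 <= f z + j%:R * mdist z y.
Proof. by rewrite addr_ge0// mulr_ge0// mdist_ge0. Qed.

Let env_has_inf j y : has_inf [set f z + j%:R * mdist z y | z in setT].
Proof. by split; [exists (f y + j%:R * mdist y y), y|exists 0 => _ [z _ <-]]. Qed.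

Lemma lip_env_ge0 j y : 0 <= lip_env f j y.
Proof. by apply: lb_le_inf; [case: (env_has_inf j y)|move=> _ [z _ <-]]. Qed.

Let lip_env_le_at j y z : lip_env f j y <= f z + j%:R * mdist z y.
Proof. by apply: ge_inf; [case: (env_has_inf j y)|exists z]. Qed.

Lemma lip_env_le j y : lip_env f j y <= f y.
Proof. by rewrite (le_trans (lip_env_le_at j y y))// mdistxx mulr0 addr0. Qed.

Lemma lip_env_lip j y z : `|lip_env f j y - lip_env f j z| <= j%:R * mdist y z.
Proof.
wlog suff h : y z / lip_env f j y <= lip_env f j z + j%:R * mdist y z.
  by have := h y z; have := h z y; rewrite (metric_sym z y) ler_norml; move: (lip_env f j y) (lip_env f j z) (j%:R * mdist y z) {h} => p q v => h1 h2; apply/andP; split; lra.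
rewrite -lerBlDr; apply: lb_le_inf; first by case: (env_has_inf j z).
move=> _ [u _ <-]; rewrite lerBlDr (le_trans (lip_env_le_at j y u))// -addrA lerD2l -mulrDr.
by rewrite ler_wpM2l// (metric_sym y z) metric_triangle.
Qed.

(** Points at distance at least [v] from [y] cost at least [j * v], which exceeds [f y] for large
    [j]; closer points are controlled by continuity. *)
Lemma lip_env_cvg y : continuous f -> lip_env f j y @[j --> \oo] --> f y.
Proof.
move=> fc; apply/cvgrPdist_le => e e0.
have FFy := nbhs_filter y.
have hn : \forall z \near y, `|f y - f z| < e by exact: ((cvgrPdist_lt _ _).1 (fc y) _ e0).
have /nbhs_ballP[v /= v0 hv] := hn.
near=> j.
have hj : f y <= j%:R * v.
  rewrite -ler_pdivrMr//; near: j; exact: nbhs_infty_ger.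
rewrite ger0_norm ?subr_ge0 ?lip_env_le// lerBlDr -lerBlDl.
apply: lb_le_inf; first by case: (env_has_inf j y).
move=> _ [z _ <-]; have [zy|zy] := ltP (mdist z y) v.
  have := hv z; rewrite ballEmdist/= metric_sym => /(_ zy); rewrite ltr_norml => /andP[_ h].
  have : 0 <= j%:R * mdist z y by rewrite mulr_ge0// mdist_ge0.
  by move: h; move: (j%:R * _) => q; lra.
have : j%:R * v <= j%:R * mdist z y by rewrite ler_wpM2l.
by move: (f0 z) hj; move: (j%:R * mdist z y) (j%:R * v) => q q'; lra.
Unshelve. all: by end_near. Qed.

End lip_env.
End distance_to_set.

(** Truncation at [r + 1] does not affect the sublevel set at [r], even when [C] is empty. *)
Lemma fatteningE {R : realType} {S : PointedMetric.type R} (C : set S) (r : R) : 0 < r ->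
  fattening C r = [set y | tdist (r + 1) C y <= r].
Proof.
move=> r0; have r10 : 0 <= r + 1 by lra.
apply/seteqP; split=> y /= h.
  apply/ler_addgt0Pl => v v0; rewrite [leRHS]addrC.
  have /ereal_inf_lt[_ [e Ce <-]] : (ereal_inf [set (mdist c y)%:E | c in C] < (r + v)%:E)%E.
    by rewrite (le_lt_trans h)// lte_fin ltrDl.
  by rewrite lte_fin => /ltW; apply: le_trans; exact: tdist_le_mdist.
apply/lee_addgt0Pr => v v0.
have [||e Ce ey] := @tdist_lt _ _ (r + 1) C y (r + Num.min v 1) r10.
- by rewrite (le_lt_trans h)// ltrDl lt_min v0 ltr01.
- by rewrite lerD2l ge_min lexx orbT.
apply: (@le_trans _ _ (mdist e y)%:E); first by apply: ereal_inf_lbound; exists e.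
by rewrite -EFinD lee_fin (le_trans (ltW ey))// lerD2l ge_min lexx.
Qed.

Lemma measurable_fattening {R : realType} {S : PointedMetric.type R} (C : set S) (r : R) : 0 < r ->
  measurable (fattening C r : set (borel S)).
Proof.
move=> r0; rewrite fatteningE//; apply: measurable_borel_closed.
rewrite (_ : [set y | _] = tdist (r + 1) C @^-1` [set u | u <= r])//.
apply: (preimage_closed _ (@closed_le R r)) => y _.
by apply: tdist_continuous; lra.
Qed.

(** * Uniform convergence and portmanteau inequalities *)

Lemma half_sandwich_lower {R : realFieldType} (p q u v s t e : R) :
  q < e / 2 -> u <= v -> p < e / 2 -> - (u - s) <= p -> t - s <= q -> t - e < v.
Proof. lra. Qed.

Lemma ltr_norm_sandwich {R : realFieldType} (p q u v e : R) :
  v - e < u -> q - v - e / 2 < p - u -> p - q <= e / 2 -> `|u - v| < e.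
Proof. by move=> h1 h2 h3; rewrite ltr_norml; apply/andP; split; lra. Qed.

Lemma half_sandwich_upper {R : realFieldType} (p q u v s t e b : R) :
  q < e / 2 -> v <= u -> p < e / 2 -> u - s <= p -> - (t - s) <= q -> t <= b -> v < b + e.
Proof. lra. Qed.

Section uniform_convergence.
Context {R : realType} {S : PointedMetric.type R} {Th : topologicalType}.
Context {disp : measure_display} {Omega : measurableType disp} (P : probability Omega R).
Variables (X : R -> Th -> Omega -> S) (c : R -> R) (J : Th -> {measure set (borel S) -> \bar R}).
Variables (A : set Th) (C : set S).
Hypothesis mX : forall eta x, 0 < eta -> measurable_fun setT (X eta x : Omega -> borel S).
Hypothesis c_gt0 : forall eta, 0 < eta -> 0 < c eta.
Hypothesis A_compact : compact A.

Definition lipschitz_test (f : S -> R) : Prop := exists r M L,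
  [/\ 0 < r, 0 <= L, forall y, 0 <= f y <= M, forall x y, `|f x - f y| <= L * mdist x y
    & forall xi y, C xi -> mdist xi y <= r -> f y = 0].

Local Notation pre f eta x := (c eta * \int[P]_w f (X eta x w)).
Local Notation Phi f x := (\int[J x]_y f y).

(** The limit is joint in [eta] and the starting point, and is compared with the value at the fixed
    [x]: sequences give this form, and compactness turns it into uniform convergence. *)
Definition locally_uniform (f : S -> R) : Prop := forall x e, A x -> 0 < e ->
  \forall x' \near x & eta \near 0^'+, A x' -> `|pre f eta x' - Phi f x| < e.

Hypothesis J_fin : forall f x, lipschitz_test f -> A x -> (\int[J x]_y (f y)%:E < +oo)%E.
Hypothesis J_cvg : forall f, lipschitz_test f -> locally_uniform f.

Let near_eta x (Q : R -> Prop) : (\forall eta \near 0^'+, Q eta) ->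
  \forall x' \near (x : Th) & eta \near 0^'+, Q eta.
Proof. by move=> h; exists (setT, Q); [split => //=; exact: filterT|move=> [u v] /= []]. Qed.

Let near_x x (Q : Th -> Prop) : (\forall x' \near x, Q x') ->
  \forall x' \near (x : Th) & eta \near (0 : R)^'+, Q x'.
Proof. by move=> h; exists (Q, setT); [split => //=; exact: filterT|move=> [u v] /= []]. Qed.

Let near_pos x : \forall x' \near (x : Th) & eta \near (0 : R)^'+, 0 < eta.
Proof. by apply: near_eta; exact: nbhs_right_gt. Qed.

Lemma measurable_lipschitz_test f : lipschitz_test f ->
  measurable_fun setT (f : borel S -> R).
Proof.
move=> [r [M [L [_ L0 _ fL _]]]]; apply: borel_measurable_continuous.
exact: mdist_lipschitz_continuous L0 fL.
Qed.

Lemma lipschitz_test_integrable f x : lipschitz_test f -> A x ->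
  (J x).-integrable setT (EFin \o (f : borel S -> R)).
Proof.
move=> tf Ax; apply/integrableP; split.
  by apply/measurable_EFinP; exact: measurable_lipschitz_test.
rewrite (eq_integral (fun y : borel S => (f y)%:E)); first exact: J_fin.
move=> y _ /=; rewrite ger0_norm//; have [r [M [L [_ _ fM _ _]]]] := tf.
by have /andP[] := fM y.
Qed.

Lemma dominated_integrable f chi M x : A x -> lipschitz_test chi ->
  measurable_fun setT (f : borel S -> R) -> (forall y, 0 <= f y <= M * chi y) ->
  (J x).-integrable setT (EFin \o (f : borel S -> R)).
Proof.
move=> Ax tchi mf fM.
apply: (@le_integrable _ _ _ (J x) setT measurableT _ (EFin \o (fun y => M * chi y))).
- exact/measurable_EFinP.
- move=> y _ /=; rewrite lee_fin; have /andP[f0 h] := fM y.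
  by rewrite !ger0_norm// (le_trans f0).
- rewrite (_ : EFin \o _ = (fun y => M%:E * (EFin \o (chi : borel S -> R)) y)%E)//.
  by apply: integrableZl => //; exact: lipschitz_test_integrable.
Qed.

Lemma dominated_test (h : nat -> S -> R) h0 chi M x : A x -> lipschitz_test chi ->
  (forall n, measurable_fun setT (h n : borel S -> R)) ->
  measurable_fun setT (h0 : borel S -> R) ->
  (forall n y, 0 <= h n y <= M * chi y) -> (forall y, 0 <= h0 y <= M * chi y) ->
  (forall y, h n y @[n --> \oo] --> h0 y) ->
  Phi (h n) x @[n --> \oo] --> Phi h0 x.
Proof.
move=> Ax tchi mh mh0 hM h0M hh0.
have i0 := dominated_integrable Ax tchi mh0 h0M.
have f0 : (\int[J x]_y (h0 y)%:E)%E \is a fin_num by exact: integrable_fin_num i0.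
have iM : (J x).-integrable setT (EFin \o (fun y => M * chi y : R)).
  rewrite (_ : EFin \o _ = (fun y => M%:E * (EFin \o (chi : borel S -> R)) y)%E)//.
  by apply: integrableZl => //; exact: lipschitz_test_integrable.
apply: fine_cvg; rewrite fineK//.
apply: (@dominated_cvg _ _ _ (J x) setT measurableT (fun n y => (h n y)%:E) (fun y => (h0 y)%:E)
  (EFin \o (fun y => M * chi y))) => //.
- by move=> n; apply/measurable_EFinP.
- by move=> y _; apply: cvg_EFin; [exact: nearW|exact: hh0].
- by move=> n y _ /=; rewrite lee_fin; have /andP[g0 g1] := hM n y; rewrite ger0_norm.
Qed.

Lemma path_integrable (f : S -> R) M eta x : 0 < eta -> measurable_fun setT (f : borel S -> R) ->
  (forall y, 0 <= f y <= M) -> P.-integrable setT (EFin \o (fun w => f (X eta x w))).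
Proof.
move=> eta0 mf fM; apply: (@bounded_integrable _ _ _ P _ M).
  exact: (measurableT_comp mf (mX x eta0)).
by move=> w; have /andP[f0 f1] := fM (X eta x w); rewrite ger0_norm.
Qed.

Lemma prelimit_le (f g : S -> R) M N eta x : 0 < eta ->
  measurable_fun setT (f : borel S -> R) -> measurable_fun setT (g : borel S -> R) ->
  (forall y, 0 <= f y <= M) -> (forall y, 0 <= g y <= N) -> (forall y, f y <= g y) ->
  pre f eta x <= pre g eta x.
Proof.
move=> eta0 mf mg fM gN fg; rewrite ler_wpM2l//; first exact/ltW/c_gt0.
apply: le_Rintegral => //.
- exact: path_integrable fM.
- exact: path_integrable gN.
Qed.

(** Letting [eta] tend to 0 at a fixed [x'] near [x] shows that the limit is continuous along
    [A]. *)
Lemma locally_uniform_dist f x e : locally_uniform f -> A x -> 0 < e ->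
  \forall x' \near x, A x' -> `|Phi f x' - Phi f x| <= e.
Proof.
move=> lf Ax e0; have [[U V] /= [xU V0] hUV] := lf x e Ax e0.
apply: filterS xU => x' Ux' Ax'; apply/ler_addgt0Pl => v v0.
have [[U' V'] /= [xU' V'0] hUV'] := lf x' v Ax' v0.
near (0 : R)^'+ => eta.
have h1 : `|pre f eta x' - Phi f x| < e.
  by apply: (hUV (x', eta)) => //; split => //=; near: eta.
have h2 : `|pre f eta x' - Phi f x'| < v.
  apply: (hUV' (x', eta)) => //; split => /=; first exact: nbhs_singleton.
  by near: eta.
rewrite (le_trans (ler_distD (pre f eta x') _ _))// lerD ?ltW//.
by rewrite distrC.
Unshelve. all: by end_near. Qed.

Lemma locally_uniform_uniform f e : locally_uniform f -> 0 < e ->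
  \forall eta \near 0^'+, forall x, A x -> `|pre f eta x - Phi f x| < e.
Proof.
move=> lf e0; have e2 : 0 < e / 2 by rewrite divr_gt0.
apply: filterS (_ : \forall eta \near 0^'+, A `<=` (fun x => A x -> `|pre f eta x - Phi f x| < e)).
  by move=> eta h x Ax; exact: h.
apply: ((compact_near_coveringP A).1 A_compact) => x Ax.
apply: filterS2 (lf x _ Ax e2) (near_x (locally_uniform_dist lf Ax e2)) => -[x' eta] /= h1 h2 Ax'.
rewrite (le_lt_trans (ler_distD (Phi f x) _ _))// (splitr e) ltr_leD//; first exact: h1.
by rewrite distrC h2.
Qed.

Lemma locally_uniform_bounded f : locally_uniform f -> exists K, forall x, A x -> Phi f x <= K.
Proof.
move=> lf; have : \forall K \near +oo%R, A `<=` (fun x => A x -> Phi f x <= K).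
  apply: ((compact_near_coveringP A).1 A_compact) => x Ax.
  have h1 := locally_uniform_dist lf Ax ltr01.
  have h2 : \forall K \near +oo, Phi f x + 1 <= K by apply: nbhs_pinfty_ge; exact: num_real.
  exists ([set x' | A x' -> `|Phi f x' - Phi f x| <= 1], [set K | Phi f x + 1 <= K]) => //.
  move=> [x' K] /= [g1 g2] Ax'; rewrite (le_trans _ g2)//.
  by have := ler_norm (Phi f x' - Phi f x); have := g1 Ax'; move: `|_| => q; lra.
move=> hK; near (+oo%R : set_system R) => K; exists K => x Ax.
have : A `<=` (fun x => A x -> Phi f x <= K) by near: K.
by move=> /(_ x Ax Ax).
Unshelve. all: by end_near. Qed.

Section continuous_test.
Variables (r : R).
Hypothesis r0 : 0 < r.
(** 0 within [r / 2] of [C] and 1 at distance at least [r]: a Lipschitz test whose multiples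
    dominate every bounded function vanishing within [r] of [C], whence integrability. *)
Definition cutoff (y : S) : R := clamp (- 1 + (2 / r) * tdist r C y).

Lemma cutoff_test : lipschitz_test cutoff.
Proof.
exists (r / 2), 1, `|2 / r|; split => //.
- by rewrite divr_gt0.
- by move=> y; exact: clamp_itv.
- by move=> x y; apply: clamp_tdist_lip; exact: ltW.
- move=> xi y Cxi xy; apply: clamp_le0.
  have h : tdist r C y <= r / 2 by rewrite (le_trans (tdist_le_mdist y (ltW r0) Cxi)).
  have : 2 / r * tdist r C y <= 2 / r * (r / 2) by rewrite ler_wpM2l// divr_ge0// ltW.
  by rewrite mulrA divfK ?gt_eqF// divff// addrC subr_le0.
Qed.

Lemma le_cutoff f M : (forall y, 0 <= f y <= M) ->
  (forall xi y, C xi -> mdist xi y <= r -> f y = 0) -> forall y, f y <= M * cutoff y.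
Proof.
move=> fM fv y; have /andP[f0 f1] := fM y.
have M0 : 0 <= M by exact: le_trans f1.
have [h|h] := ltP (tdist r C y) r.
  have [xi Cxi xy] := tdist_lt (ltW r0) h (lexx r).
  by rewrite (fv xi y Cxi (ltW xy)) mulr_ge0//; have /andP[] := clamp_itv (- 1 + (2 / r) * tdist r C y).
rewrite /cutoff clamp_ge1 ?mulr1//.
have : 2 / r * r <= 2 / r * tdist r C y by rewrite ler_wpM2l// divr_ge0// ltW.
by rewrite divfK ?gt_eqF//; move: (_ * tdist _ _ _) => q; lra.
Qed.
End continuous_test.

(** The Lipschitz envelopes stay below [f] and vanish where it does, so they are Lipschitz tests,
    and their integrals tend to that of [f] by domination. *)
Lemma continuous_test_ge (f : S -> R) (r M : R) x (e : R) : 0 < r -> continuous f -> (forall y, 0 <= f y <= M) ->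
  (forall xi y, C xi -> mdist xi y <= r -> f y = 0) -> A x -> 0 < e ->
  \forall x' \near x & eta \near 0^'+, A x' -> Phi f x - e < pre f eta x'.
Proof.
move=> r0 fc fM fv Ax e0; have e2 : 0 < e / 2 by rewrite divr_gt0.
have f0 y : 0 <= f y by have /andP[] := fM y.
have envM j y : 0 <= lip_env f j y <= M.
  by rewrite lip_env_ge0//= (le_trans (lip_env_le f0 j y))//; have /andP[] := fM y.
have envt j : lipschitz_test (lip_env f j).
  exists r, M, j%:R; split => //; first by move=> y z; exact: lip_env_lip.
  move=> xi y Cxi xy; apply/eqP; rewrite eq_le lip_env_ge0// andbT.
  by rewrite -(fv xi y Cxi xy) lip_env_le.
have mf : measurable_fun setT (f : borel S -> R) by exact: borel_measurable_continuous.
have menv j := measurable_lipschitz_test (envt j).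
have fchi := le_cutoff r0 fM fv.
have ecv : Phi (lip_env f j) x @[j --> \oo] --> Phi f x.
  apply: (@dominated_test _ _ (cutoff r) M) => //.
  - exact: cutoff_test.
  - by move=> j y; rewrite lip_env_ge0//= (le_trans (lip_env_le f0 j y)).
  - by move=> y; rewrite f0 fchi.
  - by move=> y; exact: lip_env_cvg.
have n1 : \forall j \near \oo, `|Phi f x - Phi (lip_env f j) x| < e / 2.
  exact: ((cvgrPdist_lt _ _).1 ecv _ e2).
near \oo => j.
have hj : `|Phi f x - Phi (lip_env f j) x| < e / 2 by near: j.
apply: filterS2 (J_cvg (envt j) Ax e2) (near_pos x) => -[x' eta] /= h eta0 Ax'.
have h3 := prelimit_le x' eta0 (menv j) mf (envM j) fM (lip_env_le f0 j).
have := ler_norm (Phi f x - Phi (lip_env f j) x).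
have := ler_norm (- (pre (lip_env f j) eta x' - Phi (lip_env f j) x)); rewrite normrN.
have {h} := h Ax'; move: hj h3; move: `|_| `|_| => p q.
by move=> h4 h5 h6 h7 h8; exact: half_sandwich_lower h4 h5 h6 h7 h8.
Unshelve. all: by end_near. Qed.

(* continuous_test_ge is applied both to f and to M * cutoff - f. *)
Lemma continuous_test_cvg (f : S -> R) (r M : R) : 0 < r -> continuous f -> (forall y, 0 <= f y <= M) ->
  (forall xi y, C xi -> mdist xi y <= r -> f y = 0) -> locally_uniform f.
Proof.
move=> r0 fc fM fv x e Ax e0; have e2 : 0 < e / 2 by rewrite divr_gt0.
have M0 : 0 <= M by have /andP[f0 f1] := fM point; exact: le_trans f1.
have tchi := cutoff_test r0; have fchi := le_cutoff r0 fM fv.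
have mchi := measurable_lipschitz_test tchi.
have mf : measurable_fun setT (f : borel S -> R) by exact: borel_measurable_continuous.
have [r' [M' [L [r'0 L0 chiM chiL chiv]]]] := tchi.
have chi1 y : 0 <= cutoff r y <= 1 by exact: clamp_itv.
pose g y := M * cutoff r y - f y.
have gM y : 0 <= g y <= M.
  rewrite subr_ge0 fchi/= lerBlDr; have /andP[f0 _] := fM y.
  rewrite (@le_trans _ _ M)// ?lerDl//.
  by rewrite ler_piMr//; have /andP[] := chi1 y.
have gc : continuous g.
  move=> y; apply: cvgB; last exact: fc.
  by apply: cvgMr; exact: (mdist_lipschitz_continuous L0 chiL).
have gv xi y : C xi -> mdist xi y <= Num.min r r' -> g y = 0.
  rewrite le_min => Cxi /andP[h1 h2]; rewrite /g (chiv xi y)// (fv xi y)//.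
  by rewrite mulr0 subr0.
have rr : 0 < Num.min r r' by rewrite lt_min r0.
have em : 0 < e / 2 / (M + 1) by rewrite divr_gt0// ltr_wpDl.
have [ichi ifx] : (J x).-integrable setT (EFin \o (cutoff r : borel S -> R)) /\
    (J x).-integrable setT (EFin \o (f : borel S -> R)).
  split; first exact: lipschitz_test_integrable.
  by apply: (@dominated_integrable f (cutoff r) M x Ax tchi mf) => y; rewrite fchi andbT; have /andP[] := fM y.
have iMchi : (J x).-integrable setT (EFin \o (fun y : borel S => M * cutoff r y)).
  rewrite (_ : EFin \o _ = (fun y => M%:E * (EFin \o (cutoff r : borel S -> R)) y)%E)//.
  exact: integrableZl.
have gE : Phi g x = M * Phi (cutoff r) x - Phi f x.
  by rewrite /g RintegralB// RintegralZl.
have low := continuous_test_ge r0 fc fM fv Ax e0.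
have gge := continuous_test_ge rr gc gM gv Ax e2.
have mid := J_cvg tchi Ax em.
apply: filterS2 (filterI low gge) (filterI mid (near_pos x)) => -[x' eta] /= [h1 h2] [h3 eta0] Ax'.
have ichiP := path_integrable x' eta0 mchi chi1.
have ifP := path_integrable x' eta0 mf fM.
have iMchiP : P.-integrable setT (EFin \o (fun w => M * cutoff r (X eta x' w))).
  rewrite (_ : EFin \o _ = (fun w => M%:E * (EFin \o (fun w => cutoff r (X eta x' w))) w)%E)//.
  exact: integrableZl.
have gP : pre g eta x' = M * pre (cutoff r) eta x' - pre f eta x'.
  by rewrite /g RintegralB// RintegralZl// mulrBr !mulrA (mulrC M).
have {h1} := h1 Ax'; have {h2} := h2 Ax'; have {h3} := h3 Ax'.
rewrite gE gP => h3 h2 h1.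
have h4 : M * (pre (cutoff r) eta x' - Phi (cutoff r) x) <= e / 2.
  have := ler_norm (pre (cutoff r) eta x' - Phi (cutoff r) x) => /le_lt_trans/(_ h3)/ltW h.
  rewrite (le_trans (ler_wpM2l M0 h))// mulrCA ler_piMr ?ltW//.
  by rewrite ltr_pdivrMr ?ltr_wpDl// mul1r ltrDl.
rewrite ltr_norml; move: h1 h2 h4; rewrite mulrBr.
by move=> h1 h2 h4; rewrite -ltr_norml; exact: ltr_norm_sandwich h1 h2 h4.
Qed.

Let patch_eq (f : S -> R) y : (f \_ (~` C)) y = if y \in ~` C then f y else 0.
Proof. exact: patchE. Qed.

(** A test function is constrained only outside [C]; extended by 0 it is continuous everywhere,
    because it vanishes near [C]. *)
Lemma test_function_patch f : test_function C f -> exists r M,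
  [/\ 0 < r, continuous (f \_ (~` C) : S -> R), forall y, 0 <= (f \_ (~` C)) y <= M
    & forall xi y, C xi -> mdist xi y <= r -> (f \_ (~` C)) y = 0].
Proof.
move=> [f0 [M fM] fc [r r0 fv]].
have gv xi y : C xi -> mdist xi y <= r -> (f \_ (~` C)) y = 0.
  move=> Cxi xy; rewrite patch_eq; case: ifPn => // /set_mem nCy; apply: fv => //.
  apply: (@le_trans _ _ (mdist xi y)%:E); last by rewrite lee_fin.
  by apply: ereal_inf_lbound; exists xi.
exists r, (Num.max M 0); split => //; last first.
  move=> y; rewrite patch_eq le_max; case: ifPn => [/set_mem nCy|_]; last by rewrite lexx orbT.
  by rewrite f0//= fM.
move=> y; have FFy := nbhs_filter y; have [h|h] := ltP (tdist r C y) r.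
  have [xi Cxi xy] := tdist_lt (ltW r0) h (lexx r).
  have hn : \forall z \near y, tdist r C z < r.
    have h0 : 0 < r - tdist r C y by rewrite subr_gt0.
    apply: filterS (nbhs_mdist y h0) => z yz; have := tdist_lip C z y (ltW r0).
    by rewrite metric_sym => /(le_trans (ler_norm _))/le_lt_trans/(_ yz); rewrite ltrD2r.
  rewrite /continuous_at (gv xi y Cxi (ltW xy)); apply: cvg_near_cst.
  apply: filterS hn => z hz; have [zeta Cz zz] := tdist_lt (ltW r0) hz (lexx r).
  exact: gv Cz (ltW zz).
have hn : \forall z \near y, ~ C z.
  apply: filterS (nbhs_mdist y r0) => z yz Cz.
  by move: h; rewrite leNgt (le_lt_trans (tdist_le_mdist y (ltW r0) Cz))// metric_sym.
have nCy : ~ C y by exact: (nbhs_singleton hn).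
have fy := (subspace_continuousP _ _).1 fc y nCy.
apply/cvgrPdist_lt => e e0.
have hw : \forall z \near within (~` C) (nbhs y), `|f y - f z| < e.
  exact: ((cvgrPdist_lt _ _).1 fy _ e0).
rewrite near_withinE in hw; apply: filterS2 hn hw => z nCz /(_ nCz).
by rewrite !patch_eq !mem_set.
Qed.

Variables (nu_ : R -> Th -> set (borel S) -> \bar R) (nu : Th -> set (borel S) -> \bar R).
Hypothesis A_neq0 : A !=set0.
Hypothesis nu_E : forall eta x E, 0 < eta -> A x -> measurable E ->
  nu_ eta x E = ((c eta)%:E * P [set w | E (X eta x w)])%E.
Hypothesis nuE : forall x E, A x -> measurable E -> nu x E = J x E.

Let prelaw eta x (eta0 : 0 < eta) : {measure set (borel S) -> \bar R} :=
  mscale (NngNum (ltW (c_gt0 eta0)))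
    (measure_function_pushforward__canonical__measure_function_Measure P (mX x eta0)).

Let prelawE eta x (eta0 : 0 < eta) E : A x -> measurable E -> nu_ eta x E = prelaw x eta0 E.
Proof. by move=> Ax mE; rewrite nu_E. Qed.

Let mXE eta x (E : set (borel S)) : 0 < eta -> measurable E -> measurable [set w | E (X eta x w)].
Proof. by move=> eta0 mE; have := mX x eta0 measurableT mE; rewrite setTI. Qed.

Let J_fattening x r : A x -> 0 < r -> (J x (~` fattening C r) < +oo)%E.
Proof.
move=> Ax r0; have mF : measurable (~` fattening C r : set (borel S)).
  by apply: measurableC; exact: measurable_fattening.
apply: le_lt_trans (J_fin (cutoff_test r0) Ax).
rewrite [leLHS](_ : _ = \int[J x]_y (\1_(~` fattening C r) y)%:E)%E; last by rewrite integral_indic// setIT.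
apply: ge0_le_integral => //.
- by apply/measurable_EFinP; exact: measurable_indic.
- apply/measurable_EFinP; exact: measurable_lipschitz_test (cutoff_test r0).
move=> y _; rewrite lee_fin indicE.
case: (boolP (y \in _)) => [/set_mem ny|_]; last by have /andP[] := clamp_itv (- 1 + (2 / r) * tdist r C y).
have h : r <= tdist r C y.
  rewrite leNgt; apply/negP => h; have [xi Cxi xy] := tdist_lt (ltW r0) h (lexx r).
  apply: ny; apply: (@le_trans _ _ (mdist xi y)%:E); last by rewrite lee_fin ltW.
  by apply: ereal_inf_lbound; exists xi.
rewrite /cutoff clamp_ge1//.
have : 2 / r * r <= 2 / r * tdist r C y by rewrite ler_wpM2l// divr_ge0// ltW.
by rewrite divfK ?gt_eqF//; move: (_ * tdist _ _ _) => q; lra.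
Qed.

Theorem uniform_Mcvg : Mcvg_uniform 0^'+ C A nu_ nu.
Proof.
split.
- near=> eta => x Ax; have eta0 : 0 < eta by [].
  split; first by exists (prelaw x eta0) => E mE _; exact: prelawE.
  move=> r r0; have mF : measurable (~` fattening C r : set (borel S)).
    by apply: measurableC; exact: measurable_fattening.
  rewrite nu_E//; apply: lte_mul_pinfty => //; first by rewrite lee_fin ltW// c_gt0.
  by rewrite (le_lt_trans (probability_le1 P _)) ?ltry//; exact: mXE.
- move=> x Ax; split; first by exists (J x) => E mE _; exact: nuE.
  move=> r r0; rewrite nuE//; first exact: J_fattening.
  by apply: measurableC; exact: measurable_fattening.
move=> f tf; have [r [M [r0 gc gM gv]]] := test_function_patch tf.
have lu := continuous_test_cvg r0 gc gM gv.
have mg := borel_measurable_continuous gc.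
set g := f \_ (~` C) in gc gM gv lu mg.
have gE : (fun y => (f y)%:E) \_ (~` C) = (fun y : S => (g y)%:E).
  by apply/funext => y; rewrite patchE /g patch_eq; case: ifP.
have eI x : A x -> (\int[nu x]_(y in ~` C) (f y)%:E = (Phi g x)%:E)%E.
  move=> Ax; rewrite (integral_set_function (m' := J x)); last by move=> E mE _; exact: nuE.
  rewrite (integral_mkcond (mu := J x)) gE fineK//; apply: integrable_fin_num => //.
  apply: (dominated_integrable Ax (cutoff_test r0) mg (M := M)) => y.
  by rewrite (le_cutoff r0 gM gv) andbT; have /andP[] := gM y.
have eP eta x : 0 < eta -> A x -> (\int[nu_ eta x]_(y in ~` C) (f y)%:E = (pre g eta x)%:E)%E.
  move=> eta0 Ax; rewrite (integral_set_function (m' := prelaw x eta0)); last by move=> E mE _; exact: prelawE.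
  rewrite (integral_mkcond (mu := prelaw x eta0)) gE ge0_integral_mscale//; last 2 first.
    exact/measurable_EFinP.
    by move=> y _; rewrite lee_fin; have /andP[] := gM y.
  rewrite (ge0_integral_pushforward (mX x eta0))//; last 2 first.
    exact/measurable_EFinP.
    by move=> y _; rewrite lee_fin; have /andP[] := gM y.
  rewrite preimage_setT EFinM fineK//; apply: integrable_fin_num => //.
  exact: path_integrable gM.
have main e : 0 < e -> \forall eta \near 0^'+, (0 <= ereal_sup [set
    `| \int[nu_ eta x]_(y in ~` C) (f y)%:E - \int[nu x]_(y in ~` C) (f y)%:E | | x in A]
    <= e%:E)%E.
  move=> e0; apply: filterS2 (locally_uniform_uniform lu e0) (nbhs_right_gt 0) => eta h eta0.
  apply/andP; split.
    have [x0 Ax0] := A_neq0.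
    apply: le_trans (ereal_sup_ubound _); last by exists x0; [exact: Ax0|reflexivity].
    exact: abse_ge0.
  apply: ge_ereal_sup => _ [x Ax <-]; rewrite eP// eI// -EFinB abse_EFin lee_fin ltW//.
  exact: h.
apply/fine_cvgP; split.
  apply: filterS (main 1 ltr01) => eta /andP[h0 h1].
  by rewrite ge0_fin_numE// (le_lt_trans h1)// ltry.
apply/cvgrPdist_le => e e0; apply: filterS (main e e0) => eta /andP[h0 h1] /=.
by rewrite sub0r normrN ger0_norm ?fine_ge0// -lee_fin fineK// ge0_fin_numE// (le_lt_trans h1)// ltry.
Unshelve. all: by end_near. Qed.

Section portmanteau.
Variable B : set S.
Hypotheses (mB : measurable (B : set (borel S))) (B_away : bounded_away B C).

Let mcl : measurable (closure B : set (borel S)).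
Proof. by apply: measurable_borel_closed; exact: closed_closure. Qed.

Let mint : measurable (B° : set (borel S)).
Proof. by apply: measurable_borel_open; exact: open_interior. Qed.

Let sub_int_cl : B° `<=` closure B.
Proof. exact: subset_trans (@interior_subset _ B) (@subset_closure _ B). Qed.

Let gap : exists2 q : R, 0 < q & forall b xi, B b -> C xi -> q <= mdist b xi.
Proof.
have h b xi : B b -> C xi -> (ereal_inf [set (mdist p.1 p.2)%:E | p in B `*` C] <= (mdist b xi)%:E)%E.
  by move=> Bb Cxi; apply: ereal_inf_lbound; exists (b, xi).
move: B_away h; rewrite /bounded_away; case: (ereal_inf _) => [q| |]//.
  by rewrite lte_fin => q0 h; exists q => // b xi Bb Cxi; rewrite -lee_fin; exact: h.
(* An infinite infimum: there is no pair of points, for instance because [C] is empty, and any gap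
   will do. *)
by move=> _ h; exists 1 => // b xi Bb Cxi; have := h b xi Bb Cxi; rewrite leye_eq.
Qed.

(** A large offset [N] makes the transition layers thinner than the gap between [B] and [C], so that
    the functions below vanish near [C] and are admissible tests for every [n]. *)
Let slope (N n : nat) : R := (n + N)%:R.
(** [outer] tends to the indicator of the closure of [B] from above, [inner] to that of its interior
    from below. *)
Let outer N n (y : S) : R := clamp (1 + - slope N n * tdist 1 B y).
Let inner N n (y : S) : R := clamp (0 + slope N n * tdist 1 (~` B) y).

Let tests : exists N, (forall n, lipschitz_test (outer N n)) /\ (forall n, lipschitz_test (inner N n)).
Proof.
have [q q0 hq] := gap; near \oo => N; exists N.
have N1 n : 1 <= slope N n.
  rewrite /slope ler1n; apply: leq_trans (leq_addl _ _); near: N; exact: nbhs_infty_ge.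
have Nq n : 2 / q <= slope N n.
  apply: (@le_trans _ _ N%:R); last by rewrite ler_nat leq_addl.
  by near: N; exact: nbhs_infty_ger.
split=> n.
  exists (q / 2), 1, `|- slope N n|; split => //.
  - by rewrite divr_gt0.
  - by move=> y; exact: clamp_itv.
  - by move=> x y; exact: clamp_tdist_lip.
  move=> xi y Cxi xy; apply: clamp_le0; rewrite mulNr subr_le0.
  have s0 : 0 < slope N n by exact: lt_le_trans (N1 n).
  rewrite mulrC -ler_pdivrMr// leNgt; apply/negP => h.
  have s1 : 1 / slope N n <= 1 by rewrite ler_pdivrMr// mul1r.
  have [b Bb yb] := tdist_lt ler01 h s1.
  have s2 : 1 / slope N n <= q / 2.
    by rewrite ler_pdivrMr// mulrC -ler_pdivrMr ?divr_gt0// invf_div mul1r.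
  have := hq b xi Bb Cxi; have := metric_triangle b y xi; rewrite (metric_sym y xi).
  by move: (mdist b xi) (mdist b y) (mdist xi y) (1 / _) xy yb s2 => u v w z; lra.
exists (q / 2), 1, `|slope N n|; split => //.
- by rewrite divr_gt0.
- by move=> y; exact: clamp_itv.
- by move=> x y; exact: clamp_tdist_lip.
move=> xi y Cxi xy; apply: clamp_le0; rewrite add0r.
have nBy : (~` B) y.
  move=> By; have := hq y xi By Cxi; rewrite metric_sym => /le_trans/(_ xy).
  by move=> h; lra.
by rewrite (tdist0_closure (~` B) y ltr01).2 ?mulr0//; exact: subset_closure.
Unshelve. all: by end_near. Qed.

Let slope_cvg N t : 0 < t -> \forall n \near \oo, 1 <= slope N n * t.
Proof.
move=> t0; near=> n; rewrite -ler_pdivrMr//; apply: (@le_trans _ _ n%:R); last by rewrite ler_nat leq_addr.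
by near: n; exact: nbhs_infty_ger.
Unshelve. all: by end_near. Qed.

Let outer_cvg N y : outer N n y @[n --> \oo] --> (\1_(closure B) y : R).
Proof.
apply: cvg_near_cst; rewrite indicE; have [cy|ncy] := pselect (closure B y).
  rewrite mem_set//; apply: nearW => n.
  by rewrite /outer (tdist0_closure B y ltr01).2// mulr0 addr0 clamp_ge1.
rewrite memNset//; have t0 : 0 < tdist 1 B y.
  rewrite lt_neqAle tdist_ge0// andbT eq_sym; apply/eqP => h; apply: ncy.
  exact: (tdist0_closure B y ltr01).1.
apply: filterS (slope_cvg N t0) => n h.
by rewrite /outer clamp_le0// mulNr subr_le0.
Qed.

Let inner_cvg N y : inner N n y @[n --> \oo] --> (\1_(B°) y : R).
Proof.
apply: cvg_near_cst; rewrite indicE; have [iy|niy] := pselect (B° y); last first.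
  rewrite memNset//; apply: nearW => n.
  rewrite /inner (tdist0_closure (~` B) y ltr01).2; last by rewrite closure_setC.
  by rewrite mulr0 addr0 clamp_le0.
rewrite mem_set//; have t0 : 0 < tdist 1 (~` B) y.
  rewrite lt_neqAle tdist_ge0// andbT eq_sym; apply/eqP => h.
  by have := (tdist0_closure (~` B) y ltr01).1 h; rewrite closure_setC; exact.
apply: filterS (slope_cvg N t0) => n h.
by rewrite /inner add0r clamp_ge1.
Qed.

Let outer1 N n y : closure B y -> outer N n y = 1.
Proof. by move=> cy; rewrite /outer (tdist0_closure B y ltr01).2// mulr0 addr0 clamp_ge1. Qed.

Let inner0 N n y : ~ B y -> inner N n y = 0.
Proof.
move=> nBy; rewrite /inner (tdist0_closure (~` B) y ltr01).2 ?mulr0 ?addr0 ?clamp_le0//.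
exact: subset_closure.
Qed.

Let outer_itv N n y : 0 <= outer N n y <= 1. Proof. exact: clamp_itv. Qed.
Let inner_itv N n y : 0 <= inner N n y <= 1. Proof. exact: clamp_itv. Qed.

Let outer_le N n y : outer N n y <= outer N 0 y.
Proof.
have h : slope N 0 * tdist 1 B y <= slope N n * tdist 1 B y.
  by rewrite ler_wpM2r ?tdist_ge0// ler_nat leq_add2r.
rewrite /outer !mulNr; move: h; move: (_ * _) (slope N 0 * _) => u v vu.
by rewrite /clamp le_max2// le_min2// lerD2l lerN2.
Qed.

Let inner_le N n y : inner N n y <= outer N 0 y.
Proof.
have [By|nBy] := pselect (B y).
  by rewrite (outer1 N 0 (subset_closure By)); have /andP[] := inner_itv N n y.
by rewrite (inner0 N n nBy); have /andP[] := outer_itv N 0 y.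
Qed.

Let indic_itv (E : set S) y : 0 <= (\1_E y : R) <= 1.
Proof. by rewrite indicE; case: (_ \in _); rewrite /= ?lexx ?ler01. Qed.

Let J_indic x (E : set (borel S)) : A x -> measurable E -> E `<=` closure B ->
  (J x).-integrable setT (EFin \o (\1_E : borel S -> R)) /\ J x E = (Phi (\1_E : borel S -> R) x)%:E.
Proof.
move=> Ax mE EB; have [N [t1 t2]] := tests.
have iE : (J x).-integrable setT (EFin \o (\1_E : borel S -> R)).
  apply: (@dominated_integrable _ (outer N 0) 1 x Ax (t1 0%N)); first exact: measurable_indic.
  move=> y; rewrite mul1r; have /andP[-> _]/= := indic_itv E y.
  rewrite indicE; case: (boolP (y \in E)) => [/set_mem Ey|_]; first by rewrite outer1//; exact: EB.
  by have /andP[] := outer_itv N 0 y.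
split => //; rewrite fineK; last exact: integrable_fin_num iE.
by rewrite integral_indic// setIT.
Qed.

Let outer_int x N : A x -> (forall n, lipschitz_test (outer N n)) ->
  Phi (outer N n) x @[n --> \oo] --> fine (J x (closure B)).
Proof.
move=> Ax t1; have [_ ->] := J_indic Ax mcl (@subset_refl _ _).
apply: (@dominated_test _ _ (outer N 0) 1) => //.
- by move=> n; exact: measurable_lipschitz_test.
- by move=> n y; rewrite mul1r outer_le andbT; have /andP[] := outer_itv N n y.
- move=> y; rewrite mul1r; have /andP[-> _]/= := indic_itv (closure B) y.
  rewrite indicE; case: (boolP (y \in closure B)) => [/set_mem Ey|_]; first by rewrite outer1.
  by have /andP[] := outer_itv N 0 y.
Qed.

Let inner_int x N : A x -> lipschitz_test (outer N 0) -> (forall n, lipschitz_test (inner N n)) ->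
  Phi (inner N n) x @[n --> \oo] --> fine (J x B°).
Proof.
move=> Ax t1 t2; have [_ ->] := J_indic Ax mint sub_int_cl.
apply: (@dominated_test _ _ (outer N 0) 1) => //.
- by move=> n; exact: measurable_lipschitz_test.
- by move=> n y; rewrite mul1r inner_le andbT; have /andP[] := inner_itv N n y.
- move=> y; rewrite mul1r; have /andP[-> _]/= := indic_itv (B°) y.
  rewrite indicE; case: (boolP (y \in (interior B : set S))) => [/set_mem Ey|_]; first by rewrite outer1//; exact: sub_int_cl.
  by have /andP[] := outer_itv N 0 y.
Qed.

Let pB eta x := pre (\1_B : S -> R) eta x.

Let mB1 : measurable_fun setT (\1_B : borel S -> R). Proof. exact: measurable_indic. Qed.

Let le_pB N n eta x : 0 < eta -> lipschitz_test (inner N n) -> pre (inner N n) eta x <= pB eta x.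
Proof.
move=> eta0 t2; apply: (prelimit_le x eta0 (measurable_lipschitz_test t2) mB1 (inner_itv N n) (indic_itv B)).
move=> y; rewrite indicE; case: (boolP (y \in B)) => [_|/negP nBy]; first by have /andP[] := inner_itv N n y.
by rewrite inner0// => By; apply: nBy; exact: mem_set.
Qed.

Let pB_le N n eta x : 0 < eta -> lipschitz_test (outer N n) -> pB eta x <= pre (outer N n) eta x.
Proof.
move=> eta0 t1; apply: (prelimit_le x eta0 mB1 (measurable_lipschitz_test t1) (indic_itv B) (outer_itv N n)).
move=> y; rewrite indicE; case: (boolP (y \in B)) => [/set_mem By|_]; last by have /andP[] := outer_itv N n y.
by rewrite outer1//; exact: subset_closure.
Qed.

Let probE eta x : 0 < eta -> P [set w | B (X eta x w)] = (pB eta x / c eta)%:E.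
Proof.
move=> eta0; have c0 := c_gt0 eta0; rewrite /pB mulrAC divff ?gt_eqF// mul1r.
rewrite fineK; last by apply: integrable_fin_num => //; exact: (path_integrable x eta0 mB1 (indic_itv B)).
rewrite (eq_integral (fun w => (\1_[set w | B (X eta x w)] w)%:E))//.
by rewrite integral_indic ?setIT//; exact: mXE.
Qed.

(** At each [x] one function [inner N n] is good up to [e / 2], and its local uniform convergence
    extends the bound to a neighbourhood of [x]; compactness of [A] concludes. *)
Let inner_uniform a e : 0 < e -> (forall x, A x -> a <= fine (J x B°)) ->
  \forall eta \near 0^'+, forall x, A x -> a - e < pB eta x.
Proof.
move=> e0 ha; have [N [t1 t2]] := tests; have e2 : 0 < e / 2 by rewrite divr_gt0.
apply: filterS (_ : \forall eta \near 0^'+, A `<=` (fun x => A x -> a - e < pB eta x)).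
  by move=> eta h x Ax; exact: h.
apply: ((compact_near_coveringP A).1 A_compact) => x Ax.
have hn : \forall n \near \oo, `|fine (J x B°) - Phi (inner N n) x| < e / 2.
  exact: ((cvgrPdist_lt _ _).1 (inner_int Ax (t1 0%N) t2) _ e2).
near \oo => n; have hj : `|fine (J x B°) - Phi (inner N n) x| < e / 2 by near: n.
apply: filterS2 (J_cvg (t2 n) Ax e2) (near_pos x) => -[x' eta] /= h eta0 Ax'.
have h1 := le_pB x' eta0 (t2 n); have {h} h := h Ax'.
have := ler_norm (fine (J x B°) - Phi (inner N n) x).
have := ler_norm (- (pre (inner N n) eta x' - Phi (inner N n) x)); rewrite normrN.
move=> h2 h3; have := half_sandwich_lower hj h1 h h2 h3; apply: le_lt_trans.
by rewrite lerD2r ha.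
Unshelve. all: by end_near. Qed.

Let outer_uniform b e : 0 < e -> (forall x, A x -> fine (J x (closure B)) <= b) ->
  \forall eta \near 0^'+, forall x, A x -> pB eta x < b + e.
Proof.
move=> e0 hb; have [N [t1 t2]] := tests; have e2 : 0 < e / 2 by rewrite divr_gt0.
apply: filterS (_ : \forall eta \near 0^'+, A `<=` (fun x => A x -> pB eta x < b + e)).
  by move=> eta h x Ax; exact: h.
apply: ((compact_near_coveringP A).1 A_compact) => x Ax.
have hn : \forall n \near \oo, `|fine (J x (closure B)) - Phi (outer N n) x| < e / 2.
  exact: ((cvgrPdist_lt _ _).1 (outer_int Ax t1) _ e2).
near \oo => n; have hj : `|fine (J x (closure B)) - Phi (outer N n) x| < e / 2 by near: n.
apply: filterS2 (J_cvg (t1 n) Ax e2) (near_pos x) => -[x' eta] /= h eta0 Ax'.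
have h1 := pB_le x' eta0 (t1 n); have {h} h := h Ax'.
have := ler_norm (- (fine (J x (closure B)) - Phi (outer N n) x)); rewrite normrN.
have := ler_norm (pre (outer N n) eta x' - Phi (outer N n) x).
move=> h2 h3; exact: half_sandwich_upper hj h1 h h2 h3 (hb x Ax).
Unshelve. all: by end_near. Qed.

Theorem uniform_portmanteau :
  ([/\ ereal_inf [set nu x B° | x in A]
         <= limf_einf (fun eta =>
              ereal_inf [set P [set w | B (X eta x w)] | x in A] * (c eta)%:E) 0^'+,
       limf_einf (fun eta =>
           ereal_inf [set P [set w | B (X eta x w)] | x in A] * (c eta)%:E) 0^'+
         <= limf_esup (fun eta =>
              ereal_sup [set P [set w | B (X eta x w)] | x in A] * (c eta)%:E) 0^'+,
       limf_esup (fun eta =>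
           ereal_sup [set P [set w | B (X eta x w)] | x in A] * (c eta)%:E) 0^'+
         <= ereal_sup [set nu x (closure B) | x in A]
     & ereal_sup [set nu x (closure B) | x in A] < +oo])%E.
Proof.
have [x0 Ax0] := A_neq0; have [N [t1 t2]] := tests.
rewrite (eq_imagel (f' := fun x => J x B°)); last by move=> x Ax; exact: nuE.
rewrite (eq_imagel (f := fun x => nu x (closure B)) (f' := fun x => J x (closure B))); last by move=> x Ax; exact: nuE.
have supfin : (ereal_sup [set J x (closure B) | x in A] < +oo)%E.
  have [K hK] := locally_uniform_bounded (J_cvg (t1 0%N)).
  apply: (@le_lt_trans _ _ K%:E); last exact: ltry.
  apply: ge_ereal_sup => _ [x Ax <-]; have [iE ->] := J_indic Ax mcl (@subset_refl _ _).
  rewrite lee_fin (le_trans _ (hK x Ax))//; apply: le_Rintegral => //.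
    exact: lipschitz_test_integrable.
  move=> y _; rewrite indicE; case: (boolP (y \in closure B)) => [/set_mem Ey|_]; first by rewrite outer1.
  by have /andP[] := outer_itv N 0 y.
split => //.
- have : (ereal_inf [set J x B° | x in A] \is a fin_num).
    rewrite ge0_fin_numE; last by apply: le_ereal_inf_tmp => _ [x Ax <-]; exact: measure_ge0.
    apply: (@le_lt_trans _ _ (J x0 B°)); first by apply: ereal_inf_lbound; exists x0.
    by have [_ ->] := J_indic Ax0 mint sub_int_cl; exact: ltry.
  move=> /fineK aE; set a := fine _ in aE; rewrite -aE.
  have ha x : A x -> a <= fine (J x B°).
    move=> Ax; rewrite -lee_fin aE; have [_ h] := J_indic Ax mint sub_int_cl.
    by rewrite fineK ?h//; rewrite -h; apply: ereal_inf_lbound; exists x.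
  apply/lee_subgt0Pr => e e0; rewrite limf_einfE.
  have hV := filterI (inner_uniform e0 ha) (nbhs_right_gt 0).
  apply: le_trans (ereal_sup_ubound _); last by eexists; [exact: hV|reflexivity].
  apply: le_ereal_inf_tmp => _ [eta /= [h eta0] <-]; have c0 := c_gt0 eta0.
  rewrite (_ : (a%:E - e%:E)%E = ((a - e) / c eta)%:E * (c eta)%:E)%E; last by rewrite -EFinM divfK// gt_eqF.
  apply: lee_wpmul2r; first by rewrite lee_fin ltW.
  apply: le_ereal_inf_tmp => _ [x Ax <-]; rewrite probE// lee_fin.
  by rewrite ler_pM2r ?invr_gt0// ltW// h.
- rewrite limf_einfE limf_esupE; apply: ge_ereal_sup => _ [V hV <-].
  apply: le_ereal_inf_tmp => _ [W hW <-].
  have : \forall eta \near (0 : R)^'+, V eta /\ W eta /\ 0 < eta.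
    by apply: filterI => //; apply: filterI => //; exact: nbhs_right_gt.
  move=> /filter_ex[eta [Ve [We eta0]]].
  apply: (@le_trans _ _ (ereal_inf [set P [set w | B (X eta x w)] | x in A] * (c eta)%:E)%E).
    by apply: ereal_inf_lbound; exists eta.
  apply: (@le_trans _ _ (ereal_sup [set P [set w | B (X eta x w)] | x in A] * (c eta)%:E)%E); last first.
    by apply: ereal_sup_ubound; exists eta.
  apply: lee_wpmul2r; first by rewrite lee_fin ltW// c_gt0.
  apply: (@le_trans _ _ (P [set w | B (X eta x0 w)])).
    by apply: ereal_inf_lbound; exists x0.
  by apply: ereal_sup_ubound; exists x0.
- have : (ereal_sup [set J x (closure B) | x in A] \is a fin_num).
    rewrite ge0_fin_numE// (@le_trans _ _ (J x0 (closure B)))//.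
    by apply: ereal_sup_ubound; exists x0.
  move=> /fineK bE; set b := fine _ in bE; rewrite -bE.
  have hb x : A x -> fine (J x (closure B)) <= b.
    move=> Ax; rewrite -lee_fin bE; have [_ h] := J_indic Ax mcl (@subset_refl _ _).
    by rewrite fineK ?h//; rewrite -h; apply: ereal_sup_ubound; exists x.
  apply/lee_addgt0Pr => e e0; rewrite limf_esupE.
  have hV := filterI (outer_uniform e0 hb) (nbhs_right_gt 0).
  apply: le_trans (ereal_inf_lbound _) _; first by eexists; [exact: hV|reflexivity].
  apply: ge_ereal_sup => _ [eta /= [h eta0] <-]; have c0 := c_gt0 eta0.
  rewrite (_ : (b%:E + e%:E)%E = ((b + e) / c eta)%:E * (c eta)%:E)%E; last by rewrite -EFinM divfK// gt_eqF.
  apply: lee_wpmul2r; first by rewrite lee_fin ltW.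
  apply: ge_ereal_sup => _ [x Ax <-]; rewrite probE// lee_fin.
  by rewrite ler_pM2r ?invr_gt0// ltW// h.
Qed.

End portmanteau.

End uniform_convergence.

(** * Conclusion *)

(** By contradiction: a failure within every radius [1 / n.+1] yields, by choice, sequences to which
    the assumption applies. *)
Lemma near_right_of_sequences {R : realType} {m : nat} (g : R -> 'cV[R]_m -> R) (l : R)
    (A : set 'cV[R]_m) (x : 'cV[R]_m) :
  (forall (eta : nat -> R) (xs : nat -> 'cV[R]_m), eta n @[n --> \oo] --> 0^'+ ->
    xs n @[n --> \oo] --> x -> (forall n, A (xs n)) ->
    g (eta n) (xs n) @[n --> \oo] --> l) ->
  forall e, 0 < e -> \forall x' \near x & eta \near 0^'+, A x' -> `|g eta x' - l| < e.
Proof.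
move=> h e e0; apply: contrapT => nh.
have ex n : exists p : 'cV[R]_m * R, [/\ A p.1, enorm (p.1 - x) < n.+1%:R^-1,
    0 < p.2 < n.+1%:R^-1 & ~ (`|g p.2 p.1 - l| < e)].
  have n0 : 0 < n.+1%:R^-1 :> R by rewrite invr_gt0.
  apply: contrapT => np; apply: nh.
  exists ([set x' | enorm (x' - x) < n.+1%:R^-1], [set eta | 0 < eta < n.+1%:R^-1]).
    split => /=; first exact: ((enorm_cvgP (F := nbhs x) id x).1 cvg_id _ n0).
    by apply: filterS2 (nbhs_right_gt 0) (nbhs_right_lt n0) => eta /= h1 h2; exact/andP.
  move=> [x' eta] [/= h1 h2] Ax'; apply: contrapT => ng; apply: np.
  by exists (x', eta).
have [p hp] := choice ex.
have pe : (p n).2 @[n --> \oo] --> 0^'+.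
  move=> V hV; have {hV}/nbhs_ballP[v /= v0 hV] : \forall u \near (0 : R), 0 < u -> V u := hV.
  apply: filterS (near_infty_natSinv_lt (PosNum v0)) => n /= nv.
  have [_ _ /andP[q0 q1] _] := hp n; apply: hV => //=.
  by rewrite -ball_normE /= sub0r normrN gtr0_norm// (lt_trans q1).
have px : (p n).1 @[n --> \oo] --> x.
  apply/enorm_cvgP => v v0; apply: filterS (near_infty_natSinv_lt (PosNum v0)) => n /= nv.
  by have [_ q1 _ _] := hp n; exact: lt_trans nv.
have hl := h _ _ pe px (fun n => let: And4 pA _ _ _ := hp n in pA).
have : \forall n \near \oo, `|l - g (p n).2 (p n).1| < e.
  exact: ((cvgrPdist_lt _ _).1 hl _ e0).
by move=> /filter_ex[n]; rewrite distrC; have [_ _ _] := hp n.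
Qed.

(* Z 0 is the generic copy Z of the noise; the process uses Z 1, Z 2, etc *)
Theorem theorem2p6 (R : realType) (m d : nat)
    (disp : measure_display) (Omega : measurableType disp)
    (P : probability Omega R)
    (Z : nat -> {RV P >-> borel 'cV[R]_d.+1})
    (a : 'cV[R]_m.+1 -> 'cV[R]_m.+1)
    (sigma : 'cV[R]_m.+1 -> 'M[R]_(m.+1, d.+1))
    (alpha : R) (nu : {measure set (borel (halfline R)) -> \bar R})
    (S : probability (borel (sphere R d)) R)
    (D C : R) (k : nat) (T : {posnum R}) (eps : R) (A : set 'cV[R]_m.+1)
    (Z_iid : iid P Z)
    (Z_mean : forall i,
      ('E_P[fun w => (Z 0%N w : 'cV[R]_d.+1) i ord0] = 0)%E)
    (alpha_gt1 : 1 < alpha) (nu_alpha : is_nu_alpha alpha nu)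
    (Z_MRV : MRV P (Z 0%N) alpha nu S)
    (D_ge1 : 1 <= D)
    (lipschitz : forall x y,
      Num.max (opnorm (sigma x - sigma y)) (enorm (a x - a y))
        <= D * enorm (x - y))
    (C_ge1 : 1 <= C)
    (bounded : forall x, Num.max (enorm (a x)) (opnorm (sigma x)) <= C)
    (eps_gt0 : 0 < eps) (A_neq0 : A !=set0) (A_compact : compact A) :
  let X (eta : R) (x : 'cV[R]_m.+1) (w : Omega) : Dspace m.+1 T :=
    step_path T (sgd a sigma eta (Z ^~ w) x) eta in
  let lambdak (eta : R) : R := lambda P (Z 0%N) eta ^+ k in
  let Ck : 'cV[R]_m.+1 -> set (borel (Dspace m.+1 T)) -> \bar R :=
    limit_measure a sigma T nu S k in
  Mcvg_uniform 0^'+ (jump_paths_pred a sigma T A k eps) A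
    (fun eta x B => ((lambdak eta)^-1)%:E * P [set w | B (X eta x w)])%E Ck
  /\
  forall B : set (Dspace m.+1 T), measurable (B : set (borel (Dspace m.+1 T))) ->
    (exists2 e, 0 < e & bounded_away B (jump_paths_pred a sigma T A k e)) ->
    ([/\ ereal_inf [set Ck x B° | x in A]
           <= limf_einf (fun eta =>
                ereal_inf [set P [set w | B (X eta x w)] | x in A]
                * ((lambdak eta)^-1)%:E) 0^'+,
         limf_einf (fun eta =>
             ereal_inf [set P [set w | B (X eta x w)] | x in A]
             * ((lambdak eta)^-1)%:E) 0^'+
           <= limf_esup (fun eta =>
                ereal_sup [set P [set w | B (X eta x w)] | x in A]
                * ((lambdak eta)^-1)%:E) 0^'+,
         limf_esup (fun eta =>
             ereal_sup [set P [set w | B (X eta x w)] | x in A]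
             * ((lambdak eta)^-1)%:E) 0^'+
           <= ereal_sup [set Ck x (closure B) | x in A]
       & ereal_sup [set Ck x (closure B) | x in A] < +oo])%E.
Proof.
move=> X lambdak Ck.
have D0 : 0 <= D by exact: le_trans ler01 D_ge1.
have C0 : 0 < C by exact: lt_le_trans ltr01 C_ge1.
have aL x y : enorm (a x - a y) <= D * enorm (x - y).
  by have := lipschitz x y; rewrite ge_max => /andP[].
have sL x y w : enorm ((sigma x - sigma y) *m w) <= D * enorm (x - y) * enorm w.
  rewrite (le_trans (enorm_mulmx _ _))// ler_wpM2r ?enorm_ge0//.
  by have := lipschitz x y; rewrite ge_max => /andP[].
have aB x : enorm (a x) <= C by have := bounded x; rewrite ge_max => /andP[].
have sB x w : enorm (sigma x *m w) <= C * enorm w.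
  rewrite (le_trans (enorm_mulmx _ _))// ler_wpM2r ?enorm_ge0//.
  by have := bounded x; rewrite ge_max => /andP[].
have [phi F] := ex_flow D0 (ltW C0) aL aB.
have [rho [nuS rho_fin rho_cvg]] := MRV_radial Z_MRV.
have Hreg := Z_MRV.1.
have mZ n : measurable_fun setT (Z n) by exact: measurable_funPT.
have mX eta x (eta0 : 0 < eta) := measurable_step_path F sL sB (T := T) mZ x eta0.
have c0 eta : 0 < eta -> 0 < (lambdak eta)^-1.
  by move=> eta0; rewrite invr_gt0 exprn_gt0// (lambda_gt0 Hreg).
pose J := @jump_measure R m.+1 d a sigma D C phi F sL sB T k rho.
have CkJ x E : A x -> measurable E -> Ck x E = J x E.
  by move=> _ mE; exact: (limit_measureE F sL sB k x nuS mE).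
have J_int e f x : 0 < e -> lipschitz_test (jump_paths_pred a sigma T A k e) f -> A x ->
    (\int[J x]_y (f y)%:E)%E = (limit_value rho a sigma k f x)%:E.
  move=> e0 [r [M [L [r0 L0 fM fL fv]]]] Ax.
  exact: (integral_jump_law_lipschitz F sL sB rho_fin e0 r0 C0 L0 fM fL fv Ax).
have J_fin e f x : 0 < e -> lipschitz_test (jump_paths_pred a sigma T A k e) f -> A x ->
    (\int[J x]_y (f y)%:E < +oo)%E.
  by move=> e0 tf Ax; rewrite (J_int e)// ltry.
have J_cvg e f : 0 < e -> lipschitz_test (jump_paths_pred a sigma T A k e) f ->
    locally_uniform P X (fun eta => (lambdak eta)^-1) J A f.
  move=> e0 tf x v Ax v0; have := J_int e f x e0 tf Ax.
  move: tf => [r [M [L [r0 L0 fM fL fv]]]] JE.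
  rewrite /Rintegral JE.
  apply: (near_right_of_sequences (g := fun eta x' => (lambdak eta)^-1 * \int[P]_w f (X eta x' w))) => // eta xs eta0 xsx xsA.
  exact: (path_limit Z_iid alpha_gt1 Hreg rho_fin rho_cvg F C0 sL sB Z_mean e0 r0 L0 fM fL fv eta0 xsx xsA).
split.
  exact: (uniform_Mcvg mX c0 A_compact (fun f x => J_fin eps f x eps_gt0) (fun f => J_cvg eps f eps_gt0)
    A_neq0 (fun eta x E _ _ _ => erefl) CkJ).
(* The set to be avoided is now taken with the margin [e] for which [B] is known to be bounded away,
   independently of [eps]. *)
move=> B mB [e e0 Baway].
exact: (uniform_portmanteau mX c0 A_compact (fun f x => J_fin e f x e0) (fun f => J_cvg e f e0)
    A_neq0 CkJ mB Baway).
Qed.
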